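(* Let $\tau\in L^1_{loc}(\mathbb{R})$ vanish on $(-\infty,0)$, have convergent (improper) Laplace transform $\mathcal{L}\{\tau;s\}=\int_0^\infty\tau(x)e^{-sx}\,\mathrm{d}x$ for $\Re e\, s>0$, and be very slowly decreasing. Then $\tau$ is very slowly oscillating if and only if there are a constant $b'$ and a function $G(s)$ analytic on the intersection of $\Re e\, s>0$ with a complex neighborhood of $s=0$ such that both $$\mathcal{L}\{\tau;s\}-\frac{b'}{s}-\frac{G(s)}{s}\quad\text{and}\quad G(s)$$ admit pseudofunction boundary behavior at $s=0$. Moreover, in that case, for sufficiently small $\lambda>0$ there is a function $g$ with $g(y)\to0$ as $y\to\infty$ whose Fourier transform satisfies $\hat g(t)=\lim_{\sigma\to0^+}G(\sigma+it)$ in $\mathcal{D}'(-\lambda,\lambda)$, such that $\tau(x)=b+\int_0^xg(y)\,\mathrm{d}y+o(1)$ as $x\to\infty$, where $$b=b'+\lim_{\sigma\to0^+}\int_0^\infty g(-x)e^{-\sigma x}\,\mathrm{d}x=b'+\lim_{\sigma\to0^+}\left(G(\sigma)-\int_0^\infty g(x)e^{-\sigma x}\,\mathrm{d}x\right).$$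
   Context: A real-valued $\tau$ is very slowly decreasing if there is $\delta>0$ with $\liminf_{x\to\infty}\inf_{h\in[0,\delta]}(\tau(x+h)-\tau(x))\geq0$ (complex-valued: real and imaginary parts are); $\tau$ is very slowly oscillating if both $\tau$ and $-\tau$ are very slowly decreasing. Fourier transform $\hat\varphi(t)=\int e^{-itx}\varphi(x)\,\mathrm{d}x$, extended to tempered distributions by duality. A tempered distribution $f$ is a pseudofunction if $\hat f\in L^\infty$ and $\hat f(x)\to0$ as $|x|\to\infty$. An analytic function $F$ defined on $\{\Re e\, s>0\}$ near $0$ has pseudofunction boundary behavior at $s=0$ if there is an open interval $U\ni0$ such that $F(\sigma+it)$ converges in $\mathcal{D}'(U)$ as $\sigma\to0^+$ to a distribution that coincides near each point of $U$ with a pseudofunction. *)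

(* Defs.v *)
From HB Require Import structures.
From mathcomp Require Import all_boot all_order all_algebra.
From mathcomp Require Import all_classical all_reals all_analysis.
From mathcomp Require Import complex.

Set Implicit Arguments.
Unset Strict Implicit.
Unset Printing Implicit Defensive.

Import Order.TTheory GRing.Theory Num.Theory.
Import numFieldTopology.Exports numFieldNormedType.Exports.
Local Open Scope classical_set_scope.
Local Open Scope ring_scope.

Section Defs.
Variable R : realType.
Local Notation C := (R[i]).
Local Notation mu := (@lebesgue_measure R).

Definition cnorm (z : C) : R := ComplexField.Normc.normc z.

Definition RtoC (x : R) : C := Complex x 0.
Definition cexp (z : C) : C :=
  Complex (expR (complex.Re z) * cos (complex.Im z)) (expR (complex.Re z) * sin (complex.Im z)).
Definition iC : C := Complex 0 1.

Definition cint (D : set R) (f : R -> C) : C :=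
  Complex (Rintegral mu D (fun x => complex.Re (f x))) (Rintegral mu D (fun x => complex.Im (f x))).

Definition cintegrable (D : set R) (f : R -> C) : Prop :=
  mu.-integrable D (fun x => (complex.Re (f x))%:E) /\ mu.-integrable D (fun x => (complex.Im (f x))%:E).

Definition loc_integrable (f : R -> C) : Prop :=
  forall a b : R, cintegrable `[a, b]%classic f.

Definition ccvg_right0 (f : R -> C) (l : C) : Prop :=
  forall e : R, 0 < e -> exists2 d : R, 0 < d &
    forall s : R, 0 < s < d -> cnorm (f s - l) < e.
Definition ccvg_pinfty (f : R -> C) (l : C) : Prop :=
  forall e : R, 0 < e -> exists M : R,
    forall x : R, M < x -> cnorm (f x - l) < e.

Definition laplace_conv (tau : R -> C) (s : C) (l : C) : Prop :=
  ccvg_pinfty (fun T => cint `[0, T]%classic (fun x => tau x * cexp (- (s * RtoC x)))) l.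

(* very slowly decreasing, real-valued:
   exists delta > 0, liminf_{x->oo} inf_{h in [0,delta]} (f(x+h) - f(x)) >= 0
   (liminf unfolded: for every eps > 0, eventually the infimum is >= -eps) *)
Definition vsd_real (f : R -> R) : Prop :=
  exists2 delta : R, 0 < delta &
    forall eps : R, 0 < eps -> exists X : R, forall x h : R,
      X <= x -> 0 <= h <= delta -> - eps <= f (x + h) - f x.

Definition vsd (f : R -> C) : Prop :=
  vsd_real (fun x => complex.Re (f x)) /\ vsd_real (fun x => complex.Im (f x)).

Definition vso (f : R -> C) : Prop := vsd f /\ vsd (fun x => - f x).

Definition smooth (f : R -> R) : Prop :=
  forall (n : nat) (x : R), derivable (derive1n n f) x 1.

Definition test_fun (U : set R) (phi : R -> C) : Prop :=
  smooth (fun x => complex.Re (phi x)) /\ smooth (fun x => complex.Im (phi x)) /\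
  exists a b : R, `[a, b]%classic `<=` U /\ (forall x, ~ `[a, b]%classic x -> phi x = 0).

Definition fourier (phi : R -> C) (t : R) : C :=
  cint setT (fun x => cexp (- (iC * RtoC (t * x))) * phi x).
Definition ifourier (psi : R -> C) (x : R) : C :=
  RtoC (2 * pi)^-1 * cint setT (fun t => cexp (iC * RtoC (t * x)) * psi t).

(* The distribution T (a functional on test functions) coincides on the open
   set V with a pseudofunction f, i.e. a tempered distribution whose Fourier
   transform is a function h in L^oo with h(x) -> 0 as |x| -> oo.  Then
   <f, phi> = <f^, F^{-1} phi> = int h(x) (F^{-1} phi)(x) dx. *)
Definition pseudofunction_on (V : set R) (T : (R -> C) -> C) : Prop :=
  exists h : R -> C,
    measurable_fun setT (fun x => complex.Re (h x)) /\
    measurable_fun setT (fun x => complex.Im (h x)) /\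
    (exists M : R, forall x, cnorm (h x) <= M) /\
    (forall e : R, 0 < e -> exists A : R, forall x, A < `|x| -> cnorm (h x) < e) /\
    (forall phi, test_fun V phi -> T phi = cint setT (fun x => h x * ifourier phi x)).

Definition pf_boundary (F : C -> C) : Prop :=
  exists U : set R, [/\ open U, is_interval U & U 0] /\
  exists T : (R -> C) -> C,
    (forall phi, test_fun U phi ->
       ccvg_right0 (fun sigma => cint setT (fun t => F (Complex sigma t) * phi t)) (T phi)) /\
    (forall t0, U t0 -> exists V : set R,
       [/\ open V, V t0 & V `<=` U] /\ pseudofunction_on V T).

Definition cderiv_at (G : C -> C) (z l : C) : Prop :=
  forall e : R, 0 < e -> exists2 d : R, 0 < d &
    forall h : C, h != 0 -> cnorm h < d -> cnorm ((G (z + h) - G z) / h - l) < e.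
Definition analytic_on (D : set C) (G : C -> C) : Prop :=
  (forall z, D z -> exists2 r : R, 0 < r & forall w, cnorm (w - z) < r -> D w) /\
  (forall z, D z -> exists l, cderiv_at G z l).

Definition analytic_near0_right (G : C -> C) : Prop :=
  exists2 r : R, 0 < r &
    analytic_on (fun s => cnorm s < r /\ 0 < complex.Re s) G.

Definition tempered_fun (g : R -> C) : Prop :=
  loc_integrable g /\
  exists N : nat, cintegrable setT (fun x => g x / RtoC ((1 + `|x|) ^+ N)).

End Defs.

(* Main.v *)
Require Import Defs.
From HB Require Import structures.
From mathcomp Require Import all_boot all_order all_algebra.
From mathcomp Require Import all_classical all_reals all_analysis.
From mathcomp Require Import measurable_realfun complex.
From mathcomp Require Import ring lra.

(* Write [D = G - L(g+)] for [Re s > 0] and [A(s) = int_0^oo g(-x) e^(s x) dx] for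
   [Re s < 0], where [g] is read off the pseudofunction boundary value of [G].  Both
   converge to the same distribution on the imaginary axis near [0], so they glue:
   the gliding hump turns convergence on test functions into uniform bounds for the
   moments of [D] and [A] against a family of bumps, Goursat's lemma gives the
   Cauchy-Riemann equations for these moments across the axis, and a mean value
   argument over radial weights makes [D] and [A] jointly Lipschitz near [0].  Their
   common value [d] at [0] gives [b = b' + d].  The Laplace transform of
   [r = tau - b - int_0^x g] is then [P + (D - d) / s], with [P] of pseudofunction
   boundary behavior and [(D - d) / s] bounded; pairing with the modulations of a
   test function whose Fourier transform [K] is nonnegative, the Riemann-Lebesgue
   lemma yields [(r * K)(y) -> 0], and a Tauberian argument for very slowly
   decreasing functions yields [r -> 0].  Conversely, if [tau] is very slowly
   oscillating, [g(x) = tau(x + 1) - tau(x)] on a half-line, [G = L(g)] and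
   [b' = int_X^(X+1) tau] work, since then
   [tau(x) - b' - int_0^x g = tau(x) - int_x^(x+1) tau]. *)

(** The factor 1/s is the obstacle. Near s = 0 it can only be absorbed if D(s) - d is of order |s|,
    so the agreement of [D] and [A] as distributions must become a Lipschitz bound up to the axis,
    while the hypotheses control pairings with test functions only. Moments against translated bumps
    are genuine functions of (x, t) on a full neighbourhood of 0, the axis included; but what is
    wanted concerns bumps shrinking to points. The mean value step provides this uniformity: a
    first-order moment, averaged against a radial weight, hands its derivative over to the weight,
    and what remains is bounded by the mass of the bump times a constant independent of its width.
    Dividing by the mass and shrinking the bump recovers [D] and [A]. For this the slices of the
    weight must belong to the very bump family that has the uniform bounds. In the Tauberian part
    positivity of [K] works twice: monotone convergence removes the exponential weight, and
    one-sided information on [r] turns window averages into bounds. *)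

Set Implicit Arguments.
Unset Strict Implicit.
Unset Printing Implicit Defensive.
Import Order.TTheory GRing.Theory Num.Theory.
Import numFieldTopology.Exports numFieldNormedType.Exports.
Local Open Scope classical_set_scope.
Local Open Scope ring_scope.

(** * Integration on the real line *)

Section RealIntegral.
Variable R : realType.
Local Notation mu := (@lebesgue_measure R).
Implicit Types f g : R -> R.

Definition integ f := mu.-integrable setT (EFin \o f).

Lemma mea_EFin d (T : measurableType d) (D : set T) (f : T -> R) :
  measurable_fun D f -> measurable_fun D (EFin \o f).
Proof. by move=> ?; exact/measurable_EFinP. Qed.

Lemma integ_mea f : integ f -> measurable_fun setT f.
Proof. by move=> /integrableP[/measurable_EFinP]. Qed.

Lemma integ_dom f g : measurable_fun setT f -> integ g ->
  (forall x, `|f x| <= g x) -> integ f.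
Proof.
move=> mf ig fg; apply: (le_integrable _ _ _ ig) => //; first exact/measurable_EFinP.
by move=> x _ /=; rewrite lee_fin (le_trans (fg x))// ler_norm.
Qed.

Lemma integD f g : integ f -> integ g -> integ (fun x => f x + g x).
Proof. by move=> hf hg; have := integrableD measurableT hf hg; apply: eq_integrable. Qed.

Lemma integB f g : integ f -> integ g -> integ (fun x => f x - g x).
Proof. by move=> hf hg; have := integrableB measurableT hf hg; apply: eq_integrable. Qed.

Lemma integZ c f : integ f -> integ (fun x => c * f x).
Proof. by move=> hf; have := integrableZl measurableT c hf; apply: eq_integrable. Qed.

Lemma integN f : integ f -> integ (fun x => - f x).
Proof. by move=> hf; have := integZ (-1) hf; apply: eq_integrable => // x _ /=; rewrite mulN1r. Qed.

Lemma integ_norm f : integ f -> integ (fun x => `|f x|).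
Proof. by move=> hf; have := integrable_norm hf; apply: eq_integrable. Qed.

Lemma integ0 : integ (fun=> 0).
Proof. exact: integrable0. Qed.

Lemma eq_integ f g : f =1 g -> integ f -> integ g.
Proof. by move=> /funext ->. Qed.

Lemma integ_indic a b : integ (\1_(`[a, b]%classic) : R -> R).
Proof.
apply/integrableP; split; first exact/measurable_EFinP/measurable_indic.
under eq_integral do rewrite /= ger0_norm//.
rewrite integral_indic// setIT.
have := lebesgue_measure_itv `[a, b]; rewrite /= => ->.
by case: ifP => _; rewrite ?ltry// -EFinD ltry.
Qed.

Lemma integ_bdd_supp f M a b : measurable_fun setT f -> (forall x, `|f x| <= M) ->
  (forall x, ~ `[a, b]%classic x -> f x = 0) -> integ f.
Proof.
move=> mf fM f0; apply: (integ_dom mf (integZ M (integ_indic a b))) => x.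
rewrite indicE; case: (boolP (x \in _)) => [_|/negP]; first by rewrite mulr1.
by rewrite inE => /f0 ->; rewrite normr0 mulr0.
Qed.

Lemma integM_bdd f g M : integ f -> measurable_fun setT g -> (forall x, `|g x| <= M) ->
  integ (fun x => f x * g x).
Proof.
move=> hf mg gM; apply: (@integ_dom _ (fun x => M * `|f x|)).
- by apply: measurable_funM => //; exact: integ_mea.
- exact/integZ/integ_norm.
- by move=> x; rewrite normrM mulrC ler_wpM2r.
Qed.

Local Notation rint := (Rintegral mu setT).

Lemma rint_ge0 f : (forall x, 0 <= f x) -> 0 <= rint f.
Proof. by move=> f0; apply: Rintegral_ge0. Qed.

Lemma le_rint f g : integ f -> integ g -> (forall x, f x <= g x) -> rint f <= rint g.
Proof. by move=> hf hg fg; apply: le_Rintegral. Qed.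

Lemma le_norm_rint f g : measurable_fun setT f -> integ g -> (forall x, `|f x| <= g x) ->
  `|rint f| <= rint g.
Proof.
move=> mf ig fg; have hf := integ_dom mf ig fg.
rewrite (le_trans (le_normr_Rintegral _ _))// le_rint//; exact: integ_norm.
Qed.

Lemma rint_indic a b : a <= b -> rint (\1_(`[a, b]%classic)) = b - a.
Proof.
move=> ab; rewrite /Rintegral (_ : (fun x => _) = EFin \o \1_(`[a, b]%classic))//.
rewrite integral_indic// setIT.
have := lebesgue_measure_itv `[a, b]; rewrite /= => ->; rewrite lte_fin.
by move: ab; rewrite le_eqVlt => /orP[/eqP->|->//]; rewrite ltxx subrr.
Qed.

Lemma rint_bdd_supp f (M a b : R) : a <= b -> measurable_fun setT f -> (forall x, `|f x| <= M) ->
  (forall x, ~ `[a, b]%classic x -> f x = 0) -> `|rint f| <= M * (b - a).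
Proof.
move=> ab mf fM f0.
rewrite -rint_indic// -RintegralZl//; last exact: integ_indic.
apply: le_norm_rint => //; first exact/integZ/integ_indic.
move=> x; rewrite /=; case: (boolP (x \in _)) => [_|/negP]; first by rewrite mulr1.
by rewrite inE => /f0 ->; rewrite normr0 mulr0.
Qed.

Lemma rint_mkcond (D : set R) f : Rintegral mu D f = rint (fun x => f x * \1_D x).
Proof.
rewrite Rintegral_mkcond; apply: eq_Rintegral => x _.
by rewrite /patch indicE; case: ifP => _; rewrite ?mulr1 ?mulr0.
Qed.

Lemma integ_mkcond (D : set R) f : measurable D ->
  mu.-integrable D (EFin \o f) <-> integ (fun x => f x * \1_D x).
Proof.
move=> mD; have -> : integ (fun x => f x * \1_D x) = mu.-integrable setT ((EFin \o f) \_ D).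
  congr (mu.-integrable setT _); apply/funext => x.
  by rewrite /patch /= indicE; case: ifP => _; rewrite ?mulr1 ?mulr0.
exact: (@integrable_mkcond _ _ _ mu D (EFin \o f) mD).
Qed.

Lemma dct_seq (F : nat -> R -> R) f g :
  (forall n, measurable_fun setT (F n)) -> measurable_fun setT f ->
  {ae mu, forall x, F ^~ x @ \oo --> f x} ->
  integ g -> (forall n x, `|F n x| <= g x) ->
  integ f /\ rint (F n) @[n --> \oo] --> rint f.
Proof.
move=> mF mf cF ig Fg.
have [] := @dominated_convergence _ _ _ mu setT measurableT (fun n => EFin \o F n) (EFin \o f) (EFin \o g).
- by move=> n; exact: (mea_EFin (mF n)).
- exact: (mea_EFin mf).
- apply: (@filterS _ _ (ae_filter_ringOfSetsType mu) _ _ _ cF) => x cx _.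
  by apply: cvg_EFin => //; exact: nearW.
- exact: ig.
- by apply: aeW => x n _ /=; rewrite lee_fin.
move=> hf _ cvg; split=> //; apply: fine_cvg.
rewrite fineK//; exact: (integrable_fin_num _ hf).
Qed.

Lemma dct_right0 (F : R -> R -> R) f g (d : R) : 0 < d ->
  (forall s, 0 < s < d -> measurable_fun setT (F s)) -> measurable_fun setT f ->
  {ae mu, forall x, F s x @[s --> 0^'+] --> f x} ->
  integ g -> (forall s x, 0 < s < d -> `|F s x| <= g x) ->
  rint (F s) @[s --> 0^'+] --> rint f.
Proof.
move=> d0 mF mf cF ig Fg.
apply/cvg_at_rightP => u [u0 ul].
(* The hypotheses speak of 0 < s < d only, so the sequence is shifted until it stays below [d]. *)
have [N _ Nd] : \forall n \near \oo, u n < d by apply: cvgr_lt ul _ d0.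
rewrite -(cvg_shiftn N) /=.
have ud n : 0 < u (n + N)%N < d by rewrite u0 Nd//= leq_addl.
apply: (dct_seq _ mf _ ig _).2 => [n||n x]; [exact: mF| |exact: Fg].
apply: (@filterS _ _ (ae_filter_ringOfSetsType mu) _ _ _ cF) => x /cvg_at_rightP/(_ u (conj u0 ul)).
by rewrite -(cvg_shiftn N).
Qed.

Lemma dct_pinfty (F : R -> R -> R) f g :
  (forall s, measurable_fun setT (F s)) -> measurable_fun setT f ->
  {ae mu, forall x, F s x @[s --> +oo] --> f x} ->
  integ g -> (forall s x, `|F s x| <= g x) ->
  rint (F s) @[s --> +oo] --> rint f.
Proof.
move=> mF mf cF ig Fg.
apply/cvg_pinftyP => u ul.
apply: (dct_seq _ mf _ ig _).2 => [n||n x]; [exact: mF| |exact: Fg].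
by apply: (@filterS _ _ (ae_filter_ringOfSetsType mu) _ _ _ cF) => x /cvg_pinftyP/(_ u ul).
Qed.

(** Tonelli's criterion with a majorant [a] in place of the inner norms, which then need only be
    estimated. *)
Lemma integ_prod (F : R * R -> R) (a : R -> R) : measurable_fun setT F ->
  (forall x, integ (fun y => F (x, y))) -> (forall x, rint (fun y => `|F (x, y)|) <= a x) ->
  integ a -> (mu \x mu)%E.-integrable setT (EFin \o F).
Proof.
move=> mF iF Fa ia.
apply/(@integrable12ltyP _ _ _ _ _ mu mu); first exact/measurable_EFinP.
have E x : (\int[mu]_y `|(EFin \o F) (x, y)| = (rint (fun y => `|F (x, y)|))%:E)%E.
  by rewrite /Rintegral fineK//; exact: (integrable_fin_num _ (integ_norm (iF x))).
move/integrableP : (ia) => [ma]; apply: le_lt_trans.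
have m1 : measurable_fun setT (fun x => \int[mu]_y `|(EFin \o F) (x, y)|)%E.
  apply: (measurable_fun_fubini_tonelli_F (m2 := mu) (abse \o (EFin \o F))) => //=.
  by apply: measurableT_comp => //; exact/measurable_EFinP.
apply: ge0_le_integral => //=.
- by move=> x _; exact: integral_ge0.
- exact: (measurableT_comp (@abse_measurable _ setT) ma).
- by move=> x _; rewrite E lee_fin (le_trans (Fa x))// ler_norm.
Qed.

Lemma integ_prodC (F : R * R -> R) : (mu \x mu)%E.-integrable setT (EFin \o F) ->
  (mu \x mu)%E.-integrable setT (EFin \o (fun z => F (z.2, z.1))).
Proof.
move=> iF; have /integrableP[/measurable_EFinP mF _] := iF.
have mFs : measurable_fun setT (EFin \o (fun z => F (z.2, z.1))).
  by apply: mea_EFin; apply: (measurableT_comp mF); exact: measurable_fun_pair.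
apply/(@integrable12ltyP _ _ _ _ _ mu mu) => //.
by have /(@integrable21ltyP _ _ _ _ _ mu mu) := iF; apply; exact: mea_EFin.
Qed.

(** [Rintegral] applies [fine] to the inner integral, which changes it where it is infinite; since
    the inner integral is itself integrable, this happens on a null set only. *)
Lemma rint_rint (F : R * R -> R) : (mu \x mu)%E.-integrable setT (EFin \o F) ->
  (rint (fun x => rint (fun y => F (x, y))))%:E = (\int[mu]_x \int[mu]_y (F (x, y))%:E)%E.
Proof.
move=> iP; pose I1 x := (\int[mu]_y (F (x, y))%:E)%E.
have if1 : mu.-integrable setT I1 by apply: (@integrable_fubini_F _ _ _ _ _ mu mu _ iP).
have aefin : (\int[mu]_x (fine (I1 x))%:E = \int[mu]_x I1 x)%E.
  apply: ae_eq_integral => //.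
  - apply: mea_EFin; apply: (measurableT_comp _ (measurable_int mu if1)).
    exact: fine_measurable.
  - exact: (measurable_int mu).
  - have := integrable_ae measurableT if1.
    apply: (@filterS _ _ (ae_filter_ringOfSetsType mu)) => x /(_ Logic.I) h _.
    by rewrite fineK.
rewrite /Rintegral [X in (fine X)%:E]aefin fineK//.
exact: (integrable_fin_num _ if1).
Qed.

Lemma fubini (F : R * R -> R) (a : R -> R) : measurable_fun setT F ->
  (forall x, integ (fun y => F (x, y))) -> (forall x, rint (fun y => `|F (x, y)|) <= a x) ->
  integ a ->
  rint (fun x => rint (fun y => F (x, y))) = rint (fun y => rint (fun x => F (x, y))).
Proof.
move=> mF iF Fa ia; have iP := integ_prod mF iF Fa ia.
apply: EFin_inj; rewrite (rint_rint iP) (rint_rint (integ_prodC iP)).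
exact: (@Fubini _ _ _ _ _ mu mu (EFin \o F)).
Qed.

(** The scaled pushforward agrees with Lebesgue measure on half-open intervals, which determine it;
    a negative [a] turns them into intervals closed on the left, of the same length. *)
Lemma pushforward_affine (a b : R) (A : set R) : a != 0 -> measurable A ->
  (mu A = `|a|%:E * mu ((fun x => a * x + b)%R @^-1` A))%E.
Proof.
move=> a0 mA.
have mphi : measurable_fun setT (fun x : R => a * x + b).
  by apply: measurable_funD => //; exact: measurable_funM.
pose phi := (fun x : R => a * x + b).
have mphi' : measurable_fun setT (phi : measurableTypeR R -> measurableTypeR R) by exact: mphi.
pose nu0 : {measure set (measurableTypeR R) -> \bar R} :=
  mscale (NngNum (normr_ge0 a)) (pushforward mu (phi : measurableTypeR R -> measurableTypeR R)).
pose nu' := nu0 mphi'.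
apply: (@lebesgue_measure_unique R nu') => //= X [[u v] _ <-] /=.
rewrite /nu' /nu0 /mscale /= /pushforward.
have -> : mu `]u, v]%classic = (if (u < v)%R then ((v - u)%R)%:E else 0)%E.
  by have := lebesgue_measure_itv `]u, v]; rewrite /= lte_fin.
have [ap|an] := ltP 0 a.
  have -> : phi @^-1` `]u, v]%classic = `](u - b) / a, (v - b) / a]%classic.
    apply/seteqP; split=> x /=; rewrite !in_itv/= ltr_pdivrMr// ler_pdivlMr// ltrBlDr lerBrDr mulrC //.
  have := lebesgue_measure_itv `](u - b) / a, (v - b) / a]; rewrite /= lte_fin => ->.
  rewrite ltr_pM2r ?invr_gt0// ltrD2r; case: ifP => _; last by rewrite mule0.
  by rewrite -EFinD -EFinM gtr0_norm//; congr (_%:E); field; exact: lt0r_neq0.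
have {an}an : a < 0 by rewrite lt_neqAle a0.
have -> : phi @^-1` `]u, v]%classic = `[(v - b) / a, (u - b) / a[%classic.
  apply/seteqP; split=> x /=; rewrite !in_itv/= ltr_ndivlMr// ler_ndivrMr// ltrBlDr lerBrDr mulrC;
  by rewrite andbC.
have := lebesgue_measure_itv `[(v - b) / a, (u - b) / a[; rewrite /= lte_fin => ->.
rewrite ltr_nM2r ?invr_lt0// ltrD2r; case: ifP => _; last by rewrite mule0.
by rewrite -EFinD -EFinM ltr0_norm//; congr (_%:E); field.
Qed.

Lemma ge0_integral_affine (a b : R) (f : R -> R) : a != 0 -> measurable_fun setT f ->
  (forall x, 0 <= f x) ->
  (\int[mu]_x (f x)%:E = `|a|%:E * \int[mu]_x (f (a * x + b)%R)%:E)%E.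
Proof.
move=> a0 mf f0.
have mphi : measurable_fun setT (fun x : R => a * x + b).
  by apply: measurable_funD => //; exact: measurable_funM.
pose phi := (fun x : R => a * x + b).
have mphi' : measurable_fun setT (phi : measurableTypeR R -> measurableTypeR R) by exact: mphi.
pose nu0 : {measure set (measurableTypeR R) -> \bar R} :=
  mscale (NngNum (normr_ge0 a)) (pushforward mu (phi : measurableTypeR R -> measurableTypeR R)).
pose nu' := nu0 mphi'.
rewrite (@eq_measure_integral _ _ _ setT nu' mu); last first.
  by move=> A mA _; exact: pushforward_affine.
rewrite ge0_integral_mscale//=; last 2 first.
- exact: mea_EFin.
- by move=> x _; rewrite lee_fin.
congr (_ * _)%E; rewrite ge0_integral_pushforward//.
- exact: mea_EFin.
- by move=> x _ /=; rewrite lee_fin.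
Qed.

Lemma integ_affine (a b : R) f : a != 0 -> integ f -> integ (fun x => f (a * x + b)).
Proof.
move=> a0 hf; have mf := integ_mea hf.
have mphi : measurable_fun setT (fun x : R => a * x + b).
  by apply: measurable_funD => //; exact: measurable_funM.
have mfp : measurable_fun setT (fun x => f (a * x + b)) by exact: (measurableT_comp mf mphi).
apply/integrableP; split; first exact: mea_EFin.
have /integrableP[_] := hf.
have := @ge0_integral_affine a b (fun x => `|f x|) a0 (measurableT_comp (@normr_measurable _ setT) mf) (fun x => normr_ge0 _).
rewrite /= => ->; set J := (\int[_]_(_ in _) _)%E => H.
rewrite ltey; apply/negP => /eqP JE; move: H; rewrite JE.
by rewrite gt0_muley ?ltxx// lte_fin normr_gt0.
Qed.

Lemma rint_affine (a b : R) f : a != 0 -> integ f ->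
  rint f = `|a| * rint (fun x => f (a * x + b)).
Proof.
move=> a0 hf; have mf := integ_mea hf.
have E h : measurable_fun setT h -> integ h -> (forall x, 0 <= h x) ->
    rint h = `|a| * rint (fun x => h (a * x + b)).
  move=> mh ih h0; rewrite /Rintegral (ge0_integral_affine b a0 mh h0) fineM//.
  exact: (integrable_fin_num _ (integ_affine b a0 ih)).
pose fp x := 2^-1 * (`|f x| + f x); pose fn x := 2^-1 * (`|f x| - f x).
have ip : integ fp by apply: integZ; apply: integD => //; exact: integ_norm.
have iN : integ fn by apply: integZ; apply: integB => //; exact: integ_norm.
have fE x : f x = fp x - fn x by rewrite /fp /fn; field.
rewrite (_ : f = fun x => fp x - fn x); last exact/funext.
rewrite RintegralB// RintegralB//; last 2 first.
- exact: (integ_affine b a0 ip).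
- exact: (integ_affine b a0 iN).
rewrite mulrBr -!E//; try exact: integ_mea.
- by move=> x; rewrite mulr_ge0// subr_ge0 ler_norm.
- by move=> x; rewrite mulr_ge0// -lerBlDr sub0r -normrN ler_norm.
Qed.

Lemma rint_shift (b : R) f : integ f -> rint (fun x => f (x + b)) = rint f.
Proof.
move=> hf; rewrite (rint_affine b (oner_neq0 _) hf) normr1 mul1r.
by under [RHS]eq_Rintegral do rewrite mul1r.
Qed.

Lemma integ_shift (b : R) f : integ f -> integ (fun x => f (x + b)).
Proof.
by move=> hf; apply: eq_integ (integ_affine b (oner_neq0 _) hf) => x; rewrite mul1r.
Qed.

Lemma integ_refl (b : R) f : integ f -> integ (fun x => f (b - x)).
Proof.
move=> hf; have h : (-1 : R) != 0 by rewrite oppr_eq0 oner_neq0.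
by apply: eq_integ (integ_affine b h hf) => x; rewrite mulN1r addrC.
Qed.

Lemma rint_refl (b : R) f : integ f -> rint (fun x => f (b - x)) = rint f.
Proof.
move=> hf; have h : (-1 : R) != 0 by rewrite oppr_eq0 oner_neq0.
rewrite (rint_affine b h hf) normrN1 mul1r.
by under [RHS]eq_Rintegral do rewrite mulN1r addrC.
Qed.

(** An open set of the plane is the union of the boxes with rational centre and radius that it
    contains, a countable family in the product sigma-algebra. *)
Lemma box_open_measurable (W : set (R * R)) :
  (forall z, W z -> exists2 e : R, 0 < e &
     forall x y, `|x - z.1| < e -> `|y - z.2| < e -> W (x, y)) -> measurable W.
Proof.
move=> oW.
pose box (q : rat * rat * rat) := `]ratr q.1.1 - ratr q.2 : R, ratr q.1.1 + ratr q.2[%classic `*`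
   `]ratr q.1.2 - ratr q.2 : R, ratr q.1.2 + ratr q.2[%classic.
pose F (q : rat * rat * rat) := if `[< box q `<=` W >] then box q else set0.
have -> : W = \bigcup_q F q.
  apply/seteqP; split=> [z Wz|z [q _]]; last by rewrite /F; case: asboolP => // h /h.
  have [e e0 he] := oW z Wz.
  have e2 : 0 < e / 2 by rewrite divr_gt0.
  have [d] := @rat_in_itvoo R 0 (e / 2) e2; rewrite in_itv/= => /andP[d0 de].
  have [p] := @rat_in_itvoo R (z.1 - ratr d) (z.1 + ratr d) ltac:(lra).
  rewrite in_itv/= => /andP[p1 p2].
  have [r] := @rat_in_itvoo R (z.2 - ratr d) (z.2 + ratr d) ltac:(lra).
  rewrite in_itv/= => /andP[r1 r2].
  exists (p, r, d) => //; rewrite /F asboolT.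
    by rewrite /box/= !in_itv/=; split; lra.
  move=> [x y] [] /=; rewrite !in_itv/= => /andP[h1 h2] /andP[h3 h4].
  by apply: he; rewrite ltr_norml; lra.
apply: countable_bigcupT_measurable => [|q]; first exact: countableP.
rewrite /F; case: asboolP => _ //.
by apply: measurableX; exact: measurable_itv.
Qed.

(** A superlevel set meets [O] in an open set, and contains all or nothing of the complement of [O]
    according to the sign of the level. *)
Lemma box_continuous_measurable (F : R * R -> R) (O : set (R * R)) :
  (forall z, O z -> exists2 e : R, 0 < e &
     forall x y, `|x - z.1| < e -> `|y - z.2| < e -> O (x, y)) ->
  (forall z, ~ O z -> F z = 0) ->
  (forall z (e : R), O z -> 0 < e -> exists2 d : R, 0 < d &
     forall x y, `|x - z.1| < d -> `|y - z.2| < d -> `|F (x, y) - F z| < e) ->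
  measurable_fun setT F.
Proof.
move=> oO F0 cF.
have mO := box_open_measurable oO.
apply: (measurability _ (RGenOInfty.measurableE R)) => // _ [_ [y ->] <-].
rewrite setTI.
have -> : F @^-1` `]y, +oo[%classic = (O `&` [set z | y < F z]) `|` (if y < 0 then ~` O else set0).
  apply/seteqP; split=> z /=; rewrite in_itv/= andbT.
    by have [Oz|Oz] := pselect (O z); [left|rewrite F0// => ->; right].
  by move=> [[]//|]; case: ifP => // y0 /F0 ->.
apply: measurableU; last by case: ifP => // _; exact: measurableC.
apply: box_open_measurable => z [Oz /= yz].
have [d d0 hd] := cF z (F z - y) Oz ltac:(lra).
have [e e0 he] := oO z Oz.
exists (Num.min d e) => [|u v]; first by rewrite lt_min d0.
rewrite !lt_min => /andP[a1 a2] /andP[b1 b2]; split; first exact: he.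
by have := hd _ _ a1 b1; rewrite /= ltr_norml; lra.
Qed.

End RealIntegral.

(** * Complex-valued functions *)

Section Complex.
Variable R : realType.
Local Notation C := R[i].
Local Notation mu := (@lebesgue_measure R).
Local Notation Re := (@complex.Re R).
Local Notation Im := (@complex.Im R).
Local Notation rint := (Rintegral mu setT).
Local Notation cintT := (cint setT).
Implicit Types (z w : C) (f g : R -> C).

Lemma ReD z w : Re (z + w) = Re z + Re w. Proof. by case: z; case: w. Qed.
Lemma ImD z w : Im (z + w) = Im z + Im w. Proof. by case: z; case: w. Qed.
Lemma ReN z : Re (- z) = - Re z. Proof. by case: z. Qed.
Lemma ImN z : Im (- z) = - Im z. Proof. by case: z. Qed.
Lemma ReB z w : Re (z - w) = Re z - Re w. Proof. by rewrite ReD ReN. Qed.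
Lemma ImB z w : Im (z - w) = Im z - Im w. Proof. by rewrite ImD ImN. Qed.
Lemma ReM z w : Re (z * w) = Re z * Re w - Im z * Im w. Proof. by case: z; case: w. Qed.
Lemma ImM z w : Im (z * w) = Re z * Im w + Im z * Re w. Proof. by case: z; case: w. Qed.
Lemma C_ext z w : Re z = Re w -> Im z = Im w -> z = w.
Proof. by case: z => a b; case: w => c d /= -> ->. Qed.

Lemma RtoCD (x y : R) : RtoC (x + y) = RtoC x + RtoC y.
Proof. by apply: C_ext; rewrite ?ReD ?ImD /= ?addr0. Qed.
Lemma RtoCN (x : R) : RtoC (- x) = - RtoC x.
Proof. by apply: C_ext; rewrite ?ReN ?ImN /= ?oppr0. Qed.
Lemma RtoCM (x y : R) : RtoC (x * y) = RtoC x * RtoC y.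
Proof. by apply: C_ext; rewrite ?ReM ?ImM /= ?mulr0 ?mul0r ?subr0 ?addr0. Qed.
Lemma RtoC0 : RtoC (0 : R) = 0. Proof. by []. Qed.
Lemma RtoC1 : RtoC (1 : R) = 1. Proof. by []. Qed.
Lemma RtoCV (x : R) : RtoC x^-1 = (RtoC x)^-1.
Proof.
have [->|x0] := eqVneq x 0; first by rewrite RtoC0 !invr0.
apply: (@mulfI _ (RtoC x)); first by apply: contra_neq x0 => /(congr1 Re).
by rewrite -RtoCM mulfV// mulfV//; apply: contra_neq x0 => /(congr1 Re).
Qed.
Lemma RtoC_eq0 (x : R) : (RtoC x == 0) = (x == 0).
Proof. by apply/eqP/eqP => [/(congr1 Re)|->]. Qed.

Lemma cnorm_ge0 z : 0 <= cnorm z. Proof. by case: z => a b; exact: sqrtr_ge0. Qed.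
Lemma cnormM z w : cnorm (z * w) = cnorm z * cnorm w. Proof. exact: ComplexField.Normc.normcM. Qed.
Lemma cnormD z w : cnorm (z + w) <= cnorm z + cnorm w. Proof. exact: le_normcD. Qed.
Lemma cnormN z : cnorm (- z) = cnorm z. Proof. exact: normcN. Qed.
Lemma cnormB z w : cnorm (z - w) <= cnorm z + cnorm w.
Proof. by rewrite (le_trans (cnormD _ _))// cnormN. Qed.
Lemma cnormBC z w : cnorm (z - w) = cnorm (w - z).
Proof. by rewrite -cnormN opprB. Qed.
Lemma cnorm_triangle z w (v : C) : cnorm (z - w) <= cnorm (z - v) + cnorm (v - w).
Proof. by have -> : z - w = (z - v) + (v - w); [ring|exact: cnormD]. Qed.
Lemma cnorm0 : cnorm (0 : C) = 0. Proof. exact: ComplexField.Normc.normc0. Qed.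
Lemma cnormV z : cnorm z^-1 = (cnorm z)^-1. Proof. exact: ComplexField.Normc.normcV. Qed.
Lemma cnorm_eq0 z : (cnorm z == 0) = (z == 0).
Proof. by apply/eqP/eqP => [|->]; [exact: ComplexField.Normc.eq0_normc|exact: cnorm0]. Qed.
Lemma cnorm_gt0 z : (0 < cnorm z) = (z != 0).
Proof. by rewrite lt_neqAle cnorm_ge0 andbT eq_sym cnorm_eq0. Qed.
Lemma cnorm_RtoC (x : R) : cnorm (RtoC x) = `|x|.
Proof. by rewrite /cnorm /= expr0n addr0 sqrtr_sqr. Qed.
Lemma norm_Re z : `|Re z| <= cnorm z.
Proof.
case: z => a b /=; rewrite -[X in X <= _]sqrtr_sqr /cnorm /= ler_wsqrtr//.
by rewrite lerDl sqr_ge0.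
Qed.
Lemma norm_Im z : `|Im z| <= cnorm z.
Proof.
case: z => a b /=; rewrite -[X in X <= _]sqrtr_sqr /cnorm /= ler_wsqrtr//.
by rewrite lerDr sqr_ge0.
Qed.
Lemma cnorm_le z : cnorm z <= `|Re z| + `|Im z|.
Proof.
case: z => a b /=; rewrite /cnorm /= -[X in _ <= X]ger0_norm ?addr_ge0// -sqrtr_sqr.
apply: ler_wsqrtr; rewrite sqrrD !real_normK ?num_real//.
by rewrite -addrA lerD2l lerDr mulrn_wge0// mulr_ge0.
Qed.
Lemma cnorm_sqr z : cnorm z ^+ 2 = Re z ^+ 2 + Im z ^+ 2.
Proof. by case: z => a b; rewrite /cnorm /= sqr_sqrtr// addr_ge0 ?sqr_ge0. Qed.
Lemma cnorm_cexp z : cnorm (cexp z) = expR (Re z).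
Proof.
have /eqP : cnorm (cexp z) ^+ 2 = expR (Re z) ^+ 2.
  by rewrite cnorm_sqr /= !exprMn -mulrDr cos2Dsin2 mulr1.
by rewrite eqrXn2 ?cnorm_ge0 ?expR_ge0// => /eqP.
Qed.
Lemma cexpD z w : cexp (z + w) = cexp z * cexp w.
Proof.
by apply: C_ext; rewrite ?ReM ?ImM /= ReD ImD ?cosD ?sinD expRD; ring.
Qed.
Lemma cexp_RtoC (x : R) : cexp (RtoC x) = RtoC (expR x).
Proof. by apply: C_ext; rewrite /= ?cos0 ?sin0 ?mulr1 ?mulr0. Qed.

Definition cmea f := measurable_fun setT (fun x => Re (f x)) /\ measurable_fun setT (fun x => Im (f x)).
Definition cinteg f := integ (fun x => Re (f x)) /\ integ (fun x => Im (f x)).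

Lemma eq_cinteg f g : f =1 g -> cinteg f -> cinteg g.
Proof. by move=> /funext ->. Qed.
Lemma eq_cint f g : f =1 g -> cintT f = cintT g.
Proof. by move=> /funext ->. Qed.

Lemma cmeaD f g : cmea f -> cmea g -> cmea (fun x => f x + g x).
Proof.
move=> [f1 f2] [g1 g2]; split.
- by under eq_fun do rewrite ReD; exact: measurable_funD.
- by under eq_fun do rewrite ImD; exact: measurable_funD.
Qed.
Lemma cmeaM f g : cmea f -> cmea g -> cmea (fun x => f x * g x).
Proof.
move=> [f1 f2] [g1 g2]; split.
- by under eq_fun do rewrite ReM; apply: measurable_funB; exact: measurable_funM.
- by under eq_fun do rewrite ImM; apply: measurable_funD; exact: measurable_funM.
Qed.
Lemma cmea_cst z : cmea (fun=> z). Proof. by split; exact: measurable_cst. Qed.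
Lemma cmeaN f : cmea f -> cmea (fun x => - f x).
Proof.
by move=> [f1 f2]; split; [under eq_fun do rewrite ReN|under eq_fun do rewrite ImN]; exact: measurable_funN.
Qed.
Lemma cmeaB f g : cmea f -> cmea g -> cmea (fun x => f x - g x).
Proof. by move=> hf hg; apply: cmeaD => //; exact: cmeaN. Qed.
Lemma cmea_RtoC (h : R -> R) : measurable_fun setT h -> cmea (fun x => RtoC (h x)).
Proof. by move=> mh; split => //=; exact: measurable_cst. Qed.
Lemma cmea_cexp f : cmea f -> cmea (fun x => cexp (f x)).
Proof.
move=> [f1 f2]; split => /=; apply: measurable_funM.
- exact: (measurableT_comp (@measurable_expR R)).
- by apply: (measurableT_comp _ f2); apply: continuous_measurable_fun; exact: continuous_cos.
- exact: (measurableT_comp (@measurable_expR R)).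
- by apply: (measurableT_comp _ f2); apply: continuous_measurable_fun; exact: continuous_sin.
Qed.
Lemma cmea_comp f (h : R -> R) : cmea f -> measurable_fun setT h -> cmea (fun x => f (h x)).
Proof. by move=> [f1 f2] mh; split; [exact: (measurableT_comp f1)|exact: (measurableT_comp f2)]. Qed.
Lemma mea_cnorm f : cmea f -> measurable_fun setT (fun x => cnorm (f x)).
Proof.
move=> [f1 f2].
have -> : (fun x => cnorm (f x)) = (fun x => Num.sqrt (Re (f x) ^+ 2 + Im (f x) ^+ 2)).
  by apply/funext => x; rewrite -cnorm_sqr sqrtr_sqr ger0_norm// cnorm_ge0.
apply: (@measurableT_comp _ _ _ _ _ _ (@Num.sqrt R)).
  by apply: continuous_measurable_fun; exact: sqrt_continuous.
by apply: measurable_funD; exact: measurable_funX.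
Qed.

Lemma cinteg_mea f : cinteg f -> cmea f.
Proof. by move=> [h1 h2]; split; exact: integ_mea. Qed.
Lemma cinteg_dom f (g : R -> R) : cmea f -> integ g -> (forall x, cnorm (f x) <= g x) -> cinteg f.
Proof.
move=> [m1 m2] ig fg; split; apply: (integ_dom _ ig) => // x.
- exact: le_trans (norm_Re _) (fg x).
- exact: le_trans (norm_Im _) (fg x).
Qed.
Lemma cinteg_norm f : cinteg f -> integ (fun x => cnorm (f x)).
Proof.
move=> hf; have [h1 h2] := hf.
apply: (integ_dom (mea_cnorm (cinteg_mea hf)) (integD (integ_norm h1) (integ_norm h2))) => x.
by rewrite ger0_norm ?cnorm_ge0// cnorm_le.
Qed.
Lemma cintegD f g : cinteg f -> cinteg g -> cinteg (fun x => f x + g x).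
Proof.
move=> [f1 f2] [g1 g2]; split.
- by under eq_fun do rewrite ReD; exact: integD.
- by under eq_fun do rewrite ImD; exact: integD.
Qed.
Lemma cintegN f : cinteg f -> cinteg (fun x => - f x).
Proof.
by move=> [f1 f2]; split; [under eq_fun do rewrite ReN|under eq_fun do rewrite ImN]; exact: integN.
Qed.
Lemma cintegB f g : cinteg f -> cinteg g -> cinteg (fun x => f x - g x).
Proof. by move=> hf hg; apply: cintegD => //; exact: cintegN. Qed.
Lemma cintegM_bdd f g M : cinteg f -> cmea g -> (forall x, cnorm (g x) <= M) ->
  cinteg (fun x => f x * g x).
Proof.
move=> hf mg gM; apply: (cinteg_dom (cmeaM (cinteg_mea hf) mg) (integZ M (cinteg_norm hf))) => x.
by rewrite cnormM mulrC ler_wpM2r// cnorm_ge0.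
Qed.
Lemma cintegZ z f : cinteg f -> cinteg (fun x => z * f x).
Proof.
move=> hf; apply: eq_cinteg (cintegM_bdd hf (cmea_cst z) (fun=> lexx _)) => x.
by rewrite mulrC.
Qed.

Lemma cintD f g : cinteg f -> cinteg g -> cintT (fun x => f x + g x) = cintT f + cintT g.
Proof.
move=> [f1 f2] [g1 g2]; apply: C_ext; rewrite ?ReD ?ImD /=.
- by under eq_Rintegral do rewrite ReD; exact: RintegralD.
- by under eq_Rintegral do rewrite ImD; exact: RintegralD.
Qed.
Lemma cintZ z f : cinteg f -> cintT (fun x => z * f x) = z * cintT f.
Proof.
move=> [f1 f2]; apply: C_ext; rewrite ?ReM ?ImM /=.
- under eq_Rintegral do rewrite ReM.
  by rewrite RintegralB//; [rewrite !RintegralZl|exact: integZ|exact: integZ].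
- under eq_Rintegral do rewrite ImM.
  by rewrite RintegralD//; [rewrite !RintegralZl|exact: integZ|exact: integZ].
Qed.
Lemma cintN f : cinteg f -> cintT (fun x => - f x) = - cintT f.
Proof. by move=> hf; rewrite -mulN1r -cintZ//; apply: eq_cint => x; rewrite mulN1r. Qed.
Lemma cintB f g : cinteg f -> cinteg g -> cintT (fun x => f x - g x) = cintT f - cintT g.
Proof. by move=> hf hg; rewrite cintD ?cintN//; exact: cintegN. Qed.
Lemma cint_RtoC (h : R -> R) : cintT (fun x => RtoC (h x)) = RtoC (rint h).
Proof. by rewrite /cint /= Rintegral_cst// mul0r. Qed.

(** Real and imaginary parts are bounded separately, whence the factor 2. *)
Lemma cnorm_cint f (g : R -> R) : cmea f -> integ g -> (forall x, cnorm (f x) <= g x) ->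
  cnorm (cintT f) <= 2 * rint g.
Proof.
move=> [m1 m2] ig fg; rewrite (le_trans (cnorm_le _))//= mulr_natl mulr2n lerD//;
  apply: le_norm_rint => // x.
- exact: le_trans (norm_Re _) (fg x).
- exact: le_trans (norm_Im _) (fg x).
Qed.

Lemma cint_mkcond (D : set R) f : cint D f = cintT (fun x => f x * RtoC (\1_D x)).
Proof.
apply: C_ext => /=; rewrite rint_mkcond; apply: eq_Rintegral => x _;
by rewrite ?ReM ?ImM /= mulr0 ?subr0 ?add0r.
Qed.
Lemma cinteg_mkcond (D : set R) f : measurable D ->
  cintegrable D f <-> cinteg (fun x => f x * RtoC (\1_D x)).
Proof.
move=> mD; rewrite /cintegrable /cinteg.
have -> : (fun x => Re (f x * RtoC (\1_D x))) = (fun x => Re (f x) * \1_D x).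
  by apply/funext => x; rewrite ReM /= mulr0 subr0.
have -> : (fun x => Im (f x * RtoC (\1_D x))) = (fun x => Im (f x) * \1_D x).
  by apply/funext => x; rewrite ImM /= mulr0 add0r.
by split=> -[h1 h2]; split; apply/(integ_mkcond _ mD).
Qed.

Lemma cint_shift b f : cinteg f -> cintT (fun x => f (x + b)) = cintT f.
Proof. by move=> [h1 h2]; apply: C_ext => /=; [rewrite (rint_shift b h1)|rewrite (rint_shift b h2)]. Qed.
Lemma cint_refl b f : cinteg f -> cintT (fun x => f (b - x)) = cintT f.
Proof. by move=> [h1 h2]; apply: C_ext => /=; [rewrite (rint_refl b h1)|rewrite (rint_refl b h2)]. Qed.
Lemma cinteg_shift b f : cinteg f -> cinteg (fun x => f (x + b)).
Proof. by move=> [h1 h2]; split; [exact: (integ_shift b h1)|exact: (integ_shift b h2)]. Qed.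
Lemma cinteg_refl b f : cinteg f -> cinteg (fun x => f (b - x)).
Proof. by move=> [h1 h2]; split; [exact: (integ_refl b h1)|exact: (integ_refl b h2)]. Qed.

Lemma cfubini (F : R * R -> C) (a : R -> R) :
  measurable_fun setT (fun z : R * R => Re (F z)) ->
  measurable_fun setT (fun z : R * R => Im (F z)) ->
  (forall x, cinteg (fun y => F (x, y))) ->
  (forall x, rint (fun y => cnorm (F (x, y))) <= a x) -> integ a ->
  cintT (fun x => cintT (fun y => F (x, y))) = cintT (fun y => cintT (fun x => F (x, y))).
Proof.
move=> m1 m2 iF Fa ia.
apply: C_ext => /=.
- apply: (@fubini R (fun z : R * R => Re (F z)) a) => // x; first exact: (iF x).1.
  apply: le_trans (Fa x); apply: le_rint => [||y]; last exact: norm_Re.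
    exact/integ_norm/(iF x).1.
  exact/cinteg_norm/iF.
- apply: (@fubini R (fun z : R * R => Im (F z)) a) => // x; first exact: (iF x).2.
  apply: le_trans (Fa x); apply: le_rint => [||y]; last exact: norm_Im.
    exact/integ_norm/(iF x).2.
  exact/cinteg_norm/iF.
Qed.

Lemma ccvg_right0P (f : R -> C) l : ccvg_right0 f l <->
  Re (f s) @[s --> 0^'+] --> Re l /\ Im (f s) @[s --> 0^'+] --> Im l.
Proof.
split=> [h|[/cvgrPdist_lt h1 /cvgrPdist_lt h2] e e0].
  split; apply/cvgrPdist_lt => e e0; have [d d0 hd] := h e e0;
  (exists d => //= s /=; rewrite sub0r normrN => sd s0;
   have := hd s; rewrite s0 -[X in X < d]gtr0_norm// sd => /(_ isT); apply: le_lt_trans).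
  - by rewrite distrC -ReB norm_Re.
  - by rewrite distrC -ImB norm_Im.
have e2 : 0 < e / 2 by rewrite divr_gt0.
have [d1 /= d10 H1] := h1 _ e2; have [d2 /= d20 H2] := h2 _ e2.
exists (Num.min d1 d2); first by rewrite lt_min d10.
move=> s; rewrite lt_min => /and3P[s0 s1 s2].
rewrite (le_lt_trans (cnorm_le _))// (splitr e) ltrD// ?ReB ?ImB distrC.
- by apply: H1 => //=; rewrite sub0r normrN gtr0_norm.
- by apply: H2 => //=; rewrite sub0r normrN gtr0_norm.
Qed.

Lemma ccvg_pinftyP (f : R -> C) l : ccvg_pinfty f l <->
  Re (f s) @[s --> +oo] --> Re l /\ Im (f s) @[s --> +oo] --> Im l.
Proof.
split=> [h|[/cvgrPdist_lt h1 /cvgrPdist_lt h2] e e0].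
  split; apply/cvgrPdist_lt => e e0; have [M hM] := h e e0;
  (exists M; split; first exact: num_real); move=> s /hM; apply: le_lt_trans.
  - by rewrite distrC -ReB norm_Re.
  - by rewrite distrC -ImB norm_Im.
have e2 : 0 < e / 2 by rewrite divr_gt0.
have [M1 [_ H1]] := h1 _ e2; have [M2 [_ H2]] := h2 _ e2.
exists (Num.max M1 M2) => s; rewrite gt_max => /andP[s1 s2].
rewrite (le_lt_trans (cnorm_le _))// (splitr e) ltrD// ?ReB ?ImB distrC.
- exact: H1.
- exact: H2.
Qed.

Lemma cdct_right0 (F : R -> R -> C) f (g : R -> R) (d : R) : 0 < d ->
  (forall s, 0 < s < d -> cmea (F s)) -> cmea f ->
  {ae mu, forall x, ccvg_right0 (F ^~ x) (f x)} ->
  integ g -> (forall s x, 0 < s < d -> cnorm (F s x) <= g x) ->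
  ccvg_right0 (fun s => cintT (F s)) (cintT f).
Proof.
move=> d0 mF [mf1 mf2] cF ig Fg; apply/ccvg_right0P; split => /=.
- apply: (@dct_right0 R (fun s x => Re (F s x)) _ _ d) ig _ => // [s /mF[]//||s x sd].
    apply: (@filterS _ _ (ae_filter_ringOfSetsType mu) _ _ _ cF) => x.
    by move=> /ccvg_right0P[].
  exact: le_trans (norm_Re _) (Fg s x sd).
- apply: (@dct_right0 R (fun s x => Im (F s x)) _ _ d) ig _ => // [s /mF[]//||s x sd].
    apply: (@filterS _ _ (ae_filter_ringOfSetsType mu) _ _ _ cF) => x.
    by move=> /ccvg_right0P[].
  exact: le_trans (norm_Im _) (Fg s x sd).
Qed.

Lemma cdct_pinfty (F : R -> R -> C) f (g : R -> R) :
  (forall s, cmea (F s)) -> cmea f ->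
  {ae mu, forall x, ccvg_pinfty (F ^~ x) (f x)} ->
  integ g -> (forall s x, cnorm (F s x) <= g x) ->
  ccvg_pinfty (fun s => cintT (F s)) (cintT f).
Proof.
move=> mF [mf1 mf2] cF ig Fg; apply/ccvg_pinftyP; split => /=.
- apply: (@dct_pinfty R (fun s x => Re (F s x))) ig _ => // [s||s x].
  + exact: (mF s).1.
  + by apply: (@filterS _ _ (ae_filter_ringOfSetsType mu) _ _ _ cF) => x /ccvg_pinftyP[].
  + exact: le_trans (norm_Re _) (Fg s x).
- apply: (@dct_pinfty R (fun s x => Im (F s x))) ig _ => // [s||s x].
  + exact: (mF s).2.
  + by apply: (@filterS _ _ (ae_filter_ringOfSetsType mu) _ _ _ cF) => x /ccvg_pinftyP[].
  + exact: le_trans (norm_Im _) (Fg s x).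
Qed.

Lemma ccvg_right0_unique (f : R -> C) l l' : ccvg_right0 f l -> ccvg_right0 f l' -> l = l'.
Proof.
move=> h h'; apply/eqP; rewrite -subr_eq0 -cnorm_eq0; apply/negPn/negP => /negP.
rewrite cnorm_eq0 => /negP; rewrite -cnorm_gt0 => e0.
have e2 : 0 < cnorm (l - l') / 2 by rewrite divr_gt0.
have [d d0 hd] := h _ e2; have [d' d'0 hd'] := h' _ e2.
pose s := Num.min d d' / 2.
have m0 : 0 < Num.min d d' by rewrite lt_min d0.
have s0 : 0 < s by rewrite divr_gt0.
have sm : s < Num.min d d' by rewrite /s; lra.
move: sm; rewrite lt_min => /andP[sd sd'].
have H1 := hd s; have H2 := hd' s; rewrite s0 sd in H1; rewrite s0 sd' in H2.
have := cnorm_triangle l l' (f s); rewrite (cnormBC l (f s)).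
by have := H1 isT; have := H2 isT; lra.
Qed.

Lemma ccvg_right0D (f g : R -> C) a b : ccvg_right0 f a -> ccvg_right0 g b ->
  ccvg_right0 (fun s => f s + g s) (a + b).
Proof.
move=> /ccvg_right0P[h1 h2] /ccvg_right0P[h3 h4]; apply/ccvg_right0P.
by rewrite ReD ImD; split; [under eq_fun do rewrite ReD|under eq_fun do rewrite ImD]; exact: cvgD.
Qed.
Lemma ccvg_right0N (f : R -> C) a : ccvg_right0 f a -> ccvg_right0 (fun s => - f s) (- a).
Proof.
move=> /ccvg_right0P[h1 h2]; apply/ccvg_right0P.
by rewrite ReN ImN; split; [under eq_fun do rewrite ReN|under eq_fun do rewrite ImN]; exact: cvgN.
Qed.
Lemma ccvg_right0_near (f g : R -> C) a (d : R) : 0 < d -> (forall s, 0 < s < d -> f s = g s) ->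
  ccvg_right0 f a -> ccvg_right0 g a.
Proof.
move=> d0 fg h e e0; have [d' d'0 hd] := h e e0.
exists (Num.min d d'); first by rewrite lt_min d0.
by move=> s; rewrite lt_min => /and3P[s0 sd sd']; rewrite -fg ?s0//; apply: hd; rewrite s0.
Qed.
End Complex.

(** * Smooth functions *)

Section Smooth.
Variable R : realType.
Implicit Types (f g : R -> R) (n : nat).

(** Derivatives are taken from the inside, so that an induction quantified over all functions gives
    closure under sums, products and composition; [derive1n] adds them on the outside. *)
Fixpoint diffn n f : Prop :=
  if n is n'.+1 then (forall x, derivable f x 1) /\ diffn n' (derive1 f) else True.

Lemma derive1nS' n f : derive1n n.+1 f = derive1n n (derive1 f).
Proof. by rewrite /derive1n iterSr. Qed.

Lemma smoothP f : smooth f <-> forall n, diffn n f.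
Proof.
split=> [sf n|].
  elim: n f sf => // n IH f sf; split=> [x|]; first exact: (sf 0).
  by apply: IH => m x; rewrite -derive1nS'; exact: sf.
move=> sf n; elim: n f sf => [f /(_ 1)[]//|n IH f sf x].
by rewrite derive1nS'; apply: IH => m; have [] := sf m.+1.
Qed.

Lemma diffnW n f : diffn n.+1 f -> diffn n f.
Proof. by elim: n f => // n IH f [df /IH]. Qed.

Lemma diffn_cst n (c : R) : diffn n (fun=> c).
Proof.
elim: n c => // n IH c; split=> [x|]; first exact: derivable_cst.
by rewrite (_ : derive1 _ = fun=> (0 : R)); [exact: IH|apply/funext => x; rewrite derive1_cst].
Qed.

Lemma derive1D f g : (forall x, derivable f x 1) -> (forall x, derivable g x 1) ->
  derive1 (fun x => f x + g x) = (fun x => (derive1 f) x + (derive1 g) x).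
Proof.
by move=> df dg; apply/funext => x; rewrite !derive1E deriveD.
Qed.

Lemma derive1M f g : (forall x, derivable f x 1) -> (forall x, derivable g x 1) ->
  derive1 (fun x => f x * g x) = (fun x => f x * (derive1 g) x + (derive1 f) x * g x).
Proof.
move=> df dg; apply/funext => x; rewrite !derive1E deriveM//=.
by congr (_ + _); rewrite mulrC.
Qed.

Lemma diffnD n f g : diffn n f -> diffn n g -> diffn n (fun x => f x + g x).
Proof.
elim: n f g => // n IH f g [df hf] [dg hg]; split=> [x|]; first exact: derivableD.
by rewrite derive1D//; exact: IH.
Qed.

Lemma diffnM n f g : diffn n f -> diffn n g -> diffn n (fun x => f x * g x).
Proof.
elim: n f g => // n IH f g hf hg; have [df hf'] := hf; have [dg hg'] := hg.
split=> [x|]; first exact: derivableM.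
rewrite derive1M//; apply: diffnD; apply: IH => //; exact: diffnW.
Qed.

Lemma diffn_id n : diffn n (fun x : R => x).
Proof.
case: n => // n; split=> [x|]; first exact: derivable_id.
rewrite (_ : derive1 _ = fun=> (1 : R)); first exact: diffn_cst.
by apply/funext => x; rewrite derive1E derive_id.
Qed.

Lemma derive1_comp' f g : (forall x, derivable f x 1) -> (forall x, derivable g x 1) ->
  derive1 (fun x => g (f x)) = (fun x => (derive1 g) (f x) * (derive1 f) x).
Proof. by move=> df dg; apply/funext => x; rewrite (derive1_comp (df x) (dg (f x))). Qed.

Lemma derivable_comp' f g x : derivable f x 1 -> derivable g (f x) 1 ->
  derivable (fun x => g (f x)) x 1.
Proof.
move=> /derivable1_diffP df /derivable1_diffP dg.
by apply/derivable1_diffP; exact: differentiable_comp.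
Qed.

Lemma diffn_comp n f g : diffn n f -> (forall m, diffn m g) -> diffn n (fun x => g (f x)).
Proof.
elim: n f g => // n IH f g hf hg; have [df hf'] := hf.
have dg := (hg 1).1.
split=> [x|]; first exact: derivable_comp'.
rewrite derive1_comp'//; apply: diffnM => //; apply: IH; first exact: diffnW.
by move=> m; have [] := hg m.+1.
Qed.

Lemma smoothD f g : smooth f -> smooth g -> smooth (fun x => f x + g x).
Proof. by move=> /smoothP hf /smoothP hg; apply/smoothP => n; exact: diffnD. Qed.
Lemma smoothM f g : smooth f -> smooth g -> smooth (fun x => f x * g x).
Proof. by move=> /smoothP hf /smoothP hg; apply/smoothP => n; exact: diffnM. Qed.
Lemma smooth_cst (c : R) : smooth (fun=> c).
Proof. by apply/smoothP => n; exact: diffn_cst. Qed.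
Lemma smooth_id : smooth (fun x : R => x).
Proof. by apply/smoothP => n; exact: diffn_id. Qed.
Lemma smooth_comp f g : smooth f -> smooth g -> smooth (fun x => g (f x)).
Proof. by move=> /smoothP hf /smoothP hg; apply/smoothP => n; exact: diffn_comp. Qed.
Lemma smoothN f : smooth f -> smooth (fun x => - f x).
Proof.
move=> hf; rewrite (_ : (fun x => - f x) = fun x => (-1) * f x).
  exact: (smoothM (@smooth_cst (-1)) hf).
by apply/funext => x; rewrite mulN1r.
Qed.
Lemma smoothB f g : smooth f -> smooth g -> smooth (fun x => f x - g x).
Proof. by move=> hf hg; exact: (smoothD hf (smoothN hg)). Qed.
Lemma smooth_derivable f x : smooth f -> derivable f x 1.
Proof. by move=> /(_ 0%N x). Qed.
Lemma smooth_derive1 f : smooth f -> smooth (derive1 f).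
Proof. by move=> hf n x; rewrite -derive1nS'; exact: hf. Qed.
Lemma smooth_continuous f : smooth f -> continuous f.
Proof.
by move=> hf x; apply: differentiable_continuous; apply/derivable1_diffP; exact: smooth_derivable.
Qed.
Lemma smooth_mea f : smooth f -> measurable_fun setT f.
Proof. by move=> hf; apply: continuous_measurable_fun; exact: smooth_continuous. Qed.

(** Coinduction for smoothness. The classes it is applied to are combinations of cosine and sine,
    bump profiles, polynomials, sums of series and convolutions. *)
Lemma smooth_ind (P : (R -> R) -> Prop) :
  (forall f, P f -> forall x, derivable f x 1) -> (forall f, P f -> P (derive1 f)) ->
  forall f, P f -> smooth f.
Proof.
move=> Pd P' f Pf n x; elim: n f Pf => [|n IH] f Pf; first exact: Pd.
by rewrite derive1nS'; apply: IH; exact: P'.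
Qed.

Lemma smooth_cos : smooth (@cos R) /\ smooth (@sin R).
Proof.
pose P f := exists a b : R, f = fun x => a * cos x + b * sin x.
have h : forall f, P f -> smooth f.
  apply: smooth_ind => [f [a [b ->]] x|f [a [b ->]]].
    by apply: derivableD; apply: derivableM => //; exact: derivable_cst.
  exists b, (- a); apply/funext => x.
  rewrite derive1D => [|y|y]; try by apply: derivableM => //; exact: derivable_cst.
  rewrite !derive1M => [|y|y|y|y] //; try exact: derivable_cst.
  rewrite !derive1_cst !derive1E !derive_val; ring.
split; apply: h; [exists 1, 0|exists 0, 1]; apply/funext => x; ring.
Qed.

(* The profiles p(1/x) exp(-1/x), extended by 0, are stable under differentiation. *)
Definition bumpf (p : {poly R}) (x : R) : R := if 0 < x then p.[x^-1] * expR (- x^-1) else 0.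
Definition bump_deriv (p : {poly R}) : {poly R} := 'X^2 * (p - p^`()).

Lemma poly_expRN_cvg (p : {poly R}) n : p.[x] * x ^+ n * expR (- x) @[x --> +oo] --> (0 : R).
Proof.
have mono m : x ^+ m * expR (- x) @[x --> +oo] --> (0 : R).
  apply/cvgrPdist_lt => e e0; exists (Num.max 1 ((m.+1)`!%:R / e)); split; first exact: num_real.
  move=> x; rewrite gt_max => /andP[x1 xe].
  have x0 : 0 < x by lra.
  rewrite sub0r normrN ger0_norm ?mulr_ge0 ?expR_ge0 ?exprn_ge0 ?ltW//.
  have H : x ^+ m.+1 / (m.+1)`!%:R < expR x.
    by apply: lt_le_trans (expR_ge1Dxn m (ltW x0)); rewrite ltrDr.
  rewrite expRN ltr_pdivrMr ?expR_gt0//.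
  have f0 : 0 < (m.+1)`!%:R :> R by rewrite ltr0n fact_gt0.
  move: H; rewrite ltr_pdivrMr// exprS => H.
  move: xe; rewrite ltr_pdivrMr// => xe.
  have X0 : 0 < x ^+ m by exact: exprn_gt0.
  rewrite -(ltr_pM2l x0) (lt_trans H)// (_ : x * (e * expR x) = expR x * (x * e)); last ring.
  by rewrite ltr_pM2l// expR_gt0.
elim/poly_ind: p n => [|p c IH] n.
  by under eq_fun do rewrite horner0 !mul0r; exact: cvg_cst.
have -> : (fun x : R => (p * 'X + c%:P).[x] * x ^+ n * expR (- x)) =
   (fun x => p.[x] * x ^+ n.+1 * expR (- x) + c * (x ^+ n * expR (- x))).
  by apply/funext => x; rewrite hornerD hornerM hornerX hornerC exprS; ring.
rewrite -[0]addr0 -[X in _ + X](mulr0 c); apply: cvgD; first exact: IH.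
by apply: cvgM; [exact: cvg_cst|exact: mono].
Qed.

Lemma bumpf_is_derive p (x : R) : is_derive x (1 : R) (bumpf p) (bumpf (bump_deriv p) x).
Proof.
case: (ltgtP 0 x) => [x0|x0|<-].
- have E : \near x, (fun y => p.[y^-1] * expR (- y^-1)) x = bumpf p x.
    by near=> y; rewrite /bumpf; case: ifPn => // /negP[]; near: y; exact: lt_nbhsr.
  apply: (near_eq_is_derive E).
  have xn : x != 0 by rewrite gt_eqF.
  rewrite /bumpf x0.
  have d1 : is_derive x (1 : R) (fun y : R => y^-1) (- x ^- 2).
    have := @is_deriveV R (fun y : R => y) x 1 1 xn (is_derive_id x 1).
    by rewrite /GRing.scale /= mulr1.
  have d2 := @is_derive1_comp R (horner p) _ x _ _ (is_derive_poly p x^-1) d1.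
  have d3 : is_derive x (1 : R) (fun y : R => - y^-1) (x ^- 2).
    by have := is_deriveN d1; rewrite opprK.
  have d4 := @is_derive1_comp R (@expR R) _ x _ _ (is_derive_expR (- x^-1)) d3.
  have := is_deriveM d2 d4; set D := (X in is_derive _ _ _ X) => dD.
  have <- : D = (bump_deriv p).[x^-1] * expR (- x^-1) => //.
  rewrite /D /bump_deriv hornerM hornerXn hornerD hornerN /= /GRing.scale /=.
  by rewrite exprVn; ring.
- have E : \near x, (fun y => 0) x = bumpf p x.
    near=> y; rewrite /bumpf ltNge; have -> // : y <= 0.
    by apply: ltW; near: y; exact: lt_nbhsl.
  apply: (near_eq_is_derive E).
  by rewrite /bumpf ltNge ltW//=; exact: is_derive_cst.
- have B0 q : bumpf q 0 = 0 by rewrite /bumpf ltxx.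
  rewrite B0.
  (* At 0 the difference quotient is the profile times one more power of 1/h; this is the exponent 1
     given to [poly_expRN_cvg]. *)
  have H : h^-1 *: ((bumpf p \o shift 0) (h *: (1 : R)) - bumpf p 0) @[h --> 0^'] --> (0 : R).
    rewrite B0; apply/cvgrPdist_lt => e e0.
    have /cvgrPdist_lt/(_ e e0)[M [_ hM]] := poly_expRN_cvg p 1.
    pose M' := Num.max M 1.
    have M0 : 0 < M' by rewrite lt_max ltr01 orbT.
    exists M'^-1; first by rewrite /= invr_gt0.
    move=> h /=; rewrite sub0r normrN => hM' h0.
    rewrite sub0r normrN subr0 addr0 /GRing.scale /= mulr1 /bumpf.
    case: ifPn => [hp|_]; last by rewrite mulr0 normr0.
    have : M < h^-1.
      apply: (@le_lt_trans _ _ M'); first by rewrite le_max lexx.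
      by rewrite -[M']invrK ltf_pV2 ?posrE ?invr_gt0// -[h]gtr0_norm.
    by move=> /hM; rewrite sub0r normrN expr1 [p.[_] * _]mulrC mulrA.
  apply: DeriveDef; first by apply/cvg_ex; exists 0.
  exact: cvg_lim H.
Unshelve. all: by end_near.
Qed.

Lemma bumpf_smooth p : smooth (bumpf p).
Proof.
suff : forall f, (exists p, f = bumpf p) -> smooth f by apply; exists p.
apply: smooth_ind => [f [{}p ->] x|f [{}p ->]].
  by have [] := bumpf_is_derive p x.
exists (bump_deriv p); apply/funext => x; rewrite derive1E.
by have [] := bumpf_is_derive p x.
Qed.
End Smooth.

Opaque smooth.

(** * Uniform bounds for a family of bump functions *)

Section Bump.
Variable R : realType.
Local Notation C := R[i].
Implicit Types (f g : R -> R) (n : nat).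

Definition bump : R -> R := bumpf (1 : {poly R}).

Lemma bumpf_eq0 p (x : R) : x <= 0 -> bumpf p x = 0.
Proof. by rewrite /bumpf ltNge => ->. Qed.
Lemma bump_gt0 x : 0 < x -> 0 < bump x.
Proof. by move=> x0; rewrite /bump /bumpf x0 hornerE mul1r expR_gt0. Qed.
Lemma bump_ge0 x : 0 <= bump x.
Proof. by have [/bump_gt0/ltW//|/(bumpf_eq0 1)] := ltP 0 x; rewrite /bump => ->. Qed.

Lemma bumpf_bounded p (M : R) : exists C : R, forall x, x <= M -> `|bumpf p x| <= C.
Proof.
pose M' := Num.max M 0.
have cb : {within `[0, M'], continuous (bumpf p)}.
  by apply: continuous_subspaceT; exact: (smooth_continuous (@bumpf_smooth R p)).
have [C hC] : exists C : R, forall x, x \in `[0, M'] -> `|bumpf p x| <= C.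
  have cn : {within `[0, M'], continuous (fun x => `|bumpf p x|)}.
    apply: continuous_subspaceT => x; apply: cvg_norm.
    exact: (smooth_continuous (@bumpf_smooth R p)).
  have m0 : (0 : R) <= M' by rewrite le_max lexx orbT.
  by have [c _ hc] := EVT_max m0 cn; exists `|bumpf p c|.
exists `|C| => x xM; have [x0|/(bumpf_eq0 p)->] := ltP 0 x; last by rewrite normr0.
by rewrite (le_trans (hC _ _)) ?ler_norm// in_itv/= ltW//= le_max xM.
Qed.

Lemma smooth_horner (p : {poly R}) : smooth (horner p).
Proof.
suff : forall f, (exists p : {poly R}, f = horner p) -> smooth f by apply; exists p.
apply: smooth_ind => [f [{}p ->] x|f [{}p ->]]; first exact: derivable_horner.
exists p^`(); apply/funext => x; rewrite derive1E.
by have [] := is_derive_poly p x.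
Qed.

Lemma smooth_bump_comp (r p : {poly R}) (q : R) : smooth (fun u => r.[u] * bumpf p (q - u ^+ 2)).
Proof.
apply: (@smoothM R _ _ (@smooth_horner r)).
have h : smooth (fun u : R => q - u ^+ 2).
  apply: (@smoothB R _ _ (@smooth_cst R q)).
  exact: (@smoothM R _ _ (@smooth_id R) (@smooth_id R)).
exact: (@smooth_comp R _ _ h (@bumpf_smooth R p)).
Qed.

Lemma derive1_bump_comp (r p : {poly R}) (q : R) :
  derive1 (fun u => r.[u] * bumpf p (q - u ^+ 2)) =
  (fun u => r^`().[u] * bumpf p (q - u ^+ 2) + (- 2%:P * 'X * r).[u] * bumpf (bump_deriv p) (q - u ^+ 2)).
Proof.
apply/funext => u; rewrite derive1E.
have d1 := is_derive_poly r u.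
have d2 : is_derive u (1 : R) (fun u : R => q - u ^+ 2) (- (2 * u)).
  have d := is_deriveB (is_derive_cst q u (1 : R)) (is_deriveX 2 (is_derive_id u (1 : R))).
  by move: d; rewrite sub0r /= expr1 /GRing.scale /= mulr1.
have d3 := @is_derive1_comp R (bumpf p) _ u _ _ (bumpf_is_derive p (q - u ^+ 2)) d2.
have [_ E] := is_deriveM d1 d3; apply: (etrans E).
rewrite /= /GRing.scale /= !hornerM hornerN hornerX hornerC; ring.
Qed.

Lemma derive1nD n f g (x : R) : smooth f -> smooth g ->
  derive1n n (fun x => f x + g x) x = derive1n n f x + derive1n n g x.
Proof.
elim: n f g => // n IH f g sf sg; rewrite !derive1nS'.
rewrite derive1D; [|by move=> y; exact: smooth_derivable|by move=> y; exact: smooth_derivable].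
by apply: IH; exact: smooth_derive1.
Qed.

Lemma derive1nZ n (c : R) f (x : R) : smooth f ->
  derive1n n (fun x => c * f x) x = c * derive1n n f x.
Proof.
elim: n f => // n IH f sf; rewrite !derive1nS' -(IH (derive1 f)); last exact: smooth_derive1.
congr (derive1n n _ x).
rewrite derive1M; [|by move=> y; exact: derivable_cst|by move=> y; exact: smooth_derivable].
by apply/funext => y; rewrite derive1_cst mul0r addr0.
Qed.

Lemma bump_family_bounded n (r p : {poly R}) : exists C : R, forall q u : R, q <= 1 ->
  `|derive1n n (fun u => r.[u] * bumpf p (q - u ^+ 2)) u| <= C.
Proof.
elim: n r p => [|n IH] r p; last first.
  have [C1 h1] := IH r^`() p; have [C2 h2] := IH (- 2%:P * 'X * r) (bump_deriv p).
  exists (C1 + C2) => q u q1; rewrite derive1nS' derive1_bump_comp derive1nD.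
  - by rewrite (le_trans (ler_normD _ _))// lerD ?h1 ?h2.
  - exact: smooth_bump_comp.
  - exact: smooth_bump_comp.
have [C1 h1] := bumpf_bounded p 1.
have cn : {within `[-1, 1], continuous (fun x => `|r.[x]|)}.
  apply: continuous_subspaceT => x; apply: cvg_norm.
  exact: (smooth_continuous (@smooth_horner r)).
have [c _ hc] := EVT_max (ltac:(lra) : (-1 : R) <= 1) cn.
have C10 : 0 <= C1 by apply: le_trans (h1 0 ler01); exact: normr_ge0.
exists (`|r.[c]| * C1) => q u q1; rewrite /= normrM.
have [h|h] := leP (q - u ^+ 2) 0; first by rewrite bumpf_eq0// normr0 mulr0 mulr_ge0.
apply: ler_pM => //.
  apply: hc; rewrite in_itv/= -ler_norml -(@ler_pXn2r _ 2)// ?nnegrE//.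
  by rewrite real_normK ?num_real// expr1n; nra.
apply: h1; nra.
Qed.
End Bump.

(** * Termwise differentiation of geometrically dominated series *)

Section SmoothSeries.
Variable R : realType.
Implicit Types (f : nat -> R -> R) (n k : nat).

(** Every order of derivative has its own constant but the same ratio, so the class is stable under
    termwise differentiation. The ratio 1/3 is that of the signed sums in the uniform boundedness
    argument. *)
Definition good_series f := (forall k, smooth (f k)) /\
  forall n, exists C : R, forall k t, `|derive1n n (f k) t| <= C * 3^-1 ^+ k.

Lemma good_series_derive f : good_series f -> good_series (fun k => derive1 (f k)).
Proof.
move=> [sf bf]; split=> [k|n]; first exact: smooth_derive1.
by have [C hC] := bf n.+1; exists C => k t; rewrite -derive1nS'.
Qed.

Definition ssum f (t : R) : R := limn (series (f ^~ t)).

Lemma geo_sum_le m k : (m <= k)%N ->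
  \sum_(m <= j < k) (3^-1 : R) ^+ j <= 3 / 2 * (3^-1 ^+ m - 3^-1 ^+ k).
Proof.
move=> mk; rewrite -(subnKC mk); elim: (k - m)%N => [|i IH].
  by rewrite addn0 big_geq// subrr mulr0.
rewrite addnS big_nat_recr ?leq_addr//= (le_trans (lerD IH (lexx _)))// exprS.
set x := 3^-1 ^+ (m + i); lra.
Qed.

Lemma series_tail (u : nat -> R) (C : R) m k : (m <= k)%N ->
  (forall k, `|u k| <= C * 3^-1 ^+ k) -> `|series u k - series u m| <= C * (3 / 2) * 3^-1 ^+ m.
Proof.
move=> mk hu; rewrite sub_series_geq//.
have C0 : 0 <= C by have := hu 0%N; rewrite expr0 mulr1; apply: le_trans.
rewrite (le_trans (ler_norm_sum _ _ _))//.
apply: (@le_trans _ _ (\sum_(m <= j < k) C * 3^-1 ^+ j)); first exact: ler_sum.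
rewrite -mulr_sumr -mulrA ler_wpM2l// (le_trans (geo_sum_le mk))// ler_wpM2l//.
by rewrite lerBlDr lerDl exprn_ge0.
Qed.

Lemma ssum_cvg f t : good_series f -> cvgn (series (f ^~ t)).
Proof.
move=> [_ /(_ 0%N)[C hC]].
apply: normed_cvg; apply: (@series_le_cvg _ _ (geometric C 3^-1)) => [k|k|k|].
- exact: normr_ge0.
- exact: le_trans (hC k t).
- exact: hC.
- by apply: is_cvg_geometric_series; rewrite ger0_norm//; lra.
Qed.

Lemma ssum_tail f (C : R) m t : good_series f -> (forall k t, `|f k t| <= C * 3^-1 ^+ k) ->
  `|ssum f t - series (f ^~ t) m| <= C * (3 / 2) * 3^-1 ^+ m.
Proof.
move=> gf hC; have cf := ssum_cvg (t := t) gf.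
have c2 : `|series (f ^~ t) k - series (f ^~ t) m| @[k --> \oo] --> `|ssum f t - series (f ^~ t) m|.
  by apply: cvg_norm; apply: cvgB => //; exact: cvg_cst.
rewrite -(cvg_lim _ c2)//; apply: limr_le; first by apply/cvg_ex; eexists; exact: c2.
by near=> k; apply: series_tail => //; near: k; exact: nbhs_infty_ge.
Unshelve. all: by end_near.
Qed.

(** Two applications of the mean value theorem, hence [C] and not C/2. *)
Lemma taylor2 (f : R -> R) (C x h : R) : smooth f -> (forall t, `|derive1n 2 f t| <= C) ->
  `|f (x + h) - f x - h * derive1 f x| <= C * h ^+ 2.
Proof.
move=> sf hC.
have mvt (g : R -> R) a b : smooth g -> exists2 c, `|c - a| <= `|b - a| & g b - g a = derive1 g c * (b - a).
  move=> sg; have dg x0 : is_derive x0 (1 : R) g (derive1 g x0).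
    by rewrite derive1E; apply: DeriveDef => //; exact: smooth_derivable.
  have [ab|ba|->] := ltgtP a b.
  - have [c cab ->] := MVT ab (fun z _ => dg z) (continuous_subspaceT (smooth_continuous sg)).
    by exists c => //; move: cab; rewrite in_itv/= => /andP[? ?]; rewrite !ger0_norm; lra.
  - have [c cab e] := MVT ba (fun z _ => dg z) (continuous_subspaceT (smooth_continuous sg)).
    exists c; last by lra.
    by move: cab; rewrite in_itv/= => /andP[? ?]; rewrite !ler0_norm; lra.
  - by exists b => //; rewrite !subrr mulr0.
have [c hc e1] := mvt f x (x + h) sf.
have [d _ e2] := mvt (derive1 f) x c (smooth_derive1 sf).
rewrite e1 (_ : x + h - x = h) in hc *; last ring.
rewrite (mulrC h) -mulrBl e2 !normrM -(real_normK (num_real h)) expr2 mulrA.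
by rewrite ler_wpM2r// ler_pM//; exact: hC.
Qed.

(** The second-order Taylor bounds of the terms add up to a quadratic bound for the whole sum, which
    identifies the derivative. *)
Lemma ssum_is_derive f x : good_series f ->
  is_derive x (1 : R) (ssum f) (ssum (fun k => derive1 (f k)) x).
Proof.
move=> gf; have gf' := good_series_derive gf; have [sf bf] := gf.
have [C hC] := bf 2%N.
have C0 : 0 <= C by have := hC 0%N 0; rewrite expr0 mulr1; apply: le_trans.
have key h : `|ssum f (x + h) - ssum f x - h * ssum (fun k => derive1 (f k)) x| <= C * (3 / 2) * h ^+ 2.
  have c1 := ssum_cvg (t := x + h) gf; have c2 := ssum_cvg (t := x) gf; have c3 := ssum_cvg (t := x) gf'.
  have cc : `|series (f ^~ (x + h)) k - series (f ^~ x) k - h * series (fun k => derive1 (f k) x) k| @[k --> \oo]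
     --> `|ssum f (x + h) - ssum f x - h * ssum (fun k => derive1 (f k)) x|.
    apply: cvg_norm; apply: cvgB; first exact: cvgB.
    by apply: cvgM => //; exact: cvg_cst.
  rewrite -(cvg_lim _ cc)//; apply: limr_le; first by apply/cvg_ex; eexists; exact: cc.
  apply: nearW => k; rewrite /series /= mulr_sumr -!sumrB.
  rewrite (le_trans (ler_norm_sum _ _ _))//.
  apply: (@le_trans _ _ (\sum_(0 <= j < k) (C * 3^-1 ^+ j) * h ^+ 2)).
    by apply: ler_sum => j _; apply: taylor2.
  rewrite -mulr_suml ler_wpM2r ?sqr_ge0// -mulr_sumr ler_wpM2l//.
  rewrite (le_trans (geo_sum_le (leq0n k)))// expr0 ler_piMr//.
have H : h^-1 *: ((ssum f \o shift x) (h *: (1 : R)) - ssum f x) @[h --> 0^'] --> ssum (fun k => derive1 (f k)) x.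
  apply/cvgrPdist_lt => e e0; pose K := C * (3 / 2) + 1.
  have K0 : 0 < K by rewrite /K; lra.
  exists (e / K); first by rewrite /= divr_gt0.
  move=> h /=; rewrite sub0r normrN => hK h0.
  rewrite /GRing.scale /= mulr1 (addrC h) distrC.
  have -> : h^-1 * (ssum f (x + h) - ssum f x) - ssum (fun k => derive1 (f k)) x =
     h^-1 * (ssum f (x + h) - ssum f x - h * ssum (fun k => derive1 (f k)) x).
    by field.
  rewrite normrM normfV.
  have hp : 0 < `|h| by rewrite normr_gt0.
  rewrite mulrC ltr_pdivrMr// (le_lt_trans (key h))// -(real_normK (num_real h)) expr2 mulrA ltr_pM2r//.
  move: hK; rewrite ltr_pdivlMr// => hK; apply: le_lt_trans hK; rewrite mulrC ler_wpM2l//; rewrite /K; lra.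
apply: DeriveDef; first by apply/cvg_ex; eexists; exact: H.
exact: cvg_lim H.
Qed.

Lemma ssum_smooth f : good_series f -> smooth (ssum f).
Proof.
move=> gf; suff : forall g, (exists2 f, good_series f & g = ssum f) -> smooth g by apply; exists f.
apply: smooth_ind => [g [h gh ->] x|g [h gh ->]].
  by have [] := ssum_is_derive x gh.
exists (fun k => derive1 (h k)); first exact: good_series_derive.
by apply/funext => x; rewrite derive1E; have [] := ssum_is_derive x gh.
Qed.
End SmoothSeries.

(** * Uniform boundedness on test functions *)

Section UniformBoundedness.
Variable R : realType.
Local Notation C := R[i].
Variables (I : Type) (f : I -> R -> R) (U : nat -> (R -> R) -> C) (a : R).

Definition tfun (phi : R -> R) := smooth phi /\ forall t, ~ `[- a, a]%classic t -> phi t = 0.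

Hypothesis tf : forall i, tfun (f i).
Hypothesis bf : forall n, exists K : R, forall i t, `|derive1n n (f i) t| <= K.
Hypothesis UD : forall n phi psi c, tfun phi -> tfun psi ->
  U n (fun t => phi t + c * psi t) = U n phi + RtoC c * U n psi.
Hypothesis UB : forall n, exists2 N : R, 0 <= N & forall phi M, tfun phi -> (forall t, `|phi t| <= M) ->
  cnorm (U n phi) <= N * M.
Hypothesis Upt : forall phi, tfun phi -> exists M : R, forall n, cnorm (U n phi) <= M.

Lemma tfunDZ phi psi c : tfun phi -> tfun psi -> tfun (fun t => phi t + c * psi t).
Proof.
move=> [s1 z1] [s2 z2]; split=> [|t ht]; last by rewrite z1// z2// mulr0 addr0.
exact: (@smoothD R _ _ s1 (@smoothM R _ _ (@smooth_cst R c) s2)).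
Qed.

(** The two candidates differ by 2 [w], so they cannot both be shorter than [w]. This is what allows
    the signs to be chosen one at a time. *)
Lemma max_cnorm (z w : C) : cnorm w <= cnorm (z + w) \/ cnorm w <= cnorm (z - w).
Proof.
have [h|h] := leP (cnorm w) (cnorm (z + w)); [by left|right].
have := cnormB (z + w) (z - w).
rewrite (_ : z + w - (z - w) = RtoC 2 * w).
  by rewrite cnormM cnorm_RtoC ger0_norm//; lra.
by rewrite RtoCD RtoC1; ring.
Qed.

(* Sokal's proof of the uniform boundedness principle: the signs in
   sum_k +-3^-k f_(i_k) are chosen one after the other. *)
Lemma uniform_boundedness : exists M : R, forall n i, cnorm (U n (f i)) <= M.
Proof.
apply: contrapT => nM.
have big (M : R) : exists n i, M < cnorm (U n (f i)).
  apply: contrapT => h; apply: nM; exists M => n i; rewrite leNgt; apply/negP => lt.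
  by apply: h; exists n, i.
have [K hK] := bf 0.
pose A n := sup [set cnorm (U n (f i)) | i in [set: I]].
have sA n (i0 : I) : has_sup [set cnorm (U n (f i)) | i in [set: I]].
  split; first by exists (cnorm (U n (f i0))); exists i0.
  have [N N0 hN] := UB n; exists (N * K) => _ [i _ <-].
  by apply: hN => // t; exact: (hK i).
have /choice[nk hnk] k : exists n, exists i, 4 ^+ k < cnorm (U n (f i)) by exact: big.
have hA k : 4 ^+ k < A (nk k).
  have [i hi] := hnk k; apply: lt_le_trans hi _.
  by apply: ub_le_sup; [exact: (sA _ i).2|exists i].
(* The fraction 3/4 of the supremum has to beat the tail of the signed series, which is at most 1/2
   of it on the scale 3^-k. *)
have /choice[ik hik] k : exists i, 3 / 4 * A (nk k) < cnorm (U (nk k) (f i)).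
  have [i0 _] := hnk k.
  have A0 : 0 < A (nk k) by apply: lt_trans (hA k); exact: exprn_gt0.
  have /(_ (A (nk k) / 4))[|_ [i _ <-] h] := sup_adherent _ (sA (nk k) i0); first by rewrite divr_gt0.
  exists i; apply: le_lt_trans h; rewrite -[sup _]/(A (nk k)); lra.
pose g k := f (ik k); pose V k := U (nk k).
pose sgn (k : nat) (x : R -> R) : R :=
  if 3^-1 ^+ k * cnorm (V k (g k)) <= cnorm (V k (fun t => x t + 3^-1 ^+ k * g k t)) then 1 else -1.
pose fix X (k : nat) : R -> R := if k is k'.+1 then
   fun t => X k' t + (sgn k' (X k') * 3^-1 ^+ k') * g k' t else fun=> 0.
have tX k : tfun (X k).
  elim: k => [|k IH]; last exact: (@tfunDZ (X k) (g k) _ IH (tf _)).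
  by split => //; exact: (@smooth_cst R 0).
have VX k : 3^-1 ^+ k * cnorm (V k (g k)) <= cnorm (V k (X k.+1)).
  rewrite /= /sgn; case: ifPn => [|h]; first by rewrite mul1r.
  have p3 : 0 <= 3^-1 ^+ k :> R by rewrite exprn_ge0.
  rewrite /V (UD _ _ (tX k) (tf (ik k))) RtoCM RtoCN RtoC1 mulN1r mulNr.
  have := max_cnorm (U (nk k) (X k)) (RtoC (3^-1 ^+ k) * U (nk k) (g k)).
  rewrite -(UD _ _ (tX k) (tf (ik k))) cnormM cnorm_RtoC ger0_norm// => -[|//].
  by rewrite (negbTE h).
have VS k m : V k (X m.+1) = V k (X m) + RtoC (sgn m (X m) * 3^-1 ^+ m) * V k (g m).
  exact: (UD _ _ (tX m) (tf _)).
have XE k t : X k t = series (fun j => sgn j (X j) * 3^-1 ^+ j * g j t) k.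
  rewrite /series /=; elim: k => [|k IH]; first by rewrite big_geq.
  by rewrite big_nat_recr//= -IH.
pose h k t := sgn k (X k) * 3^-1 ^+ k * g k t.
have n3 k : `|3^-1 ^+ k : R| = 3^-1 ^+ k by rewrite ger0_norm// exprn_ge0.
have sgn1 k : `|sgn k (X k)| = 1 by rewrite /sgn; case: ifP; rewrite ?normrN normr1.
have gh : good_series h.
  split=> [k|n].
    exact: (@smoothM R _ _ (@smooth_cst R _) (tf (ik k)).1).
  have [Kn hKn] := bf n; exists Kn => k t.
  have -> : derive1n n (h k) t = (sgn k (X k) * 3^-1 ^+ k) * derive1n n (g k) t.
    by rewrite /h derive1nZ//; exact: (tf (ik k)).1.
  rewrite normrM normrM sgn1 mul1r mulrC n3.
  by rewrite ler_wpM2r ?exprn_ge0//; exact: hKn.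
pose phi := ssum h.
have hb k t : `|h k t| <= K * 3^-1 ^+ k.
  rewrite /h normrM normrM sgn1 mul1r mulrC n3.
  by rewrite ler_wpM2r ?exprn_ge0//; exact: (hK (ik k)).
have tphi : tfun phi.
  split; first exact: ssum_smooth.
  move=> t ht; rewrite /phi /ssum (_ : series _ = fun=> 0) ?lim_cst//.
  apply/funext => k; rewrite /series /= big1// => j _.
  by rewrite /h /g (tf (ik j)).2// mulr0.
have [M hM] := Upt tphi.
have tail k m : (k < m)%N -> cnorm (V k (X m) - V k (X k.+1)) <= A (nk k) * (2^-1 * 3^-1 ^+ k).
  move=> km.
  have A0 : 0 <= A (nk k) by apply: ltW; apply: lt_trans (hA k); exact: exprn_gt0.
  apply: (@le_trans _ _ (A (nk k) * (\sum_(k.+1 <= j < m) 3^-1 ^+ j))); last first.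
    rewrite ler_wpM2l// (le_trans (geo_sum_le R km))// exprS.
    have : 0 <= 3^-1 ^+ m :> R by rewrite exprn_ge0.
    set u := 3^-1 ^+ m; set v := 3^-1 ^+ k; lra.
  rewrite -(subnKC km); elim: (m - k.+1)%N => [|j IH].
    by rewrite addn0 subrr cnorm0 big_geq// mulr0.
  rewrite addnS VS big_nat_recr ?leq_addr// [X in _ <= _ * X]/= mulrDr.
  set w := RtoC _ * _; rewrite (_ : _ - _ = (V k (X (k.+1 + j)%N) - V k (X k.+1)) + w); last first.
    by ring.
  rewrite (le_trans (cnormD _ _))// lerD// /w cnormM cnorm_RtoC normrM sgn1 mul1r.
  rewrite n3 mulrC ler_wpM2r ?exprn_ge0//.
  by apply: ub_le_sup; [exact: (sA _ (ik k)).2|exists (ik (k.+1 + j)%N)].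
have tailphi k : cnorm (V k phi - V k (X k.+1)) <= A (nk k) * (2^-1 * 3^-1 ^+ k).
  have [N N0 hN] := UB (nk k).
  apply/ler_addgt0Pr => e e0.
  have [m km hm] : exists2 m, (k < m)%N & N * (K * (3 / 2) * 3^-1 ^+ m) < e.
    have c0 : N * (K * (3 / 2)) * 3^-1 ^+ m @[m --> \oo] --> (0 : R).
      rewrite -[X in _ --> X](mulr0 (N * (K * (3 / 2)))); apply: cvgM; first exact: cvg_cst.
      by apply: cvg_expr; rewrite ger0_norm//; lra.
    have : \forall m \near \oo, (k < m)%N /\ N * (K * (3 / 2)) * 3^-1 ^+ m < e.
      near=> m; split; first by near: m; exact: nbhs_infty_gt.
      by near: m; apply: cvgr_lt c0 _ e0.
    move=> [m0 _ /(_ m0 (leqnn _))[]] h1 h2; exists m0 => //; by rewrite mulrA.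
  rewrite (le_trans (cnorm_triangle _ _ (V k (X m))))// addrC lerD ?tail// ltW//.
  apply: le_lt_trans hm.
  have -> : V k phi - V k (X m) = V k (fun t => phi t + (-1) * X m t).
    by rewrite /V (UD _ _ tphi (tX m)) RtoCN RtoC1 mulN1r.
  apply: hN => [|t]; first exact: (@tfunDZ phi (X m) _ tphi (tX m)).
  rewrite mulN1r XE; exact: ssum_tail.
(* Of the main term, 3/4 of A 3^-k, the tail takes at most 1/2; the remaining quarter exceeds
   (4/3)^k / 4 because A > 4^k. *)
have lower k : (4 / 3) ^+ k / 4 <= M.
  have h1 := VX k; have h2 := tailphi k; have h3 := hik k; have h4 := hA k.
  have p3 : 0 < 3^-1 ^+ k :> R by rewrite exprn_gt0.
  have h5 : cnorm (V k (X k.+1)) <= cnorm (V k phi) + cnorm (V k phi - V k (X k.+1)).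
    by have := cnorm_triangle (V k (X k.+1)) 0 (V k phi); rewrite !subr0 cnormBC; lra.
  have h6 := hM (nk k); rewrite -/(V k) in h6.
  have : 3^-1 ^+ k * (3 / 4 * A (nk k)) <= 3^-1 ^+ k * cnorm (V k (g k)) by rewrite ler_pM2l// ltW.
  have : 3^-1 ^+ k * 4 ^+ k <= 3^-1 ^+ k * A (nk k) by rewrite ler_pM2l// ltW.
  rewrite -[X in X <= _ -> _]exprMn (_ : 3^-1 * 4 = 4 / 3); last by lra.
  nra.
have bern k : 1 + k%:R / 3 <= (4 / 3 : R) ^+ k.
  elim: k => [|k IH]; first by rewrite mul0r addr0.
  rewrite exprS -natr1; apply: (@le_trans _ _ (4 / 3 * (1 + k%:R / 3))); last by rewrite ler_pM2l.
  have : 0 <= k%:R :> R by []. 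
  lra.
have := archi_boundP (normr_ge0 (12 * M)); set k := Num.bound _.
have := lower k; have := bern k; have := ler_norm (12 * M); lra.
Unshelve. all: by end_near.
Qed.
End UniformBoundedness.

(** * Goursat's lemma and the weak Cauchy-Riemann equations *)

Section Goursat.
Variable R : realType.
Local Notation mu := (@lebesgue_measure R).
Implicit Types (f g : R -> R).

Definition sint f (a b : R) : R := Rintegral mu `[a, b] f.
Definition cont_on (a b : R) f := forall x, a <= x <= b -> {for x, continuous f}.

Lemma cont_on_integrable a b f : cont_on a b f -> mu.-integrable `[a, b] (EFin \o f).
Proof.
move=> cf; apply: continuous_compact_integrable; first exact: segment_compact.
by apply: continuous_in_subspaceT => x; rewrite inE /= in_itv/= => /cf.
Qed.

Lemma cont_onS a b a' b' f : a <= a' -> b' <= b -> cont_on a b f -> cont_on a' b' f.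
Proof. by move=> aa bb cf x /andP[x1 x2]; apply: cf; lra. Qed.

Lemma cont_onD a b f g : cont_on a b f -> cont_on a b g -> cont_on a b (fun x => f x + g x).
Proof. by move=> cf cg x hx; apply: cvgD; [exact: cf|exact: cg]. Qed.
Lemma cont_onB a b f g : cont_on a b f -> cont_on a b g -> cont_on a b (fun x => f x - g x).
Proof. by move=> cf cg x hx; apply: cvgB; [exact: cf|exact: cg]. Qed.
Lemma cont_on_cst a b (c : R) : cont_on a b (fun=> c).
Proof. by move=> x _; exact: cvg_cst. Qed.

Lemma sint_cst a b c : a <= b -> sint (fun=> c) a b = c * (b - a).
Proof.
move=> ab; rewrite /sint Rintegral_cst//.
have := lebesgue_measure_itv `[a, b]; rewrite /= => ->; rewrite lte_fin.
by move: ab; rewrite le_eqVlt => /orP[/eqP->|->//]; rewrite ltxx subrr.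
Qed.

Lemma sintD a b f g : cont_on a b f -> cont_on a b g ->
  sint (fun x => f x + g x) a b = sint f a b + sint g a b.
Proof. by move=> cf cg; apply: RintegralD => //; exact: cont_on_integrable. Qed.
Lemma sintB a b f g : cont_on a b f -> cont_on a b g ->
  sint (fun x => f x - g x) a b = sint f a b - sint g a b.
Proof. by move=> cf cg; apply: RintegralB => //; exact: cont_on_integrable. Qed.

Lemma eq_sint a b f g : (forall x, a <= x <= b -> f x = g x) -> sint f a b = sint g a b.
Proof. by move=> fg; apply: eq_Rintegral => x; rewrite inE /= in_itv/= => /fg. Qed.

Lemma sint_split a m b f : a <= m <= b -> cont_on a b f ->
  sint f a b = sint f a m + sint f m b.
Proof.
move=> /andP[am mb] cf; rewrite /sint.
have ic := cont_on_integrable cf.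
have := @Rintegral_itvB R f (BLeft a) (BRight b) m ic; rewrite !bnd_simp => /(_ am mb).
rewrite (@Rintegral_itv_obnd_cbnd R m (BRight b)) => [<-|]; first by rewrite addrC subrK.
apply: integrableS ic => // x /=; rewrite !in_itv/= => /andP[mx ->].
by rewrite andbT (le_trans am)// ltW.
Qed.

Lemma sint_bound (a b : R) f (M : R) : a <= b -> cont_on a b f -> (forall x, a <= x <= b -> `|f x| <= M) ->
  `|sint f a b| <= M * (b - a).
Proof.
move=> ab cf fM; have ic := cont_on_integrable cf.
rewrite (le_trans (le_normr_Rintegral _ ic))//.
have i1 : mu.-integrable `[a, b] (EFin \o (fun x => `|f x|)).
  by apply: cont_on_integrable => x hx; apply: cvg_norm; exact: cf.
have i2 : mu.-integrable `[a, b] (EFin \o (fun=> M)).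
  by apply: cont_on_integrable; exact: cont_on_cst.
rewrite -sint_cst//; exact: (le_Rintegral _ i1 i2).
Qed.

(** The vector field (p, q) is differentiable at (x, y) with zero divergence: the coefficient of [h]
    in [p] and that of [k] in [q] are opposite. Differentiability is pointwise, with no continuity
    of the derivative, exactly as a complex derivative supplies it. *)
Definition dfree (p q : R -> R -> R) (x y : R) := exists p1 p2 q1 : R,
  forall e : R, 0 < e -> exists2 d : R, 0 < d & forall h k : R, `|h| < d -> `|k| < d ->
    `|p (x + h) (y + k) - p x y - (p1 * h + p2 * k)| <= e * (`|h| + `|k|) /\
    `|q (x + h) (y + k) - q x y - (q1 * h - p1 * k)| <= e * (`|h| + `|k|).

Lemma dfree_cont p q x y : dfree p q x y -> forall e : R, 0 < e -> exists2 d : R, 0 < d &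
  forall h k : R, `|h| < d -> `|k| < d -> `|p (x + h) (y + k) - p x y| < e /\ `|q (x + h) (y + k) - q x y| < e.
Proof.
move=> [p1 [p2 [q1 H]]] e e0; have [d d0 hd] := H 1 ltr01.
pose K := `|p1| + `|p2| + `|q1| + 1.
have K0 : 0 < K by rewrite /K; have := normr_ge0 p1; have := normr_ge0 p2; have := normr_ge0 q1; lra.
exists (Num.min d (e / (4 * K))); first by rewrite lt_min d0 divr_gt0// mulr_gt0.
move=> h k; rewrite !lt_min !ltr_pdivlMr ?mulr_gt0// => /andP[h1 h2] /andP[k1 k2].
have [a1 a2] := hd h k h1 k1.
have bd (u v w : R) : `|u - (v * h + w * k)| <= 1 * (`|h| + `|k|) -> `|v| + `|w| + 1 <= K -> `|u| < e.
  move=> hu vK.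
  have : `|v * h + w * k| <= `|v| * `|h| + `|w| * `|k| by rewrite -!normrM ler_normD.
  have := ler_normD (u - (v * h + w * k)) (v * h + w * k); rewrite subrK.
  have := normr_ge0 h; have := normr_ge0 k; have := normr_ge0 v; have := normr_ge0 w.
  nra.
split; [apply: (bd _ _ _ a1)|apply: (bd _ q1 (- p1))].
- by rewrite /K; have := normr_ge0 q1; lra.
- by rewrite mulNr.
- by rewrite /K normrN; have := normr_ge0 p2; lra.
Qed.

Lemma dfree_cont1 p q x y : dfree p q x y -> {for y, continuous (p x)} /\ {for x, continuous (q ^~ y)}.
Proof.
move=> /dfree_cont H; split; apply/cvgrPdist_lt => e e0; have [d d0 hd] := H e e0.
- exists d => //= t; rewrite /= distrC => ht.
  have [|] := hd 0 (t - y) _ ht; first by rewrite normr0.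
  by rewrite addr0 subrKC distrC => *.
- exists d => //= t; rewrite /= distrC => ht.
  have [|_] := hd (t - x) 0 ht; first by rewrite normr0.
  by rewrite addr0 subrKC distrC => *.
Qed.

Definition flux p q (a b c d : R) := sint (fun t => p b t - p a t) c d + sint (fun s => q s d - q s c) a b.

Section Rect.
Variables (p q : R -> R -> R) (a b c d : R).
Hypothesis H : forall x y, a <= x <= b -> c <= y <= d -> dfree p q x y.

Lemma dfree_contp x : a <= x <= b -> cont_on c d (p x).
Proof. by move=> hx y hy; have [] := dfree_cont1 (H hx hy). Qed.
Lemma dfree_contq y : c <= y <= d -> cont_on a b (q ^~ y).
Proof. by move=> hy x hx; have [] := dfree_cont1 (H hx hy). Qed.

Lemma flux_splith m : a <= m <= b -> c <= d -> flux p q a b c d = flux p q a m c d + flux p q m b c d.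
Proof.
move=> /andP[am mb] cd.
have ca : cont_on c d (p a) by apply: dfree_contp; lra.
have cb : cont_on c d (p b) by apply: dfree_contp; lra.
have cm : cont_on c d (p m) by apply: dfree_contp; lra.
have cq : cont_on a b (fun s => q s d - q s c).
  by apply: cont_onB; apply: dfree_contq; lra.
rewrite /flux (sint_split (m := m) _ cq) ?am//.
rewrite (sintB cb ca) (sintB cm ca) (sintB cb cm); ring.
Qed.

Lemma flux_splitv m : c <= m <= d -> a <= b -> flux p q a b c d = flux p q a b c m + flux p q a b m d.
Proof.
move=> /andP[cm md] ab.
have cc : cont_on a b (q ^~ c) by apply: dfree_contq; lra.
have cd : cont_on a b (q ^~ d) by apply: dfree_contq; lra.
have cm' : cont_on a b (q ^~ m) by apply: dfree_contq; lra.
have cp : cont_on c d (fun t => p b t - p a t).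
  by apply: cont_onB; apply: dfree_contp; lra.
rewrite /flux (sint_split (m := m) _ cp) ?cm//.
rewrite (sintB cd cc) (sintB cm' cc) (sintB cd cm'); ring.
Qed.
End Rect.

(** The linear part of the field contributes p1 times the area through the vertical sides and its
    opposite through the horizontal ones, so only the error terms survive. *)
Lemma flux_small p q a b c d z1 z2 : a < b -> c < d ->
  (forall x y, a <= x <= b -> c <= y <= d -> dfree p q x y) ->
  a <= z1 <= b -> c <= z2 <= d -> forall p1 p2 q1 e : R, 0 <= e ->
  (forall x y, a <= x <= b -> c <= y <= d ->
    `|p x y - p z1 z2 - (p1 * (x - z1) + p2 * (y - z2))| <= e * (`|x - z1| + `|y - z2|) /\
    `|q x y - q z1 z2 - (q1 * (x - z1) - p1 * (y - z2))| <= e * (`|x - z1| + `|y - z2|)) ->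
  `|flux p q a b c d| <= 2 * e * ((b - a) + (d - c)) ^+ 2.
Proof.
move=> ab cd H z1h z2h p1 p2 q1 e e0 B.
pose D := (b - a) + (d - c).
have cp : cont_on c d (fun t => p b t - p a t).
  by apply: cont_onB; apply: (dfree_contp H); lra.
have cq : cont_on a b (fun s => q s d - q s c).
  by apply: cont_onB; apply: (dfree_contq H); lra.
have -> : flux p q a b c d = sint (fun t => p b t - p a t - p1 * (b - a)) c d +
    sint (fun s => q s d - q s c + p1 * (d - c)) a b.
  rewrite (sintB cp (@cont_on_cst _ _ _)) (sintD cq (@cont_on_cst _ _ _)).
  by rewrite !sint_cst ?ltW// /flux; ring.
have D1 x y : a <= x <= b -> c <= y <= d -> `|x - z1| + `|y - z2| <= D.
  by move=> hx hy; rewrite /D lerD// ler_norml; lra.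
have B2 x y hx hy := B x y hx hy.
have tri (u v w : R) M : `|u| <= M -> `|v| <= M -> w = u - v -> `|w| <= 2 * M.
  by move=> hu hv ->; rewrite (le_trans (ler_normB _ _))//; lra.
have eD x y : a <= x <= b -> c <= y <= d -> e * (`|x - z1| + `|y - z2|) <= e * D.
  by move=> hx hy; rewrite ler_wpM2l// D1.
rewrite (le_trans (ler_normD _ _))//.
have -> : 2 * e * D ^+ 2 = (2 * (e * D)) * (d - c) + (2 * (e * D)) * (b - a) by rewrite /D; ring.
apply: lerD; apply: sint_bound; rewrite ?ltW//.
- by apply: cont_onB => //; exact: cont_on_cst.
- move=> t ht; have hb : a <= b <= b by lra.
  have ha : a <= a <= b by lra.
  apply: (tri _ _ _ _ (le_trans (B b t hb ht).1 (eD _ _ hb ht)) (le_trans (B a t ha ht).1 (eD _ _ ha ht))); ring.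
- by apply: cont_onD => //; exact: cont_on_cst.
- move=> s hs; have hd : c <= d <= d by lra.
  have hc : c <= c <= d by lra.
  apply: (tri _ _ _ _ (le_trans (B s d hs hd).2 (eD _ _ hs hd)) (le_trans (B s c hs hc).2 (eD _ _ hs hc))); ring.
Qed.

Lemma nested_intervals (u v : nat -> R) : (forall n, u n <= u n.+1) ->
  (forall n, v n.+1 <= v n) -> (forall n, u n <= v n) -> exists z, forall n, u n <= z <= v n.
Proof.
move=> uu vv uv.
have um m n : (m <= n)%N -> u m <= u n.
  by move=> /subnKC <-; elim: (n - m)%N => [|k IH]; rewrite ?addn0// addnS (le_trans IH).
have vm m n : (m <= n)%N -> v n <= v m.
  by move=> /subnKC <-; elim: (n - m)%N => [|k IH]; rewrite ?addn0// addnS (le_trans _ IH).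
have uvm m n : u m <= v n.
  by rewrite (le_trans (um m (maxn m n) (leq_maxl _ _)))// (le_trans (uv _))// vm ?leq_maxr.
exists (sup (range u)) => n; apply/andP; split.
  by apply: ub_le_sup; [exists (v 0%N) => _ [m _ <-]|exists n].
by apply: ge_sup => [|_ [m _ <-]//]; exists (u 0%N); exists 0%N.
Qed.

Definition subrect (r r' : R * R * R * R) := let: (a, b, c, d) := r in let: (a2, b2, c2, d2) := r' in
  [/\ a <= a2, b2 <= b, c <= c2 & d2 <= d] /\ (b2 - a2 = (b - a) / 2 /\ d2 - c2 = (d - c) / 2).

Lemma flux_quarter p q a b c d (M : R) : a < b -> c < d ->
  (forall x y, a <= x <= b -> c <= y <= d -> dfree p q x y) -> M <= `|flux p q a b c d| ->
  exists a2 b2 c2 d2, subrect (a, b, c, d) (a2, b2, c2, d2) /\ M / 4 <= `|flux p q a2 b2 c2 d2|.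
Proof.
move=> ab cd H hM.
pose m := (a + b) / 2; pose n := (c + d) / 2.
have mE : m + m = a + b by rewrite /m; field.
have nE : n + n = c + d by rewrite /n; field.
have Hl x y : a <= x <= m -> c <= y <= d -> dfree p q x y by move=> hx hy; apply: H; lra.
have Hr x y : m <= x <= b -> c <= y <= d -> dfree p q x y by move=> hx hy; apply: H; lra.
have am : a <= m <= b by lra.
have cn : c <= n <= d by lra.
have ha : m - a = (b - a) / 2 by lra.
have hb : b - m = (b - a) / 2 by lra.
have hc : n - c = (d - c) / 2 by lra.
have hd : d - n = (d - c) / 2 by lra.
have /andP[am1 am2] := am; have /andP[cn1 cn2] := cn.
apply: contrapT => nex.
have small a2 b2 c2 d2 : subrect (a, b, c, d) (a2, b2, c2, d2) -> `|flux p q a2 b2 c2 d2| < M / 4.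
  by move=> hf; rewrite ltNge; apply/negP => lek; apply: nex; exists a2, b2, c2, d2.
have q1 : `|flux p q a m c n| < M / 4 by apply: small; split; split.
have q2 : `|flux p q a m n d| < M / 4 by apply: small; split; split.
have q3 : `|flux p q m b c n| < M / 4 by apply: small; split; split.
have q4 : `|flux p q m b n d| < M / 4 by apply: small; split; split.
have S1 := @flux_splith p q a b c d H m am (ltW cd).
have S2 := @flux_splitv p q a m c d Hl n cn am1.
have S3 := @flux_splitv p q m b c d Hr n cn am2.
move: hM q1 q2 q3 q4; rewrite S1 S2 S3.
move: (flux _ _ _ _ _ _) (flux _ _ _ _ _ _) (flux _ _ _ _ _ _) (flux _ _ _ _ _ _) => f1 f2 f3 f4.
move=> {S1 S2 S3 small nex Hl Hr H}.
have := ler_normD (f4 + f3) (f2 + f1); have := ler_normD f4 f3; have := ler_normD f2 f1; lra.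
Qed.

Theorem goursat p q a b c d : a < b -> c < d ->
  (forall x y, a <= x <= b -> c <= y <= d -> dfree p q x y) -> flux p q a b c d = 0.
Proof.
move=> ab cd H; apply/eqP/negPn/negP => nz.
pose W := b - a; pose V := d - c.
have W0 : 0 < W by rewrite /W; lra.
have V0 : 0 < V by rewrite /V; lra.
(* Flux per unit of area, which the passage to a suitable quarter never decreases. *)
pose kap := `|flux p q a b c d| / (W * V).
have kap0 : 0 < kap by rewrite divr_gt0 ?mulr_gt0// normr_gt0.
pose rect := (R * R * R * R)%type.
pose ok (r : rect) := let: (a', b', c', d') := r in
  [/\ a <= a', b' <= b, c <= c' & d' <= d] /\
  [/\ a' < b', c' < d' & kap * ((b' - a') * (d' - c')) <= `|flux p q a' b' c' d'|].
have step r : exists r', ok r -> ok r' /\ subrect r r'.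
  case: (pselect (ok r)) => [okr|nr]; last by exists r.
  case: r okr => -[[a' b'] c'] d' [[h1 h2 h3 h4] [h5 h6 h7]].
  have H' x y : a' <= x <= b' -> c' <= y <= d' -> dfree p q x y by move=> hx hy; apply: H; lra.
  have [a2 [b2 [c2 [d2 [sr big]]]]] := flux_quarter h5 h6 H' h7.
  exists (a2, b2, c2, d2) => _; split=> //; have [[k1 k2 k3 k4] [k5 k6]] := sr.
  split; first by split; lra.
  split; [lra|lra|].
  by rewrite k5 k6; apply: le_trans big; rewrite le_eqVlt; apply/orP; left; apply/eqP; field.
have [F hF] := choice step.
pose rn n := iter n F (a, b, c, d).
have ok0 : ok (a, b, c, d).
  split; split=> //; rewrite /kap -/W -/V -mulrA mulVf ?mulr1//.
  by rewrite mulf_neq0// gt_eqF.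
have okn n : ok (rn n) by elim: n => //= n IH; exact: (hF _ IH).1.
have hfn n : subrect (rn n) (rn n.+1) by exact: (hF _ (okn n)).2.
pose an n := (rn n).1.1.1; pose bn n := (rn n).1.1.2; pose cn n := (rn n).1.2; pose dn n := (rn n).2.
have rE n : rn n = (an n, bn n, cn n, dn n) by rewrite /an /bn /cn /dn; case: (rn n) => -[[]].
have oks n : [/\ a <= an n, bn n <= b, c <= cn n & dn n <= d] /\
  [/\ an n < bn n, cn n < dn n & kap * ((bn n - an n) * (dn n - cn n)) <= `|flux p q (an n) (bn n) (cn n) (dn n)|].
  by have := okn n; rewrite rE.
have hfs n : [/\ an n <= an n.+1, bn n.+1 <= bn n, cn n <= cn n.+1 & dn n.+1 <= dn n] /\
   (bn n.+1 - an n.+1 = (bn n - an n) / 2 /\ dn n.+1 - cn n.+1 = (dn n - cn n) / 2).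
  by have := hfn n; rewrite !rE.
have len n : bn n - an n = W * 2^-1 ^+ n /\ dn n - cn n = V * 2^-1 ^+ n.
  elim: n => [|n [IH1 IH2]]; first by rewrite /bn /an /dn /cn /= !expr0 !mulr1.
  have [_ [-> ->]] := hfs n; rewrite IH1 IH2 exprS; split; by field.
have [z1 hz1] : exists z, forall n, an n <= z <= bn n.
  by apply: nested_intervals => n; [have [[]] := hfs n|have [[]] := hfs n|have [_ [/ltW]] := oks n].
have [z2 hz2] : exists z, forall n, cn n <= z <= dn n.
  by apply: nested_intervals => n; [have [[]] := hfs n|have [[]] := hfs n|have [_ [_ /ltW]] := oks n].
have [p1 [p2 [q1 Hd]]] : dfree p q z1 z2.
  have /andP[u3 u4] := hz1 0%N; have /andP[u1 u2] := hz2 0%N; have [[w1 w2 w3 w4] _] := oks 0%N.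
  have h1 : a <= z1 <= b by apply/andP; split; [exact: le_trans w1 u3|exact: le_trans u4 w2].
  have h2 : c <= z2 <= d by apply/andP; split; [exact: le_trans w3 u1|exact: le_trans u2 w4].
  exact: (H _ _ h1 h2).
(* With this value the bound of [flux_small] is half of [kap] times the area on every rectangle of
   the sequence, as all have the proportions of the first one. *)
pose e : R := kap * (W * V) / (4 * (W + V) ^+ 2).
have WV0 : 0 < (W + V) ^+ 2 by rewrite exprn_gt0// addr_gt0.
have e0 : 0 < e.
  by apply: divr_gt0; [apply: mulr_gt0 => //; exact: mulr_gt0|exact: mulr_gt0].
have [dl dl0 hdl] := Hd e e0.
have [n hn] : exists n : nat, (W + V) * 2^-1 ^+ n < dl.
  have c0 : (W + V) * 2^-1 ^+ n @[n --> \oo] --> (0 : R).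
    rewrite -[X in _ --> X](mulr0 (W + V)); apply: cvgM; first exact: cvg_cst.
    by apply: cvg_expr; rewrite ger0_norm//; lra.
  by have [n _ /(_ n (leqnn _))] := cvgr_lt _ c0 _ dl0; exists n.
have [l1 l2] := len n.
have [[w1 w2 w3 w4] [w5 w6 w7]] := oks n.
have x0 : 0 < 2^-1 ^+ n :> R by rewrite exprn_gt0.
have := hz1 n; have := hz2 n => hz2n hz1n.
move: w7 l1 l2 x0 hn w1 w2 w3 w4 w5 w6 hz1n hz2n.
move: (an n) (bn n) (cn n) (dn n) (2^-1 ^+ n) => a' b' c' d' X.
clear -H W0 V0 kap0 WV0 e0 hdl => w7 l1 l2 x0 hn w1 w2 w3 w4 w5 w6 hz1n hz2n.
have H' x y : a' <= x <= b' -> c' <= y <= d' -> dfree p q x y by move=> hx hy; apply: H; lra.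
have WX : 0 < W * X by rewrite mulr_gt0.
have VX : 0 < V * X by rewrite mulr_gt0.
have hsum : W * X + V * X < dl by rewrite -mulrDl.
have B x y : a' <= x <= b' -> c' <= y <= d' ->
    `|p x y - p z1 z2 - (p1 * (x - z1) + p2 * (y - z2))| <= e * (`|x - z1| + `|y - z2|) /\
    `|q x y - q z1 z2 - (q1 * (x - z1) - p1 * (y - z2))| <= e * (`|x - z1| + `|y - z2|).
  move=> hx hy.
  have := hdl (x - z1) (y - z2); rewrite !subrKC; apply; rewrite ltr_norml; lra.
have := flux_small w5 w6 H' hz1n hz2n (ltW e0) B.
apply/negP; rewrite -ltNge; apply: lt_le_trans w7.
rewrite l1 l2 -mulrDl exprMn /e.
have -> : 2 * (kap * (W * V) / (4 * (W + V) ^+ 2)) * ((W + V) ^+ 2 * X ^+ 2) = kap * (W * V) * X ^+ 2 / 2.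
  by field; rewrite gt_eqF// addr_gt0.
have : 0 < kap * (W * V) * X ^+ 2.
  by apply: mulr_gt0; [apply: mulr_gt0 => //; exact: mulr_gt0|exact: exprn_gt0].
have -> : kap * (W * X * (V * X)) = kap * (W * V) * X ^+ 2 by ring.
by move: (_ * _ ^+ 2) => Y; lra.
Qed.
End Goursat.

Section WeakCR.
Variable R : realType.
Local Notation mu := (@lebesgue_measure R).
Local Notation rint := (Rintegral mu setT).

Lemma rect_bounded (q : R -> R -> R) (a b c d : R) :
  (forall x y (e : R), a <= x <= b -> c <= y <= d -> 0 < e -> exists2 dl : R, 0 < dl &
    forall h k : R, `|h| < dl -> `|k| < dl -> `|q (x + h) (y + k) - q x y| < e) ->
  exists M : R, forall x y, a <= x <= b -> c <= y <= d -> `|q x y| <= M.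
Proof.
move=> cq; pose f (z : R * R) := q z.1 z.2.
pose K : set (R * R) := `[a, b]%classic `*` `[c, d]%classic.
have cK : compact K by apply: compact_setX; exact: segment_compact.
have cf : {within K, continuous f}.
  apply: continuous_in_subspaceT => -[x y]; rewrite inE => -[/=]; rewrite !in_itv/= => hx hy.
  apply/cvgrPdist_lt => e e0; have [dl dl0 hd] := cq x y e hx hy e0.
  exists (ball x dl, ball y dl); first by split; exact: nbhsx_ballx.
  move=> [x' y'] [/= h1 h2]; rewrite /f /= distrC.
  rewrite -(subrKC x x') -(subrKC y y').
  by apply: hd; rewrite distrC.
have /compact_bounded[M [_ hM]] := continuous_compact cf cK.
exists (M + 1) => x y hx hy; apply: (hM (M + 1)); first by rewrite ltrDl.
by exists (x, y) => //; split; rewrite /= in_itv.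
Qed.

Lemma rint_le_supp (f : R -> R) (M a b : R) : a <= b -> measurable_fun setT f ->
  (forall x, a <= x <= b -> `|f x| <= M) -> `|Rintegral mu `[a, b] f| <= M * (b - a).
Proof.
move=> ab mf fM; have M0 : 0 <= M by apply: le_trans (fM a _); rewrite ?normr_ge0// lexx.
rewrite rint_mkcond; apply: rint_bdd_supp => //.
- by apply: measurable_funM => //; exact: measurable_indic.
- move=> x; rewrite indicE; case: (boolP (x \in _)); last by rewrite mulr0 normr0.
  by rewrite inE /= in_itv/= mulr1 => /fM.
- by move=> x nx; rewrite indicE memNset// mulr0.
Qed.

Lemma mea_slice (q : R -> R -> R) x : measurable_fun setT (fun z : R * R => q z.1 z.2) ->
  measurable_fun setT (q x).
Proof.
move=> mq; apply: (@measurableT_comp _ _ _ _ _ _ (fun z : R * R => q z.1 z.2) _ (fun y => (x, y))) => //.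
exact: measurable_fun_pair.
Qed.

Lemma mea_slice2 (q : R -> R -> R) y : measurable_fun setT (fun z : R * R => q z.1 z.2) ->
  measurable_fun setT (q ^~ y).
Proof.
move=> mq; apply: (@measurableT_comp _ _ _ _ _ _ (fun z : R * R => q z.1 z.2) _ (fun x => (x, y))) => //.
Qed.

Lemma mea_rint (F : R * R -> R) : (mu \x mu)%E.-integrable setT (EFin \o F) ->
  measurable_fun setT (fun x => rint (fun y => F (x, y))).
Proof.
move=> iF; have if1 := @integrable_fubini_F _ _ _ _ _ mu mu _ iF.
apply: (measurableT_comp _ (measurable_int mu if1)); exact: fine_measurable.
Qed.

Definition ind (u v x : R) : R := if u <= x <= v then 1 else 0.

Lemma mea_le_ind d (T : measurableType d) (f g : T -> R) :
  measurable_fun setT f -> measurable_fun setT g ->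
  measurable_fun setT (fun x => if f x <= g x then 1 else 0 : R).
Proof. by move=> mf mg; apply: measurable_fun_ifT => //; exact: measurable_fun_ler. Qed.

Lemma mea_ind d (T : measurableType d) (u v : R) (f : T -> R) :
  measurable_fun setT f -> measurable_fun setT (fun x => ind u v (f x)).
Proof.
move=> mf; rewrite (_ : (fun x => _) =
    fun x => (if u <= f x then 1 else 0) * (if f x <= v then 1 else 0)).
  by apply: measurable_funM; exact: mea_le_ind.
by apply/funext => x; rewrite /ind; case: (u <= f x); case: (f x <= v); rewrite ?mulr1 ?mulr0.
Qed.

Lemma ind_in (u v x : R) : u <= x <= v -> ind u v x = 1. Proof. by rewrite /ind => ->. Qed.
Lemma ind_out (u v x : R) : ~ (u <= x <= v) -> ind u v x = 0. Proof. by rewrite /ind; case: ifP. Qed.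

Lemma ind_le (u v x t : R) : t <= v -> ind u v x * (if x <= t then 1 else 0) = ind u t x.
Proof.
move=> tv; rewrite /ind; have [xt|xt] := leP x t; last by rewrite andbF mulr0.
by rewrite (le_trans xt tv) mulr1.
Qed.
Lemma ind_ge (u v x t : R) : u <= t -> ind u v x * (if t <= x then 1 else 0) = ind t v x.
Proof.
move=> ut; rewrite /ind; have [tx|tx] := leP t x; last by rewrite mulr0.
by rewrite (le_trans ut tx) mulr1.
Qed.

Lemma indM_bdd (u v x t M : R) : 0 <= M -> (u <= x <= v -> `|t| <= M) -> `|ind u v x * t| <= M.
Proof.
move=> M0; rewrite /ind; case: ifP => [_ /(_ isT)|_ _]; first by rewrite mul1r.
by rewrite mul0r normr0.
Qed.

Lemma sint_ind (f : R -> R) (u v : R) : sint f u v = rint (fun x => ind u v x * f x).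
Proof.
rewrite /sint rint_mkcond; apply: eq_Rintegral => x _; rewrite indicE mulrC.
have [h|h] := pselect (u <= x <= v); first by rewrite ind_in// mem_set//= in_itv.
by rewrite ind_out// memNset//= in_itv.
Qed.

Lemma integ_ind (f : R -> R) (M u v : R) : measurable_fun setT f -> 0 <= M ->
  (forall x, u <= x <= v -> `|f x| <= M) -> integ (fun x => ind u v x * f x).
Proof.
move=> mf M0 fM; apply: (@integ_bdd_supp R _ M u v).
- by apply: measurable_funM => //; exact: (mea_ind _ _ (@measurable_id _ _ _)).
- by move=> x; apply: indM_bdd => // /fM.
- by move=> x hx; rewrite ind_out ?mul0r// => h; apply: hx; rewrite /= in_itv.
Qed.

Lemma rint_eq0 (f : R -> R) : (forall x, f x = 0) -> rint f = 0.
Proof. by move=> f0; rewrite (_ : f = fun=> 0) ?Rintegral_cst ?mul0r//; exact/funext. Qed.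

Lemma integ_box (F : R * R -> R) (M a b c d : R) : a <= b -> c <= d -> measurable_fun setT F ->
  (forall z, `|F z| <= M) -> (forall x y, ~ (a <= x <= b /\ c <= y <= d) -> F (x, y) = 0) ->
  [/\ integ (fun x => rint (fun y => F (x, y))),
      integ (fun y => rint (fun x => F (x, y))) &
      rint (fun x => rint (fun y => F (x, y))) = rint (fun y => rint (fun x => F (x, y)))].
Proof.
move=> ab cd mF FM F0.
have M0 : 0 <= M by apply: le_trans (FM (0, 0)).
have mF' : measurable_fun setT (fun z : R * R => (fun x y => F (x, y)) z.1 z.2).
  by rewrite (_ : (fun z => _) = F)//; apply/funext => -[].
have ms x : measurable_fun setT (fun y => F (x, y)) := @mea_slice (fun x y => F (x, y)) x mF'.
have ms2 y : measurable_fun setT (fun x => F (x, y)) := @mea_slice2 (fun x y => F (x, y)) y mF'.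
have z1 x y : ~ `[c, d]%classic y -> F (x, y) = 0.
  by move=> hy; apply: F0 => -[_ h]; apply: hy; rewrite /= in_itv.
have z2 x y : ~ `[a, b]%classic x -> F (x, y) = 0.
  by move=> hx; apply: F0 => -[h _]; apply: hx; rewrite /= in_itv.
have iF x : integ (fun y => F (x, y)) by apply: (@integ_bdd_supp R _ M c d) => // y; exact: z1.
pose A x := M * (d - c) * \1_(`[a, b]%classic : set R) x.
have iA : integ A by apply: integZ; exact: integ_indic.
have FA x : rint (fun y => `|F (x, y)|) <= A x.
  rewrite /A indicE; have [hx|hx] := pselect (`[a, b]%classic x); last first.
    by rewrite memNset// mulr0 rint_eq0// => y; rewrite z2// normr0.
  rewrite mem_set// mulr1 (le_trans (ler_norm _))// rint_bdd_supp//.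
  - exact: measurableT_comp.
  - by move=> y; rewrite normr_id.
  - by move=> y hy; rewrite z1// normr0.
have iP := integ_prod mF iF FA iA.
have iP' := integ_prodC iP.
split; last exact: (fubini mF iF FA iA).
- apply: (@integ_bdd_supp R _ (M * (d - c)) a b); first exact: mea_rint.
    by move=> x; apply: rint_bdd_supp => // y; exact: z1.
  by move=> x hx; apply: rint_eq0 => y; exact: z2.
- apply: (@integ_bdd_supp R _ (M * (b - a)) c d).
  + exact: (mea_rint iP').
  + by move=> y; apply: rint_bdd_supp => // x; exact: z2.
  + by move=> y hy; apply: rint_eq0 => x; exact: z1.
Qed.

Lemma tfun_bounded a (phi : R -> R) : 0 <= a -> tfun a phi ->
  exists2 K : R, 0 <= K & forall y, `|phi y| <= K.
Proof.
move=> a0 [sphi z]; have cphi := smooth_continuous sphi.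
have cn : {within `[- a, a], continuous (fun y => `|phi y|)}.
  by apply: continuous_subspaceT => y; apply: cvg_norm; exact: cphi.
have [c _ hc] := EVT_max (ltac:(lra) : - a <= a) cn.
exists `|phi c| => // y; have [hy|hy] := pselect (`[- a, a]%classic y); first exact: hc.
by rewrite (z _ hy) normr0.
Qed.

Lemma rintZ (c : R) f : integ f -> rint (fun x => c * f x) = c * rint f.
Proof. by move=> hf; apply: RintegralZl. Qed.

Lemma ftc_smooth (phi : R -> R) a b : a <= b -> smooth phi ->
  sint (derive1 phi) a b = phi b - phi a.
Proof.
rewrite le_eqVlt => /orP[/eqP -> _|ab sphi].
  by rewrite subrr /sint set_itv1 Rintegral_set1.
have cphi := smooth_continuous sphi.
rewrite /sint /Rintegral (@continuous_FTC2 R (derive1 phi) phi a b)//.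
- by apply: continuous_subspaceT; exact: (smooth_continuous (smooth_derive1 sphi)).
- split=> [x _||]; first exact: smooth_derivable.
  + by apply: cvg_at_right_filter; exact: cphi.
  + by apply: cvg_at_left_filter; exact: cphi.
Qed.

Lemma tfun_derive1 a (phi : R -> R) : tfun a phi -> tfun a (derive1 phi).
Proof.
move=> [sphi z]; split; first exact: smooth_derive1.
move=> t ht; rewrite derive1E (@near_eq_derive _ _ _ _ (fun=> 0)) ?derive_cst//.
have op : open (~` `[- a, a]%classic) by apply: closed_openC; exact: interval_closed.
have : nbhs t (~` `[- a, a]%classic) by exact: open_nbhs_nbhs.
by apply: filterS => x; exact: z.
Qed.

Lemma mea_sint_upper (g : R -> R) (r Mg : R) : - r < r -> measurable_fun setT g -> 0 <= Mg ->
  (forall y, - r <= y <= r -> `|g y| <= Mg) ->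
  measurable_fun setT (fun t : R => ind (- r) r t * sint g (- r) t).
Proof.
move=> r0 mg Mg0 gM.
pose F' (z : R * R) := ind (- r) r z.1 * (ind (- r) r z.2 * g z.2) * (if z.2 <= z.1 then 1 else 0).
have [h _ _] : [/\ integ (fun x => rint (fun y => F' (x, y))),
  integ (fun y => rint (fun x => F' (x, y))) &
  rint (fun x => rint (fun y => F' (x, y))) = rint (fun y => rint (fun x => F' (x, y)))].
  apply: (@integ_box F' Mg (- r) r (- r) r); [exact: ltW|exact: ltW| | |].
  - apply: measurable_funM; last by apply: mea_le_ind; [exact: measurable_snd|exact: measurable_fst].
    apply: measurable_funM; first exact: mea_ind measurable_fst.
    apply: measurable_funM; first exact: mea_ind measurable_snd.
    exact: (measurableT_comp mg measurable_snd).
  - move=> [y t]; rewrite /F' [fst _]/= [snd _]/= -mulrA; apply: indM_bdd => // _.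
    rewrite mulrC; case: ifP => _; last by rewrite mul0r normr0.
    by rewrite mul1r; apply: indM_bdd => // /gM.
  - move=> y t h; rewrite /F' [fst _]/= [snd _]/=.
    have [hy|hy] := pselect (- r <= y <= r); last by rewrite (ind_out hy) !mul0r.
    by rewrite (@ind_out (- r) r t) ?mul0r ?mulr0 ?mul0r// => ht; exact: h.
apply: eq_measurable_fun (integ_mea h) => t _.
have [ht|ht] := pselect (- r <= t <= r); last first.
  by rewrite (ind_out ht) mul0r rint_eq0// => x; rewrite /F' /= (ind_out ht) !mul0r.
rewrite sint_ind -rintZ; last first.
  by apply: (integ_ind mg Mg0) => x hx; apply: gM; move: hx ht; clear; lra.
apply: eq_Rintegral => x _; rewrite /F' [fst _]/= [snd _]/= -mulrA; congr (_ * _).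
by rewrite mulrAC ind_le//; case/andP: ht.
Qed.

(** Integration by parts for a bounded measurable [g]: since [phi] vanishes at r, phi(y) is minus
    the integral of its derivative over [y, r], and Fubini over the triangle y <= t produces the
    primitive of [g]. *)
Lemma ibp_primitive (g phi : R -> R) (a r Mg : R) : 0 <= a < r -> measurable_fun setT g -> 0 <= Mg ->
  (forall y, - r <= y <= r -> `|g y| <= Mg) -> tfun a phi ->
  rint (fun y => g y * phi y) = - rint (fun t => (ind (- r) r t * derive1 phi t) * sint g (- r) t).
Proof.
move=> /andP[a0 ar] mg Mg0 gM tphi.
have rr : - r < r by lra.
have rr' := ltW rr.
have r2 : 0 <= r + r by lra.
have tphi' := tfun_derive1 tphi.
have [Md Md0 hMd] := tfun_bounded a0 tphi'.
have [sphi zphi] := tphi; have [sphi' _] := tphi'.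
have out y : ~ (- r <= y <= r) -> phi y = 0.
  by move=> h; apply: zphi => h'; apply: h; move: h'; rewrite /= in_itv/=; lra.
have pr1 : phi r = 0 by apply: zphi; rewrite /= in_itv/=; lra.
have mphi' : measurable_fun setT (derive1 phi) by exact: smooth_mea.
pose F (z : R * R) := - (ind (- r) r z.1 * g z.1) * (ind (- r) r z.2 * derive1 phi z.2) *
   (if z.1 <= z.2 then 1 else 0).
have [_ _ FubF] : [/\ integ (fun x => rint (fun y => F (x, y))),
      integ (fun y => rint (fun x => F (x, y))) &
      rint (fun x => rint (fun y => F (x, y))) = rint (fun y => rint (fun x => F (x, y)))].
  apply: (@integ_box F (Mg * Md) (- r) r (- r) r); [by []|by []| | |].
  - apply: measurable_funM; last by apply: mea_le_ind; [exact: measurable_fst|exact: measurable_snd].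
    apply: measurable_funM.
      apply: measurable_funN; apply: measurable_funM; first exact: mea_ind measurable_fst.
      exact: (measurableT_comp mg measurable_fst).
    apply: measurable_funM; first exact: mea_ind measurable_snd.
    exact: (measurableT_comp mphi' measurable_snd).
  - move=> [y t]; rewrite /F [fst _]/= [snd _]/= normrM normrM normrN -[X in _ <= X]mulr1.
    apply: ler_pM => //; last by case: ifP; rewrite ?normr1 ?normr0.
    by apply: ler_pM => //; apply: indM_bdd => //; exact: gM.
  - move=> y t h; rewrite /F [fst _]/= [snd _]/=.
    have [hy|hy] := pselect (- r <= y <= r); last by rewrite (ind_out hy) mul0r oppr0 !mul0r.
    by rewrite (@ind_out (- r) r t) ?mul0r ?mulr0 ?mul0r// => ht; exact: h.
transitivity (rint (fun x => rint (fun y => F (x, y)))).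
  apply: eq_Rintegral => y _.
  transitivity (- (ind (- r) r y * g y) * rint (fun t => ind y r t * derive1 phi t)).
    have [hy|hy] := pselect (- r <= y <= r); last first.
      by rewrite (ind_out hy) (out _ hy) mulr0 mul0r oppr0 mul0r.
    have yr : y <= r by case/andP: hy.
    rewrite -(sint_ind (derive1 phi) y r) (ftc_smooth yr sphi) pr1 (ind_in hy); ring.
  rewrite -rintZ; last by apply: (integ_ind mphi' Md0).
  apply: eq_Rintegral => t _; rewrite /F [fst _]/= [snd _]/=.
  have [hy|hy] := pselect (- r <= y <= r); last by rewrite (ind_out hy) !mul0r oppr0 !mul0r.
  rewrite -mulrA; congr (_ * _); rewrite mulrAC; congr (_ * _).
  by rewrite ind_ge//; case/andP: hy.
rewrite FubF -mulN1r -rintZ; last first.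
  have msg := mea_sint_upper rr mg Mg0 gM.
  apply: (@integ_bdd_supp R _ (Mg * (r + r) * Md) (- r) r).
  - by under eq_fun do rewrite mulrAC; apply: measurable_funM.
  - move=> t; rewrite mulrAC normrM; apply: ler_pM => //.
    apply: indM_bdd => [|ht]; first by apply: mulr_ge0.
    apply: le_trans (rint_le_supp (M := Mg) _ mg _) _; first by case/andP: ht.
      by move=> x hx; apply: gM; move: hx ht; clear; lra.
    by apply: ler_wpM2l => //; move: ht; clear; lra.
  - by move=> t ht; rewrite ind_out ?mul0r// => h; apply: ht; rewrite /= in_itv.
apply: eq_Rintegral => y _; have [hy|hy] := pselect (- r <= y <= r); last first.
  by rewrite (ind_out hy) !(mul0r, mulr0) rint_eq0// => x; rewrite /F /= (ind_out hy) mul0r mulr0 mul0r.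
rewrite mulrA sint_ind -rintZ; last first.
  by apply: (integ_ind mg Mg0) => x hx; apply: gM; move: hx hy; clear; lra.
apply: eq_Rintegral => x _; rewrite /F [fst _]/= [snd _]/= (ind_in hy) !mul1r mulN1r.
rewrite -(@ind_le _ r x y); last by case/andP: hy.
move: (ind _ _ _) (g x) (derive1 phi y) (if _ then _ else _) => i gx d e.
by ring.
Qed.

Lemma swap_box (q : R -> R -> R) (psi : R -> R) (x1 x2 r Mq Md : R) : x1 <= x2 -> 0 <= r ->
  measurable_fun setT (fun z : R * R => q z.1 z.2) -> measurable_fun setT psi -> 0 <= Mq -> 0 <= Md ->
  (forall x y, x1 <= x <= x2 -> - r <= y <= r -> `|q x y| <= Mq) -> (forall y, `|psi y| <= Md) ->
  (forall y, ~ (- r <= y <= r) -> psi y = 0) ->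
  [/\ integ (fun s => ind x1 x2 s * rint (fun y => q s y * psi y)),
      integ (fun t => psi t * sint (q ^~ t) x1 x2) &
      rint (fun t => psi t * sint (q ^~ t) x1 x2) = sint (fun s => rint (fun y => q s y * psi y)) x1 x2].
Proof.
move=> x12 r0 mq mpsi Mq0 Md0 hMq hMd out.
pose F2 (z : R * R) := ind x1 x2 z.1 * (q z.1 z.2 * psi z.2).
have F20 x y : ~ (x1 <= x <= x2 /\ - r <= y <= r) -> F2 (x, y) = 0.
  move=> h; rewrite /F2 [fst _]/= [snd _]/=.
  have [hx|hx] := pselect (x1 <= x <= x2); last by rewrite (ind_out hx) !mul0r.
  by rewrite (out y) ?mulr0// => hy; exact: h.
have [iF2 iF2' FubF2] : [/\ integ (fun x => rint (fun y => F2 (x, y))),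
      integ (fun y => rint (fun x => F2 (x, y))) &
      rint (fun x => rint (fun y => F2 (x, y))) = rint (fun y => rint (fun x => F2 (x, y)))].
  apply: (@integ_box F2 (Mq * Md) x1 x2 (- r) r) => //; first lra.
  - apply: measurable_funM; first exact: mea_ind measurable_fst.
    by apply: measurable_funM => //; exact: (measurableT_comp mpsi measurable_snd).
  - move=> [x y]; have [[hx hy]|h] := pselect (x1 <= x <= x2 /\ - r <= y <= r); last first.
      by rewrite F20// normr0 mulr_ge0.
    by rewrite /F2 [fst _]/= [snd _]/= ind_in// !mul1r normrM ler_pM// hMq.
have e1 y : rint (fun x => F2 (x, y)) = psi y * sint (q ^~ y) x1 x2.
  have [hy|hy] := pselect (- r <= y <= r); last first.
    by rewrite (out _ hy) mul0r rint_eq0// => x; rewrite /F2 /= (out _ hy) !mulr0.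
  rewrite sint_ind -rintZ; last by apply: (integ_ind (mea_slice2 y mq) Mq0) => x hx; exact: hMq.
  by apply: eq_Rintegral => x _; rewrite /F2 [fst _]/= [snd _]/= mulrA mulrC.
have e2 s : rint (fun y => F2 (s, y)) = ind x1 x2 s * rint (fun y => q s y * psi y).
  have [hs|hs] := pselect (x1 <= s <= x2); last first.
    by rewrite (ind_out hs) mul0r rint_eq0// => y; rewrite /F2 /= (ind_out hs) mul0r.
  by rewrite (ind_in hs) mul1r; apply: eq_Rintegral => y _; rewrite /F2 [fst _]/= [snd _]/= (ind_in hs) mul1r.
move/funext: e1 => e1; move/funext: e2 => e2.
by move: iF2 iF2' FubF2; rewrite e1 e2 => i1 i2 E; split=> //; rewrite sint_ind -E.
Qed.

(** Weak form of d/dx of the integral of p phi = integral of q phi', with an error bound around [L].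
    By [goursat] on [x1, x2] x [-r, y], the primitive in y of p(x2, .) - p(x1, .) is minus the
    integral of q(., y) over [x1, x2] up to a constant; integration by parts in y then puts the
    derivative on [phi]. *)
Lemma weak_cr_bound (p q : R -> R -> R) (x1 x2 r a L M : R) (phi : R -> R) :
  x1 < x2 -> 0 <= a < r -> (forall x y, x1 <= x <= x2 -> - r <= y <= r -> dfree p q x y) ->
  measurable_fun setT (fun z : R * R => p z.1 z.2) ->
  measurable_fun setT (fun z : R * R => q z.1 z.2) -> tfun a phi ->
  (forall s, x1 <= s <= x2 -> `|rint (fun y => q s y * derive1 phi y) - L| <= M) ->
  `|rint (fun y => p x2 y * phi y) - rint (fun y => p x1 y * phi y) - L * (x2 - x1)| <= M * (x2 - x1).
Proof.
move=> x12 a0r H mp mq tphi hM; have /andP[a0 ar] := a0r.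
have r0 : - r <= r by lra.
have tphi' := tfun_derive1 tphi.
have [K K0 hK] := tfun_bounded a0 tphi.
have [Md Md0 hMd] := tfun_bounded a0 tphi'.
have [sphi zphi] := tphi; have [sphi' zphi'] := tphi'.
have out y : ~ (- r <= y <= r) -> ~ `[- a, a]%classic y.
  by move=> h h'; apply: h; move: h'; rewrite /= in_itv/=; lra.
have mphi' : measurable_fun setT (derive1 phi) by exact: smooth_mea.
have mphi : measurable_fun setT phi by exact: smooth_mea.
have bdd (w : R -> R -> R) : (forall x y (e : R), x1 <= x <= x2 -> - r <= y <= r -> 0 < e ->
    exists2 dl : R, 0 < dl & forall h k : R, `|h| < dl -> `|k| < dl -> `|w (x + h) (y + k) - w x y| < e) ->
    exists2 B : R, 0 <= B & forall x y, x1 <= x <= x2 -> - r <= y <= r -> `|w x y| <= B.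
  move=> /rect_bounded[B hB]; exists `|B| => // x y hx hy.
  by rewrite (le_trans (hB x y hx hy))// ler_norm.
have [Mp Mp0 hMp] : exists2 B : R, 0 <= B & forall x y, x1 <= x <= x2 -> - r <= y <= r -> `|p x y| <= B.
  apply: bdd => x y e hx hy e0; have [dl dl0 hd] := dfree_cont (H x y hx hy) e0.
  by exists dl => // h k hh hk; have [] := hd h k hh hk.
have [Mq Mq0 hMq] : exists2 B : R, 0 <= B & forall x y, x1 <= x <= x2 -> - r <= y <= r -> `|q x y| <= B.
  apply: bdd => x y e hx hy e0; have [dl dl0 hd] := dfree_cont (H x y hx hy) e0.
  by exists dl => // h k hh hk; have [] := hd h k hh hk.
have h1 : x1 <= x1 <= x2 by lra.
have h2 : x1 <= x2 <= x2 by lra.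
pose g t := p x2 t - p x1 t.
have mg : measurable_fun setT g by apply: measurable_funB; apply: mea_slice.
have gM y : - r <= y <= r -> `|g y| <= Mp + Mp.
  by move=> hy; rewrite (le_trans (ler_normB _ _))// lerD// hMp.
have cq y : - r <= y <= r -> cont_on x1 x2 (q ^~ y) by move=> hy; apply: (dfree_contq H).
(* The bottom side of the rectangle gives a constant, which integrates to 0 against the derivative
   of [phi]. *)
pose k := sint (q ^~ (- r)) x1 x2.
have PE y : - r <= y <= r -> sint g (- r) y = - (sint (q ^~ y) x1 x2 - k).
  move=> hy; have /andP[y1 y2] := hy; move: y1; rewrite le_eqVlt => /orP[/eqP <-|y1].
    by rewrite subrr oppr0 /sint set_itv1 Rintegral_set1.
  have : flux p q x1 x2 (- r) y = 0.
    by apply: goursat => // x t hx ht; apply: H => //; lra.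
  rewrite /flux (sintB (cq y hy) (cq (- r) _)) -/k; last by lra.
  by move=> /eqP; rewrite addr_eq0 => /eqP.
have ip x : x1 <= x <= x2 -> integ (fun y => p x y * phi y).
  move=> hx; have i1 := integ_ind (mea_slice x mp) Mp0 (fun y => hMp x y hx).
  apply: eq_integ (integM_bdd i1 mphi hK) => y.
  have [hy|hy] := pselect (- r <= y <= r); first by rewrite ind_in// mul1r.
  by rewrite zphi ?mulr0//; exact: out.
have E1 : rint (fun y => p x2 y * phi y) - rint (fun y => p x1 y * phi y) = rint (fun y => g y * phi y).
  rewrite -RintegralB//; [|exact: ip|exact: ip].
  by apply: eq_Rintegral => y _; rewrite /g mulrBl.
pose psi y := ind (- r) r y * derive1 phi y.
have psiE y : psi y = derive1 phi y.
  rewrite /psi; have [hy|hy] := pselect (- r <= y <= r); first by rewrite ind_in// mul1r.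
  by rewrite zphi' ?mulr0//; exact: out.
have psi0 y : ~ (- r <= y <= r) -> psi y = 0 by move=> hy; rewrite /psi ind_out// mul0r.
have mpsi : measurable_fun setT psi by rewrite (_ : psi = derive1 phi)//; exact/funext.
have psiM y : `|psi y| <= Md by rewrite psiE.
have r0' : 0 <= r by lra.
have [iS iT E2] := swap_box (ltW x12) r0' mq mpsi Mq0 Md0 hMq psiM psi0.
have ipsi : integ psi by apply: (integ_ind mphi' Md0).
have E3 : rint (fun y => g y * phi y) = sint (fun s => rint (fun y => q s y * psi y)) x1 x2.
  rewrite (ibp_primitive a0r mg (addr_ge0 Mp0 Mp0) gM tphi) -E2.
  have -> : (fun t => ind (- r) r t * derive1 phi t * sint g (- r) t) =
      (fun t => k * psi t - psi t * sint (q ^~ t) x1 x2).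
    apply/funext => t; have [ht|ht] := pselect (- r <= t <= r).
      by rewrite PE// -/(psi t); ring.
    by rewrite -/(psi t) psi0// !(mul0r, mulr0) subrr.
  rewrite RintegralB//; last exact: integZ.
  rewrite rintZ// -sint_ind ftc_smooth// ?zphi ?subrr ?mulr0 ?sub0r ?opprK//.
  - by rewrite /= in_itv/=; lra.
  - by rewrite /= in_itv/=; lra.
rewrite E1 E3.
have -> : L * (x2 - x1) = sint (fun=> L) x1 x2 by rewrite sint_cst// ltW.
have mB : measurable_fun setT (fun s => ind x1 x2 s * (rint (fun y => q s y * psi y) - L)).
  under eq_fun do rewrite mulrBr; apply: measurable_funB; first exact: integ_mea.
  by apply: measurable_funM => //; apply: mea_ind.
rewrite !sint_ind -RintegralB//; last first.
  by apply: (@integ_ind (fun=> L) `|L|) => //; exact: normr_ge0.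
under eq_Rintegral do rewrite -mulrBr.
apply: rint_bdd_supp => //; first exact: ltW.
- move=> s; apply: indM_bdd => [|hs]; first by apply: le_trans (hM x1 h1); exact: normr_ge0.
  by under eq_Rintegral do rewrite psiE; exact: hM.
- by move=> s hs; rewrite ind_out ?mul0r// => h; apply: hs; rewrite /= in_itv.
Qed.
End WeakCR.

(** * Moments against a bump family *)

Section BumpFamily.
Variable R : realType.
Local Notation mu := (@lebesgue_measure R).
Local Notation rint := (Rintegral mu setT).

(** The profile is the derivative of [bump]. Hence bump(s^2 - x^2 - t^2) has gradient -2 (x, t)
    times [bfam (s ^+ 2 - x ^+ 2) 0 t], and the slices of the radial weight used in the mean value
    argument belong to this one family indexed by [q]. *)
Definition bfam (q : R) (j : nat) : R -> R :=
  derive1n j (fun u => bumpf (bump_deriv 1) (q - u ^+ 2)).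

Lemma bfam0_smooth (q : R) : smooth (fun u => bumpf (bump_deriv 1) (q - u ^+ 2)).
Proof.
rewrite (_ : (fun u => _) = fun u => (1 : {poly R}).[u] * bumpf (bump_deriv 1) (q - u ^+ 2)).
  exact: smooth_bump_comp.
by apply/funext => u; rewrite hornerE mul1r.
Qed.

Lemma derive1_bfam q j : derive1 (bfam q j) = bfam q j.+1. Proof. by []. Qed.

Lemma bfam_smooth q j : smooth (bfam q j).
Proof.
elim: j => [|j IH]; first exact: bfam0_smooth.
by rewrite -derive1_bfam; exact: smooth_derive1.
Qed.

Lemma bfam_eq0 q j u : q <= u ^+ 2 -> bfam q j u = 0.
Proof.
move=> qu; rewrite /bfam.
suff H : forall r p : {poly R}, derive1n j (fun u => r.[u] * bumpf p (q - u ^+ 2)) u = 0.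
  rewrite (_ : (fun u => _) = fun u => (1 : {poly R}).[u] * bumpf (bump_deriv 1) (q - u ^+ 2))//.
  by apply/funext => v; rewrite hornerE mul1r.
elim: j => [|j IH] r p; first by rewrite /= bumpf_eq0 ?mulr0// subr_le0.
rewrite derive1nS' derive1_bump_comp derive1nD ?IH ?addr0//; exact: smooth_bump_comp.
Qed.

Lemma bfam_bounded j : exists2 K : R, 0 <= K & forall q u : R, q <= 1 -> `|bfam q j u| <= K.
Proof.
have [K hK] := bump_family_bounded j (1 : {poly R}) (bump_deriv 1).
have H q u : q <= 1 -> `|bfam q j u| <= K.
  move=> q1; rewrite /bfam.
  rewrite (_ : (fun u => _) = fun u => (1 : {poly R}).[u] * bumpf (bump_deriv 1) (q - u ^+ 2)).
    exact: hK.
  by apply/funext => v; rewrite hornerE mul1r.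
by exists K => //; apply: le_trans (H 0 0 ler01); exact: normr_ge0.
Qed.

Lemma bfam0_ge0 q u : 0 <= bfam q 0 u.
Proof.
rewrite /bfam /= /bumpf; case: ifP => // _; rewrite mulr_ge0 ?expR_ge0//.
by rewrite /bump_deriv derivC subr0 mulr1 hornerXn sqr_ge0.
Qed.
Lemma bfam0_gt0 q u : u ^+ 2 < q -> 0 < bfam q 0 u.
Proof.
move=> uq; have h : 0 < q - u ^+ 2 by rewrite subr_gt0.
rewrite /bfam /= /bumpf h mulr_gt0 ?expR_gt0//.
by rewrite /bump_deriv derivC subr0 mulr1 hornerXn exprn_gt0// invr_gt0.
Qed.

Lemma derive1n_shift n (f : R -> R) (t : R) : smooth f ->
  derive1n n (fun y => f (y - t)) = (fun y => derive1n n f (y - t)).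
Proof.
elim: n f => // n IH f sf; rewrite !derive1nS'.
have -> : derive1 (fun y => f (y - t)) = (fun y => derive1 f (y - t)).
  rewrite (@derive1_comp' R (fun y => y - t) f).
  - apply/funext => y; rewrite !derive1E deriveB// derive_id derive_cst subr0 mulr1//.
  - by move=> x; apply: derivableB => //; exact: derivable_cst.
  - by move=> x; exact: smooth_derivable.
exact: (IH _ (smooth_derive1 sf)).
Qed.

Lemma tfun_bfam (a s q t : R) j : 0 <= s -> q <= s ^+ 2 -> `|t| + s <= a ->
  tfun a (fun y => bfam q j (y - t)).
Proof.
move=> s0 qs ts; split.
  have h : smooth (fun y : R => y - t).
    exact: (@smoothB R _ _ (@smooth_id R) (@smooth_cst R t)).
  exact: (@smooth_comp R _ _ h (@bfam_smooth q j)).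
move=> y hy; apply: bfam_eq0; apply: le_trans qs _.
rewrite -[leRHS]real_normK ?num_real// ler_pXn2r ?nnegrE//.
rewrite leNgt; apply/negP => h; apply: hy; rewrite /= in_itv/=.
move: h ts; rewrite ltr_norml => /andP[h1 h2]; have := ler_norm t; have := ler_norm (- t).
by rewrite normrN; lra.
Qed.

Lemma derive1_bfam_shift q j t : derive1 (fun y => bfam q j (y - t)) = (fun y => bfam q j.+1 (y - t)).
Proof. exact: (derive1n_shift 1 t (@bfam_smooth q j)). Qed.

Lemma integ_tfun (w phi : R -> R) (a N : R) : measurable_fun setT w -> 0 <= a -> 0 <= N ->
  (forall y, - a <= y <= a -> `|w y| <= N) -> tfun a phi -> integ (fun y => w y * phi y).
Proof.
move=> mw a0 N0 hN tphi; have [K K0 hK] := tfun_bounded a0 tphi; have [sphi zphi] := tphi.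
apply: eq_integ (integM_bdd (integ_ind mw N0 hN) (smooth_mea sphi) hK) => y.
have [hy|hy] := pselect (- a <= y <= a); first by rewrite ind_in// mul1r.
by rewrite zphi ?mulr0// => h; apply: hy; move: h; rewrite /= in_itv.
Qed.

Lemma rint_tfun_le (w phi : R -> R) (a N M : R) : measurable_fun setT w -> 0 <= a -> 0 <= N ->
  (forall y, - a <= y <= a -> `|w y| <= N) -> tfun a phi -> (forall y, `|phi y| <= M) ->
  `|rint (fun y => w y * phi y)| <= N * (a + a) * M.
Proof.
move=> mw a0 N0 hN tphi hM; have [sphi zphi] := tphi.
have M0 : 0 <= M by apply: le_trans (hM 0); exact: normr_ge0.
rewrite mulrAC (_ : a + a = a - - a); last by rewrite opprK.
apply: (@rint_bdd_supp R _ (N * M) (- a) a).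
- by lra.
- by apply: measurable_funM => //; exact: smooth_mea.
- move=> y; rewrite normrM; have [hy|hy] := pselect (- a <= y <= a).
    by apply: ler_pM => //; exact: hN.
  by rewrite zphi ?normr0 ?mulr0 ?mulr_ge0// => h; apply: hy; move: h; rewrite /= in_itv.
- by move=> y hy; rewrite zphi// mulr0.
Qed.

(** Without such a bound some sequence x_n -> 0 would make the pairings unbounded over the family in
    [q] and [t], although for each single test function they converge; [uniform_boundedness]
    excludes this. *)
Lemma bfam_pairing_bounded (w : R -> R -> R) (d a s t1 : R) j : 0 < d -> 0 <= a -> 0 <= s <= 1 -> t1 + s <= a ->
  (forall x, measurable_fun setT (w x)) ->
  (forall x, 0 < `|x| < d -> exists2 N : R, 0 <= N & forall y, - a <= y <= a -> `|w x y| <= N) ->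
  (forall phi, tfun a phi -> exists l : R, rint (fun y => w x y * phi y) @[x --> 0^'] --> l) ->
  exists2 e : R, 0 < e & exists M : R, forall x q t, 0 < `|x| < e -> q <= s ^+ 2 -> `|t| <= t1 ->
    `|rint (fun y => w x y * bfam q j (y - t))| <= M.
Proof.
move=> d0 a0 /andP[s0 s1] tsa mw bw cw; apply: contrapT => nex.
have H n : exists z : R * R * R, [/\ 0 < `|z.1.1| < Num.min d n.+1%:R^-1, z.1.2 <= s ^+ 2, `|z.2| <= t1 &
    n%:R < `|rint (fun y => w z.1.1 y * bfam z.1.2 j (y - z.2))|].
  apply: contrapT => h; apply: nex; exists (Num.min d n.+1%:R^-1); first by rewrite lt_min d0 invr_gt0 ltr0Sn.
  exists n%:R => x q t hx hq ht; rewrite leNgt; apply/negP => lt; apply: h.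
  by exists (x, q, t); split.
have [z hz] := choice H.
pose I := {i : R * R | i.1 <= s ^+ 2 /\ `|i.2| <= t1}.
pose f (i : I) y := bfam (sval i).1 j (y - (sval i).2).
pose X n := (z n).1.1.
have hX n : 0 < `|X n| < d.
  by have [/andP[h1]] := hz n; rewrite lt_min => /andP[h2 _] _ _ _; apply/andP.
have Xc : X @ \oo --> (0 : R).
  apply/cvgrPdist_lt => e e0; near=> n; rewrite sub0r normrN.
  have [/andP[_]] := hz n; rewrite lt_min => /andP[_ h] _ _ _; apply: lt_trans h _.
  rewrite invf_plt ?posrE ?ltr0Sn//; near: n.
  have := @nbhs_infty_gtr R e^-1; apply: filterS => n /lt_trans; apply.
  by rewrite ltr_nat.
have Xn0 n : X n != 0 by rewrite -normr_gt0; have /andP[] := hX n.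
have tf i : tfun a (f i).
  by case: i => i [i1 i2]; apply: (@tfun_bfam a s) => //; exact: le_trans (lerD i2 (lexx _)) tsa.
have bf n : exists K : R, forall i t, `|derive1n n (f i) t| <= K.
  have [K _ hK] := bfam_bounded (n + j).
  exists K => -[i [i1 i2]] t; rewrite /f [sval _]/= derive1n_shift; last exact: bfam_smooth.
  rewrite /bfam /derive1n -iterD; apply: hK; apply: le_trans i1 _.
  by rewrite exprn_ile1.
pose U n phi := RtoC (rint (fun y => w (X n) y * phi y)).
have UD n phi psi c : tfun a phi -> tfun a psi ->
    U n (fun t => phi t + c * psi t) = U n phi + RtoC c * U n psi.
  move=> tphi tpsi; rewrite /U -RtoCM -RtoCD; congr RtoC.
  have [N N0 hN] := bw _ (hX n).
  have i1 := integ_tfun (mw (X n)) a0 N0 hN tphi; have i2 := integ_tfun (mw (X n)) a0 N0 hN tpsi.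
  rewrite -rintZ// -RintegralD//; last exact: integZ.
  by apply: eq_Rintegral => y _; rewrite mulrDr mulrCA.
have UB n : exists2 N : R, 0 <= N & forall phi M, tfun a phi -> (forall t, `|phi t| <= M) ->
    cnorm (U n phi) <= N * M.
  have [N N0 hN] := bw _ (hX n); exists (N * (a + a)) => [|phi M tphi hM].
    by rewrite mulr_ge0// addr_ge0.
  by rewrite cnorm_RtoC; exact: (rint_tfun_le (mw (X n)) a0 N0 hN tphi hM).
have Upt phi : tfun a phi -> exists M : R, forall n, cnorm (U n phi) <= M.
  move=> /cw[l cl].
  have /cvg_seq_bounded[M [_ hM]] : cvgn (fun n => rint (fun y => w (X n) y * phi y)).
    apply/cvg_ex; exists l; apply: (cvg_comp _ _ _ cl).
    by move=> A [e e0 he]; have /cvgrPdist_lt/(_ e e0) := Xc; apply: filterS => n hn; apply: he.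
  by exists (M + 1) => n; rewrite cnorm_RtoC; apply: (hM (M + 1)) => //; rewrite ltrDl.
have [M hM] := uniform_boundedness tf bf UD UB Upt.
have [n _ /(_ n (leqnn n))/= hn] := @nbhs_infty_gtr R M.
have [_ h1 h2 h3] := hz n.
have := hM n (exist _ ((z n).1.2, (z n).2) (conj h1 h2)).
by rewrite cnorm_RtoC leNgt (lt_trans hn h3).
Unshelve. all: by end_near.
Qed.
End BumpFamily.

(** * Moments of a function against translated bumps *)

Section Moments.
Variable R : realType.
Local Notation mu := (@lebesgue_measure R).
Local Notation rint := (Rintegral mu setT).

(** Carries estimates across the line x = 0, where no differential equation is known: a step over 0
    is cut at points close to 0, and continuity there closes the gap. *)
Lemma glue0 (g : R -> R) (K a b : R) : 0 <= K -> a <= b -> g x @[x --> 0^'] --> g 0 ->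
  (forall x1 x2, a <= x1 -> x1 < x2 -> x2 <= b -> 0 < x1 \/ x2 < 0 -> `|g x2 - g x1| <= K * (x2 - x1)) ->
  `|g b - g a| <= K * (b - a).
Proof.
move=> K0 ab cg H.
have near0 eta : 0 < eta -> exists2 dl : R, 0 < dl & forall x, x != 0 -> `|x| < dl -> `|g 0 - g x| < eta.
  move=> eta0; have /cvgrPdist_lt/(_ eta eta0)[dl /= dl0 hd] := cg.
  by exists dl => // x x0 xd; apply: hd => //=; rewrite sub0r normrN.
have right0 : a <= 0 -> 0 < b -> `|g b - g 0| <= K * b.
  move=> a0 b0; apply/ler_addgt0Pl => eta eta0; have [dl dl0 hd] := near0 _ eta0.
  pose x := Num.min (dl / 2) (b / 2).
  have x0 : 0 < x by rewrite lt_min !divr_gt0.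
  have xd : x <= dl / 2 by rewrite ge_min lexx.
  have xb : x <= b / 2 by rewrite ge_min lexx orbT.
  have h1 := H x b ltac:(lra) ltac:(lra) (lexx _) (or_introl x0).
  have h2 := hd x (lt0r_neq0 x0); rewrite gtr0_norm// in h2.
  have h3 := h2 ltac:(lra).
  rewrite (_ : g b - g 0 = (g b - g x) - (g 0 - g x)); last ring.
  rewrite (le_trans (ler_normB _ _))//; nra.
have left0 : a < 0 -> 0 <= b -> `|g 0 - g a| <= K * - a.
  move=> a0 b0; apply/ler_addgt0Pl => eta eta0; have [dl dl0 hd] := near0 _ eta0.
  pose x := Num.max (- (dl / 2)) (a / 2).
  have x0 : x < 0 by rewrite gt_max; apply/andP; split; lra.
  have xd : - (dl / 2) <= x by rewrite le_max lexx.
  have xb : a / 2 <= x by rewrite le_max lexx orbT.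
  have h1 := H a x (lexx _) ltac:(lra) ltac:(lra) (or_intror x0).
  have h2 := hd x (ltr0_neq0 x0); rewrite ltr0_norm// in h2.
  have h3 := h2 ltac:(lra).
  rewrite (_ : g 0 - g a = (g x - g a) + (g 0 - g x)); last ring.
  rewrite (le_trans (ler_normD _ _))//; nra.
have [a0|a0] := ltP 0 a.
  move: ab; rewrite le_eqVlt => /orP[/eqP <-|ab]; first by rewrite !subrr normr0 mulr0.
  by apply: H => //; left.
have [b0|b0] := ltP b 0.
  move: ab; rewrite le_eqVlt => /orP[/eqP <-|ab]; first by rewrite !subrr normr0 mulr0.
  by apply: H => //; right.
have h1 : `|g b - g 0| <= K * b.
  by move: b0 right0; rewrite le_eqVlt => /orP[/eqP <- _|b0 h]; [rewrite subrr normr0 mulr0|exact: h].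
have h2 : `|g 0 - g a| <= K * - a.
  move: a0 left0; rewrite le_eqVlt => /orP[/eqP -> _|a0 h]; last exact: h.
  by rewrite subrr normr0 oppr0 mulr0.
rewrite (_ : g b - g a = (g b - g 0) + (g 0 - g a)); last ring.
rewrite (le_trans (ler_normD _ _))//; lra.
Qed.

Lemma mvt_le (f df : R -> R) (x y L K : R) : (forall z, Num.min x y <= z <= Num.max x y -> is_derive z (1 : R) f (df z)) ->
  (forall z, Num.min x y <= z <= Num.max x y -> `|df z - L| <= K) ->
  `|f y - f x - L * (y - x)| <= K * `|y - x|.
Proof.
move=> d h.
have main (u v : R) : u <= v -> (forall z, u <= z <= v -> is_derive z (1 : R) f (df z)) ->
    (forall z, u <= z <= v -> `|df z - L| <= K) -> `|f v - f u - L * (v - u)| <= K * (v - u).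
  move=> uv d' h'.
  have [z] : exists2 z, z \in `[u, v] & f v - f u = df z * (v - u).
    apply: MVT_segment => // [z hz|]; first by apply: d'; move: hz; rewrite in_itv/= => /andP[h1 h2]; rewrite !ltW.
    apply: continuous_in_subspaceT => z; rewrite inE /= in_itv/= => hz.
    apply: differentiable_continuous; apply/derivable1_diffP.
    by have [] := d' z hz.
  rewrite in_itv/= => hz ->; rewrite -mulrBl normrM [`|v - u|]ger0_norm ?subr_ge0//.
  by rewrite ler_wpM2r ?subr_ge0// h'.
have [xy|yx] := leP x y.
  by rewrite [`|y - x|]ger0_norm ?subr_ge0//; move: d h; rewrite min_l// max_r// => d h; exact: main.
have yx' := ltW yx; move: d h; rewrite min_r// max_l// => d h.
rewrite [`|y - x|]distrC [`|x - y|]ger0_norm; last by rewrite subr_ge0 ltW.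
rewrite -normrN (_ : - (f y - f x - L * (y - x)) = f x - f y - L * (x - y)); last ring.
exact: main.
Qed.

Lemma is_derive_quad (f : R -> R) (x l K dl : R) : 0 < dl ->
  (forall h, `|h| < dl -> `|f (x + h) - f x - l * h| <= K * h ^+ 2) -> is_derive x (1 : R) f l.
Proof.
move=> dl0 H.
have Hc : h^-1 *: ((f \o shift x) (h *: (1 : R)) - f x) @[h --> 0^'] --> l.
  apply/cvgrPdist_lt => e e0.
  have K0 : 0 < `|K| + 1 by have := normr_ge0 K; lra.
  exists (Num.min dl (e / (`|K| + 1))) => /=; first by rewrite lt_min dl0 divr_gt0.
  move=> h /=; rewrite sub0r normrN lt_min ltr_pdivlMr// => /andP[h1 h2] h0.
  rewrite /GRing.scale /= mulr1 [h + x]addrC -normrN opprB.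
  rewrite (_ : _ - l = h^-1 * (f (x + h) - f x - l * h)); last by field.
  rewrite normrM normfV ltr_pdivrMl ?normr_gt0//.
  apply: le_lt_trans (H h h1) _.
  rewrite -[h ^+ 2]real_normK ?num_real//.
  have := ler_norm K; have h3 : 0 < `|h| by rewrite normr_gt0.
  nra.
apply: DeriveDef; first by apply/cvg_ex; exists l.
exact: cvg_lim Hc.
Qed.

Lemma between_norm (x y z : R) : Num.min x y <= z <= Num.max x y ->
  `|z| <= Num.max `|x| `|y| /\ `|z - x| <= `|y - x|.
Proof.
have [xy|/ltW xy] := leP x y; move=> /andP[h1 h2].
  split; last by rewrite !ger0_norm ?subr_ge0// ?lerD2r// (le_trans h1).
  rewrite le_max; have [z0|/ltW z0] := leP 0 z.
    by rewrite (ger0_norm z0) (ger0_norm (le_trans z0 h2)) h2 orbT.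
  by rewrite (ler0_norm z0) (ler0_norm (le_trans h1 z0)) lerN2 h1.
split; last by rewrite !ler0_norm ?subr_le0// ?lerN2 ?lerD2r// (le_trans h1).
rewrite le_max; have [z0|/ltW z0] := leP 0 z.
  by rewrite (ger0_norm z0) (ger0_norm (le_trans z0 h2)) h2.
by rewrite (ler0_norm z0) (ler0_norm (le_trans h1 z0)) lerN2 h1 orbT.
Qed.

(** Derivatives are carried by the bump, so [j] is the order of the moment. On the axis the value is
    the two-sided limit; it exists in the application because the boundary values from left and
    right coincide. *)
Definition mom (w : R -> R -> R) (q : R) (j : nat) (x t : R) : R :=
  if x == 0 then lim (rint (fun y => w z y * bfam q j (y - t)) @[z --> 0^'])
  else rint (fun y => w x y * bfam q j (y - t)).

(** Bookkeeping of the ranges: [w] is controlled for 0 < |x| < d, test functions live in [-a, a],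
    the bump has radius at most [s] and centre |t| <= t1, and [M] bounds the moments for 0 < |x| <
    e. Five derivatives leave room for the higher moments that serve as derivatives of a first-order
    one. *)
Record mom_hyp (w : R -> R -> R) (d a s t1 e M q : R) : Prop := MomHyp {
  mh_pos : [/\ 0 <= a, 0 <= s <= 1, t1 + s < a, 0 < e <= d & 0 <= M];
  mh_q : q <= s ^+ 2;
  mh_mea : measurable_fun setT (fun z : R * R => w z.1 z.2);
  mh_bdd : forall x, 0 < `|x| < d -> exists2 N : R, 0 <= N & forall y, - a <= y <= a -> `|w x y| <= N;
  mh_cvg : forall phi, tfun a phi -> exists l : R, rint (fun y => w x y * phi y) @[x --> 0^'] --> l;
  mh_bound : forall j x t, (j <= 5)%N -> 0 < `|x| < e -> `|t| <= t1 ->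
     `|rint (fun y => w x y * bfam q j (y - t))| <= M }.

Lemma cvg0_le (F : R -> R) (l B e' : R) : 0 < e' -> F x @[x --> 0^'] --> l ->
  (forall x, 0 < `|x| < e' -> `|F x| <= B) -> `|l| <= B.
Proof.
move=> e0 cF H; have cN : `|F x| @[x --> 0^'] --> `|l| by exact: cvg_norm.
rewrite -(cvg_lim _ cN)//; apply: limr_le; first by apply/cvg_ex; eexists; exact: cN.
exists e' => //= x; rewrite /= sub0r normrN => xe x0.
by apply: H; rewrite normr_gt0 x0.
Qed.

Section MomW.
Variables (w : R -> R -> R) (d a s t1 e M q : R).
Hypothesis mh : mom_hyp w d a s t1 e M q.

Lemma mh_tfun j t : `|t| <= t1 -> tfun a (fun y => bfam q j (y - t)).
Proof.
have [[_ /andP[s0 _] ts _ _] qs _ _ _ _] := mh => ht.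
by apply: (tfun_bfam j s0 qs); lra.
Qed.

Lemma mom_cvg j t : `|t| <= t1 -> mom w q j x t @[x --> 0^'] --> mom w q j 0 t.
Proof.
move=> ht; have [l cl] := mh_cvg mh (mh_tfun j ht).
rewrite {2}/mom eqxx (cvg_lim _ cl)//.
apply: cvg_trans cl; apply: near_eq_cvg; exists 1 => //= x _ x0.
by rewrite /mom (negbTE x0).
Qed.

Lemma mom_nz j x t : x != 0 -> mom w q j x t = rint (fun y => w x y * bfam q j (y - t)).
Proof. by rewrite /mom => /negbTE ->. Qed.

Lemma mom_bound j x t : (j <= 5)%N -> `|x| < e -> `|t| <= t1 -> `|mom w q j x t| <= M.
Proof.
have [[_ _ _ /andP[e0 _] _] _ _ _ _ hb] := mh => j5 xe ht.
have [->|x0] := eqVneq x 0; last by rewrite mom_nz// hb// normr_gt0 x0.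
apply: (cvg0_le e0 (mom_cvg (j := j) ht)) => z /andP[z0 ze].
by rewrite mom_nz -?normr_gt0// hb// z0.
Qed.

Lemma mom_is_derive j x t : x != 0 -> `|x| < e -> `|t| <= t1 ->
  is_derive t (1 : R) (mom w q j x) (- mom w q j.+1 x t).
Proof.
have [[a0 /andP[s0 s1] ts /andP[e0 ed] _] qs mw bw _ hb] := mh => x0 xe ht.
have [N N0 hN] : exists2 N : R, 0 <= N & forall y, - a <= y <= a -> `|w x y| <= N.
  by apply: bw; rewrite normr_gt0 x0 (lt_le_trans xe).
have mwx := mea_slice x mw.
have [K K0 hK] := bfam_bounded R j.+2.
have q1 : q <= 1 by apply: le_trans qs _; rewrite exprn_ile1.
apply: (@is_derive_quad _ _ _ (N * (a + a) * K) (a - t1 - s)); first by lra.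
move=> h hh.
have t1' : `|t| + s <= a by lra.
have t2' : `|t + h| + s <= a by have := ler_normD t h; lra.
have f1 := @tfun_bfam R a s q t j s0 qs t1'.
have f2 := @tfun_bfam R a s q (t + h) j s0 qs t2'.
have f3 := @tfun_bfam R a s q t j.+1 s0 qs t1'.
have i1 := integ_tfun mwx a0 N0 hN f1.
have i2 := integ_tfun mwx a0 N0 hN f2.
have i3 := integ_tfun mwx a0 N0 hN f3.
pose Rm y := bfam q j (y - (t + h)) + (-1) * bfam q j (y - t) + h * bfam q j.+1 (y - t).
have tR : tfun a Rm by apply: tfunDZ f3; exact: tfunDZ.
rewrite !mom_nz//.
rewrite (_ : _ - _ - _ = rint (fun y => w x y * Rm y)); last first.
  rewrite mulNr opprK mulrC -rintZ// -RintegralB// -RintegralD//; last 2 first.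
  - exact: integB.
  - exact: integZ.
  by apply: eq_Rintegral => y _; rewrite /Rm; ring.
rewrite -mulrA; apply: (rint_tfun_le mwx a0 N0 hN tR) => y.
have := @taylor2 R (bfam q j) K (y - t) (- h) (@bfam_smooth R q j) (fun z => hK q z q1).
rewrite derive1_bfam sqrrN; congr (`|_| <= _).
by rewrite /Rm opprD addrA; ring.
Qed.

Lemma mom_lip_t j x t t' : (j <= 4)%N -> `|x| < e -> `|t| <= t1 -> `|t'| <= t1 ->
  `|mom w q j x t' - mom w q j x t| <= M * `|t' - t|.
Proof.
have [[_ _ _ /andP[e0 _] _] _ _ _ _ _] := mh => j4 xe ht ht'.
have H z : z != 0 -> `|z| < e -> `|mom w q j z t' - mom w q j z t| <= M * `|t' - t|.
  move=> z0 ze; rewrite -[_ - mom _ _ _ _ _]subr0 -(mul0r (t' - t)).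
  have bt v : Num.min t t' <= v <= Num.max t t' -> `|v| <= t1.
    by move=> /between_norm[h _]; apply: le_trans h _; rewrite ge_max ht.
  apply: (@mvt_le _ (fun v => - mom w q j.+1 z v)) => v hv.
    by apply: mom_is_derive => //; exact: bt.
  by rewrite subr0 normrN mom_bound//; exact: bt.
have [->|x0] := eqVneq x 0; last exact: H.
apply: (cvg0_le e0 (cvgB (mom_cvg (j := j) ht') (mom_cvg (j := j) ht))) => z /andP[z0 ze].
by apply: H; rewrite -?normr_gt0.
Qed.

Lemma mom_dt j x t t' : (j <= 3)%N -> `|x| < e -> `|t| <= t1 -> `|t'| <= t1 ->
  `|mom w q j x t' - mom w q j x t + mom w q j.+1 x t * (t' - t)| <= M * (t' - t) ^+ 2.
Proof.
have [[_ _ _ /andP[e0 _] _] _ _ _ _ _] := mh => j3 xe ht ht'.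
have H z : z != 0 -> `|z| < e ->
    `|mom w q j z t' - mom w q j z t + mom w q j.+1 z t * (t' - t)| <= M * (t' - t) ^+ 2.
  move=> z0 ze; rewrite -[X in _ - _ + X]opprK -mulNr -[_ ^+ 2]real_normK ?num_real// expr2 mulrA.
  have bt v : Num.min t t' <= v <= Num.max t t' -> `|v| <= t1 /\ `|v - t| <= `|t' - t|.
    by move=> /between_norm[h h2]; split => //; apply: le_trans h _; rewrite ge_max ht.
  apply: (@mvt_le _ (fun v => - mom w q j.+1 z v)) => v /bt[v1 v2]; first exact: mom_is_derive.
  rewrite opprK addrC distrC -normrN opprB.
  have M0 : 0 <= M by have [[]] := mh.
  have := @mom_lip_t j.+1 z v t j3 ze v1 ht; rewrite [`|t - v|]distrC => /le_trans; apply.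
  by rewrite ler_wpM2l.
have [->|x0] := eqVneq x 0; last exact: H.
apply: (cvg0_le e0 (cvgD (cvgB (mom_cvg (j := j) ht') (mom_cvg (j := j) ht)) (cvgM (mom_cvg (j := j.+1) ht) (@cvg_cst _ (t' - t) _ _ _)))) => z /andP[z0 ze].
by apply: H; rewrite -?normr_gt0.
Qed.
End MomW.

(* If (p, q') is divergence free off the line x = 0, the moments of p are
   differentiable in x, also across that line. *)
Section MomX.
Variables (p r : R -> R -> R) (d a s t1 e M q : R).
Hypotheses (hp : mom_hyp p d a s t1 e M q) (hr : mom_hyp r d a s t1 e M q).
Variable rho : R.
Hypothesis arho : a < rho.
Hypothesis Hdf : forall x y, 0 < `|x| < d -> - rho <= y <= rho -> dfree p r x y.

Lemma mom_cr j L K x1 x2 t : x1 <= x2 -> - e < x1 -> x2 < e -> `|t| <= t1 -> 0 <= K ->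
  (forall x, x1 <= x <= x2 -> x != 0 -> `|mom r q j.+1 x t - L| <= K) ->
  `|mom p q j x2 t - mom p q j x1 t - L * (x2 - x1)| <= K * (x2 - x1).
Proof.
have [[a0 s01 ts /andP[e0 ed] M0] qs mp bp cp hbp] := hp.
have [_ _ mr _ _ _] := hr => x12 ex1 ex2 ht K0 H.
pose g x := mom p q j x t - L * x.
rewrite (_ : _ - _ = g x2 - g x1); last by rewrite /g; ring.
apply: glue0 => //.
  rewrite /g; apply: cvgB; first exact: (mom_cvg hp).
  by apply: cvgM; [exact: cvg_cst|apply: cvg_within].
move=> y1 y2 h1 y12 h2 y0.
have nz x : y1 <= x <= y2 -> x != 0.
  move=> /andP[hx1 hx2]; case: y0 => y0; first by rewrite gt_eqF// (lt_le_trans y0).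
  by rewrite lt_eqF// (le_lt_trans hx2).
have ex x : y1 <= x <= y2 -> `|x| < e by move=> hx; rewrite ltr_norml; lra.
rewrite (_ : g y2 - g y1 = mom p q j y2 t - mom p q j y1 t - L * (y2 - y1)); last by rewrite /g; ring.
have y1z := nz y1 (introT andP (conj (lexx _) (ltW y12))).
have y2z := nz y2 (introT andP (conj (ltW y12) (lexx _))).
rewrite (mom_nz _ _ _ _ y1z) (mom_nz _ _ _ _ y2z).
apply: (weak_cr_bound (r := rho) (a := a)) => //; first by rewrite a0.
- move=> x y hx hy; apply: Hdf => //; rewrite normr_gt0 nz//=.
  exact: lt_le_trans (ex x hx) ed.
- exact: mr.
- exact: (mh_tfun hp).
- move=> x hx; rewrite derive1_bfam_shift -mom_nz ?nz//; apply: H; last exact: nz.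
  by lra.
Qed.

Lemma mom_lip_x j x x' t : (j <= 4)%N -> `|x| < e -> `|x'| < e -> `|t| <= t1 ->
  `|mom p q j x' t - mom p q j x t| <= M * `|x' - x|.
Proof.
move=> j4; have M0 : 0 <= M by have [[]] := hp.
wlog xx : x x' / x <= x'.
  move=> H hx hx' ht; have [h|/ltW h] := leP x x'; first exact: H.
  by rewrite distrC [`|x' - x|]distrC; exact: H.
rewrite !ltr_norml => /andP[h1 h2] /andP[h3 h4] ht.
rewrite [`|x' - x|]ger0_norm ?subr_ge0//.
rewrite -[_ - mom _ _ _ _ _]subr0 -(mul0r (x' - x)).
apply: mom_cr => // z hz z0; rewrite subr0; apply: (mom_bound hr) => //.
by rewrite ltr_norml; lra.
Qed.
End MomX.

Section MomXX.
Variables (p r p' : R -> R -> R) (d a s t1 e M q : R).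
Hypotheses (hp : mom_hyp p d a s t1 e M q) (hr : mom_hyp r d a s t1 e M q)
  (hp' : mom_hyp p' d a s t1 e M q).
Variable rho : R.
Hypothesis arho : a < rho.
Hypothesis Hdf : forall x y, 0 < `|x| < d -> - rho <= y <= rho -> dfree p r x y.
Hypothesis Hdf' : forall x y, 0 < `|x| < d -> - rho <= y <= rho -> dfree r p' x y.

(** Two divergence-free pairs are involved: (p, r) identifies the derivative in x as a moment of
    [r], and (r, p') makes that derivative Lipschitz, whence the quadratic remainder. *)
Lemma mom_dx j x x' t : (j <= 3)%N -> `|x| < e -> `|x'| < e -> `|t| <= t1 ->
  `|mom p q j x' t - mom p q j x t - mom r q j.+1 x t * (x' - x)| <= M * (x' - x) ^+ 2.
Proof.
move=> j3 hx hx' ht; have M0 : 0 <= M by have [[]] := hp.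
have bd z : Num.min x x' <= z <= Num.max x x' -> `|z| < e /\ `|z - x| <= `|x' - x|.
  by move=> /between_norm[h h2]; split => //; apply: le_lt_trans h _; rewrite gt_max hx.
have LK z : Num.min x x' <= z <= Num.max x x' -> `|mom r q j.+1 z t - mom r q j.+1 x t| <= M * `|x' - x|.
  move=> /bd[z1 z2].
  by apply: le_trans (mom_lip_x hr hp' arho Hdf' _ hx z1 ht) _ => //; rewrite ler_wpM2l.
have K0 : 0 <= M * `|x' - x| by rewrite mulr_ge0.
rewrite -[(x' - x) ^+ 2]real_normK ?num_real// expr2 mulrA.
move: hx hx'; rewrite !ltr_norml => /andP[h1 h2] /andP[h3 h4].
have [xx|xx] := leP x x'.
  rewrite [X in _ <= _ * X]ger0_norm ?subr_ge0//.
  by apply: (mom_cr hp hr arho Hdf) => // z hz _; apply: LK; rewrite min_l// max_r.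
rewrite [X in _ <= _ * X]distrC [X in _ <= _ * X]ger0_norm; last by rewrite subr_ge0 ltW.
rewrite -normrN (_ : - (mom p q j x' t - mom p q j x t - mom r q j.+1 x t * (x' - x)) = mom p q j x t - mom p q j x' t - mom r q j.+1 x t * (x - x')); last ring.
by apply: (mom_cr hp hr arho Hdf) => //; [exact: ltW|]; move=> z hz _; apply: LK; rewrite min_r ?max_l// ltW.
Qed.
End MomXX.
End Moments.

Section HarmonicMean.
Variable R : realType.
Local Notation mu := (@lebesgue_measure R).
Local Notation rint := (Rintegral mu setT).
Variables (rho rho' : R).
Hypothesis rr : 0 < rho < rho'.
Implicit Types F G : R -> R -> R.

Definition inbox (x t : R) := `|x| < rho' /\ `|t| < rho'.
(** One class, on a square larger than the domain of integration, closed under all operations below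
    and in which every slice is continuous and every iterated integral exists. *)
Definition lip2 F := exists2 K : R, 0 <= K & forall x t x' t', inbox x t -> inbox x' t' ->
  `|F x' t' - F x t| <= K * (`|x' - x| + `|t' - t|).

Lemma lip2_bounded F : lip2 F -> exists2 B : R, 0 <= B & forall x t, inbox x t -> `|F x t| <= B.
Proof.
case/andP: rr => r0 r1 [K K0 hK]; have r'0 := lt_trans r0 r1.
have i0 : inbox 0 0 by split; rewrite normr0.
exists (`|F 0 0| + K * (rho' + rho')); first by rewrite addr_ge0// mulr_ge0// addr_ge0 ?ltW.
move=> x t xt; have := hK 0 0 x t i0 xt; rewrite !subr0 => h; have [h1 h2] := xt.
rewrite -(subrK (F 0 0) (F x t)) addrC (le_trans (ler_normD _ _))// lerD2l (le_trans h)//.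
by rewrite ler_wpM2l// lerD// ltW.
Qed.

Lemma lip2_cst (c : R) : lip2 (fun _ _ => c).
Proof. by exists 0 => // x t x' t' _ _; rewrite subrr normr0 mul0r. Qed.
Lemma lip2_fst : lip2 (fun x _ => x).
Proof. by exists 1 => // x t x' t' _ _; rewrite mul1r lerDl. Qed.
Lemma lip2_snd : lip2 (fun _ t => t).
Proof. by exists 1 => // x t x' t' _ _; rewrite mul1r lerDr. Qed.
Lemma lip2D F G : lip2 F -> lip2 G -> lip2 (fun x t => F x t + G x t).
Proof.
move=> [K K0 hK] [L L0 hL]; exists (K + L) => [|x t x' t' h h']; first exact: addr_ge0.
rewrite mulrDl (_ : _ - _ = (F x' t' - F x t) + (G x' t' - G x t)); last ring.
by rewrite (le_trans (ler_normD _ _))// lerD ?hK ?hL.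
Qed.
Lemma lip2M F G : lip2 F -> lip2 G -> lip2 (fun x t => F x t * G x t).
Proof.
move=> lF lG; have [B B0 hB] := lip2_bounded lF; have [D D0 hD] := lip2_bounded lG.
move: lF lG => [K K0 hK] [L L0 hL].
exists (B * L + D * K) => [|x t x' t' h h']; first by rewrite addr_ge0// mulr_ge0.
rewrite (_ : _ - _ = F x' t' * (G x' t' - G x t) + G x t * (F x' t' - F x t)); last ring.
rewrite mulrDl -!mulrA (le_trans (ler_normD _ _))// !normrM lerD//.
  by apply: ler_pM => //; [exact: hB|exact: hL].
by apply: ler_pM => //; [exact: hD|exact: hK].
Qed.
Lemma lip2Z (c : R) F : lip2 F -> lip2 (fun x t => c * F x t).
Proof. by move=> lF; apply: lip2M => //; exact: lip2_cst. Qed.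
Lemma lip2B F G : lip2 F -> lip2 G -> lip2 (fun x t => F x t - G x t).
Proof.
move=> lF lG; have [K K0 hK] := lip2D lF (lip2Z (-1) lG).
by exists K => // x t x' t' h h'; have := hK x t x' t' h h'; rewrite !mulN1r.
Qed.
Lemma inbox_scale (c x t : R) : 0 <= c <= 1 -> inbox x t -> inbox (c * x) (c * t).
Proof.
move=> /andP[c0 c1] [h1 h2]; split; rewrite normrM (ger0_norm c0).
  by apply: le_lt_trans h1; rewrite ler_piMl.
by apply: le_lt_trans h2; rewrite ler_piMl.
Qed.
Lemma lip2_scale (c : R) F : 0 <= c <= 1 -> lip2 F -> lip2 (fun x t => F (c * x) (c * t)).
Proof.
move=> c01 [K K0 hK]; have /andP[c0 c1] := c01.
exists K => // x t x' t' h h'; rewrite (le_trans (hK _ _ _ _ _ _))//; try exact: inbox_scale.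
by rewrite -!mulrBr !normrM -mulrDr (ger0_norm c0) ler_wpM2l// ler_piMl// addr_ge0.
Qed.
Lemma lip2_comp (f f' : R -> R) F (K : R) : 0 <= K -> (forall x : R, is_derive x (1 : R) f (f' x)) ->
  (forall x t, inbox x t -> F x t <= 1) -> (forall x, x <= 1 -> `|f' x| <= K) -> lip2 F ->
  lip2 (fun x t => f (F x t)).
Proof.
move=> K0 df F1 hK [L L0 hL]; exists (K * L) => [|x t x' t' h h']; first exact: mulr_ge0.
rewrite -[_ - f _]subr0 -(mul0r (F x' t' - F x t)) -mulrA.
apply: le_trans (mvt_le (K := K) (fun z _ => df z) _) _ => [z /andP[_ hz]|].
  by rewrite subr0 hK// (le_trans hz)// ge_max !F1.
by rewrite ler_wpM2l// hL.
Qed.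

Lemma lip2_cont1 F t : lip2 F -> `|t| < rho' -> cont_on (- rho) rho (F ^~ t).
Proof.
case/andP: rr => r0 r1 [K K0 hK] ht x hx.
have hx' : `|x| < rho' by rewrite ltr_norml; lra.
have K1 : 0 < K + 1 by lra.
apply/cvgrPdist_lt => e e0; exists (Num.min (rho' - `|x|) (e / (K + 1))) => /=.
  by rewrite lt_min subr_gt0 hx' divr_gt0.
move=> y; rewrite /= lt_min ltr_pdivlMr// => /andP[h1 h2].
have hy : `|y| < rho'.
  by have := ler_normB x (x - y); rewrite (_ : x - (x - y) = y); [lra|ring].
have := hK y t x t (conj hy ht) (conj hx' ht); rewrite subrr normr0 addr0.
have := normr_ge0 (x - y); nra.
Qed.
Lemma lip2_swap F : lip2 F -> lip2 (fun x t => F t x).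
Proof.
move=> [K K0 hK]; exists K => // x t x' t' [h1 h2] [h3 h4].
by rewrite [X in K * X]addrC; exact: hK.
Qed.
Lemma lip2_cont2 F x : lip2 F -> `|x| < rho' -> cont_on (- rho) rho (F x).
Proof. by move=> lF hx; exact: (lip2_cont1 (lip2_swap lF) hx). Qed.

Definition J F := sint (fun x => sint (F x) (- rho) rho) (- rho) rho.

Lemma in_rho x : - rho <= x <= rho -> `|x| < rho'.
Proof. by case/andP: rr => r0 r1 hx; rewrite ltr_norml; lra. Qed.

Lemma mrho : - rho <= rho. Proof. by case/andP: rr => r0 _; lra. Qed.

Lemma J_cont F : lip2 F -> cont_on (- rho) rho (fun x => sint (F x) (- rho) rho).
Proof.
move=> lF; have [K K0 hK] := lF; case/andP: rr => r0 r1 x hx.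
have hx' := in_rho hx.
have K1 : 0 < K * (rho + rho) + 1 by rewrite ltr_wpDl// mulr_ge0//; lra.
apply/cvgrPdist_lt => e e0; exists (Num.min (rho' - `|x|) (e / (K * (rho + rho) + 1))) => /=.
  by rewrite lt_min subr_gt0 hx' divr_gt0.
move=> y; rewrite /= lt_min ltr_pdivlMr// => /andP[h1 h2].
have hy : `|y| < rho'.
  by have := ler_normB x (x - y); rewrite (_ : x - (x - y) = y); [lra|ring].
rewrite -sintB; [|exact: lip2_cont2|exact: lip2_cont2].
have cB : cont_on (- rho) rho (fun t => F x t - F y t) by apply: cont_onB; exact: lip2_cont2.
have := @sint_bound _ _ _ _ (K * `|x - y|) mrho cB.
have bd t : - rho <= t <= rho -> `|F x t - F y t| <= K * `|x - y|.
  move=> ht; have := hK y t x t (conj hy (in_rho ht)) (conj hx' (in_rho ht)).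
  by rewrite subrr normr0 addr0.
move=> /(_ bd); have := normr_ge0 (x - y); rewrite opprK; nra.
Qed.

Lemma JD F G : lip2 F -> lip2 G -> J (fun x t => F x t + G x t) = J F + J G.
Proof.
move=> lF lG; rewrite /J -sintD; [|exact: J_cont|exact: J_cont].
by apply: eq_sint => x /in_rho hx; rewrite sintD//; exact: lip2_cont2.
Qed.
Lemma JB F G : lip2 F -> lip2 G -> J (fun x t => F x t - G x t) = J F - J G.
Proof.
move=> lF lG; rewrite /J -sintB; [|exact: J_cont|exact: J_cont].
by apply: eq_sint => x /in_rho hx; rewrite sintB//; exact: lip2_cont2.
Qed.
Lemma eq_J F G : (forall x t, - rho <= x <= rho -> - rho <= t <= rho -> F x t = G x t) -> J F = J G.
Proof. by move=> FG; apply: eq_sint => x hx; apply: eq_sint => t; exact: FG. Qed.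
Lemma sintZ (c : R) (f : R -> R) a b : cont_on a b f -> sint (fun x => c * f x) a b = c * sint f a b.
Proof. by move=> cf; apply: RintegralZl => //; exact: cont_on_integrable. Qed.
Lemma JZ (c : R) F : lip2 F -> J (fun x t => c * F x t) = c * J F.
Proof.
move=> lF; rewrite /J -sintZ; last exact: J_cont.
by apply: eq_sint => x /in_rho hx; rewrite sintZ//; exact: lip2_cont2.
Qed.
Lemma J_bound F (B : R) : lip2 F -> (forall x t, - rho <= x <= rho -> - rho <= t <= rho -> `|F x t| <= B) ->
  `|J F| <= B * (rho + rho) ^+ 2.
Proof.
move=> lF hB; rewrite expr2 mulrA; have := @sint_bound _ _ _ _ (B * (rho + rho)) mrho (J_cont lF).
rewrite opprK; apply=> x hx.
have := @sint_bound _ _ _ _ B mrho (lip2_cont2 lF (in_rho hx)).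
by rewrite opprK; apply=> t ht; exact: hB.
Qed.
Lemma lip2_mea F : lip2 F -> measurable_fun setT (fun z : R * R => ind (- rho) rho z.1 * (ind (- rho) rho z.2 * F z.1 z.2)).
Proof.
move=> [K K0 hK]; pose O := [set z : R * R | inbox z.1 z.2].
have oO z : O z -> exists2 e : R, 0 < e & forall x y, `|x - z.1| < e -> `|y - z.2| < e -> O (x, y).
  case: z => z1 z2 [/= h1 h2]; exists (Num.min (rho' - `|z1|) (rho' - `|z2|)); first by rewrite lt_min !subr_gt0 h1.
  move=> x y; rewrite !lt_min => /andP[a1 _] /andP[_ a2]; split=> /=.
  - by have := ler_normD (x - z1) z1; rewrite subrK; lra.
  - by have := ler_normD (y - z2) z2; rewrite subrK; lra.
have m : measurable_fun setT (fun z : R * R => F z.1 z.2 * \1_O z).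
  apply: (box_continuous_measurable oO) => [z nO|z e Oz e0].
    by rewrite indicE memNset// mulr0.
  have [d d0 hd] := oO z Oz.
  have K1 : 0 < K + K + 1 by lra.
  exists (Num.min d (e / (K + K + 1))); first by rewrite lt_min d0 divr_gt0.
  move=> x y; rewrite !lt_min !ltr_pdivlMr// => /andP[a1 a2] /andP[b1 b2].
  rewrite !indicE (mem_set Oz) mem_set ?mulr1; last exact: hd.
  have := hK _ _ _ _ Oz (hd x y a1 b1); rewrite /=.
  have := normr_ge0 (x - z.1); have := normr_ge0 (y - z.2); nra.
have -> : (fun z : R * R => ind (- rho) rho z.1 * (ind (- rho) rho z.2 * F z.1 z.2)) =
   (fun z => ind (- rho) rho z.1 * (ind (- rho) rho z.2 * (F z.1 z.2 * \1_O z))).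
  apply/funext => -[x t] /=.
  have [/in_rho hx|hx] := pselect (- rho <= x <= rho); last by rewrite ind_out// !mul0r.
  have [/in_rho ht|ht] := pselect (- rho <= t <= rho); last by rewrite (ind_out ht) !(mul0r, mulr0).
  by rewrite indicE mem_set// mulr1.
apply: measurable_funM; first exact: mea_ind measurable_fst.
by apply: measurable_funM; first exact: mea_ind measurable_snd.
Qed.
Lemma J_swap F : lip2 F -> J F = J (fun x t => F t x).
Proof.
move=> lF; have [B B0 hB] := lip2_bounded lF.
have b1 (z : R * R) : `|ind (- rho) rho z.1 * (ind (- rho) rho z.2 * F z.1 z.2)| <= B.
  by apply: indM_bdd => // /in_rho hx; apply: indM_bdd => // /in_rho ht; exact: hB.
have b2 x t : ~ (- rho <= x <= rho /\ - rho <= t <= rho) -> ind (- rho) rho x * (ind (- rho) rho t * F x t) = 0.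
  move=> h; have [hx|hx] := pselect (- rho <= x <= rho); last by rewrite ind_out// mul0r.
  by rewrite (@ind_out _ _ _ t) ?mul0r ?mulr0// => ht; exact: h.
have [_ _ /= E] := integ_box mrho mrho (lip2_mea lF) b1 b2.
rewrite /J; transitivity (rint (fun x => rint (fun y => ind (- rho) rho x * (ind (- rho) rho y * F x y)))).
  rewrite sint_ind; apply: eq_Rintegral => x _.
  have [hx|hx] := pselect (- rho <= x <= rho); last by rewrite ind_out// mul0r rint_eq0// => y; rewrite mul0r.
  by rewrite sint_ind ind_in// mul1r; under [in RHS]eq_Rintegral do rewrite mul1r.
rewrite E sint_ind; apply: eq_Rintegral => x _.
have [hx|hx] := pselect (- rho <= x <= rho); last first.
  by rewrite ind_out// mul0r rint_eq0// => y; rewrite mul0r mulr0.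
rewrite sint_ind ind_in// mul1r; apply: eq_Rintegral => y _; by rewrite mul1r.
Qed.

Lemma ibp_quad (f f' phi : R -> R) (K : R) : (forall x x', `|x| < rho' -> `|x'| < rho' ->
    `|f x' - f x - f' x * (x' - x)| <= K * (x' - x) ^+ 2) -> cont_on (- rho) rho f' -> smooth phi ->
  phi rho = 0 -> phi (- rho) = 0 ->
  sint (fun x => f x * derive1 phi x) (- rho) rho = - sint (fun x => f' x * phi x) (- rho) rho.
Proof.
case/andP: rr => r0 r1 hf cf' sphi p1 p2.
have df x : - rho <= x <= rho -> is_derive x (1 : R) f (f' x).
  move=> hx; have hx' := in_rho hx.
  apply: (@is_derive_quad _ _ _ _ K (rho' - `|x|)); first by rewrite subr_gt0.
  move=> h hh; have := hf x (x + h) hx' _; rewrite (_ : x + h - x = h); last ring.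
  by apply; have := ler_normD x h; lra.
have dphi x : is_derive x (1 : R) phi (derive1 phi x).
  by rewrite derive1E; apply: derivableP; exact: smooth_derivable.
have dF x : - rho <= x <= rho -> is_derive x (1 : R) (fun x => f x * phi x) (f x * derive1 phi x + f' x * phi x).
  move=> /df dfx; have := is_deriveM dfx (dphi x); rewrite /GRing.scale /=.
  by rewrite [phi x * _]mulrC.
have cphi := smooth_continuous sphi.
have cf : cont_on (- rho) rho f.
  by move=> x /df dfx; apply: differentiable_continuous; apply/derivable1_diffP; case: dfx.
have c1 : cont_on (- rho) rho (fun x => f x * derive1 phi x).
  by move=> x hx; apply: cvgM; [exact: cf|exact: (smooth_continuous (smooth_derive1 sphi))].
have c2 : cont_on (- rho) rho (fun x => f' x * phi x).
  by move=> x hx; apply: cvgM; [exact: cf'|exact: cphi].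
have cF : cont_on (- rho) rho (fun x => f x * phi x).
  by move=> x hx; apply: cvgM; [exact: cf|exact: cphi].
apply/eqP; rewrite -addr_eq0 -sintD//; apply/eqP.
have mr : - rho < rho by lra.
rewrite /sint /Rintegral (@continuous_FTC2 R _ (fun x => f x * phi x) _ _ mr) /=.
- by rewrite p1 p2 !mulr0 subr0.
- by apply: continuous_in_subspaceT => x; rewrite inE /= in_itv/= => hx; apply: cvgD; [exact: c1|exact: c2].
- split=> [x|//|//].
  + by rewrite in_itv/= => /andP[h1 h2]; have [] := dF x ltac:(lra).
  + by apply: cvg_at_right_filter; apply: cF; lra.
  + by apply: cvg_at_left_filter; apply: cF; lra.
- by move=> x; rewrite in_itv/= => /andP[h1 h2]; rewrite derive1E; have [] := dF x ltac:(lra).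
Qed.

Variables (U P Q W : R -> R -> R) (K s : R).
Hypothesis K0 : 0 <= K.
Hypothesis hU : forall x t x' t', inbox x t -> inbox x' t' ->
  `|U x' t' - U x t - P x t * (x' - x) - Q x t * (t' - t)| <= K * ((x' - x) ^+ 2 + (t' - t) ^+ 2).
Hypothesis hP : forall x t x', inbox x t -> inbox x' t ->
  `|P x' t - P x t - W x t * (x' - x)| <= K * (x' - x) ^+ 2.
Hypothesis hQ : forall x t t', inbox x t -> inbox x t' ->
  `|Q x t' - Q x t + W x t * (t' - t)| <= K * (t' - t) ^+ 2.
Hypotheses (lU : lip2 U) (lP : lip2 P) (lQ : lip2 Q) (lW : lip2 W).
Hypothesis hs : 0 < s <= rho.
Hypothesis rho1 : rho <= 1.

(** Though written through its slices, this is radial: the derivative of the bump profile at s^2 -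
    x^2 - t^2. Its product with the vector (x, t) is -1/2 times the gradient of [Bx], which drives
    the integrations by parts. *)
Definition bx (x t : R) := bfam (s ^+ 2 - x ^+ 2) 0 t.
Definition Bx (x t : R) := bump (s ^+ 2 - x ^+ 2 - t ^+ 2).

Lemma bxC x t : bx x t = bx t x.
Proof. by rewrite /bx /bfam /= addrAC. Qed.
Lemma BxC x t : Bx x t = Bx t x.
Proof. by rewrite /Bx addrAC. Qed.
Lemma Bx_out x t : `|x| = rho -> Bx x t = 0.
Proof.
move=> hx; apply: bumpf_eq0; have /andP[s0 sr] := hs.
rewrite subr_le0 -[x ^+ 2]real_normK ?num_real// hx.
by have := sqr_ge0 t; nra.
Qed.

Lemma lip2_sqr : lip2 (fun x t => s ^+ 2 - x ^+ 2 - t ^+ 2).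
Proof.
by apply: lip2B; [apply: lip2B; [exact: lip2_cst|]|]; apply: lip2M; try exact: lip2_fst; exact: lip2_snd.
Qed.
Lemma sqr_le1 x t : s ^+ 2 - x ^+ 2 - t ^+ 2 <= 1.
Proof.
have /andP[s0 sr] := hs; have s1 := le_trans sr rho1; have s2 : s ^+ 2 <= 1 by nra.
by have := sqr_ge0 t; have := sqr_ge0 x; lra.
Qed.
Lemma lip2_bumpf p : lip2 (fun x t => bumpf p (s ^+ 2 - x ^+ 2 - t ^+ 2)).
Proof.
have [C hC] := bumpf_bounded (bump_deriv p) 1.
have C0 : 0 <= C by apply: le_trans (hC 0 ler01); exact: normr_ge0.
by apply: (lip2_comp C0 (fun x => bumpf_is_derive p x) _ hC lip2_sqr) => x t _; exact: sqr_le1.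
Qed.
Lemma lip2_bx : lip2 bx. Proof. exact: lip2_bumpf. Qed.
Lemma lip2_Bx : lip2 Bx. Proof. exact: lip2_bumpf. Qed.

Lemma smooth_Bx t : smooth (fun x => Bx x t).
Proof.
rewrite (_ : (fun x => _) = fun x => (1 : {poly R}).[x] * bumpf 1 ((s ^+ 2 - t ^+ 2) - x ^+ 2)).
  exact: smooth_bump_comp.
by apply/funext => x; rewrite hornerE mul1r /Bx addrAC.
Qed.
Lemma derive1_Bx t x : derive1 (fun x => Bx x t) x = - 2 * (x * bx x t).
Proof.
rewrite (_ : (fun x => _) = fun x => (1 : {poly R}).[x] * bumpf 1 ((s ^+ 2 - t ^+ 2) - x ^+ 2)).
  rewrite derive1_bump_comp derivC !hornerE /bx /bfam /= [s ^+ 2 - x ^+ 2 - _]addrAC; ring.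
by apply/funext => z; rewrite hornerE mul1r /Bx addrAC.
Qed.

(** Integration by parts in x: x times [bx] is -1/2 times the derivative of [Bx], and
    differentiating F(c x, c t) brings out the factor [c]. *)
Lemma J_half c (F F' : R -> R -> R) : 0 <= c <= 1 -> lip2 F -> lip2 F' ->
  (forall x t x', inbox x t -> inbox x' t -> `|F x' t - F x t - F' x t * (x' - x)| <= K * (x' - x) ^+ 2) ->
  J (fun x t => F (c * x) (c * t) * (x * bx x t)) = 2^-1 * (c * J (fun x t => F' (c * x) (c * t) * Bx x t)).
Proof.
move=> c01 lF lF' hF; have /andP[c0 c1] := c01.
have lF1 := lip2_scale c01 lF; have lF2 := lip2_scale c01 lF'.
have l1 : lip2 (fun x t => F (c * x) (c * t) * (x * bx x t)).
  by apply: lip2M => //; apply: lip2M; [exact: lip2_fst|exact: lip2_bx].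
have l2 : lip2 (fun x t => F' (c * x) (c * t) * Bx x t) by apply: lip2M => //; exact: lip2_Bx.
have l2' := lip2Z (2^-1 * c) l2.
rewrite mulrA -(JZ (2^-1 * c) l2) (J_swap l1) (J_swap l2') /J; apply: eq_sint => t /in_rho ht.
have c2 := lip2_cont1 l2 ht; have c3 := lip2_cont1 l1 ht; have c4 := lip2_cont1 lF2 ht.
have H x x' : `|x| < rho' -> `|x'| < rho' -> `|F (c * x') (c * t) - F (c * x) (c * t) - (c * F' (c * x) (c * t)) * (x' - x)| <= K * (x' - x) ^+ 2.
  move=> hx hx'; have := hF (c * x) (c * t) (c * x') (inbox_scale c01 (conj hx ht)) (inbox_scale c01 (conj hx' ht)).
  rewrite (_ : c * F' (c * x) (c * t) * (x' - x) = F' (c * x) (c * t) * (c * x' - c * x)); last ring.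
  move=> hh; apply: le_trans hh _; rewrite -mulrBr exprMn.
  by rewrite ler_wpM2l// ler_piMl ?sqr_ge0// exprn_ile1.
have c4' : cont_on (- rho) rho (fun x => c * F' (c * x) (c * t)).
  by move=> x hx; apply: cvgM; [exact: cvg_cst|exact: c4].
have r0 : 0 < rho by case/andP: rr.
have z1 : Bx rho t = 0 by rewrite Bx_out// gtr0_norm.
have z2 : Bx (- rho) t = 0 by rewrite Bx_out// normrN gtr0_norm.
have := ibp_quad H c4' (@smooth_Bx t) z1 z2.
rewrite (eq_sint (g := fun x => - 2 * (F (c * x) (c * t) * (x * bx x t)))); last first.
  by move=> x _; rewrite derive1_Bx; ring.
rewrite [in RHS](eq_sint (g := fun x => c * (F' (c * x) (c * t) * Bx x t))); last first.
  by move=> x _; rewrite mulrA.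
rewrite !sintZ// -mulrA; move: (sint _ _ _) (sint _ _ _) => A B AB.
have AB' : 2 * B = c * A by apply: oppr_inj; rewrite -AB mulNr.
by rewrite -AB' mulrA mulVf ?mul1r// pnatr_eq0.
Qed.

(** After integrating by parts in both variables, what stands against [Bx] is c/2 times the
    Laplacian of [U] at (c x, c t), that is W - W. *)
Lemma J_gradient c : 0 <= c <= 1 ->
  J (fun x t => (P (c * x) (c * t) * x + Q (c * x) (c * t) * t) * bx x t) = 0.
Proof.
move=> c01; have /andP[c0 c1] := c01.
have lP1 := lip2_scale c01 lP; have lQ1 := lip2_scale c01 lQ; have lW1 := lip2_scale c01 lW.
pose A x t := P (c * x) (c * t) * (x * bx x t).
pose B x t := Q (c * x) (c * t) * (t * bx x t).
have lA : lip2 A by apply: lip2M => //; apply: lip2M; [exact: lip2_fst|exact: lip2_bx].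
have lB : lip2 B by apply: lip2M => //; apply: lip2M; [exact: lip2_snd|exact: lip2_bx].
rewrite (_ : (fun x t => _) = fun x t => A x t + B x t); last first.
  by apply/funext => x; apply/funext => t; rewrite /A /B; ring.
rewrite JD// (J_half c01 lP lW hP) (J_swap lB).
pose Q' x t := Q t x.
rewrite (_ : (fun x t => B t x) = fun x t => Q' (c * x) (c * t) * (x * bx x t)); last first.
  by apply/funext => x; apply/funext => t; rewrite /B /Q' bxC.
rewrite (@J_half c Q' (fun x t => - W t x))//; last 3 first.
- exact: lip2_swap.
- rewrite (_ : (fun x t => _) = fun x t => (-1) * W t x); first exact/lip2Z/lip2_swap.
  by apply/funext => x; apply/funext => t; rewrite mulN1r.
- by move=> x t x' [h1 h2] [h3 h4]; rewrite mulNr opprK; exact: hQ.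
have lWB : lip2 (fun x t => W (c * x) (c * t) * Bx x t) by apply: lip2M => //; exact: lip2_Bx.
have -> : J (fun x t => - W (c * t) (c * x) * Bx x t) = - J (fun x t => W (c * x) (c * t) * Bx x t).
  rewrite (J_swap lWB) -mulN1r -JZ; last exact: lip2_swap.
  by apply: eq_J => x t _ _; rewrite BxC; ring.
by ring.
Qed.

(** [P] and [Q] are the partial derivatives of [U], and [W] is that of [P] in x and minus that of
    [Q] in t, so [U] is harmonic. The weighted mean over the square shrunk by c has zero derivative
    in c, in the form of a quadratic bound; n equal steps from c = 0 to c = 1 change it by at most
    D/n. *)
Theorem harmonic_mean : J (fun x t => U x t * bx x t) = U 0 0 * J bx.
Proof.
pose M c := J (fun x t => U (c * x) (c * t) * bx x t).
have [B B0 hB] := lip2_bounded lip2_bx.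
pose D := K * (2 * rho ^+ 2) * B * (rho + rho) ^+ 2.
have step c c' : 0 <= c <= 1 -> 0 <= c' <= 1 -> `|M c' - M c| <= D * (c' - c) ^+ 2.
  move=> c01 c01'.
  have lc := lip2M (lip2_scale c01 lU) lip2_bx; have lc' := lip2M (lip2_scale c01' lU) lip2_bx.
  pose G x t := (P (c * x) (c * t) * x + Q (c * x) (c * t) * t) * bx x t.
  have lG : lip2 G.
    apply: lip2M; last exact: lip2_bx.
    apply: lip2D; apply: lip2M; try exact: lip2_scale; [exact: lip2_fst|exact: lip2_snd].
  rewrite /M -JB// -[J _]subr0 -(mulr0 (c' - c)) -(J_gradient c01) -/G -JZ// -JB; [|exact: lip2B|exact: lip2Z].
  rewrite /D mulrAC; apply: J_bound => [|x t hx ht]; first by apply: lip2B; [exact: lip2B|exact: lip2Z].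
  have ixt : inbox x t by split; exact: in_rho.
  have := hU (inbox_scale c01 ixt) (inbox_scale c01' ixt); rewrite -!mulrBl.
  have x2 : x ^+ 2 <= rho ^+ 2 by nra.
  have t2 : t ^+ 2 <= rho ^+ 2 by nra.
  set E := (X in `|X| <= _) => hE.
  rewrite (_ : _ - _ = E * bx x t); last by rewrite /E /G; ring.
  rewrite normrM mulrAC; apply: ler_pM => //; last exact: hB.
  apply: le_trans hE _; rewrite -mulrA ler_wpM2l// !exprMn -mulrDr mulrC ler_wpM2r ?sqr_ge0//.
  by lra.
have D0 : 0 <= D.
  apply: mulr_ge0; last exact: sqr_ge0.
  by apply: mulr_ge0 => //; apply: mulr_ge0 => //; apply: mulr_ge0 => //; exact: sqr_ge0.
have tel n k : (k <= n.+1)%N -> `|M (k%:R / n.+1%:R) - M 0| <= D * (k%:R / n.+1%:R ^+ 2).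
  have n0 : 0 < n.+1%:R :> R by rewrite ltr0Sn.
  elim: k => [_|k IH kn]; first by rewrite !mul0r subrr normr0 mulr0.
  have b k' : (k' <= n.+1)%N -> 0 <= (k'%:R / n.+1%:R : R) <= 1.
    by move=> h; rewrite divr_ge0//= ler_pdivrMr// mul1r ler_nat.
  have := step _ _ (b _ (ltnW kn)) (b _ kn); have := IH (ltnW kn).
  have e1 : k.+1%:R / n.+1%:R - k%:R / n.+1%:R = n.+1%:R^-1 :> R.
    by rewrite -mulrBl -natrB// subSnn mul1r.
  have e2 : k.+1%:R / n.+1%:R ^+ 2 = k%:R / n.+1%:R ^+ 2 + n.+1%:R^-1 ^+ 2 :> R.
    by rewrite -[k.+1%:R]natr1 mulrDl mul1r exprVn.
  rewrite e1 e2 mulrDr.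
  set m0 := M 0; set mk := M (k%:R / _); set mk1 := M _.
  move=> h1 h2; rewrite (_ : mk1 - m0 = (mk - m0) + (mk1 - mk)); last by clear; ring.
  by apply: le_trans (ler_normD _ _) _; exact: lerD.
have lcst : lip2 (fun x t => U 0 0 * bx x t) by apply: lip2Z; exact: lip2_bx.
suff : M 1 = M 0.
  rewrite /M -JZ; last exact: lip2_bx.
  by under eq_fun do (under eq_fun do rewrite !mul1r); under [in RHS]eq_fun do (under eq_fun do rewrite !mul0r).
apply/eqP; rewrite -subr_eq0 -normr_le0; apply/ler_addgt0Pl => e e0; rewrite addr0.
have [n _ /(_ n (leqnn n))/= hn'] := @nbhs_infty_gtr R (D / e).
have hn : D / e < n.+1%:R by apply: lt_trans hn' _; rewrite ltr_nat.
have := tel n n.+1 (leqnn _); rewrite divff ?pnatr_eq0// => /le_trans; apply.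
rewrite expr2 invfM mulVKf ?pnatr_eq0//.
by rewrite ler_pdivrMr ?ltr0Sn// mulrC -ler_pdivrMr// ltW.
Qed.
End HarmonicMean.

(** * The edge of the wedge *)

Section EdgeOfWedge.
Variable R : realType.
Local Notation mu := (@lebesgue_measure R).
Local Notation rint := (Rintegral mu setT).

Lemma rint_gt0 (f : R -> R) : integ f -> (forall x, 0 <= f x) -> 0 < f 0 -> {for 0, continuous f} -> 0 < rint f.
Proof.
move=> hf f0 p0 cf.
have e0 : 0 < f 0 / 2 by rewrite divr_gt0.
have /cvgrPdist_lt/(_ _ e0)[d /= d0 hd] := cf.
have b0 : - (d / 2) <= d / 2 by lra.
apply: (@lt_le_trans _ _ (rint (fun x => f 0 / 2 * \1_(`[- (d / 2), d / 2]%classic : set R) x))).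
  rewrite RintegralZl//; last exact: integ_indic.
  by rewrite rint_indic// mulr_gt0//; lra.
apply: le_rint => //; first exact/integZ/integ_indic.
move=> x; rewrite indicE; have [hx|hx] := pselect (`[- (d / 2), d / 2]%classic x).
  rewrite mem_set// mulr1; have := hd x; rewrite /ball /= sub0r normrN => /(_ _)/=.
  have hx' : `|x| < d by move: hx; rewrite /= in_itv/= => /andP[h1 h2]; rewrite ltr_norml; lra.
  by move=> /(_ hx'); rewrite ltr_norml; lra.
by rewrite memNset// mulr0.
Qed.

Lemma cont_le (g : R -> R) (x B : R) : {for x, continuous g} ->
  (exists2 d : R, 0 < d & forall y, y != x -> `|y - x| < d -> `|g y| <= B) -> `|g x| <= B.
Proof.
move=> cg [d d0 hd]; apply/ler_addgt0Pl => e e0.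
have /cvgrPdist_lt/(_ _ e0)[d' /= d'0 hd'] := cg.
pose y := x + Num.min d d' / 2.
have m0 : 0 < Num.min d d' by rewrite lt_min d0.
have h1 : `|x - y| < Num.min d d'.
  rewrite /y opprD addrA subrr sub0r normrN ger0_norm ?divr_ge0 ?ltW//; lra.
have yx : y != x by rewrite /y -subr_eq0 addrC addKr gt_eqF// divr_gt0.
move: h1; rewrite lt_min => /andP[h1 h2].
have := hd y yx; rewrite distrC => /(_ h1) h3; have /= h4 := hd' y h2.
by have := ler_normD (g x - g y) (g y); rewrite subrK; lra.
Qed.

Lemma integ_bfam q j : q <= 1 -> integ (bfam q j : R -> R).
Proof.
move=> q1; have [K K0 hK] := bfam_bounded R j.
apply: (@integ_bdd_supp R _ K (-1) 1) => [||x].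
- by apply: smooth_mea; exact: bfam_smooth.
- by move=> x; exact: hK.
- rewrite /= in_itv/= => hx; apply: bfam_eq0; apply: le_trans q1 _.
  rewrite leNgt; apply/negP => h; apply: hx; nra.
Qed.

Definition cbf (q : R) : R := rint (bfam q 0).
Lemma cbf_gt0 q : 0 < q <= 1 -> 0 < cbf q.
Proof.
move=> /andP[q0 q1]; apply: rint_gt0 => [|x||]; [exact: integ_bfam|exact: bfam0_ge0| |].
  by apply: bfam0_gt0; rewrite expr0n.
exact: (smooth_continuous (@bfam_smooth R q 0)).
Qed.

Lemma rintN (f : R -> R) : integ f -> rint (fun x => - f x) = - rint f.
Proof. by move=> hf; rewrite -mulN1r -rintZ//; apply: eq_Rintegral => x _; rewrite mulN1r. Qed.

Lemma mom_integ w d a s t1 e M q (phi : R -> R) x : mom_hyp w d a s t1 e M q -> 0 < `|x| < d -> tfun a phi ->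
  integ (fun y => w x y * phi y).
Proof.
case=> -[a0 _ _ _ _] _ mw bw _ _ hx tphi; have [N N0 hN] := bw x hx.
exact: (integ_tfun (mea_slice x mw) a0 N0 hN tphi).
Qed.

Lemma mom_hypN (w : R -> R -> R) (d a s t1 e M q : R) : mom_hyp w d a s t1 e M q ->
  mom_hyp (fun x y => - w x y) d a s t1 e M q.
Proof.
move=> hw; have [pos hq mw bw cw bd] := hw; have [a0 _ _ /andP[e0 ed] _] := pos.
have E x phi : 0 < `|x| < d -> tfun a phi -> rint (fun y => - w x y * phi y) = - rint (fun y => w x y * phi y).
  move=> hx tphi; rewrite -(rintN (mom_integ hw hx tphi)).
  by apply: eq_Rintegral => y _; rewrite mulNr.
split => //.
- exact: measurable_funN.
- by move=> x /bw[N N0 hN]; exists N => // y hy; rewrite normrN hN.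
- move=> phi tphi; have [l cl] := cw phi tphi; exists (- l).
  have cN : - rint (fun y => w x y * phi y) @[x --> 0^'] --> - l by exact: cvgN.
  apply: cvg_trans cN; apply: near_eq_cvg; exists d; first exact: lt_le_trans ed.
  by move=> x /=; rewrite sub0r normrN => xd x0; rewrite E// normr_gt0 x0.
- move=> j x t j5 hx ht; rewrite E ?normrN; first exact: bd.
    by have /andP[-> /lt_le_trans] := hx; apply.
  exact: (mh_tfun hw).
Qed.

Lemma momN (w : R -> R -> R) (d a s t1 e M q : R) j x t : mom_hyp w d a s t1 e M q -> `|x| < e -> `|t| <= t1 ->
  mom (fun x y => - w x y) q j x t = - mom w q j x t.
Proof.
move=> hw xe ht; have [_ _ _ /andP[e0 ed] _] := mh_pos hw.
have H z : z != 0 -> `|z| < e -> mom (fun x y => - w x y) q j z t = - mom w q j z t.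
  move=> z0 ze; rewrite !mom_nz// -rintN; last first.
    by apply: (mom_integ hw _ (mh_tfun hw j ht)); rewrite normr_gt0 z0 (lt_le_trans ze).
  by apply: eq_Rintegral => y _; rewrite mulNr.
have [->|] := eqVneq x 0; last by move=> /H; apply.
have c1 := mom_cvg (mom_hypN hw) (j := j) ht.
have c2 : - mom w q j x t @[x --> 0^'] --> - mom w q j 0 t by apply: cvgN; exact: (mom_cvg hw).
apply: (cvg_unique _ c1) => //; apply: cvg_trans c2; apply: near_eq_cvg.
by exists e => // z /=; rewrite sub0r normrN => ze z0; rewrite H.
Qed.

Lemma sqr_out (h q s : R) : 0 < s -> q <= s ^+ 2 -> ~ (- s <= h <= s) -> q <= h ^+ 2.
Proof.
by move=> s0 qs hh; apply: le_trans qs _; rewrite leNgt; apply/negP => h1; apply: hh; nra.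
Qed.

Lemma J_bx_gt0 (rh : R) : 0 < rh <= 1 -> 0 < J rh (bx rh).
Proof.
move=> /andP[rh0 rh1].
have rr : 0 < rh < rh + rh by apply/andP; split => //; lra.
have hs : 0 < rh <= rh by rewrite rh0 lexx.
have lB := lip2_bx rr hs rh1.
have r2 : - rh <= rh by lra.
have z0 : - rh <= 0 <= rh by lra.
have cG := J_cont rr lB.
have pos (f : R -> R) : cont_on (- rh) rh f -> (forall x, 0 <= f x) -> 0 < f 0 -> 0 < sint f (- rh) rh.
  move=> cf f0 f00; have e0 : 0 < f 0 / 2 by rewrite divr_gt0.
  have /cvgrPdist_lt/(_ _ e0)[dl /= dl0 hd] := cf 0 z0.
  pose b := Num.min (dl / 2) rh.
  have b0 : 0 < b by rewrite lt_min divr_gt0.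
  have bd : b <= dl / 2 by rewrite ge_min lexx.
  have bb : b <= rh by rewrite ge_min lexx orbT.
  have cf1 : cont_on (- b) b f by apply: cont_onS cf; lra.
  have cf2 : cont_on (- rh) b f by apply: cont_onS cf; lra.
  rewrite (sint_split (m := b) _ cf); last by lra.
  rewrite (sint_split (m := - b) _ cf2); last by lra.
  have g0 x y : 0 <= sint f x y by apply: Rintegral_ge0 => z _; exact: f0.
  apply: (@lt_le_trans _ _ (sint f (- b) b)); last by rewrite -addrA addrCA lerDl addr_ge0.
  have bb2 : - b <= b by lra.
  apply: (@lt_le_trans _ _ (sint (fun=> f 0 / 2) (- b) b)).
    by rewrite sint_cst// mulr_gt0//; lra.
  have cst := @cont_on_cst R (- b) b (f 0 / 2).
  apply: le_Rintegral; [exact: measurable_itv|exact: cont_on_integrable|exact: cont_on_integrable|] => z; rewrite /= in_itv/= => hz.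
  have hz' : `|z| < dl by rewrite ltr_norml; lra.
  by have := hd z; rewrite /= sub0r normrN => /(_ hz'); rewrite ltr_norml; lra.
apply: (pos _ cG) => [x|]; first by apply: Rintegral_ge0 => t _; exact: bfam0_ge0.
apply: pos => [|x|]; [|exact: bfam0_ge0|].
- by apply: (lip2_cont2 rr lB); rewrite normr0 addr_gt0.
- by apply: bfam0_gt0; rewrite !expr0n subr0 exprn_gt0.
Qed.

(** Two Fubini exchanges around the reflection t = y - t0 - h, which trades the integration over the
    centres for one over the argument of [f]. *)
Lemma conv_swap (w f g : R -> R) (a s r t0 N K L : R) : 0 <= a -> 0 <= s -> 0 <= r -> 
  measurable_fun setT w -> measurable_fun setT f -> measurable_fun setT g ->
  (forall y, `|w y| <= N) -> (forall y, `|f y| <= K) -> (forall y, `|g y| <= L) ->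
  (forall y, ~ (- a <= y <= a) -> w y = 0) -> (forall y, ~ (- s <= y <= s) -> f y = 0) ->
  (forall y, ~ (- r <= y <= r) -> g y = 0) ->
  integ (fun h => rint (fun y => w y * f h * g (y - t0 - h))) /\
  rint (fun t => rint (fun y => w y * f (y - (t0 + t)) * g t)) =
  rint (fun h => rint (fun y => w y * f h * g (y - t0 - h))).
Proof.
move=> a0 s0 r0 mw mf mg wN fK gL w0 f0 g0.
have a2 : - a <= a by lra.
have s2 : - s <= s by lra.
have r2 : - r <= r by lra.
have N3 (x y z : R) : `|x| <= N -> `|y| <= K -> `|z| <= L -> `|x * y * z| <= N * K * L.
  by move=> hx hy hz; rewrite !normrM; apply: ler_pM => //; apply: ler_pM.
pose F (z : R * R) := w z.2 * f (z.2 - (t0 + z.1)) * g z.1.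
have mF : measurable_fun setT F.
  apply: measurable_funM; first apply: measurable_funM.
  - exact: (measurableT_comp mw measurable_snd).
  - apply: (measurableT_comp mf); apply: measurable_funB; first exact: measurable_snd.
    by apply: measurable_funD => //; exact: measurable_fst.
  - exact: (measurableT_comp mg measurable_fst).
have FM z : `|F z| <= N * K * L by exact: N3.
have Fz u y : ~ (- r <= u <= r /\ - a <= y <= a) -> F (u, y) = 0.
  move=> h; rewrite /F [fst _]/= [snd _]/=.
  have [hu|hu] := pselect (- r <= u <= r); last by rewrite (g0 _ hu) mulr0.
  have hy : ~ (- a <= y <= a) by move=> hy; exact: h.
  by rewrite (w0 _ hy) !mul0r.
have [_ _ fub] := integ_box r2 a2 mF FM Fz.
pose G (z : R * R) := w z.1 * f z.2 * g (z.1 - t0 - z.2).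
have mG : measurable_fun setT G.
  apply: measurable_funM; first apply: measurable_funM.
  - exact: (measurableT_comp mw measurable_fst).
  - exact: (measurableT_comp mf measurable_snd).
  - apply: (measurableT_comp mg); apply: measurable_funB; last exact: measurable_snd.
    by apply: measurable_funB => //; exact: measurable_fst.
have GM z : `|G z| <= N * K * L by exact: N3.
have Gz y h : ~ (- a <= y <= a /\ - s <= h <= s) -> G (y, h) = 0.
  move=> hh; rewrite /G [fst _]/= [snd _]/=.
  have [hu|hu] := pselect (- a <= y <= a); last by rewrite (w0 _ hu) !mul0r.
  have hy : ~ (- s <= h <= s) by move=> hy; exact: hh.
  by rewrite (f0 _ hy) mulr0 mul0r.
have [_ iG fub2] := integ_box a2 s2 mG GM Gz.
split; first exact: iG.
rewrite [LHS]fub -[RHS]fub2; apply: eq_Rintegral => y _.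
have iy : integ (fun h => G (y, h)).
  apply: (@integ_bdd_supp R _ (N * K * L) (- s) s); [exact: (mea_slice (q := fun x y => G (x, y)))| |].
  - by move=> h; exact: GM.
  - by move=> h hh; apply: Gz => -[_ h']; apply: hh; rewrite /= in_itv.
rewrite -(rint_refl (y - t0) iy); apply: eq_Rintegral => t _; rewrite /F /G /=.
by have -> : y - (t0 + t) = y - t0 - t; [ring|congr (_ * g _); ring].
Qed.

Section Mom1.
Variables (p r : R -> R -> R) (d a s t1 e M q rho : R).
Hypotheses (hp : mom_hyp p d a s t1 e M q) (hr : mom_hyp r d a s t1 e M q).
Hypothesis (q0 : 0 < q) (s0 : 0 < s) (t10 : 0 < t1).
Hypothesis arho : a < rho.
Hypothesis bound : forall q' x t, q' <= s ^+ 2 -> 0 < `|x| < e -> `|t| <= t1 ->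
  `|rint (fun y => p x y * bfam q' 1 (y - t))| <= M.
Hypothesis st1 : s + s <= t1.
Hypothesis D1 : forall x y, 0 < `|x| < d -> - rho <= y <= rho -> dfree p r x y.
Hypothesis D2 : forall x y, 0 < `|x| < d -> - rho <= y <= rho -> dfree r (fun x y => - p x y) x y.

(* The convolution with [bfam q 0] is moved onto the radial weight. *)
Lemma mom1_slice q' x t0 rh rh' : 0 < `|x| < e -> 0 < rh < rh' -> rh <= s -> `|t0| + rh' <= t1 -> `|t0| + s <= t1 -> q' <= rh ^+ 2 ->
  `|sint (fun t => mom p q 1 x (t0 + t) * bfam q' 0 t) (- rh) rh| <= M * cbf q.
Proof.
move=> hx rr rs ht0 ht0' hq'; have /andP[rh0 rh1] := rr; have [[a0 /andP[_ s1] ta /andP[e0 ed] M0] hq mp bp _ _] := hp.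
have /andP[x0 xe] := hx; have x0' : x != 0 by rewrite -normr_gt0.
have hxd : 0 < `|x| < d by rewrite x0 (lt_le_trans xe).
have q1 : q <= 1 by apply: le_trans hq _; rewrite exprn_ile1//; exact: ltW.
have q's : q' <= s ^+ 2 by apply: le_trans hq' _; nra.
have q'1 : q' <= 1 by apply: le_trans q's _; rewrite exprn_ile1//; exact: ltW.
have mM := mom_bound hp.
have rh2 : - rh <= rh by lra.
have a2 : - a <= a by lra.
have s2 : - s <= s by lra.
have th h : - s <= h <= s -> `|t0 + h| <= t1.
  by rewrite -ler_norml => hh; have := ler_normD t0 h; lra.
have tb t : `|t| < rh' -> `|t0 + t| <= t1 by have := ler_normD t0 t; lra.
have quad t t' : `|t| < rh' -> `|t'| < rh' ->
    `|mom p q 0 x (t0 + t') - mom p q 0 x (t0 + t) - - mom p q 1 x (t0 + t) * (t' - t)| <= M * (t' - t) ^+ 2.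
  move=> h h'; have := @mom_dt R p d a s t1 e M q hp 0 x (t0 + t) (t0 + t') isT xe (tb t h) (tb t' h').
  by rewrite mulNr opprK (_ : t0 + t' - (t0 + t) = t' - t); last ring.
have c1 : cont_on (- rh) rh (fun t => - mom p q 1 x (t0 + t)).
  move=> t ht; apply/cvgrPdist_lt => eta eta0.
  have ht' := in_rho rr ht.
  exists (Num.min (rh' - `|t|) (eta / (M + 1))); first by rewrite /= lt_min subr_gt0 ht' divr_gt0//; lra.
  move=> y; rewrite /= lt_min ltr_pdivlMr; last lra.
  move=> /andP[h1 h2].
  have hy : `|y| < rh' by have := ler_normB t (t - y); rewrite (_ : t - (t - y) = y); [lra|ring].
  have := @mom_lip_t R p d a s t1 e M q hp 1 x (t0 + t) (t0 + y) isT xe (tb t ht') (tb y hy).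
  rewrite (_ : t0 + y - (t0 + t) = - (t - y)); last ring.
  rewrite normrN opprK addrC; have := normr_ge0 (t - y); nra.
have sb := @bfam_smooth R q' 0.
have z1 : bfam q' 0 rh = 0 by exact: bfam_eq0.
have z2 : bfam q' 0 (- rh) = 0 by apply: bfam_eq0; rewrite sqrrN.
have ibp := ibp_quad rr quad c1 sb z1 z2.
(* The derivative in t leaves the moment for the weight [bfam q'], whose first-order pairings with
   [p] are bounded by [M] whatever [q'] is. *)
have -> : sint (fun t => mom p q 1 x (t0 + t) * bfam q' 0 t) (- rh) rh =
    sint (fun t => mom p q 0 x (t0 + t) * bfam q' 1 t) (- rh) rh.
  have c2 : cont_on (- rh) rh (fun t => mom p q 1 x (t0 + t) * bfam q' 0 t).
    move=> t ht; apply: cvgM; last exact: (smooth_continuous sb).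
    by rewrite -[mom p q 1 x (t0 + t)]opprK; under eq_fun do rewrite -[mom _ _ _ _ _]opprK; apply: cvgN; exact: c1.
  rewrite [RHS]ibp; apply: oppr_inj; rewrite opprK -mulN1r -sintZ//.
  by apply: eq_sint => t _; rewrite mulN1r mulNr.
pose wi y := ind (- a) a y * p x y.
have [N N0 hN] := bp x hxd.
have mpx := mea_slice x mp.
have mwi : measurable_fun setT wi by apply: measurable_funM => //; apply: mea_ind.
have wiN y : `|wi y| <= N by apply: indM_bdd => // /hN.
have wiE phi : tfun a phi -> rint (fun y => p x y * phi y) = rint (fun y => wi y * phi y).
  move=> [_ zphi]; apply: eq_Rintegral => y _; rewrite /wi.
  have [hy|hy] := pselect (- a <= y <= a); first by rewrite ind_in// mul1r.
  have -> : phi y = 0 by apply: zphi => h; apply: hy; move: h; rewrite /= in_itv.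
  by rewrite !mulr0.
have wiI phi : tfun a phi -> integ (fun y => wi y * phi y).
  move=> tphi; apply: eq_integ (mom_integ hp hxd tphi) => y; rewrite /wi.
  have [hy|hy] := pselect (- a <= y <= a); first by rewrite ind_in// mul1r.
  have -> : phi y = 0 by apply: (proj2 tphi) => h; apply: hy; move: h; rewrite /= in_itv.
  by rewrite !mulr0.
have momE t : `|t| < rh' -> mom p q 0 x (t0 + t) = rint (fun y => wi y * bfam q 0 (y - (t0 + t))).
  by move=> ht; rewrite mom_nz//; apply: wiE; exact: (mh_tfun hp 0 (tb t ht)).
have momI t : `|t| < rh' -> integ (fun y => wi y * bfam q 0 (y - (t0 + t))).
  by move=> ht; apply: wiI; exact: (mh_tfun hp 0 (tb t ht)).
have [K0 K00 hK0] := bfam_bounded R 0; have [K1 K10 hK1] := bfam_bounded R 1.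
have mb j q2 : measurable_fun setT (bfam q2 j : R -> R) by apply: smooth_mea; exact: bfam_smooth.
have wi0 y : ~ (- a <= y <= a) -> wi y = 0 by move=> hy; rewrite /wi ind_out// mul0r.
have g0 t : ~ (- rh <= t <= rh) -> bfam q' 1 t = 0 :> R.
  by move=> ht; apply: bfam_eq0; exact: (sqr_out rh0 hq' ht).
have f0 h : ~ (- s <= h <= s) -> bfam q 0 h = 0 :> R.
  by move=> hh; apply: bfam_eq0; exact: (sqr_out s0 hq hh).
have [iG fub] := conv_swap t0 a0 (ltW s0) (ltW rh0) mwi (mb 0%N q) (mb 1%N q') wiN
  (fun y => hK0 q y q1) (fun y => hK1 q' y q'1) wi0 f0 g0.
have -> : sint (fun t => mom p q 0 x (t0 + t) * bfam q' 1 t) (- rh) rh =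
    rint (fun t => rint (fun y => wi y * bfam q 0 (y - (t0 + t)) * bfam q' 1 t)).
  rewrite sint_ind; apply: eq_Rintegral => t _.
  have [ht|ht] := pselect (- rh <= t <= rh); last first.
    by rewrite (ind_out ht) mul0r; apply/esym/rint_eq0 => y; rewrite (g0 _ ht) mulr0.
  have ht' := in_rho rr ht.
  rewrite (ind_in ht) mul1r (momE t ht') mulrC -(rintZ _ (momI t ht')).
  by apply: eq_Rintegral => y _; rewrite mulrC.
rewrite fub /cbf -rintZ; last exact: integ_bfam.
apply: le_norm_rint; [exact: (integ_mea iG)|by apply: integZ; exact: integ_bfam|].
move=> h; have [hh|hh] := pselect (- s <= h <= s); last first.
  have -> : rint (fun y => wi y * bfam q 0 h * bfam q' 1 (y - t0 - h)) = 0.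
    by apply: rint_eq0 => y; rewrite (f0 _ hh) mulr0 mul0r.
  by rewrite (f0 _ hh) mulr0 normr0.
have {}th := th h hh.
have tfh : tfun a (fun y => bfam q' 1 (y - (t0 + h))).
  by apply: (tfun_bfam (s := s)); [exact: ltW|exact: q's|]; apply: le_trans (ltW ta); exact: lerD.
have -> : rint (fun y => wi y * bfam q 0 h * bfam q' 1 (y - t0 - h)) = bfam q 0 h * rint (fun y => p x y * bfam q' 1 (y - (t0 + h))).
  rewrite (wiE _ tfh); apply: etrans _ (rintZ (bfam q 0 h) (wiI _ tfh)).
  apply: eq_Rintegral => y _.
  by rewrite (_ : y - (t0 + h) = y - t0 - h); [rewrite mulrCA mulrA|ring].
rewrite normrM (ger0_norm (bfam0_ge0 q h)) mulrC; apply: ler_wpM2r; first exact: bfam0_ge0.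
exact: (bound q's hx th).
Qed.

Lemma dfreeN (f g : R -> R -> R) x y : dfree f g x y -> dfree (fun x y => - f x y) (fun x y => - g x y) x y.
Proof.
move=> [p1 [p2 [q1 H]]]; exists (- p1), (- p2), (- q1) => eta eta0.
have [dl dl0 hd] := H eta eta0; exists dl => // h k hh hk; have [h1 h2] := hd h k hh hk.
split; rewrite -normrN.
- by move: h1; congr (`|_| <= _); ring.
- by move: h2; congr (`|_| <= _); ring.
Qed.

Lemma mom_lip2 (p' r' : R -> R -> R) j x t x' t' : mom_hyp p' d a s t1 e M q -> mom_hyp r' d a s t1 e M q ->
  (forall x y, 0 < `|x| < d -> - rho <= y <= rho -> dfree p' r' x y) ->
  (j <= 4)%N -> `|x| < e -> `|x'| < e -> `|t| <= t1 -> `|t'| <= t1 ->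
  `|mom p' q j x' t' - mom p' q j x t| <= M * (`|x' - x| + `|t' - t|).
Proof.
move=> hp' hr' D j4 hx hx' ht ht'.
rewrite (_ : _ - _ = (mom p' q j x' t' - mom p' q j x t') + (mom p' q j x t' - mom p' q j x t)); last ring.
rewrite (le_trans (ler_normD _ _))// mulrDr lerD//.
- exact: (mom_lip_x hp' hr' arho D j4 hx hx' ht').
- exact: (mom_lip_t hp' j4 hx ht ht').
Qed.

(** A first-order moment is harmonic in (x, t), so its value is a radial mean, and the slices of
    that mean are bounded by [mom1_slice]. The essential feature is the right-hand side:
    proportional to the mass [cbf q] of the bump, with a factor free of [q]. *)
Lemma mom1_bound x0 t0 rh : 0 < rh <= s -> `|x0| + (rh + rh) <= e -> `|t0| + (rh + rh) <= t1 -> `|t0| + s <= t1 ->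
  `|mom p q 1 x0 t0| * J rh (bx rh) <= M * cbf q * (rh + rh).
Proof.
move=> /andP[rh0 rs] hx0 ht0 ht0'; have [[a0 /andP[_ s1] ta /andP[e0 ed] M0] _ _ _ _ _] := hp.
have hN := mom_hypN hp.
have D3 x y hx hy := dfreeN (D1 (x := x) (y := y) hx hy).
have rr : 0 < rh < rh + rh by apply/andP; split => //; lra.
have rh1 : rh <= 1 by lra.
have xb x : `|x| < rh + rh -> `|x0 + x| < e by have := ler_normD x0 x; lra.
have tb t : `|t| < rh + rh -> `|t0 + t| <= t1 by have := ler_normD t0 t; lra.
have sx x x' : x0 + x' - (x0 + x) = x' - x by ring.
have st t t' : t0 + t' - (t0 + t) = t' - t by ring.
(* With (p, r) and (r, -p) divergence free, [P] and [Q] are the derivatives of [U] in x and t; [W]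
   is the derivative of [P] in x and minus that of [Q] in t. *)
pose U x t := mom p q 1 (x0 + x) (t0 + t).
pose P x t := mom r q 2 (x0 + x) (t0 + t).
pose Q x t := - mom p q 2 (x0 + x) (t0 + t).
pose W x t := mom (fun x y => - p x y) q 3 (x0 + x) (t0 + t).
have lipm (p' r' : R -> R -> R) j : mom_hyp p' d a s t1 e M q -> mom_hyp r' d a s t1 e M q ->
    (forall x y, 0 < `|x| < d -> - rho <= y <= rho -> dfree p' r' x y) -> (j <= 4)%N ->
    lip2 (rh + rh) (fun x t => mom p' q j (x0 + x) (t0 + t)).
  move=> hp' hr' D j4; exists M => // x t x' t' [h1 h2] [h3 h4].
  have := mom_lip2 hp' hr' D j4 (xb _ h1) (xb _ h3) (tb _ h2) (tb _ h4).
  by rewrite sx st.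
have lU : lip2 (rh + rh) U by exact: lipm hp hr D1 _.
have lP : lip2 (rh + rh) P by exact: lipm hr hN D2 _.
have lQ : lip2 (rh + rh) Q.
  have := lip2Z rr (-1) (lipm _ _ 2 hp hr D1 isT); congr lip2.
  by apply/funext => x; apply/funext => t; rewrite mulN1r.
have lW : lip2 (rh + rh) W by exact: lipm hN (mom_hypN hr) D3 _.
have M20 : 0 <= M + M by exact: addr_ge0.
have hU x t x' t' : inbox (rh + rh) x t -> inbox (rh + rh) x' t' ->
  `|U x' t' - U x t - P x t * (x' - x) - Q x t * (t' - t)| <= (M + M) * ((x' - x) ^+ 2 + (t' - t) ^+ 2).
  move=> [h1 h2] [h3 h4].
  have A := mom_dx hp hr hN arho D1 D2 (j := 1) isT (xb _ h1) (xb _ h3) (tb _ h4).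
  have B := mom_dt hp (j := 1) isT (xb _ h1) (tb _ h2) (tb _ h4).
  have Cc := mom_lip_t hr (j := 2) isT (xb _ h1) (tb _ h2) (tb _ h4).
  rewrite sx in A; rewrite st in B; rewrite st in Cc.
  rewrite /U /P /Q.
  set u1 := mom p q 1 (x0 + x') (t0 + t') in A *; set u2 := mom p q 1 (x0 + x) (t0 + t') in A B.
  set u3 := mom p q 1 (x0 + x) (t0 + t) in B *; set r1 := mom r q 2 (x0 + x) (t0 + t') in A Cc.
  set r2 := mom r q 2 (x0 + x) (t0 + t) in Cc *; set p2 := mom p q 2 _ _ in B *.
  rewrite (_ : _ - _ = (u1 - u2 - r1 * (x' - x)) + (u2 - u3 + p2 * (t' - t)) + (r1 - r2) * (x' - x)); last ring.
  have D : `|(r1 - r2) * (x' - x)| <= M * (`|t' - t| * `|x' - x|) by rewrite normrM mulrA ler_wpM2r.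
  have E : 2 * (`|t' - t| * `|x' - x|) <= (x' - x) ^+ 2 + (t' - t) ^+ 2.
    rewrite -[(x' - x) ^+ 2]real_normK ?num_real// -[(t' - t) ^+ 2]real_normK ?num_real//.
    by have := sqr_ge0 (`|x' - x| - `|t' - t|); rewrite sqrrB; lra.
  rewrite (le_trans (ler_normD _ _))// (le_trans (lerD (ler_normD _ _) (lexx _)))//.
  have E2 : 0 <= `|t' - t| * `|x' - x| by exact: mulr_ge0.
  have := ler_wpM2l M0 E; have := mulr_ge0 M0 E2.
  clear -A B D; move: (x' - x) (t' - t) A B D => X T A B D; lra.
have hP x t x' : inbox (rh + rh) x t -> inbox (rh + rh) x' t ->
  `|P x' t - P x t - W x t * (x' - x)| <= (M + M) * (x' - x) ^+ 2.
  move=> [h1 h2] [h3 _].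
  have := mom_dx hr hN (mom_hypN hr) arho D2 D3 (j := 2) isT (xb _ h1) (xb _ h3) (tb _ h2).
  rewrite sx => h; apply: le_trans h _; rewrite mulrDl lerDl mulr_ge0 ?sqr_ge0//.
have hQ x t t' : inbox (rh + rh) x t -> inbox (rh + rh) x t' ->
  `|Q x t' - Q x t + W x t * (t' - t)| <= (M + M) * (t' - t) ^+ 2.
  move=> [h1 h2] [_ h3].
  have := mom_dt hp (j := 2) isT (xb _ h1) (tb _ h2) (tb _ h3).
  rewrite st /Q /W (momN 3 hp (xb _ h1) (tb _ h2)) -normrN => h.
  apply: (@le_trans _ _ (M * (t' - t) ^+ 2)); last by rewrite mulrDl lerDl mulr_ge0 ?sqr_ge0.
  move: h; clear; move: (mom p q 2 (x0 + x) (t0 + t')) (mom p q 2 (x0 + x) (t0 + t)) (mom p q 3 _ _) => A B Cc.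
  by congr (`|_| <= _); ring.
have hs : 0 < rh <= rh by rewrite rh0 lexx.
have HM := harmonic_mean rr M20 hU hP hQ lU lP lQ lW hs rh1.
have lB := lip2_bx rr hs rh1.
have lUB := lip2M rr lU lB.
have -> : `|mom p q 1 x0 t0| * J rh (bx rh) = `|J rh (fun x t => U x t * bx rh x t)|.
  rewrite HM normrM /U !addr0; congr (_ * _); rewrite ger0_norm//.
  apply: Rintegral_ge0 => x _; apply: Rintegral_ge0 => t _; exact: bfam0_ge0.
have cg := J_cont rr lUB.
have := @sint_bound _ _ _ _ (M * cbf q) (mrho rr) cg; rewrite opprK; apply.
have slice x : `|x| < rh + rh -> x0 + x != 0 -> `|sint (fun t => U x t * bx rh x t) (- rh) rh| <= M * cbf q.
  move=> hx nz; apply: (mom1_slice (rh' := rh + rh)) => //.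
    by rewrite normr_gt0 nz xb.
  by rewrite lerBlDr lerDl sqr_ge0.
move=> x hx; have xr := in_rho rr hx.
have [z|nz] := eqVneq (x0 + x) 0; last exact: slice.
(* The slice on the axis, where [bound] says nothing, is a limit of neighbouring slices. *)
apply: (cont_le (cg x hx)).
exists (rh + rh - `|x|); first by rewrite subr_gt0.
move=> y yx hy; apply: slice.
  by have := ler_normD (y - x) x; rewrite subrK; lra.
by apply: contra_neq yx => z'; apply: (@addrI _ x0); rewrite z z'.
Qed.

Lemma mom0_lip_t x t t' K : x != 0 -> `|x| < e -> `|t| <= t1 -> `|t'| <= t1 ->
  (forall v, Num.min t t' <= v <= Num.max t t' -> `|mom p q 1 x v| <= K) ->
  `|mom p q 0 x t' - mom p q 0 x t| <= K * `|t' - t|.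
Proof.
move=> x0 xe ht ht' hK; rewrite -[_ - mom _ _ _ _ _]subr0 -(mul0r (t' - t)).
apply: (@mvt_le _ _ (fun v => - mom p q 1 x v)) => v hv; last by rewrite subr0 normrN hK.
apply: (mom_is_derive hp) => //; have [h _] := between_norm hv.
by apply: le_trans h _; rewrite ge_max ht.
Qed.

(** The bump is nonnegative of total mass [cbf q], so the normalised moment is a weighted mean of
    [p x] near [t]. *)
Lemma mom0_approx x t eta : x != 0 -> 0 < `|x| < d -> `|t| <= t1 -> 0 < eta ->
  (forall y, q > (y - t) ^+ 2 -> `|p x y - p x t| <= eta) ->
  `|mom p q 0 x t - p x t * cbf q| <= eta * cbf q.
Proof.
move=> x0 hx ht eta0 H; have [[_ /andP[_ s1] _ _ _] hq _ _ _ _] := hp.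
have q1 : q <= 1 by apply: le_trans hq _; rewrite exprn_ile1//; exact: ltW.
have i0 := integ_bfam 0 q1; have i1 := integ_shift (- t) i0.
have i2 := mom_integ hp hx (mh_tfun hp 0 ht).
rewrite mom_nz// /cbf -(rint_shift (- t) i0) -!rintZ// -RintegralB//; last exact: integZ.
apply: le_norm_rint; [|exact: integZ|].
  by apply: integ_mea; apply: integB => //; exact: integZ.
move=> y; rewrite -mulrBl normrM (ger0_norm (bfam0_ge0 _ _)).
have [h|h] := ltP ((y - t) ^+ 2) q; first by rewrite ler_wpM2r ?bfam0_ge0// H.
by rewrite bfam_eq0// !mulr0.
Qed.
End Mom1.

Lemma slice_bounded (p r : R -> R -> R) (d rho a x : R) : 0 <= a < rho ->
  (forall x y, 0 < `|x| < d -> - rho <= y <= rho -> dfree p r x y) -> 0 < `|x| < d ->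
  exists2 N : R, 0 <= N & forall y, - a <= y <= a -> `|p x y| <= N.
Proof.
move=> /andP[a0 ar] D hx.
have H (x' y eta : R) : x <= x' <= x -> - a <= y <= a -> 0 < eta -> exists2 dl : R, 0 < dl &
    forall h k : R, `|h| < dl -> `|k| < dl -> `|p (x' + h) (y + k) - p x' y| < eta.
  rewrite -eq_le => /eqP <- hy eta0.
  have [|dl dl0 hd] := dfree_cont (D x y hx _) eta0; first by lra.
  by exists dl => // h k hh hk; have [] := hd h k hh hk.
have [N hN] := rect_bounded H.
by exists `|N| => // y hy; apply: le_trans (hN x y _ hy) (ler_norm _); rewrite lexx.
Qed.

Fact lt_quarter_add2_le (x y r e : R) : x < y -> y <= e / 4 -> r <= e / 4 -> 0 < e -> x + (r + r) <= e.
Proof. by lra. Qed.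
Fact lt_quarter_add2_half (t y r p : R) : t < y -> y <= p / 4 -> r <= p / 8 -> t + (r + r) <= p / 2.
Proof. by lra. Qed.
Fact lt_quarter_add_half (t y p : R) : t < y -> y <= p / 4 -> 0 < p -> t + p / 8 <= p / 2.
Proof. by lra. Qed.
Fact le_quarter_lt (y e : R) : y <= e / 4 -> 0 < e -> y < e. Proof. by lra. Qed.
Fact le_quarter_half (y e : R) : y <= e / 4 -> 0 < e -> y <= e / 2. Proof. by lra. Qed.
Fact lt_quarter_le (x y e : R) : x < y -> y <= e / 4 -> 0 < e -> x <= e. Proof. by lra. Qed.
Fact approx_transfer (m m' c w w' eta K D : R) : `|m - w * c| <= eta / 2 * c -> `|m' - w' * c| <= eta / 2 * c ->
  `|m' - m| <= K * c * D -> `|(w' - w) * c| <= (eta + K * D) * c.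
Proof.
move=> h1 h2 h3; rewrite (_ : _ * c = (m' - m) - (m' - w' * c) + (m - w * c)); last ring.
apply: le_trans (ler_normD _ _) _; apply: le_trans (lerD (ler_normB _ _) (lexx _)) _.
lra.
Qed.

Section Main.
Variables (u v : R -> R -> R) (d rho : R).
Hypotheses (d0 : 0 < d) (rho01 : 0 < rho <= 1).
Hypothesis mu_u : measurable_fun setT (fun z : R * R => u z.1 z.2).
Hypothesis mu_v : measurable_fun setT (fun z : R * R => v z.1 z.2).
Hypothesis Duv : forall x y, 0 < `|x| < d -> - rho <= y <= rho -> dfree u (fun x y => - v x y) x y.
Hypothesis Dvu : forall x y, 0 < `|x| < d -> - rho <= y <= rho -> dfree v u x y.
Hypothesis Lu : forall a phi, 0 <= a < rho -> tfun a phi -> exists l : R, rint (fun y => u x y * phi y) @[x --> 0^'] --> l.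
Hypothesis Lv : forall a phi, 0 <= a < rho -> tfun a phi -> exists l : R, rint (fun y => v x y * phi y) @[x --> 0^'] --> l.

(** Bumps of radius [s] with centre in [-t1, t1] fit into [-a, a], and a < rho. For |t| < rho / 4
    the mean value argument uses centres up to 2 s = rho / 4 away, hence t1 = rho / 2. *)
Let s := rho / 8.
Let a := 3 * rho / 4.
Let t1 := rho / 2.

Lemma uniform_moments (w r : R -> R -> R) n : measurable_fun setT (fun z : R * R => w z.1 z.2) ->
  (forall x y, 0 < `|x| < d -> - rho <= y <= rho -> dfree w r x y) ->
  (forall a phi, 0 <= a < rho -> tfun a phi -> exists l : R, rint (fun y => w x y * phi y) @[x --> 0^'] --> l) ->
  exists2 e : R, 0 < e <= d & exists2 M : R, 0 <= M & forall j q x t, (j <= n)%N -> q <= s ^+ 2 ->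
    0 < `|x| < e -> `|t| <= t1 -> `|rint (fun y => w x y * bfam q j (y - t))| <= M.
Proof.
move=> mw D L; have /andP[r0 r1] := rho01.
have one j : exists2 e : R, 0 < e & exists M : R, forall x q t, 0 < `|x| < e -> q <= s ^+ 2 -> `|t| <= t1 ->
    `|rint (fun y => w x y * bfam q j (y - t))| <= M.
  have ar : 0 <= a < rho by rewrite /a; lra.
  apply: (@bfam_pairing_bounded R w d a s t1 j d0) => [|||x|x hx|phi].
  - by rewrite /a; lra.
  - by rewrite /s; lra.
  - by rewrite /t1 /s /a; lra.
  - exact: (mea_slice x mw).
  - exact: (slice_bounded ar D hx).
  - exact: L.
elim: n => [|n [e1 /andP[e10 e1d] [M1 M10 H1]]].
  have [e2 e20 [M2 H2]] := one 0%N; exists (Num.min d e2); first by rewrite lt_min d0 e20 ge_min lexx.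
  exists `|M2| => // j q x t; rewrite leqn0 => /eqP -> hq hx ht.
  apply: le_trans (H2 x q t _ hq ht) (ler_norm _).
  by move: hx; rewrite lt_min => /and3P[-> _ ->].
have [e2 e20 [M2 H2]] := one n.+1; exists (Num.min e1 e2).
  by rewrite lt_min e10 e20 ge_min e1d.
exists (Num.max M1 M2) => [|j q x t]; first by rewrite le_max M10.
rewrite leq_eqVlt lt_min le_max => /orP[/eqP ->|jn] hq /and3P[x0 xe1 xe2] ht.
  by rewrite (H2 x q t) ?x0// orbT.
by rewrite (H1 j q x t) ?x0.
Qed.

(** The two points may lie on different sides of the axis. The zeroth moment of [u] has as partial
    derivatives, up to sign, the first moments of [v] and [u], which [mom1_bound] controls by a
    multiple of [cbf q]; after division by [cbf q] the limit q -> 0 gives [u] itself. *)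
Theorem edge_of_wedge : exists2 dl : R, 0 < dl & exists2 K : R, 0 <= K & forall x t x' t',
  0 < `|x| < dl -> 0 < `|x'| < dl -> `|t| < dl -> `|t'| < dl ->
  `|u x' t' - u x t| <= K * (`|x' - x| + `|t' - t|).
Proof.
have /andP[r0 r1] := rho01.
have [e1 /andP[e10 e1d] [M1 M10 H1]] := uniform_moments 5 mu_u Duv Lu.
have [e2 /andP[e20 e2d] [M2 M20 H2]] := uniform_moments 5 mu_v Dvu Lv.
pose e := Num.min e1 e2; pose M := M1 + M2.
have e0 : 0 < e by rewrite lt_min e10.
have ee1 : e <= e1 by rewrite ge_min lexx.
have ee2 : e <= e2 by rewrite ge_min lexx orbT.
have ed : e <= d by exact: le_trans e1d.
have M0 : 0 <= M by exact: addr_ge0.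
have ar : 0 <= a < rho by rewrite /a; lra.
have s0 : 0 < s by rewrite /s; lra.
have s01 : 0 <= s <= 1 by rewrite /s; lra.
have t10 : 0 < t1 by rewrite /t1; lra.
have ts : t1 + s < a by rewrite /t1 /s /a; lra.
have ss : s + s <= t1 by rewrite /t1 /s; lra.
have arho : a < rho by case/andP: ar.
have a0 : 0 <= a by case/andP: ar.
have pos : [/\ 0 <= a, 0 <= s <= 1, t1 + s < a, 0 < e <= d & 0 <= M] by rewrite e0.
have lt1 x : 0 < `|x| < e -> 0 < `|x| < e1 by move=> /andP[-> h]; exact: lt_le_trans ee1.
have lt2 x : 0 < `|x| < e -> 0 < `|x| < e2 by move=> /andP[-> h]; exact: lt_le_trans ee2.
have B1 j q x t : (j <= 5)%N -> q <= s ^+ 2 -> 0 < `|x| < e -> `|t| <= t1 ->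
    `|rint (fun y => u x y * bfam q j (y - t))| <= M.
  by move=> hj hq /lt1 hx ht; apply: le_trans (H1 j q x t hj hq hx ht) _; rewrite lerDl.
have B2 j q x t : (j <= 5)%N -> q <= s ^+ 2 -> 0 < `|x| < e -> `|t| <= t1 ->
    `|rint (fun y => v x y * bfam q j (y - t))| <= M.
  by move=> hj hq /lt2 hx ht; apply: le_trans (H2 j q x t hj hq hx ht) _; rewrite lerDr.
have hu q : q <= s ^+ 2 -> mom_hyp u d a s t1 e M q.
  move=> hq; split => //; first by move=> x; exact: (slice_bounded ar Duv).
    by move=> phi; exact: Lu.
  by move=> j x t j5; exact: B1.
have hv q : q <= s ^+ 2 -> mom_hyp v d a s t1 e M q.
  move=> hq; split => //; first by move=> x; exact: (slice_bounded ar Dvu).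
    by move=> phi; exact: Lv.
  by move=> j x t j5; exact: B2.
have Dvu' x y hx hy := dfreeN (Dvu (x := x) (y := y) hx hy).
have Duv' x y hx hy := dfreeN (Duv (x := x) (y := y) hx hy).
pose rh := Num.min s (e / 4).
have rh0 : 0 < rh by rewrite lt_min s0 divr_gt0.
have rhs : rh <= s by rewrite ge_min lexx.
have rhe : rh <= e / 4 by rewrite ge_min lexx orbT.
have rh01 : 0 < rh <= s by rewrite rh0.
pose A := J rh (bx rh).
have A0 : 0 < A by apply: J_bx_gt0; rewrite rh0 (le_trans rhs)//; case/andP: s01.
pose K := M * (rh + rh) / A.
have K0 : 0 <= K by rewrite divr_ge0 ?mulr_ge0// ?addr_ge0// ltW.
pose dl := Num.min (e / 4) (rho / 4).
have dl0 : 0 < dl by rewrite lt_min !divr_gt0.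
have dle : dl <= e / 4 by rewrite ge_min lexx.
have dlr : dl <= rho / 4 by rewrite ge_min lexx orbT.
have in1 (x : R) : `|x| < dl -> `|x| + (rh + rh) <= e by move=> hx; exact: lt_quarter_add2_le hx dle rhe e0.
have in2 (t : R) : `|t| < dl -> `|t| + (rh + rh) <= t1 by move=> ht; exact: lt_quarter_add2_half ht dlr rhs.
have in3 (t : R) : `|t| < dl -> `|t| + s <= t1 by move=> ht; exact: lt_quarter_add_half ht dlr r0.
have bu q x t : 0 < q <= s ^+ 2 -> `|x| < dl -> `|t| < dl -> `|mom u q 1 x t| <= K * cbf q.
  move=> /andP[q0 qs] hx ht.
  have b q' y t' : q' <= s ^+ 2 -> 0 < `|y| < e -> `|t'| <= t1 -> `|rint (fun z => u y z * bfam q' 1 (z - t'))| <= M.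
    by move=> h; exact: B1.
  have := mom1_bound (hu q qs) (mom_hypN (hv q qs)) s0 arho b Duv Dvu' rh01 (in1 x hx) (in2 t ht) (in3 t ht).
  by rewrite -ler_pdivlMr//; congr (_ <= _); rewrite /K -/A; ring.
have bv q x t : 0 < q <= s ^+ 2 -> `|x| < dl -> `|t| < dl -> `|mom v q 1 x t| <= K * cbf q.
  move=> /andP[q0 qs] hx ht.
  have b q' y t' : q' <= s ^+ 2 -> 0 < `|y| < e -> `|t'| <= t1 -> `|rint (fun z => v y z * bfam q' 1 (z - t'))| <= M.
    by move=> h; exact: B2.
  have := mom1_bound (hv q qs) (hu q qs) s0 arho b Dvu Duv rh01 (in1 x hx) (in2 t ht) (in3 t ht).
  by rewrite -ler_pdivlMr//; congr (_ <= _); rewrite /K -/A; ring.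
have dle' : dl < e by exact: le_quarter_lt dle e0.
have dlt : dl <= t1 by exact: le_quarter_half dlr r0.
exists dl => //; exists K => // x t x' t' /andP[x0 xd] /andP[x'0 x'd] td t'd.
have lip q : 0 < q <= s ^+ 2 -> `|mom u q 0 x' t' - mom u q 0 x t| <= K * cbf q * (`|x' - x| + `|t' - t|).
  move=> hq; have qs : q <= s ^+ 2 by case/andP: hq.
  have q1 : 0 <= K * cbf q.
    apply: mulr_ge0 => //; apply: ltW; apply: cbf_gt0; have /andP[-> _] := hq.
    by apply: le_trans qs _; rewrite exprn_ile1//; case/andP: s01.
  rewrite -(subrKA (mom u q 0 x t')).
  rewrite (le_trans (ler_normD _ _))// mulrDr lerD//; last first.
    apply: (mom0_lip_t (hu q qs)).
    - by rewrite -normr_gt0.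
    - exact: lt_trans dle'.
    - exact: le_trans (ltW td) dlt.
    - exact: le_trans (ltW t'd) dlt.
    - by move=> z /between_norm[h _]; apply: bu => //; apply: le_lt_trans h _; rewrite gt_max td.
  have main y y' : `|y| < dl -> `|y'| < dl -> y <= y' -> `|mom u q 0 y' t' - mom u q 0 y t'| <= K * cbf q * (y' - y).
    move=> yd y'd yy; rewrite -[_ - mom _ _ _ _ _]subr0 -(mul0r (y' - y)).
    have /andP[ye _] : (- e < y) && (y < e) by rewrite -ltr_norml; exact: lt_trans dle'.
    have /andP[_ y'e] : (- e < y') && (y' < e) by rewrite -ltr_norml; exact: lt_trans dle'.
    apply: (mom_cr (hu q qs) (mom_hypN (hv q qs)) arho Duv) => //; first exact: le_trans (ltW t'd) dlt.
    move=> z hz _; have zd : `|z| < dl.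
      have /between_norm[h _] : Num.min y y' <= z <= Num.max y y' by rewrite min_l// max_r.
      by apply: le_lt_trans h _; rewrite gt_max yd.
    rewrite subr0 (momN 1 (hv q qs)) ?normrN; [exact: bv|exact: lt_trans dle'|exact: le_trans (ltW t'd) dlt].
  have [xx|/ltW xx] := leP x x'; first by rewrite [`|x' - x|]ger0_norm ?subr_ge0//; exact: main.
  by rewrite distrC [`|x' - x|]distrC [`|x - x'|]ger0_norm ?subr_ge0//; exact: main.
apply/ler_addgt0Pl => eta eta0.
have near y z : 0 < `|y| < dl -> `|z| < dl -> exists2 q0 : R, 0 < q0 &
    forall q, 0 < q <= s ^+ 2 -> q <= q0 -> `|mom u q 0 y z - u y z * cbf q| <= eta / 2 * cbf q.
  move=> /andP[y0 yd] zd.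
  have hy : 0 < `|y| < d by rewrite y0 (lt_le_trans (lt_trans yd dle')).
  have hz : - rho <= z <= rho by rewrite -ler_norml; exact: lt_quarter_le zd dlr r0.
  have e20' : 0 < eta / 2 by rewrite divr_gt0.
  have [dz dz0 hd] := dfree_cont (Duv hy hz) e20'.
  exists (dz ^+ 2) => [|q hq qd]; first exact: exprn_gt0.
  have qs : q <= s ^+ 2 by case/andP: hq.
  apply: (mom0_approx (hu q qs)) => //.
  - by rewrite -normr_gt0.
  - exact: le_trans (ltW zd) dlt.
  - move=> w hw; have hwz : `|w - z| < dz.
      rewrite -(@ltr_pXn2r _ 2) ?nnegrE ?(ltW dz0)// real_normK ?num_real//; exact: lt_le_trans qd.
    have [] := hd 0 (w - z) _ hwz; first by rewrite normr0.
    by rewrite addr0 subrKC => /ltW.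
have [q1 q10 h1] := near x t ltac:(by rewrite x0) td.
have [q2 q20 h2] := near x' t' ltac:(by rewrite x'0) t'd.
(* One bump narrow enough for the continuity of [u] at both points. *)
pose q := Num.min (s ^+ 2) (Num.min q1 q2).
have q0 : 0 < q by rewrite !lt_min q10 q20 exprn_gt0.
have qs : q <= s ^+ 2 by rewrite ge_min lexx.
have qq1 : q <= q1 by rewrite !ge_min lexx orbT.
have qq2 : q <= q2 by rewrite !ge_min lexx !orbT.
have hq : 0 < q <= s ^+ 2 by rewrite q0.
have c0 : 0 < cbf q.
  apply: cbf_gt0; rewrite q0 (le_trans qs)// exprn_ile1//; by case/andP: s01.
have {}h1 := h1 q hq qq1; have {}h2 := h2 q hq qq2; have {}lip := lip q hq.
rewrite -(ler_pM2r c0) -{1}(ger0_norm (ltW c0)) -normrM.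
exact: approx_transfer h1 h2 lip.
Qed.
End Main.
End EdgeOfWedge.

(** * Fourier transforms of test functions *)

Section FourierDecay.
Variable R : realType.
Local Notation mu := (@lebesgue_measure R).
Local Notation rint := (Rintegral mu setT).
Local Notation C := R[i].
Local Notation Re := (@complex.Re R).
Local Notation Im := (@complex.Im R).

Lemma cauchy_integral : (\int[mu]_x ((1 + x ^+ 2)^-1)%:E = pi%:E)%E.
Proof.
rewrite (@ge0_symfun_integralT R (fun x => (1 + x ^+ 2)^-1)).
- have := @integral0y_oneDsqr R; rewrite set_itvcy => ->.
  by rewrite -EFinM; congr (_%:E); rewrite mulrC divfK.
- by move=> x; rewrite invr_ge0 addr_ge0// sqr_ge0.
- exact: (@continuous_oneDsqrV R).
- by move=> x /=; rewrite sqrrN.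
Qed.

Lemma integ_cauchy : integ (fun x : R => (1 + x ^+ 2)^-1).
Proof.
apply/integrableP; split.
  by apply: mea_EFin; apply: continuous_measurable_fun; exact: (@continuous_oneDsqrV R).
under eq_integral => x _.
  rewrite /= ger0_norm; last by rewrite invr_ge0 addr_ge0// sqr_ge0.
  over.
by rewrite cauchy_integral ltry.
Qed.

Lemma rint_cauchy : rint (fun x => (1 + x ^+ 2)^-1) = pi.
Proof. by rewrite /Rintegral cauchy_integral. Qed.

Definition hv (x : R) : R := if 0 <= x then 1 else 0.
Lemma hv_ge0 x : 0 <= x -> hv x = 1. Proof. by rewrite /hv => ->. Qed.
Lemma hv_lt0 x : x < 0 -> hv x = 0. Proof. by rewrite /hv leNgt => ->. Qed.
Lemma mea_hv : measurable_fun setT hv.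
Proof. exact: mea_le_ind (measurable_cst _) (@measurable_id _ _ _). Qed.
Lemma hv_norm x : `|hv x| <= 1.
Proof. by rewrite /hv; case: ifP; rewrite ?normr1 ?normr0. Qed.
Lemma hv01 x : 0 <= hv x <= 1. Proof. by rewrite /hv; case: ifP; rewrite ?lexx ler01. Qed.

Lemma mea_expRN (s : R) : measurable_fun setT (fun x : R => expR (- (s * x))).
Proof.
apply: (measurableT_comp (@measurable_expR R)); apply: measurable_funN.
exact: measurable_funM.
Qed.

Lemma integ_hv_exp (s : R) : 0 < s -> integ (fun x => hv x * expR (- (s * x))).
Proof.
(* Chosen so that c (1 + x^2) <= 1 + (s x)^2 / 2 <= exp(s x), which compares the exponential with
   the Cauchy density. *)
move=> s0; pose c := Num.min 1 (s ^+ 2 / 2).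
have c0 : 0 < c by rewrite lt_min ltr01 divr_gt0// exprn_gt0.
have c1 : c <= 1 by rewrite ge_min lexx.
have c2 : c <= s ^+ 2 / 2 by rewrite ge_min lexx orbT.
apply: (integ_dom _ (integZ c^-1 integ_cauchy)).
  by apply: measurable_funM; [exact: mea_hv|exact: mea_expRN].
move=> x; have d0 : 0 < 1 + x ^+ 2 by have := sqr_ge0 x; lra.
have [x0|x0] := leP 0 x; last by rewrite hv_lt0// mul0r normr0 -invfM invr_ge0 mulr_ge0// ltW.
rewrite hv_ge0// mul1r ger0_norm ?expR_ge0// expRN -invfM lef_pV2 ?posrE ?expR_gt0 ?mulr_gt0//.
have := @expR_ge1Dxn R (s * x) 1 (mulr_ge0 (ltW s0) x0); rewrite exprMn (_ : 2`! = 2)//.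
have := sqr_ge0 x; nra.
Qed.

Lemma integ_hv_lin_exp (s : R) : 0 < s -> integ (fun x => hv x * ((1 + x) * expR (- (s * x)))).
Proof.
move=> s0; have s2 : 0 < s / 2 by rewrite divr_gt0.
pose c := Num.min 1 (s / 2).
have c0 : 0 < c by rewrite lt_min ltr01.
have c1 : c <= 1 by rewrite ge_min lexx.
have c2 : c <= s / 2 by rewrite ge_min lexx orbT.
apply: (integ_dom _ (integZ c^-1 (integ_hv_exp s2))).
  apply: measurable_funM; [exact: mea_hv|apply: measurable_funM; [exact: measurable_funD|exact: mea_expRN]].
move=> x; have [x0|x0] := leP 0 x; last by rewrite hv_lt0// !mul0r normr0 mulr0.
have x1 : 0 <= 1 + x by lra.
rewrite hv_ge0// !mul1r ger0_norm; last by rewrite mulr_ge0// expR_ge0.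
rewrite ler_pdivlMl//.
have -> : - (s * x) = - (s / 2 * x) + - (s / 2 * x) by field.
rewrite expRD !mulrA ler_piMl ?expR_ge0// expRN ler_pdivrMr ?expR_gt0// mul1r.
have := @expR_ge1Dx R (s / 2 * x); nra.
Qed.

Definition fc (phi : R -> R) (x : R) := rint (fun t => phi t * cos (x * t)).
Definition fs (phi : R -> R) (x : R) := rint (fun t => phi t * sin (x * t)).

Lemma is_derive_cos_lin (x t : R) : is_derive t (1 : R) (fun t => cos (x * t)) (- (x * sin (x * t))).
Proof.
have d : is_derive t (1 : R) (fun t => x * t) x.
  by have := is_deriveM (is_derive_cst x t (1 : R)) (is_derive_id t (1 : R)); rewrite /GRing.scale /= mulr1 mulr0 addr0.
have := is_derive1_comp (is_derive_cos (x * t)) d.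
by rewrite mulNr mulrC.
Qed.
Lemma is_derive_sin_lin (x t : R) : is_derive t (1 : R) (fun t => sin (x * t)) (x * cos (x * t)).
Proof.
have d : is_derive t (1 : R) (fun t => x * t) x.
  by have := is_deriveM (is_derive_cst x t (1 : R)) (is_derive_id t (1 : R)); rewrite /GRing.scale /= mulr1 mulr0 addr0.
have := is_derive1_comp (is_derive_sin (x * t)) d.
by rewrite mulrC.
Qed.
Lemma norm_cos (x : R) : `|cos x| <= 1. Proof. by rewrite ler_norml cos_geN1 cos_le1. Qed.
Lemma norm_sin (x : R) : `|sin x| <= 1. Proof. by rewrite ler_norml sin_geN1 sin_le1. Qed.
Lemma mea_cos_lin (x : R) : measurable_fun setT (fun t => cos (x * t)).
Proof. by apply: continuous_measurable_fun => t; apply: differentiable_continuous; apply/derivable1_diffP; have [] := is_derive_cos_lin x t. Qed.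
Lemma mea_sin_lin (x : R) : measurable_fun setT (fun t => sin (x * t)).
Proof. by apply: continuous_measurable_fun => t; apply: differentiable_continuous; apply/derivable1_diffP; have [] := is_derive_sin_lin x t. Qed.

Lemma tfun_integ a (phi : R -> R) : 0 <= a -> tfun a phi -> integ phi.
Proof.
move=> a0 tphi; have [K _ hK] := tfun_bounded a0 tphi; have [s z] := tphi.
exact: (integ_bdd_supp (smooth_mea s) hK z).
Qed.
Lemma integ_cos (phi : R -> R) (x : R) : integ phi -> integ (fun t => phi t * cos (x * t)).
Proof. by move=> h; apply: (integM_bdd h (mea_cos_lin x) (fun t => norm_cos _)). Qed.
Lemma integ_sin (phi : R -> R) (x : R) : integ phi -> integ (fun t => phi t * sin (x * t)).
Proof. by move=> h; apply: (integM_bdd h (mea_sin_lin x) (fun t => norm_sin _)). Qed.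

Lemma rint_derive1 (a : R) (f f' : R -> R) : 0 <= a -> (forall t, is_derive t (1 : R) f (f' t)) -> continuous f' ->
  (forall t, ~ `[- a, a]%classic t -> f t = 0) -> (forall t, ~ `[- a, a]%classic t -> f' t = 0) -> rint f' = 0.
Proof.
move=> a0 df cf' z z'.
have cf : continuous f.
  by move=> t; apply: differentiable_continuous; apply/derivable1_diffP; have [] := df t.
have -> : rint f' = sint f' (- (a + 1)) (a + 1).
  rewrite /sint [RHS]rint_mkcond; apply: eq_Rintegral => t _; rewrite indicE.
  have [h|h] := pselect (`[- (a + 1), a + 1]%classic t); first by rewrite mem_set// mulr1.
  by rewrite memNset// mulr0 z'// => h'; apply: h; move: h'; rewrite /= !in_itv/=; lra.
have aa : - (a + 1) < a + 1 by lra.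
rewrite /sint /Rintegral (@continuous_FTC2 R f' f _ _ aa) /=.
- by rewrite !z ?subrr//= in_itv/=; lra.
- by apply: continuous_subspaceT.
- split=> [x _||]; first by have [] := df x.
  + by apply: cvg_at_right_filter; exact: cf.
  + by apply: cvg_at_left_filter; exact: cf.
- by move=> x _; rewrite derive1E; have [] := df x.
Qed.

(** Each sum to be shown zero is the integral of the derivative of an explicit compactly supported
    function, so two integrations by parts become one use of [rint_derive1]. *)
Lemma fourier_ibp a phi x : 0 <= a -> tfun a phi ->
  x ^+ 2 * fc phi x = - fc (derive1 (derive1 phi)) x /\ x ^+ 2 * fs phi x = - fs (derive1 (derive1 phi)) x.
Proof.
move=> a0 tphi; have tphi1 := tfun_derive1 tphi; have tphi2 := tfun_derive1 tphi1.
have [s0 z0] := tphi; have [s1 z1] := tphi1; have [s2 z2] := tphi2.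
have d0 t : is_derive t (1 : R) phi (derive1 phi t).
  by rewrite derive1E; apply: derivableP; exact: smooth_derivable.
have d1 t : is_derive t (1 : R) (derive1 phi) (derive1 (derive1 phi) t).
  by rewrite [X in is_derive _ _ _ X]derive1E; apply: derivableP; exact: smooth_derivable.
have c0 := smooth_continuous s0; have c1 := smooth_continuous s1; have c2 := smooth_continuous s2.
have cc : continuous (fun t : R => cos (x * t)).
  by move=> t; apply: differentiable_continuous; apply/derivable1_diffP; have [] := is_derive_cos_lin x t.
have cs : continuous (fun t : R => sin (x * t)).
  by move=> t; apply: differentiable_continuous; apply/derivable1_diffP; have [] := is_derive_sin_lin x t.
have i0 := tfun_integ a0 tphi; have i2 := tfun_integ a0 tphi2.
split.
- have df t : is_derive t (1 : R) (fun t => x * (phi t * sin (x * t)) + derive1 phi t * cos (x * t))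
      (x ^+ 2 * (phi t * cos (x * t)) + derive1 (derive1 phi) t * cos (x * t)).
    have e := is_deriveD (is_deriveM (is_derive_cst x t (1 : R)) (is_deriveM (d0 t) (is_derive_sin_lin x t)))
      (is_deriveM (d1 t) (is_derive_cos_lin x t)).
    by apply: is_derive_eq; rewrite /GRing.scale /=; ring.
  have H := rint_derive1 a0 df.
  apply/eqP; rewrite -addr_eq0 /fc -rintZ; last exact: integ_cos.
  rewrite -RintegralD//; [|by apply: integZ; exact: integ_cos|exact: integ_cos].
  apply/eqP; apply: H.
  + by move=> t; apply: cvgD; apply: cvgM; [exact: cvg_cst|apply: cvgM; [exact: c0|exact: cc]|exact: c2|exact: cc].
  + by move=> t ht; rewrite z0// z1// !mul0r mulr0 addr0.
  + by move=> t ht; rewrite z0// z2// !mul0r mulr0 addr0.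
- have df t : is_derive t (1 : R) (fun t => derive1 phi t * sin (x * t) - x * (phi t * cos (x * t)))
      (x ^+ 2 * (phi t * sin (x * t)) + derive1 (derive1 phi) t * sin (x * t)).
    have e := is_deriveB (is_deriveM (d1 t) (is_derive_sin_lin x t))
      (is_deriveM (is_derive_cst x t (1 : R)) (is_deriveM (d0 t) (is_derive_cos_lin x t))).
    by apply: is_derive_eq; rewrite /GRing.scale /=; ring.
  have H := rint_derive1 a0 df.
  apply/eqP; rewrite -addr_eq0 /fs -rintZ; last exact: integ_sin.
  rewrite -RintegralD//; [|by apply: integZ; exact: integ_sin|exact: integ_sin].
  apply/eqP; apply: H.
  + by move=> t; apply: cvgD; apply: cvgM; [exact: cvg_cst|apply: cvgM; [exact: c0|exact: cs]|exact: c2|exact: cs].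
  + by move=> t ht; rewrite z0// z1// !mul0r mulr0 subr0.
  + by move=> t ht; rewrite z0// z2// !mul0r mulr0 addr0.
Qed.

Lemma fcs_decay a phi : 0 <= a -> tfun a phi -> exists2 K : R, 0 <= K & forall x,
  `|fc phi x| <= K * (1 + x ^+ 2)^-1 /\ `|fs phi x| <= K * (1 + x ^+ 2)^-1.
Proof.
move=> a0 tphi; have tphi2 := tfun_derive1 (tfun_derive1 tphi).
have i0 := tfun_integ a0 tphi; have i2 := tfun_integ a0 tphi2.
have B (psi w : R -> R) : integ psi -> measurable_fun setT w -> (forall t, `|w t| <= 1) ->
    `|rint (fun t => psi t * w t)| <= rint (fun t => `|psi t|).
  move=> ip mw w1; apply: le_norm_rint; [exact: (integ_mea (integM_bdd ip mw w1))|exact: integ_norm|].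
  by move=> t; rewrite normrM ler_piMr.
pose K := rint (fun t => `|phi t|) + rint (fun t => `|derive1 (derive1 phi) t|).
have r0 (psi : R -> R) : 0 <= rint (fun t => `|psi t|) by apply: rint_ge0.
exists K => [|x]; first by rewrite addr_ge0.
have d0 : 0 < 1 + x ^+ 2 by have := sqr_ge0 x; lra.
have [e1 e2] := fourier_ibp x a0 tphi.
have main (A A2 : R) : `|A| <= rint (fun t => `|phi t|) -> `|A2| <= rint (fun t => `|derive1 (derive1 phi) t|) ->
    x ^+ 2 * A = - A2 -> `|A| <= K * (1 + x ^+ 2)^-1.
  move=> h1 h2 e; rewrite ler_pdivlMr// mulrDr mulr1 lerD// -[x ^+ 2]ger0_norm ?sqr_ge0//.
  by rewrite -normrM mulrC e normrN.
split.
- by apply: main e1; apply: B => //; [exact: mea_cos_lin|move=> t; exact: norm_cos|exact: mea_cos_lin|move=> t; exact: norm_cos].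
- by apply: main e2; apply: B => //; [exact: mea_sin_lin|move=> t; exact: norm_sin|exact: mea_sin_lin|move=> t; exact: norm_sin].
Qed.

Lemma cos_lip (x y : R) : `|cos x - cos y| <= `|x - y|.
Proof.
have := @mvt_le R (@cos R) (fun z => - sin z) y x 0 1 (fun z _ => is_derive_cos z).
by rewrite mul0r subr0 mul1r; apply=> z _; rewrite subr0 normrN norm_sin.
Qed.
Lemma sin_lip (x y : R) : `|sin x - sin y| <= `|x - y|.
Proof.
have := @mvt_le R (@sin R) (fun z => cos z) y x 0 1 (fun z _ => is_derive_sin z).
by rewrite mul0r subr0 mul1r; apply=> z _; rewrite subr0 norm_cos.
Qed.

Lemma lipschitz_continuous (f : R -> R) (K : R) : (forall x y, `|f x - f y| <= K * `|x - y|) -> continuous f.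
Proof.
move=> H x; apply/cvgrPdist_lt => e e0; have K0 : 0 < `|K| + 1 by have := normr_ge0 K; lra.
exists (e / (`|K| + 1)); first by rewrite /= divr_gt0.
move=> y /=; rewrite ltr_pdivlMr// => hy; apply: le_lt_trans (H x y) _.
by have := ler_norm K; have := normr_ge0 (x - y); nra.
Qed.

Lemma fcs_continuous a phi : 0 <= a -> tfun a phi -> continuous (fc phi) /\ continuous (fs phi).
Proof.
move=> a0 tphi; have i0 := tfun_integ a0 tphi.
have out t : ~ (- a <= t <= a) -> phi t = 0 by move=> h; apply: (proj2 tphi) => h'; apply: h; move: h'; rewrite /= in_itv.
have B (w1 w2 : R -> R) (D : R) : integ (fun t => phi t * w1 t) -> integ (fun t => phi t * w2 t) ->
    (forall t, `|w1 t - w2 t| <= D * `|t|) -> 0 <= D ->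
    `|rint (fun t => phi t * w1 t) - rint (fun t => phi t * w2 t)| <= a * rint (fun t => `|phi t|) * D.
  move=> h1 h2 hw D0; rewrite -RintegralB// mulrAC -rintZ; last exact: integ_norm.
  apply: le_norm_rint; [by apply: integ_mea; exact: integB|by apply: integZ; exact: integ_norm|].
  move=> t; rewrite -mulrBr normrM mulrC.
  have [ht|ht] := pselect (- a <= t <= a); last by rewrite (out _ ht) normr0 !mulr0.
  rewrite ler_wpM2r// (le_trans (hw t))// [a * D]mulrC ler_wpM2l// ler_norml//.
split; apply: (@lipschitz_continuous _ (a * rint (fun t => `|phi t|))) => x y.
- apply: B => // [||t]; [exact: integ_cos|exact: integ_cos|].
  by rewrite (le_trans (cos_lip _ _))// -mulrBl normrM.
- apply: B => // [||t]; [exact: integ_sin|exact: integ_sin|].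
  by rewrite (le_trans (sin_lip _ _))// -mulrBl normrM.
Qed.

Definition ctest a (phi : R -> C) := 0 <= a /\ tfun a (fun x => Re (phi x)) /\ tfun a (fun x => Im (phi x)).

Lemma ctest_out a phi t : ctest a phi -> ~ (- a <= t <= a) -> phi t = 0.
Proof.
move=> [_ [[_ z1] [_ z2]]] ht; have h : ~ `[- a, a]%classic t by rewrite /= in_itv.
by apply: C_ext; [exact: z1|exact: z2].
Qed.
Lemma ctest_cinteg a phi : ctest a phi -> cinteg phi.
Proof. by move=> [a0 [t1 t2]]; split; exact: (tfun_integ a0). Qed.

Lemma test_fun_ctest (rho : R) U phi : 0 < rho -> U `<=` `](- rho), rho[%classic -> test_fun U phi ->
  exists2 a : R, 0 <= a < rho & ctest a phi.
Proof.
move=> r0 Ur [s1 [s2 [a [b [abU z]]]]].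
have [ab|ba] := leP a b.
  have ha : `](- rho), rho[%classic a by apply: Ur; apply: abU; rewrite /= in_itv/= lexx ab.
  have hb : `](- rho), rho[%classic b by apply: Ur; apply: abU; rewrite /= in_itv/= lexx ab.
  move: ha hb; rewrite /= !in_itv/= -!ltr_norml => ha hb.
  exists (Num.max `|a| `|b|); first by rewrite le_max normr_ge0/= gt_max ha.
  have H t : ~ `[- Num.max `|a| `|b|, Num.max `|a| `|b|]%classic t -> phi t = 0.
    move=> ht; apply: z => h; apply: ht; move: h; rewrite /= !in_itv/= => /andP[h1 h2].
    rewrite -ler_norml; have /between_norm[] // : Num.min a b <= t <= Num.max a b.
    by rewrite min_l// max_r// h1.
  by split; [rewrite le_max normr_ge0|split; split => // t ht; rewrite (H t ht)].
(* A test function may come with an empty interval [a, b]; it is then identically 0. *)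
exists 0; first by rewrite lexx.
have H t : phi t = 0 by apply: z; rewrite /= in_itv/= => /andP[h1 h2]; have := lt_le_trans ba (le_trans h1 h2); rewrite ltxx.
by split => //; split; split => // t _; rewrite H.
Qed.

Lemma ctest_test_fun a (rho : R) phi : a < rho -> ctest a phi -> test_fun `](- rho), rho[%classic phi.
Proof.
move=> ar ct; have [a0 [[s1 z1] [s2 z2]]] := ct; split => //; split => //; exists (- a), a; split.
  by move=> x; rewrite /= !in_itv/=; lra.
by move=> x hx; apply: (ctest_out ct) => h; apply: hx; rewrite /= in_itv.
Qed.

Lemma cexp_i (y : R) : cexp (- (iC R * RtoC y)) = Complex (cos y) (- sin y).
Proof.
apply: C_ext; rewrite /= !(mul0r, mulr0, mul1r, mulr1, subr0, sub0r, addr0, add0r, oppr0) expR0 mul1r ?cosN ?sinN//.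
Qed.
Lemma cexp_pi (y : R) : cexp (iC R * RtoC y) = Complex (cos y) (sin y).
Proof.
apply: C_ext; rewrite /= !(mul0r, mulr0, mul1r, mulr1, subr0, sub0r, addr0, add0r, oppr0) expR0 mul1r //.
Qed.

Lemma fourierE a phi x : ctest a phi -> fourier phi x =
  Complex (fc (fun t => Re (phi t)) x + fs (fun t => Im (phi t)) x) (fc (fun t => Im (phi t)) x - fs (fun t => Re (phi t)) x).
Proof.
move=> [a0 [t1 t2]]; have i1 := tfun_integ a0 t1; have i2 := tfun_integ a0 t2.
apply: C_ext; rewrite /fourier /fc /fs /=.
- rewrite -RintegralD//; [|exact: integ_cos|exact: integ_sin].
  by apply: eq_Rintegral => t _; rewrite ReM cexp_i /=; ring.
- rewrite -RintegralB//; [|exact: integ_cos|exact: integ_sin].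
  by apply: eq_Rintegral => t _; rewrite ImM cexp_i /=; ring.
Qed.

Lemma fourier_decay a phi : ctest a phi -> exists2 K : R, 0 <= K & forall x, cnorm (fourier phi x) <= K * (1 + x ^+ 2)^-1.
Proof.
move=> ct; have [a0 [t1 t2]] := ct.
have [K1 K10 h1] := fcs_decay a0 t1; have [K2 K20 h2] := fcs_decay a0 t2.
exists (K1 + K2 + (K2 + K1)) => [|x]; first by rewrite !addr_ge0.
rewrite (fourierE x ct) (le_trans (cnorm_le _))//=.
have [a1 a2] := h1 x; have [b1 b2] := h2 x.
rewrite mulrDl; apply: lerD; rewrite mulrDl.
  by apply: le_trans (ler_normD _ _) _; exact: lerD.
by apply: le_trans (ler_normB _ _) _; exact: lerD.
Qed.

Lemma fourier_cmea a phi : ctest a phi -> cmea (fourier phi).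
Proof.
move=> ct; have [a0 [t1 t2]] := ct.
have [c1 c2] := fcs_continuous a0 t1; have [c3 c4] := fcs_continuous a0 t2.
have -> : fourier phi = fun x => Complex (fc (fun t => Re (phi t)) x + fs (fun t => Im (phi t)) x) (fc (fun t => Im (phi t)) x - fs (fun t => Re (phi t)) x).
  by apply/funext => x; exact: (fourierE x ct).
split => /=; apply: continuous_measurable_fun => x; first by apply: cvgD; [exact: c1|exact: c4].
by apply: cvgB; [exact: c3|exact: c2].
Qed.

Lemma fourier_cinteg a phi : ctest a phi -> cinteg (fourier phi).
Proof.
move=> ct; have [K K0 hK] := fourier_decay ct.
exact: (cinteg_dom (fourier_cmea ct) (integZ K integ_cauchy) hK).
Qed.

Lemma ifourier_fourier (phi : R -> C) (x : R) : ifourier phi x = RtoC (2 * pi)^-1 * fourier phi (- x).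
Proof. rewrite /ifourier /fourier; congr (_ * cint setT _); apply/funext => t.
by rewrite mulNr RtoCN mulrN opprK [x * t]mulrC. Qed.
End FourierDecay.

(** * Laplace transforms *)

Section Laplace.
Variable R : realType.
Local Notation mu := (@lebesgue_measure R).
Local Notation rint := (Rintegral mu setT).
Local Notation cintT := (cint setT).
Local Notation C := R[i].
Local Notation Re := (@complex.Re R).
Local Notation Im := (@complex.Im R).
Implicit Types (g : R -> C) (s : C).

Definition LT g s := cintT (fun x => g x * cexp (- (s * RtoC x))).

(** For functions carried by [0, oo) the whole-line integral in [LT] is the Laplace transform; this
    is its absolute convergence on the open right half-plane. *)
Definition lapl g := [/\ cmea g, (forall x, x < 0 -> g x = 0) &
  forall sg : R, 0 < sg -> integ (fun x => cnorm (g x) * expR (- (sg * x)))].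

Lemma Re_ker s (x : R) : Re (- (s * RtoC x)) = - (Re s * x).
Proof. by rewrite ReN ReM /= mulr0 subr0. Qed.
Lemma Im_ker s (x : R) : Im (- (s * RtoC x)) = - (Im s * x).
Proof. by rewrite ImN ImM /= mulr0 add0r. Qed.
Lemma cnorm_ker s (x : R) : cnorm (cexp (- (s * RtoC x))) = expR (- (Re s * x)).
Proof. by rewrite cnorm_cexp Re_ker. Qed.
Lemma cmea_ker s : cmea (fun x => cexp (- (s * RtoC x))).
Proof.
apply: cmea_cexp; apply: cmeaN; apply: cmeaM; first exact: cmea_cst.
by apply: cmea_RtoC.
Qed.

Lemma lapl_cinteg g s : lapl g -> 0 < Re s -> cinteg (fun x => g x * cexp (- (s * RtoC x))).
Proof.
move=> [mg _ ig] s0; apply: (cinteg_dom _ (ig _ s0)) => [|x]; first by apply: cmeaM => //; exact: cmea_ker.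
by rewrite cnormM cnorm_ker.
Qed.

Lemma lapl_dom g (w : R -> R) : cmea g -> (forall x, x < 0 -> g x = 0) ->
  (forall sg : R, 0 < sg -> integ (fun x => w x * expR (- (sg * x)))) -> (forall x, cnorm (g x) <= w x) -> lapl g.
Proof.
move=> mg cg iw gw; split => // sg sg0; apply: (integ_dom _ (iw sg sg0)) => [|x].
  by apply: measurable_funM; [exact: mea_cnorm|exact: mea_expRN].
by rewrite normrM !ger0_norm ?expR_ge0 ?cnorm_ge0// ler_wpM2r ?expR_ge0.
Qed.

Lemma lapl_lin g (M : R) : cmea g -> (forall x, x < 0 -> g x = 0) -> (forall x, 0 <= x -> cnorm (g x) <= M * (1 + x)) -> lapl g.
Proof.
move=> mg cg gM; have M0 : 0 <= M by have := le_trans (cnorm_ge0 _) (gM 0 (lexx _)); rewrite addr0 mulr1.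
apply: (@lapl_dom _ (fun x => M * (hv x * (1 + x)))) => // [sg sg0|x].
  by apply: eq_integ (integZ M (integ_hv_lin_exp sg0)) => x; rewrite !mulrA.
have [x0|x0] := leP 0 x; first by rewrite hv_ge0// mul1r gM.
by rewrite cg// cnorm0 hv_lt0// mul0r mulr0.
Qed.

Lemma lapl_bdd g (M : R) : cmea g -> (forall x, x < 0 -> g x = 0) -> (forall x, cnorm (g x) <= M) -> lapl g.
Proof.
move=> mg cg gM; have M0 : 0 <= M by exact: le_trans (cnorm_ge0 _) (gM 0).
apply: (@lapl_lin _ M) => // x x0; apply: le_trans (gM x) _; rewrite ler_peMr//; lra.
Qed.

Lemma laplB g1 g2 : lapl g1 -> lapl g2 -> lapl (fun x => g1 x - g2 x).
Proof.
move=> [m1 c1 i1] [m2 c2 i2]; apply: (@lapl_dom _ (fun x => cnorm (g1 x) + cnorm (g2 x))).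
- exact: cmeaB.
- by move=> x x0; rewrite c1// c2// subr0.
- by move=> sg sg0; apply: eq_integ (integD (i1 sg sg0) (i2 sg sg0)) => x; rewrite mulrDl.
- by move=> x; exact: cnormB.
Qed.

Lemma LTB g1 g2 s : lapl g1 -> lapl g2 -> 0 < Re s -> LT (fun x => g1 x - g2 x) s = LT g1 s - LT g2 s.
Proof.
move=> l1 l2 s0; rewrite /LT -cintB; [|exact: lapl_cinteg|exact: lapl_cinteg].
by apply: eq_cint => x; rewrite mulrBl.
Qed.

Lemma LTZ (c : C) g s : lapl g -> 0 < Re s -> LT (fun x => c * g x) s = c * LT g s.
Proof.
by move=> l s0; rewrite /LT -cintZ; [apply: eq_cint => x; rewrite mulrA|exact: lapl_cinteg].
Qed.

Lemma ker_split (sg t x : R) : cexp (- (Complex sg t * RtoC x)) =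
  RtoC (expR (- (sg * x))) * cexp (- (iC R * RtoC (x * t))) :> C.
Proof.
rewrite -cexp_RtoC -cexpD; congr cexp; apply: C_ext.
- by rewrite Re_ker ReD /= !(mul0r, mulr0, mul1r, subr0, sub0r, oppr0, addr0).
- by rewrite Im_ker ImD /= !(mul0r, mulr0, mul1r, subr0, sub0r, oppr0, addr0, add0r) mulrC.
Qed.

Lemma mea_prod1 (f : R -> R) : measurable_fun setT f -> measurable_fun setT (fun z : R * R => f z.1).
Proof. by move=> mf; exact: (measurableT_comp mf measurable_fst). Qed.
Lemma mea_prod2 (f : R -> R) : measurable_fun setT f -> measurable_fun setT (fun z : R * R => f z.2).
Proof. by move=> mf; exact: (measurableT_comp mf measurable_snd). Qed.
Lemma mea_prod12 (f : R -> R) : measurable_fun setT f -> measurable_fun setT (fun z : R * R => f (z.1 * z.2)).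
Proof.
move=> mf; apply: (measurableT_comp mf); apply: measurable_funM; [exact: measurable_fst|exact: measurable_snd].
Qed.

Definition cmea2 (F : R * R -> C) := measurable_fun setT (fun z : R * R => Re (F z)) /\ measurable_fun setT (fun z : R * R => Im (F z)).
Lemma cmea2M (F G : R * R -> C) : cmea2 F -> cmea2 G -> cmea2 (fun z => F z * G z).
Proof.
move=> [f1 f2] [g1 g2]; split.
- by under eq_fun do rewrite ReM; apply: measurable_funB; exact: measurable_funM.
- by under eq_fun do rewrite ImM; apply: measurable_funD; exact: measurable_funM.
Qed.

(** The multiplication formula, moving the transform from [f] to [phi]. *)
Lemma fourier_fubini (f phi : R -> C) : cinteg f -> cinteg phi ->
  cintT (fun t => cintT (fun x => f x * cexp (- (iC R * RtoC (x * t)))) * phi t) =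
  cintT (fun x => f x * fourier phi x).
Proof.
move=> hf ip.
have [mf1 mf2] := cinteg_mea hf; have [mp1 mp2] := cinteg_mea ip.
have mc : continuous (@cos R) := @continuous_cos R.
have ms : continuous (@sin R) := @continuous_sin R.
have mc' := continuous_measurable_fun mc; have ms' := continuous_measurable_fun ms.
have mk x : cmea (fun t => cexp (- (iC R * RtoC (x * t)))).
  by apply: cmea_cexp; apply: cmeaN; apply: cmeaM; [exact: cmea_cst|apply: cmea_RtoC; exact: measurable_funM].
have mk2 t : cmea (fun x => cexp (- (iC R * RtoC (x * t)))).
  by apply: cmea_cexp; apply: cmeaN; apply: cmeaM; [exact: cmea_cst|apply: cmea_RtoC; exact: measurable_funM].
have nk y : cnorm (cexp (- (iC R * RtoC y))) <= 1.
  by rewrite cnorm_cexp ReN ReM /= mul0r mulr0 subrr oppr0 expR0.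
pose F (z : R * R) : C := f z.1 * (cexp (- (iC R * RtoC (z.1 * z.2))) * phi z.2).
have mF : cmea2 F.
  apply: cmea2M; first by split; [exact: (mea_prod1 mf1)|exact: (mea_prod1 mf2)].
  apply: cmea2M; last by split; [exact: (mea_prod2 mp1)|exact: (mea_prod2 mp2)].
  rewrite /cmea2; under eq_fun do rewrite cexp_i; under [in X in _ /\ X]eq_fun do rewrite cexp_i.
  by split => /=; [exact: (mea_prod12 mc')|apply: measurable_funN; exact: (mea_prod12 ms')].
have e1 : (fun x => f x * fourier phi x) = (fun x => cintT (fun t => F (x, t))).
  apply/funext => x; rewrite /F /fourier -cintZ//.
  apply: eq_cinteg (cintegM_bdd ip (mk x) (fun t => nk _)) => t; exact: mulrC.
have e2 : (fun t => cintT (fun x => f x * cexp (- (iC R * RtoC (x * t)))) * phi t) = (fun t => cintT (fun x => F (x, t))).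
  apply/funext => t; rewrite mulrC -cintZ; last exact: (cintegM_bdd hf (mk2 t) (fun x => nk _)).
  by apply: eq_cint => x; rewrite /F /=; ring.
have iF x : cinteg (fun t => F (x, t)).
  rewrite /F /=; apply: cintegZ; apply: eq_cinteg (cintegM_bdd ip (mk x) (fun t => nk _)) => t; exact: mulrC.
rewrite e1 e2; apply/esym.
apply: (@cfubini R F (fun x => cnorm (f x) * rint (fun t => cnorm (phi t)))).
- exact: mF.1.
- exact: mF.2.
- exact: iF.
- move=> x; rewrite -rintZ; last exact: cinteg_norm.
  apply: le_rint; [|by apply: integZ; exact: cinteg_norm|].
    exact/cinteg_norm/iF.
  move=> t; rewrite /F /= !cnormM ler_wpM2l ?cnorm_ge0// -[leRHS]mul1r ler_wpM2r ?cnorm_ge0//.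
- by apply: eq_integ (integZ (rint (fun t => cnorm (phi t))) (cinteg_norm hf)) => x; rewrite mulrC.
Qed.

Lemma lapl_exp_cinteg g (sg : R) : lapl g -> 0 < sg -> cinteg (fun x => g x * RtoC (expR (- (sg * x)))).
Proof.
move=> lg sg0; apply: eq_cinteg (lapl_cinteg (s := RtoC sg) lg sg0) => x.
by rewrite -cexp_RtoC RtoCN RtoCM.
Qed.

(** On a vertical line the Laplace transform is the Fourier transform of [g] damped by exp(- sg
    x). *)
Lemma LT_pairing g a phi (sg : R) : lapl g -> ctest a phi -> 0 < sg ->
  cintT (fun t => LT g (Complex sg t) * phi t) = cintT (fun x => g x * RtoC (expR (- (sg * x))) * fourier phi x).
Proof.
move=> lg ct sg0; rewrite -(fourier_fubini (lapl_exp_cinteg lg sg0) (ctest_cinteg ct)).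
apply: eq_cint => t; congr (_ * _); apply: eq_cint => x.
by rewrite ker_split mulrA.
Qed.

Lemma expRN_cvg1 (x : R) : expR (- (sg * x)) @[sg --> 0^'+] --> (1 : R).
Proof.
have : {for 0, continuous (fun sg : R => expR (- (sg * x)))}.
  by apply: continuous_comp; [|exact: continuous_expR]; apply: cvgN; apply: cvgM; [exact: cvg_id|exact: cvg_cst].
by move=> /cvg_at_right_filter; rewrite mul0r oppr0 expR0.
Qed.

Lemma exp_weight_limit (f : R -> C) (w : R -> R) : cmea f -> (forall x, x < 0 -> f x = 0) -> integ w ->
  (forall x, cnorm (f x) <= w x) ->
  ccvg_right0 (fun sg => cintT (fun x => f x * RtoC (expR (- (sg * x))))) (cintT f).
Proof.
move=> mf cf iw fw; apply: (@cdct_right0 R _ _ w 1 ltr01) => //.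
- by move=> sg _; apply: cmeaM => //; apply: cmea_RtoC; exact: mea_expRN.
- apply: aeW => x; apply/ccvg_right0P; split.
  + rewrite -[X in _ --> X]mulr1; under eq_fun do rewrite ReM /= mulr0 subr0.
    by apply: cvgM; [exact: cvg_cst|exact: expRN_cvg1].
  + rewrite -[X in _ --> X]mulr1; under eq_fun do rewrite ImM /= mulr0 add0r.
    by apply: cvgM; [exact: cvg_cst|exact: expRN_cvg1].
- move=> sg x /andP[sg0 _]; have [x0|x0] := leP 0 x; last first.
    by rewrite cf// mul0r cnorm0 (le_trans _ (fw x))// cnorm_ge0.
  rewrite cnormM cnorm_RtoC ger0_norm ?expR_ge0//; apply: le_trans (fw x).
  rewrite ler_piMr ?cnorm_ge0// -expR0 ler_expR oppr_le0; apply: mulr_ge0 => //; exact: ltW.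
Qed.

(** A test function has a transform of order 1 / (1 + x^2), so integrability of [g] against that
    weight is enough to dominate the damped integrals. *)
Lemma LT_limit g a phi : lapl g -> ctest a phi -> integ (fun x => cnorm (g x) * (1 + x ^+ 2)^-1) ->
  ccvg_right0 (fun sg => cintT (fun t => LT g (Complex sg t) * phi t)) (cintT (fun x => g x * fourier phi x)).
Proof.
move=> lg ct ig; have [mg cg _] := lg; have [K K0 hK] := fourier_decay ct.
have mf := fourier_cmea ct.
have := @exp_weight_limit (fun x => g x * fourier phi x) _ (cmeaM mg mf) _ (integZ K ig) _.
move=> H; apply: (@ccvg_right0_near R _ _ _ 1 ltr01) (H _ _).
- move=> sg /andP[sg0 _]; rewrite (LT_pairing lg ct sg0); apply: eq_cint => x; ring.
- by move=> x x0; rewrite cg// mul0r.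
- by move=> x; rewrite cnormM mulrCA ler_wpM2l ?cnorm_ge0.
Qed.

Lemma integ_bdd_cauchy g (M : R) : cmea g -> (forall x, cnorm (g x) <= M) -> integ (fun x => cnorm (g x) * (1 + x ^+ 2)^-1).
Proof.
move=> mg gM; apply: (integ_dom _ (integZ M (integ_cauchy R))).
  by apply: measurable_funM; [exact: mea_cnorm|exact: (integ_mea (integ_cauchy R))].
move=> x; have d0 : 0 <= (1 + x ^+ 2)^-1 by rewrite invr_ge0 addr_ge0// sqr_ge0.
by rewrite ger0_norm ?mulr_ge0 ?cnorm_ge0// ler_wpM2r.
Qed.

Lemma sint_pinfty (f : R -> R) : measurable_fun setT f -> integ (fun x => hv x * f x) ->
  sint f 0 T @[T --> +oo] --> rint (fun x => hv x * f x).
Proof.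
move=> mf hf.
have -> : (fun T => sint f 0 T) = (fun T => rint (fun x => ind 0 T x * f x)).
  by apply/funext => T; rewrite sint_ind.
apply: (dct_pinfty _ _ _ (integ_norm hf)) => [T|||T x].
- by apply: measurable_funM => //; exact: (mea_ind _ _ (@measurable_id _ _ _)).
- by apply: measurable_funM => //; exact: mea_hv.
- apply: aeW => x; apply: cvg_near_cst; exists x; split; first exact: num_real.
  by move=> T xT; rewrite /ind /hv (ltW xT) andbT.
- rewrite /ind /hv; case: (0 <= x); rewrite /= ?mul0r ?normr0//.
  by case: (x <= T); rewrite ?mul0r ?normr0 ?mul1r.
Qed.

(** The functions exp(-a x) cos(b x) and exp(-a x) sin(b x) have derivatives that are combinations
    of the two; integrating over the half-line gives two linear equations for their integrals. *)
Lemma LT_heaviside s : 0 < Re s -> LT (fun x => RtoC (hv x)) s = s^-1.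
Proof.
case: s => a b /= a0.
pose P x := expR (- (a * x)) * cos (b * x); pose Q x := expR (- (a * x)) * sin (b * x).
have dE (x : R) : is_derive x (1 : R) (fun x => expR (- (a * x))) (- a * expR (- (a * x))).
  have d : is_derive x (1 : R) (fun x : R => - (a * x)) (- a).
    have := is_deriveN (is_deriveM (is_derive_cst a x (1 : R)) (is_derive_id x (1 : R))).
    by rewrite /GRing.scale /= mulr1 mulr0 addr0.
  by have := @is_derive1_comp R (@expR R) _ x _ _ (is_derive_expR (- (a * x))) d; rewrite mulrC.
have dP (x : R) : is_derive x (1 : R) P (- a * P x - b * Q x).
  have e := is_deriveM (dE x) (is_derive_cos_lin b x); apply: is_derive_eq.
  by rewrite /GRing.scale /= /P /Q; ring.
have dQ (x : R) : is_derive x (1 : R) Q (- a * Q x + b * P x).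
  have e := is_deriveM (dE x) (is_derive_sin_lin b x); apply: is_derive_eq.
  by rewrite /GRing.scale /= /P /Q; ring.
have cP : continuous P by move=> x; apply: differentiable_continuous; apply/derivable1_diffP; have [] := dP x.
have cQ : continuous Q by move=> x; apply: differentiable_continuous; apply/derivable1_diffP; have [] := dQ x.
have mP := continuous_measurable_fun cP; have mQ := continuous_measurable_fun cQ.
have bnd (w : R -> R) : measurable_fun setT w -> (forall x, `|w x| <= expR (- (a * x))) -> integ (fun x => hv x * w x).
  move=> mw hw; apply: (integ_dom _ (integ_hv_exp a0)) => [|x]; first by apply: measurable_funM => //; exact: mea_hv.
  by have /andP[h0 _] := hv01 x; rewrite normrM ger0_norm// ler_wpM2l.
have iP : integ (fun x => hv x * P x).
  by apply: bnd => // x; rewrite normrM ger0_norm ?expR_ge0// ler_piMr ?expR_ge0// norm_cos.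
have iQ : integ (fun x => hv x * Q x).
  by apply: bnd => // x; rewrite normrM ger0_norm ?expR_ge0// ler_piMr ?expR_ge0// norm_sin.
pose p := rint (fun x => hv x * P x); pose q := rint (fun x => hv x * Q x).
have exp0 : expR (- (a * x)) @[x --> +oo] --> (0 : R).
  apply/cvgrPdist_lt => e e0; exists (e^-1 / a); split; first exact: num_real.
  move=> x hx; rewrite sub0r normrN ger0_norm ?expR_ge0// expRN invf_plt ?posrE ?expR_gt0//.
  apply: lt_le_trans (expR_ge1Dx _); move: hx; rewrite ltr_pdivrMr// mulrC => h.
  by apply: lt_trans h _; rewrite ltrDr.
have lim0 (w : R -> R) : (forall x, `|w x| <= expR (- (a * x))) -> w x @[x --> +oo] --> (0 : R).
  move=> hw; apply/cvgr0Pnorm_lt => e e0; have /cvgr0Pnorm_lt/(_ e e0) := exp0.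
  by apply: filterS => x; rewrite ger0_norm ?expR_ge0//; exact: le_lt_trans.
have ftc (F f : R -> R) T : 0 < T -> (forall x, is_derive x (1 : R) F (f x)) -> continuous F -> continuous f -> sint f 0 T = F T - F 0.
  move=> T0 dF cF cf; rewrite /sint /Rintegral (@continuous_FTC2 R f F _ _ T0) //=.
  - exact: continuous_subspaceT.
  - split=> [x _||]; first by have [] := dF x.
    + by apply: cvg_at_right_filter; exact: cF.
    + by apply: cvg_at_left_filter; exact: cF.
  - by move=> x _; rewrite derive1E; have [] := dF x.
have key (w w1 w2 : R -> R) (c1 c2 i1 i2 : R) : (forall x, is_derive x (1 : R) w (c1 * w1 x + c2 * w2 x)) ->
    continuous w -> continuous w1 -> continuous w2 -> (forall x, `|w x| <= expR (- (a * x))) ->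
    sint w1 0 T @[T --> +oo] --> i1 -> sint w2 0 T @[T --> +oo] --> i2 -> c1 * i1 + c2 * i2 = - w 0.
  move=> dw cw cw1 cw2 hw l1 l2.
  have A : c1 * sint w1 0 T + c2 * sint w2 0 T @[T --> +oo] --> c1 * i1 + c2 * i2.
    by apply: cvgD; apply: cvgM => //; exact: cvg_cst.
  have B : c1 * sint w1 0 T + c2 * sint w2 0 T @[T --> +oo] --> - w 0.
    have B' : w T - w 0 @[T --> +oo] --> - w 0.
      by rewrite -[X in _ --> X]sub0r; apply: cvgB; [exact: lim0|exact: cvg_cst].
    apply: cvg_trans B'; apply: near_eq_cvg; exists 0; split; first exact: num_real.
    move=> T T0; have cc : continuous (fun x => c1 * w1 x + c2 * w2 x).
      by move=> x; apply: cvgD; apply: cvgM; [exact: cvg_cst|exact: cw1|exact: cvg_cst|exact: cw2].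
    have C1 : cont_on 0 T w1 by move=> x _; exact: cw1.
    have C2 : cont_on 0 T w2 by move=> x _; exact: cw2.
    have Z (c : R) (f : R -> R) : cont_on 0 T f -> cont_on 0 T (fun x => c * f x).
      by move=> h x hx; apply: cvgM; [exact: cvg_cst|exact: h].
    by rewrite -(ftc _ _ _ T0 dw cw cc) sintD ?sintZ//; exact: Z.
  exact: cvg_unique A B.
have lP := sint_pinfty mP iP; have lQ := sint_pinfty mQ iQ.
have dP' (x : R) : is_derive x (1 : R) P (- a * P x + - b * Q x) by have := dP x; rewrite -[- (b * _)]mulNr.
have nP (x : R) : `|P x| <= expR (- (a * x)) by rewrite normrM ger0_norm ?expR_ge0// ler_piMr ?expR_ge0// norm_cos.
have nQ (x : R) : `|Q x| <= expR (- (a * x)) by rewrite normrM ger0_norm ?expR_ge0// ler_piMr ?expR_ge0// norm_sin.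
have e1 := key P P Q (- a) (- b) p q dP' cP cP cQ nP lP lQ.
have e2 := key Q Q P (- a) b q p dQ cQ cQ cP nQ lQ lP.
have P0 : P 0 = 1 by rewrite /P !mulr0 oppr0 expR0 cos0 mulr1.
have Q0 : Q 0 = 0 by rewrite /Q !mulr0 sin0 mulr0.
rewrite P0 in e1; rewrite Q0 oppr0 in e2.
have -> : LT (fun x => RtoC (hv x)) (Complex a b) = Complex p (- q).
  apply: C_ext => /=.
  - apply: eq_Rintegral => x _; rewrite !mul0r !mulr0 !subr0 add0r cosN //.
  - rewrite -rintN//; apply: eq_Rintegral => x _; rewrite !mul0r !mulr0 subr0 add0r addr0 sinN.
    by rewrite /Q; ring.
have nz : Complex a b != 0 :> C by apply/eqP => /(congr1 Re)/= h; move: a0; rewrite h ltxx.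
apply: (mulfI nz); rewrite divff//.
apply: C_ext; rewrite ?ReM ?ImM /=; lra.
Qed.

Lemma LT_shift_heaviside s (y : R) : 0 < Re s ->
  cintT (fun x => RtoC (hv (x - y)) * cexp (- (s * RtoC x))) = cexp (- (s * RtoC y)) / s.
Proof.
move=> s0.
have l1 : lapl (fun x => RtoC (hv x)).
  apply: (@lapl_bdd _ 1) => [|x x0|x]; first by apply: cmea_RtoC; exact: mea_hv.
    by rewrite hv_lt0.
  by rewrite cnorm_RtoC hv_norm.
have il := lapl_cinteg l1 s0.
rewrite -(LT_heaviside s0) /LT -cintZ// -(cint_shift (- y) (cintegZ _ il)).
apply: eq_cint => x; rewrite mulrCA; congr (_ * _); rewrite -cexpD; congr cexp.
by rewrite RtoCD RtoCN; ring.
Qed.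
End Laplace.

(** * Analyticity of Laplace transforms and the transform of a primitive *)

Section Laplace2.
Variable R : realType.
Local Notation mu := (@lebesgue_measure R).
Local Notation rint := (Rintegral mu setT).
Local Notation cintT := (cint setT).
Local Notation C := R[i].
Local Notation Re := (@complex.Re R).
Local Notation Im := (@complex.Im R).
Implicit Types (g : R -> C) (s : C).

Lemma mvt_abs (f df : R -> R) (y K : R) : (forall z : R, is_derive z (1 : R) f (df z)) ->
  (forall z, `|z| <= `|y| -> `|df z| <= K) -> `|f y - f 0| <= K * `|y|.
Proof.
move=> d h; have := @mvt_le R f df 0 y 0 K (fun z _ => d z); rewrite mul0r !subr0; apply.
by move=> z /between_norm[_]; rewrite !subr0; exact: h.
Qed.

Lemma expR_taylor1 (a : R) : `|expR a - 1| <= expR `|a| * `|a|.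
Proof.
rewrite -expR0; apply: (@mvt_abs (@expR R) (@expR R)) => z hz.
by rewrite ger0_norm ?expR_ge0// ler_expR (le_trans _ hz)// ler_norm.
Qed.

Lemma expR_taylor2 (a : R) : `|expR a - 1 - a| <= expR `|a| * `|a| ^+ 2.
Proof.
rewrite expr2 mulrA.
have -> : expR a - 1 - a = (expR a - a) - (expR 0 - 0) by rewrite expR0 subr0; ring.
apply: (@mvt_abs (fun z => expR z - z) (fun z => expR z - 1)) => z hz; apply: le_trans (expR_taylor1 z) _; apply: ler_pM => //.
by rewrite ler_expR.
Qed.

Lemma cos_taylor (b : R) : `|cos b - 1| <= `|b| ^+ 2.
Proof.
rewrite -cos0 expr2; apply: (@mvt_abs (@cos R) (fun z => - sin z)) => z hz.
by rewrite normrN; apply: le_trans hz; have := sin_lip z 0; rewrite sin0 !subr0.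
Qed.

Lemma sin_taylor (b : R) : `|sin b - b| <= `|b| ^+ 2.
Proof.
have : `|sin b - b| <= 2 * `|b|.
  by have := sin_lip b 0; rewrite sin0 !subr0; have := ler_normB (sin b) b; lra.
move=> h1; have [b2|b2] := leP 2 `|b|; first by apply: le_trans h1 _; rewrite expr2 ler_wpM2r.
have -> : sin b - b = (sin b - b) - (sin 0 - 0) by rewrite sin0 !subr0.
rewrite expr2; apply: (@mvt_abs (fun z => sin z - z) (fun z => cos z - 1)) => z hz.
have cz : `|cos z - 1| <= `|z| by have := cos_lip z 0; rewrite cos0 subr0.
exact: le_trans cz hz.
Qed.

(** The remainder splits into four real terms, each at most N^2 exp(N) with N = |z|; hence the 4. *)
Lemma cexp_taylor (z : C) : cnorm (cexp z - 1 - z) <= 4 * cnorm z ^+ 2 * expR (cnorm z).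
Proof.
case: z => a b; set N := cnorm (Complex a b).
have N0 : 0 <= N := cnorm_ge0 _.
have aN : `|a| <= N := norm_Re (Complex a b).
have bN : `|b| <= N := norm_Im (Complex a b).
have eN : expR `|a| <= expR N by rewrite ler_expR.
have ea : expR a <= expR N by rewrite ler_expR (le_trans _ aN)// ler_norm.
have e0 := expR_ge0 N.
have a2 : `|a| ^+ 2 <= N ^+ 2 by rewrite ler_pXn2r ?nnegrE.
have b2 : `|b| ^+ 2 <= N ^+ 2 by rewrite ler_pXn2r ?nnegrE.
have ab : `|a| * `|b| <= N ^+ 2 by rewrite expr2 ler_pM.
have n2 : 0 <= N ^+ 2 by rewrite sqr_ge0.
have T1 : `|expR a * (cos b - 1)| <= N ^+ 2 * expR N.
  rewrite normrM (ger0_norm (expR_ge0 _)) mulrC ler_pM ?expR_ge0//; exact: le_trans (cos_taylor b) b2.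
have T2 : `|expR a - 1 - a| <= N ^+ 2 * expR N.
  by apply: le_trans (expR_taylor2 a) _; rewrite mulrC ler_pM ?sqr_ge0 ?expR_ge0.
have T3 : `|expR a * (sin b - b)| <= N ^+ 2 * expR N.
  rewrite normrM (ger0_norm (expR_ge0 _)) mulrC ler_pM ?expR_ge0//; exact: le_trans (sin_taylor b) b2.
have T4 : `|(expR a - 1) * b| <= N ^+ 2 * expR N.
  rewrite normrM; apply: le_trans (ler_wpM2r (normr_ge0 b) (expR_taylor1 a)) _.
  by rewrite -mulrA mulrC ler_pM ?expR_ge0// mulr_ge0.
apply: le_trans (cnorm_le _) _; rewrite !ReD !ImD !ReN !ImN /=.
have -> : expR a * cos b - 1 - a = expR a * (cos b - 1) + (expR a - 1 - a) by ring.
have -> : expR a * sin b - 0 - b = expR a * (sin b - b) + (expR a - 1) * b by ring.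
have -> : 4 * N ^+ 2 * expR N = (N ^+ 2 * expR N + N ^+ 2 * expR N) + (N ^+ 2 * expR N + N ^+ 2 * expR N) by ring.
by apply: lerD; apply: le_trans (ler_normD _ _) _; apply: lerD.
Qed.

Lemma sqr_le_expR (c x : R) : 0 < c -> 0 <= x -> x ^+ 2 <= 2 / c ^+ 2 * expR (c * x).
Proof.
move=> c0 x0; have := @expR_ge1Dxn R (c * x) 1 (mulr_ge0 (ltW c0) x0); rewrite exprMn (_ : 2`! = 2)// => h.
have c2 : 0 < c ^+ 2 by exact: exprn_gt0.
have -> : 2 / c ^+ 2 * expR (c * x) = (2 * expR (c * x)) / c ^+ 2 by ring.
rewrite ler_pdivlMr// mulrC; lra.
Qed.

Lemma LT_cderiv g s : lapl g -> 0 < Re s -> exists l, cderiv_at (LT g) s l.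
Proof.
move=> lg s0; have [mg cg ig] := lg.
(* The decay exp(- Re s x) is spent in quarters: one absorbs the factor x^2, one the growth exp(|h|
   x) for |h| < c, and two remain in the majorant [w]. *)
pose c := Re s / 4; have c0 : 0 < c by rewrite divr_gt0.
have iw := ig (c + c) (addr_gt0 c0 c0).
pose A := 2 / c ^+ 2; have A0 : 0 <= A by rewrite divr_ge0// exprn_ge0// ltW.
pose w x := A * (cnorm (g x) * expR (- ((c + c) * x))).
have iw' : integ w by exact: integZ.
have w0 x : 0 <= w x by apply: mulr_ge0 => //; apply: mulr_ge0; [exact: cnorm_ge0|exact: expR_ge0].
have sE : Re s = c + c + c + c by rewrite /c; field.
have xw x : 0 <= x -> x ^+ 2 * expR (c * x) * (cnorm (g x) * expR (- (Re s * x))) <= w x.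
  move=> x0; rewrite /w [A * _]mulrCA [leLHS]mulrCA ler_wpM2l ?cnorm_ge0//.
  rewrite -mulrA -expRD; apply: le_trans (ler_wpM2r (expR_ge0 _) (sqr_le_expR c0 x0)) _.
  rewrite -/A -mulrA -expRD sE; apply: ler_wpM2l => //; rewrite ler_expR; lra.
pose k x := g x * cexp (- (s * RtoC x)).
have ik : cinteg k by exact: lapl_cinteg.
pose k1 x := - RtoC x * k x.
have mk1 : cmea k1 by apply: cmeaM; [apply: cmeaN; apply: cmea_RtoC|exact: (cinteg_mea ik)].
have ik1 : cinteg k1.
  apply: (cinteg_dom mk1 (integD (cinteg_norm ik) iw')) => x.
  have [x0|x0] := leP 0 x; last first.
    by rewrite /k1 /k cg// mul0r mulr0 cnorm0 addr_ge0.
  rewrite /k1 cnormM cnormN cnorm_RtoC ger0_norm//.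
  have h := xw x x0; rewrite -cnorm_ker -cnormM -/(k x) in h.
  have e1 : 1 <= expR (c * x) by rewrite -expR0 ler_expR mulr_ge0// ltW.
  have n0 := cnorm_ge0 (k x).
  have : x * cnorm (k x) <= (1 + x ^+ 2) * cnorm (k x) by rewrite ler_wpM2r//; nra.
  have : x ^+ 2 * cnorm (k x) <= x ^+ 2 * expR (c * x) * cnorm (k x).
    by rewrite ler_wpM2r// ler_peMr// sqr_ge0.
  lra.
exists (cintT k1) => e e0; pose M := 2 * (4 * rint w) + 1.
have rw0 : 0 <= rint w by exact: rint_ge0.
have M0 : 0 < M by apply: ltr_wpDl => //; apply: mulr_ge0 => //; exact: mulr_ge0.
exists (Num.min c (e / M)); first by rewrite lt_min c0 divr_gt0.
move=> h h0; rewrite lt_min => /andP[hc]; rewrite ltr_pdivlMr// => he.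
have n0 : 0 < cnorm h by rewrite cnorm_gt0.
have sh : 0 < Re (s + h).
  by rewrite ReD; have := norm_Re h; rewrite ler_norml => /andP[h1 _]; rewrite sE; lra.
have ih := lapl_cinteg lg sh.
pose E x := k x * (cexp (- (h * RtoC x)) - 1 - - (h * RtoC x)).
have EE x : E x = g x * cexp (- ((s + h) * RtoC x)) - k x - h * k1 x.
  by rewrite /E /k1 /k mulrDl opprD cexpD; ring.
have iE : cinteg E.
  apply: eq_cinteg (cintegB (cintegB ih ik) (cintegZ h ik1)) => x.
  by rewrite EE.
have -> : (LT g (s + h) - LT g s) / h - cintT k1 = h^-1 * cintT E.
  rewrite (_ : E = fun x => g x * cexp (- ((s + h) * RtoC x)) - k x - h * k1 x); last exact/funext.
  rewrite cintB ?cintB ?cintZ//; [|exact: cintegB|exact: cintegZ].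
  by rewrite /LT mulrBr [_ * (h * _)]mulrA mulVf// mul1r mulrC.
rewrite cnormM cnormV ltr_pdivrMl//.
have Eb x : cnorm (E x) <= 4 * cnorm h ^+ 2 * w x.
  have [x0|x0] := leP 0 x; last first.
    rewrite /E /k cg// !mul0r cnorm0; apply: mulr_ge0 => //.
    by apply: mulr_ge0 => //; exact: sqr_ge0.
  rewrite /E cnormM; apply: le_trans (ler_wpM2l (cnorm_ge0 _) (cexp_taylor _)) _.
  rewrite cnormN cnormM cnorm_RtoC (ger0_norm x0) exprMn.
  have -> : cnorm (k x) * (4 * (cnorm h ^+ 2 * x ^+ 2) * expR (cnorm h * x)) =
      4 * cnorm h ^+ 2 * (x ^+ 2 * expR (cnorm h * x) * cnorm (k x)) by ring.
  apply: ler_wpM2l; first by apply: mulr_ge0 => //; exact: sqr_ge0.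
  apply: le_trans (xw x x0); rewrite /k cnormM cnorm_ker.
  apply: ler_wpM2r; first by rewrite mulr_ge0 ?cnorm_ge0 ?expR_ge0.
  by apply: ler_wpM2l; [exact: sqr_ge0|rewrite ler_expR ler_wpM2r// ltW].
have := cnorm_cint (cinteg_mea iE) (integZ _ iw') Eb; rewrite rintZ//.
move=> H; apply: le_lt_trans H _.
have -> : 2 * (4 * cnorm h ^+ 2 * rint w) = cnorm h * (cnorm h * (2 * (4 * rint w))) by ring.
rewrite ltr_pM2l//; apply: le_lt_trans he; by rewrite ler_wpM2l ?cnorm_ge0// /M lerDl.
Qed.

(** Fubini: the primitive at x is the integral of g(y) over y <= x, and the Heaviside function
    shifted to y has transform exp(- s y) / s. *)
Lemma LT_primitive g s (M : R) : cmea g -> (forall x, x < 0 -> g x = 0) -> (forall x, cnorm (g x) <= M) -> 0 < Re s ->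
  LT (fun x => RtoC (hv x) * cint `[0, x] g) s = LT g s / s.
Proof.
move=> mg cg gM s0; have M0 : 0 <= M by exact: le_trans (cnorm_ge0 _) (gM 0).
have lg := lapl_bdd mg cg gM.
have [mg1 mg2] := mg.
pose F (z : R * R) : C := g z.1 * (RtoC (hv (z.2 - z.1)) * (RtoC (hv z.2) * cexp (- (s * RtoC z.2)))).
have mk : cmea (fun x => RtoC (hv x) * cexp (- (s * RtoC x))).
  by apply: cmeaM; [apply: cmea_RtoC; exact: mea_hv|exact: cmea_ker].
have [mk1 mk2] := mk.
have mF : cmea2 F.
  apply: cmea2M; first by split; [exact: (mea_prod1 mg1)|exact: (mea_prod1 mg2)].
  apply: cmea2M; last by split; [exact: (mea_prod2 mk1)|exact: (mea_prod2 mk2)].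
  split => /=; last exact: measurable_cst.
  apply: (measurableT_comp (@mea_hv R)); apply: measurable_funB; [exact: measurable_snd|exact: measurable_fst].
have l1 : lapl (fun x : R => RtoC (hv x)).
  apply: (@lapl_bdd _ _ 1) => [|x x0|x]; first by apply: cmea_RtoC; exact: mea_hv.
    by rewrite hv_lt0.
  by rewrite cnorm_RtoC hv_norm.
have ik := lapl_cinteg l1 s0.
have e1 : (fun x => RtoC (hv x) * cint `[0, x] g * cexp (- (s * RtoC x))) = (fun x => cintT (fun y => F (y, x))).
  apply/funext => x; have [x0|x0] := leP 0 x; last first.
    rewrite hv_lt0// !mul0r (_ : (fun y => F (y, x)) = fun=> 0); last first.
      by apply/funext => y; rewrite /F /= (hv_lt0 x0) !(mul0r, mulr0).
    by rewrite /cint /= Rintegral_cst// mul0r.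
  have ig : cinteg (fun y => g y * RtoC (\1_(`[0, x]%classic) y)).
    apply: (cinteg_dom _ (integZ M (integ_indic 0 x))).
      by apply: cmeaM => //; apply: cmea_RtoC; exact: measurable_indic.
    move=> y; rewrite cnormM cnorm_RtoC ger0_norm; last by rewrite indicE.
    by rewrite ler_wpM2r// indicE.
  rewrite hv_ge0// mul1r cint_mkcond mulrC -cintZ//; apply: eq_cint => y.
  rewrite /F /= (hv_ge0 x0) mul1r.
  have [y0|y0] := ltP y 0; first by rewrite cg// !mul0r mulr0.
  suff -> : (\1_(`[0, x]%classic) y : R) = hv (x - y) by ring.
  rewrite indicE /hv subr_ge0; case: (boolP (y <= x)) => yx.
    by rewrite mem_set//= in_itv/= y0.
  by rewrite memNset//= in_itv/= => /andP[_ h]; rewrite h in yx.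
have iF y : cinteg (fun x => F (y, x)).
  rewrite /F /=; apply: cintegZ; have mh : cmea (fun x => RtoC (hv (x - y))).
    by apply: cmea_RtoC; apply: (measurableT_comp (@mea_hv R)); apply: measurable_funB.
  have bh x : cnorm (RtoC (hv (x - y))) <= 1 by rewrite cnorm_RtoC; exact: hv_norm.
  by apply: eq_cinteg (cintegM_bdd ik mh bh) => x; exact: mulrC.
have e2 : (fun y => cintT (fun x => F (y, x))) = (fun y => g y * (cexp (- (s * RtoC y)) / s)).
  apply/funext => y; have [y0|y0] := ltP y 0.
    rewrite cg// mul0r (_ : (fun x => F (y, x)) = fun=> 0); last first.
      by apply/funext => x; rewrite /F /= cg// mul0r.
    by rewrite /cint /= Rintegral_cst// mul0r.
  rewrite -LT_shift_heaviside// -cintZ; last first.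
    apply: eq_cinteg (cinteg_shift (- y) (cintegZ (cexp (- (s * RtoC y))) ik)) => x.
    rewrite mulrCA; congr (_ * _); rewrite -cexpD; congr cexp; rewrite RtoCD RtoCN; ring.
  apply: eq_cint => x; rewrite /F /=; congr (_ * _).
  have [x0|x0] := leP 0 x; first by rewrite (hv_ge0 x0) mul1r.
  by rewrite (hv_lt0 x0) (@hv_lt0 _ (x - y)) ?mul0r//; lra.
have H0 : rint (fun x => hv x * expR (- (Re s * x))) = rint (fun x => hv x * expR (- (Re s * x))) by [].
pose m := rint (fun x => hv x * expR (- (Re s * x))).
have sh y : 0 <= y -> rint (fun x => hv (x - y) * expR (- (Re s * x))) = expR (- (Re s * y)) * m.
  move=> y0; have ihe := integ_hv_exp s0.
  rewrite /m -rintZ// -(rint_shift (- y) (integZ _ ihe)); apply: eq_Rintegral => x _.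
  by rewrite mulrCA -expRD; congr (_ * expR _); ring.
rewrite /LT e1 -(@cfubini R F (fun y => cnorm (g y) * (expR (- (Re s * y)) * m))).
- rewrite e2 mulrC -cintZ; last exact: lapl_cinteg.
  by apply: eq_cint => y; ring.
- exact: mF.1.
- exact: mF.2.
- exact: iF.
- move=> y; have [y0|y0] := ltP y 0.
    by rewrite cg// cnorm0 mul0r (@rint_eq0 R)// => x; rewrite /F /= cg// mul0r cnorm0.
  have ish : integ (fun x => hv (x - y) * expR (- (Re s * x))).
    apply: eq_integ (integ_shift (- y) (integZ (expR (- (Re s * y))) (integ_hv_exp s0))) => x.
    by rewrite mulrCA -expRD; congr (_ * expR _); ring.
  rewrite -sh// -rintZ//; apply: le_rint; [exact/cinteg_norm/iF|exact: integZ|].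
  move=> x; rewrite /F /= !cnormM cnorm_ker !cnorm_RtoC ler_wpM2l ?cnorm_ge0//.
  have /andP[p1 p2] := hv01 (x - y); have /andP[p3 p4] := hv01 x.
  by rewrite !ger0_norm// ler_wpM2l// ler_piMl// expR_ge0.
- have [_ _ ig] := lg; apply: eq_integ (integZ m (ig _ s0)) => x; ring.
Qed.

Lemma cderiv_cnorm (F : C -> C) (z l : C) : cderiv_at F z l -> forall e : R, 0 < e ->
  exists2 d : R, 0 < d & forall h : C, cnorm h < d -> cnorm (F (z + h) - F z - l * h) <= e * cnorm h.
Proof.
move=> H e e0; have [d d0 hd] := H e e0; exists d => // h hh.
have [->|h0] := eqVneq h 0; first by rewrite addr0 subrr mulr0 subrr cnorm0 mulr0.
have -> : F (z + h) - F z - l * h = ((F (z + h) - F z) / h - l) * h by rewrite mulrBl divfK.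
by rewrite cnormM ler_wpM2r ?cnorm_ge0// ltW// hd.
Qed.

(** The Cauchy-Riemann equations u_x - v_y = 0 and v_x + u_y = 0, each read as a vanishing
    divergence. *)
Lemma cderiv_dfree (F : C -> C) (x y : R) (l : C) : cderiv_at F (Complex x y) l ->
  dfree (fun x y => Re (F (Complex x y))) (fun x y => - Im (F (Complex x y))) x y /\
  dfree (fun x y => Im (F (Complex x y))) (fun x y => Re (F (Complex x y))) x y.
Proof.
move=> /cderiv_cnorm H.
have key e : 0 < e -> exists2 d : R, 0 < d & forall h k : R, `|h| < d -> `|k| < d ->
   `|Re (F (Complex (x + h) (y + k))) - Re (F (Complex x y)) - (Re l * h - Im l * k)| <= e * (`|h| + `|k|) /\
   `|Im (F (Complex (x + h) (y + k))) - Im (F (Complex x y)) - (Im l * h + Re l * k)| <= e * (`|h| + `|k|).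
  move=> e0; have [d d0 hd] := H e e0; exists (d / 2); first by rewrite divr_gt0.
  move=> h k hh hk; have nh : cnorm (Complex h k) <= `|h| + `|k| := cnorm_le (Complex h k).
  have := hd (Complex h k) ltac:(lra).
  rewrite (_ : Complex x y + Complex h k = Complex (x + h) (y + k)); last exact: C_ext.
  set W := _ - _ * _ => hW.
  have hW' : cnorm W <= e * (`|h| + `|k|) by apply: le_trans hW _; rewrite ler_wpM2l// ltW.
  have rW := le_trans (norm_Re W) hW'; have iW := le_trans (norm_Im W) hW'.
  rewrite /W !ReB ReM /= in rW; rewrite /W !ImB ImM /= in iW; split => //.
  by rewrite [X in _ - X]addrC.
split.
- exists (Re l), (- Im l), (- Im l) => e e0; have [d d0 hd] := key e e0; exists d => // h k hh hk.
  have [h1 h2] := hd h k hh hk; split; first by rewrite mulNr.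
  by rewrite -normrN; move: h2; congr (`|_| <= _); ring.
- exists (Im l), (Re l), (Re l) => e e0; have [d d0 hd] := key e e0; exists d => // h k hh hk.
  by have [h1 h2] := hd h k hh hk; split.
Qed.

Lemma cderivB (F G : C -> C) z l1 l2 : cderiv_at F z l1 -> cderiv_at G z l2 -> cderiv_at (fun s => F s - G s) z (l1 - l2).
Proof.
move=> H1 H2 e e0; have e2 : 0 < e / 2 by rewrite divr_gt0.
have [d1 d10 h1] := H1 _ e2; have [d2 d20 h2] := H2 _ e2.
exists (Num.min d1 d2) => [|h h0]; first by rewrite lt_min d10.
rewrite lt_min => /andP[hh1 hh2].
rewrite (_ : _ - _ = ((F (z + h) - F z) / h - l1) - ((G (z + h) - G z) / h - l2)); last ring.
by apply: le_lt_trans (cnormB _ _) _; rewrite (splitr e) ltrD ?h1 ?h2.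
Qed.

Lemma cderiv_refl (F : C -> C) z l : cderiv_at F (- z) l -> cderiv_at (fun s => F (- s)) z (- l).
Proof.
move=> H e e0; have [d d0 hd] := H e e0; exists d => // h h0 hh.
have := hd (- h); rewrite oppr_eq0 cnormN => /(_ h0 hh).
rewrite (opprD z h) -cnormN invrN; congr (cnorm _ < _); ring.
Qed.
End Laplace2.

(** * Very slowly decreasing functions *)

Section Vsd.
Variable R : realType.
Local Notation mu := (@lebesgue_measure R).
Local Notation rint := (Rintegral mu setT).
Local Notation C := R[i].
Local Notation Re := (@complex.Re R).
Local Notation Im := (@complex.Im R).

Lemma mono_integ (Fn : nat -> R -> R) (F : R -> R) (B : R) : (forall n, integ (Fn n)) ->
  (forall n x, 0 <= Fn n x) -> (forall x m n, (m <= n)%N -> Fn m x <= Fn n x) ->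
  (forall x, Fn ^~ x @ \oo --> F x) -> (forall n, rint (Fn n) <= B) ->
  integ F /\ (forall n x, Fn n x <= F x).
Proof.
move=> iFn F0 Fm cF FB.
have FnF n x : Fn n x <= F x.
  rewrite -(cvg_lim _ (cF x))//; apply: limr_ge; first by apply/cvg_ex; eexists; exact: cF.
  by exists n => // m /= nm; exact: Fm.
split => //.
have mF : measurable_fun setT F.
  by apply: (@measurable_fun_cvg _ _ _ setT Fn) => [m|x _]; [exact: integ_mea|exact: cF].
have Fge x : 0 <= F x by exact: le_trans (F0 0%N x) (FnF 0%N x).
apply/integrableP; split; first exact: mea_EFin.
have -> : (\int[mu]_x `|(EFin \o F) x| = \int[mu]_x (F x)%:E)%E.
  by apply: eq_integral => x _ /=; rewrite ger0_norm.
have E : (\int[mu]_x (F x)%:E = limn (fun n => \int[mu]_x (Fn n x)%:E))%E.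
  rewrite -(@monotone_convergence _ _ _ mu setT measurableT (fun n x => (Fn n x)%:E)).
  - apply: eq_integral => x _; apply/esym/cvg_lim => //; apply: cvg_EFin; first exact: nearW.
    exact: cF.
  - by move=> n; exact: (mea_EFin (integ_mea (iFn n))).
  - by move=> n x _; rewrite lee_fin.
  - by move=> x _ m n mn; rewrite lee_fin Fm.
rewrite E; apply: (@le_lt_trans _ _ B%:E); last exact: ltry.
apply: lime_le.
  apply: ereal_nondecreasing_is_cvgn => m n mn; apply: ge0_le_integral => //.
  - by move=> x _; rewrite lee_fin.
  - exact: (mea_EFin (integ_mea (iFn m))).
  - exact: (mea_EFin (integ_mea (iFn n))).
  - by move=> x _; rewrite lee_fin Fm.
apply: nearW => n; rewrite -(fineK (integrable_fin_num measurableT (iFn n))) lee_fin.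
exact: FB.
Qed.

Lemma vsd_steps (f : R -> R) (dl eps X : R) n : 0 < dl -> 0 <= eps ->
  (forall x h, X <= x -> 0 <= h <= dl -> - eps <= f (x + h) - f x) ->
  forall x h, X <= x -> 0 <= h <= n%:R * dl -> - (n%:R * eps) <= f (x + h) - f x.
Proof.
move=> dl0 e0 H; elim: n => [|n IH] x h hx.
  rewrite !mul0r => hh; have -> : h = 0 by apply/eqP; rewrite eq_le andbC.
  by rewrite addr0 subrr oppr0.
rewrite -natr1 !mulrDl !mul1r => /andP[h0 hh].
have [h1|h1] := leP h dl.
  have := H x h hx; rewrite h0 h1 => /(_ isT); have : 0 <= n%:R * eps by rewrite mulr_ge0.
  lra.
have A := H (x + (h - dl)) dl ltac:(lra) ltac:(lra).
have B := IH x (h - dl) hx ltac:(lra).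
rewrite -addrA subrK in A; lra.
Qed.

(** The length in the definition is immaterial: n windows of that length cover [La], each at the
    price eps / (n + 1). *)
Lemma vsd_window (f : R -> R) (La eps : R) : vsd_real f -> 0 < eps -> exists X : R, forall x h : R,
  X <= x -> 0 <= h <= La -> - eps <= f (x + h) - f x.
Proof.
move=> [dl dl0 H] e0; have [n _ /(_ n (leqnn n))/= hn] := @nbhs_infty_gtr R (La / dl).
have n1 : 0 < n%:R + 1 :> R by rewrite ltr_wpDl.
have [X hX] := H (eps / (n%:R + 1)) (divr_gt0 e0 n1).
exists X => x h hx /andP[h0 hL].
have hn' : 0 <= h <= n%:R * dl.
  by rewrite h0 (le_trans hL)// ltW// -ltr_pdivrMr.
have := vsd_steps dl0 (ltW (divr_gt0 e0 n1)) hX hx hn'.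
move=> hh; apply: le_trans hh; rewrite lerN2 mulrCA ler_piMr ?(ltW e0)//.
by rewrite ler_pdivrMr// mul1r lerDl.
Qed.

(** About h / dl windows cover [x, x + h], and each costs at most 1, so the loss is at most linear
    in [h]. *)
Lemma vsd_drop (f : R -> R) : vsd_real f -> exists X : R, exists2 c : R, 0 <= c & forall x h : R,
  X <= x -> 0 <= h -> - (c * (1 + h)) <= f (x + h) - f x.
Proof.
move=> [dl dl0 H]; have [X hX] := H 1 ltr01.
exists X, (dl^-1 + 1) => [|x h hx h0]; first by rewrite addr_ge0// invr_ge0 ltW.
have hd : 0 <= h / dl by rewrite divr_ge0// ltW.
have /andP[n1 n2] := truncn_itv hd.
set n := Num.truncn (h / dl) in n1 n2.
have hn : 0 <= h <= n.+1%:R * dl by rewrite h0 ltW// -ltr_pdivrMr.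
have := vsd_steps dl0 ler01 hX hx hn; apply: le_trans.
rewrite lerN2 mulr1 -natr1 mulrDl mul1r; have : h / dl = dl^-1 * h by rewrite mulrC.
have : 0 < dl^-1 by rewrite invr_gt0.
by move: n1; set a := dl^-1 => n1 a0 e; rewrite e in n1; nra.
Qed.

Lemma vsd_lower (f : R -> R) : vsd_real f -> exists2 X : R, 0 <= X & exists2 c : R, 0 <= c & forall x,
  X <= x -> - (c * (1 + x)) <= f x.
Proof.
move=> /vsd_drop[X [c c0 hX]]; pose Y := Num.max X 0.
have XY : X <= Y by rewrite le_max lexx.
have Y0 : 0 <= Y by rewrite le_max lexx orbT.
exists Y => //; exists (c + `|f Y|) => [|x hx]; first exact: addr_ge0.
have := hX Y (x - Y) XY; rewrite subr_ge0 hx subrKC => /(_ isT).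
have := ler_norm (- f Y); rewrite normrN; have := normr_ge0 (f Y); nra.
Qed.

Lemma loc_integrable_cmea (f : R -> C) : loc_integrable f -> cmea f.
Proof.
move=> lf.
have cut (g : R -> R) x : g x * \1_(`[- n%:R, n%:R]%classic : set R) x @[n --> \oo] --> g x.
  have [N _ /(_ _)/= hN] := @nbhs_infty_gtr R `|x|.
  apply: cvg_near_cst; exists N => // n /= Nn.
  rewrite indicE mem_set ?mulr1//= in_itv/= -ler_norml ltW//; exact: hN.
split.
- apply: (@measurable_fun_cvg _ _ _ setT (fun n x => Re (f x) * \1_(`[- n%:R, n%:R]%classic : set R) x)) => [n|x _]; last exact: (cut (fun x => Re (f x)) x).
  by have [h _] := lf (- n%:R) n%:R; apply: integ_mea; apply/(integ_mkcond _ (measurable_itv _)).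
- apply: (@measurable_fun_cvg _ _ _ setT (fun n x => Im (f x) * \1_(`[- n%:R, n%:R]%classic : set R) x)) => [n|x _]; last exact: (cut (fun x => Im (f x)) x).
  by have [_ h] := lf (- n%:R) n%:R; apply: integ_mea; apply/(integ_mkcond _ (measurable_itv _)).
Qed.

Definition loc_integ (f : R -> R) := forall a b : R, integ (fun x => f x * ind a b x).

Lemma ind_indic (a b x : R) : \1_(`[a, b]%classic) x = ind a b x.
Proof.
rewrite indicE; have [h|h] := pselect (a <= x <= b); first by rewrite ind_in// mem_set//= in_itv.
by rewrite ind_out// memNset//= in_itv.
Qed.

(** The lower bound by a linear function makes the convergence absolute: past [X] the function f + c
    (1 + x) is nonnegative, its truncated integrals are bounded because the improper integral
    converges, and monotone convergence applies. Before [X] local integrability suffices. *)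
Lemma improper_abs (f : R -> R) (sg l : R) : measurable_fun setT f -> loc_integ f -> (forall x, x < 0 -> f x = 0) -> vsd_real f ->
  0 < sg -> sint (fun x => f x * expR (- (sg * x))) 0 T @[T --> +oo] --> l ->
  integ (fun x => f x * expR (- (sg * x))).
Proof.
move=> mf lf cf vf sg0 cl; have [X X0 [c c0 low]] := vsd_lower vf.
pose E x := expR (- (sg * x)).
have mE : measurable_fun setT E by exact: mea_expRN.
have E0 x : 0 <= E x by exact: expR_ge0.
have E1 x : 0 <= x -> `|E x| <= 1.
  by move=> x0; rewrite ger0_norm// -expR0 ler_expR oppr_le0 mulr_ge0// ltW.
pose q x := hv (x - X) * ((f x + c * (1 + x)) * E x).
have mhX : measurable_fun setT (fun x : R => hv (x - X)).
  by apply: (measurableT_comp (@mea_hv R)); apply: measurable_funB.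
have q0 x : 0 <= q x.
  rewrite /q /hv subr_ge0; case: ifP => [hx|_]; last by rewrite mul0r.
  by rewrite mul1r mulr_ge0//; have := low x hx; lra.
have ib (g w : R -> R) a b : integ (fun x => g x * ind a b x) -> measurable_fun setT w -> (forall x, a <= x <= b -> `|w x| <= 1) ->
    integ (fun x => g x * ind a b x * w x).
  move=> ig mw hw; apply: eq_integ (integM_bdd (g := fun x => ind a b x * w x) ig _ (M := 1) _) => [x||x].
  - have [h|h] := pselect (a <= x <= b); first by rewrite ind_in// mul1r.
    by rewrite ind_out// !(mulr0, mul0r).
  - by apply: measurable_funM => //; exact: (mea_ind _ _ (@measurable_id _ _ _)).
  - have [h|h] := pselect (a <= x <= b); first by rewrite ind_in// mul1r hw.
    by rewrite ind_out// mul0r normr0 ler01.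
have iexp := integZ c (integ_hv_lin_exp sg0).
have ifE (T : R) : integ (fun x => f x * ind 0 T x * E x).
  by apply: ib => // x /andP[x0 _]; exact: E1.
have ifEX : integ (fun x => f x * ind 0 X x * E x * hv (X - x)).
  apply: (@integM_bdd R _ _ 1 (ifE X)) => [|x]; last exact: hv_norm.
  by apply: (measurableT_comp (@mea_hv R)); apply: measurable_funB.
have bL : exists B : R, forall n : nat, rint (fun x => f x * ind 0 n%:R x * E x) <= B.
  have : (fun n : nat => sint (fun x => f x * E x) 0 n%:R) @ \oo --> l.
    by apply: (cvg_comp _ _ (@cvgr_idn R) cl).
  move=> /cvgP/cvg_seq_bounded[B [_ hB]]; exists (B + 1) => n.
  apply: le_trans (ler_norm _) _; have := hB (B + 1) ltac:(by rewrite ltrDl) n Logic.I.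
  rewrite /= sint_ind; congr (`|_| <= _); apply: eq_Rintegral => x _; ring.
have [B hB] := bL.
have E2 x : f x * ind 0 X x * E x * (1 - hv (x - X)) = f x * E x * (1 - hv (x - X)).
  have [x0|x0] := ltP x 0; first by rewrite cf// !mul0r.
  rewrite /hv subr_ge0; have [hx|hx] := leP X x; first by rewrite subrr !mulr0.
  by rewrite ind_in ?mulr1// x0 ltW.
have iR1 : integ (fun x => f x * E x * (1 - hv (x - X))).
  apply: eq_integ (@integM_bdd R _ (fun x => 1 - hv (x - X)) 1 (ifE X) _ _) => [x||x].
  - by rewrite -E2.
  - by apply: measurable_funB.
  - by have /andP[h1 h2] := hv01 (x - X); rewrite ler_norml; lra.
have mono : integ q.
  pose qn (n : nat) x := q x * ind 0 n%:R x.
  have iqn n : integ (qn n).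
    have i1 : integ (fun x => hv (x - X) * (f x * ind 0 n%:R x * E x + c * (hv x * ((1 + x) * E x)) * ind 0 n%:R x)).
      apply: eq_integ (@integM_bdd R (fun x => f x * ind 0 n%:R x * E x + c * (hv x * ((1 + x) * E x)) * ind 0 n%:R x) (fun x => hv (x - X)) 1 _ _ _) => [x||//|x]; [exact: mulrC| |exact: hv_norm].
      apply: integD; first exact: ifE.
      apply: (integM_bdd iexp _ (M := 1)); first exact: (mea_ind _ _ (@measurable_id _ _ _)).
      by move=> x; rewrite /ind; case: ifP; rewrite ?normr1 ?normr0.
    apply: eq_integ i1 => x; rewrite /qn /q; have [h|h] := pselect (0 <= x <= n%:R); last by rewrite ind_out// !(mulr0, mul0r) addr0 mulr0.
    have /andP[x0 _] := h; rewrite ind_in// !mulr1 (hv_ge0 x0); ring.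
  apply: (proj1 (mono_integ (Fn := qn) (B := B + rint (fun x => `|f x * E x * (1 - hv (x - X))|) + rint (fun x => c * (hv x * ((1 + x) * E x)))) _ _ _ _ _)) => //.
  - by move=> n x; rewrite /qn mulr_ge0// /ind; case: ifP.
  - move=> x m n mn; rewrite /qn ler_wpM2l// /ind.
    case: (boolP (0 <= x <= m%:R)) => [/andP[x0 xm]|_]; last by case: ifP.
    by rewrite x0 (le_trans xm)// ler_nat.
  - move=> x; rewrite /qn; have [x0|x0] := ltP x 0.
      have -> : q x = 0 by rewrite /q hv_lt0 ?mul0r//; lra.
      by under eq_fun do rewrite mul0r; exact: cvg_cst.
    have [N _ hN] := @nbhs_infty_gtr R x.
    apply: cvg_near_cst; exists N => // n /= Nn; rewrite ind_in ?mulr1// x0 ltW//; exact: hN.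
  - move=> n.
    have i2 : integ (fun x => f x * ind 0 n%:R x * E x) := ifE n%:R.
    have i3 := integ_norm iR1.
    apply: (@le_trans _ _ (rint (fun x => f x * ind 0 n%:R x * E x + `|f x * E x * (1 - hv (x - X))| + c * (hv x * ((1 + x) * E x))))).
      apply: le_rint => //; first by apply: integD => //; exact: integD.
      move=> x; rewrite /qn /q; have [h|h] := pselect (0 <= x <= n%:R).
        have x0 : 0 <= x by case/andP: h.
        rewrite ind_in// !mulr1 (hv_ge0 x0) mul1r.
        have := ler_norm (- (f x * E x * (1 - hv (x - X)))); rewrite normrN.
        have /andP[h1 h2] := hv01 (x - X); have : 0 <= c * ((1 + x) * E x) by rewrite !mulr_ge0//; lra.
        move: h1 h2; move: (`|_|) => N; have -> : (f x + c * (1 + x)) * E x = f x * E x + c * ((1 + x) * E x) by ring.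
        by move: (f x * E x) (hv (x - X)) (c * ((1 + x) * E x)) => A Hh D; nra.
      rewrite ind_out// !(mulr0, mul0r) add0r addr_ge0// mulr_ge0//.
      have [x0|x0] := leP 0 x; last by rewrite hv_lt0// mul0r.
      by rewrite !mulr_ge0//; [case/andP: (hv01 x)|lra].
    rewrite RintegralD//; last exact: integD.
    by rewrite RintegralD// !lerD2r; exact: hB.
have iR2 : integ (fun x => c * (hv x * ((1 + x) * E x)) * hv (x - X)).
  by apply: (integM_bdd iexp mhX (M := 1)) => x; exact: hv_norm.
apply: eq_integ (integD (integB mono iR2) iR1) => x; rewrite /q.
have [x0|x0] := ltP x 0.
  by rewrite (@hv_lt0 R x)// (@hv_lt0 R (x - X)) ?cf//; [ring|lra].
by rewrite (hv_ge0 x0) mul1r -/(E x); ring.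
Qed.
End Vsd.

(** * Absolute convergence of the given Laplace transform; the Riemann-Lebesgue lemma *)

Section LaplaceAbs.
Variable R : realType.
Local Notation mu := (@lebesgue_measure R).
Local Notation rint := (Rintegral mu setT).
Local Notation C := R[i].
Local Notation Re := (@complex.Re R).
Local Notation Im := (@complex.Im R).

(** Absolute convergence only depends on Re s, so it is proved at real points, where the kernel is
    real and the two parts of [tau] separate. *)
Lemma laplace_abs (tau : R -> C) (L : C -> C) : loc_integrable tau -> (forall x, x < 0 -> tau x = 0) ->
  (forall s, 0 < Re s -> laplace_conv tau s (L s)) -> vsd tau ->
  lapl tau /\ forall s, 0 < Re s -> L s = LT tau s.
Proof.
move=> lt ct cv [v1 v2]; have mt := loc_integrable_cmea lt.
have kE (sg x : R) : cexp (- (RtoC sg * RtoC x)) = RtoC (expR (- (sg * x))) :> C.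
  by rewrite -RtoCM -RtoCN cexp_RtoC.
have la : lapl tau.
  split => // sg sg0.
  have [c1 c2] := (ccvg_pinftyP _ _).1 (cv (RtoC sg) sg0).
  have i1 : integ (fun x => Re (tau x) * expR (- (sg * x))).
    apply: (@improper_abs R _ sg (Re (L (RtoC sg))) mt.1) => //.
    - by move=> a b; have [h _] := lt a b; move/(integ_mkcond _ (measurable_itv _)): h; apply: eq_integ => x; rewrite ind_indic.
    - by move=> x x0; rewrite ct.
    - move: c1; apply: cvg_trans; apply: near_eq_cvg; apply: nearW => T /=.
      by apply: eq_Rintegral => x _; rewrite kE ReM /= mulr0 subr0.
  have i2 : integ (fun x => Im (tau x) * expR (- (sg * x))).
    apply: (@improper_abs R _ sg (Im (L (RtoC sg))) mt.2) => //.
    - by move=> a b; have [_ h] := lt a b; move/(integ_mkcond _ (measurable_itv _)): h; apply: eq_integ => x; rewrite ind_indic.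
    - by move=> x x0; rewrite ct.
    - move: c2; apply: cvg_trans; apply: near_eq_cvg; apply: nearW => T /=.
      by apply: eq_Rintegral => x _; rewrite kE ImM /= mulr0 add0r.
  apply: (integ_dom _ (integD (integ_norm i1) (integ_norm i2))) => [|x].
    by apply: measurable_funM; [exact: mea_cnorm|exact: mea_expRN].
  rewrite !normrM ![`|expR _|]ger0_norm ?expR_ge0// ger0_norm ?cnorm_ge0// -mulrDl.
  by rewrite ler_wpM2r ?expR_ge0 ?cnorm_le.
split => // s s0; have [c1 c2] := (ccvg_pinftyP _ _).1 (cv s s0).
have [i1 i2] := lapl_cinteg la s0.
have E (f : R -> R) : (forall x, x < 0 -> f x = 0) -> (fun x => hv x * f x) = f.
  move=> f0; apply/funext => x; have [x0|x0] := ltP x 0; first by rewrite f0// mulr0.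
  by rewrite hv_ge0// mul1r.
have z1 x : x < 0 -> Re (tau x * cexp (- (s * RtoC x))) = 0 by move=> x0; rewrite ct// mul0r.
have z2 x : x < 0 -> Im (tau x * cexp (- (s * RtoC x))) = 0 by move=> x0; rewrite ct// mul0r.
have := @sint_pinfty R _ (integ_mea i1); rewrite E// => /(_ i1) d1.
have := @sint_pinfty R _ (integ_mea i2); rewrite E// => /(_ i2) d2.
by apply: C_ext; [apply: (cvg_unique _ c1 d1)|apply: (cvg_unique _ c2 d2)].
Qed.

Lemma cvg_squeeze_abs (f g : R -> R) (F : set_system R) : Filter F ->
  (\forall x \near F, `|f x| <= g x) -> g x @[x --> F] --> (0 : R) -> f x @[x --> F] --> (0 : R).
Proof.
move=> FF fg /cvgrPdist_lt g0; apply/cvgrPdist_lt => e e0; near=> x.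
rewrite sub0r normrN; apply: le_lt_trans (_ : `|f x| <= g x) _; first by near: x.
by apply: le_lt_trans (ler_norm _) _; rewrite -normrN -sub0r; near: x; exact: g0.
Unshelve. all: by end_near. Qed.

(** A shift by the half period pi / y changes the sign of [k], so twice the integral is the integral
    of f(t) - f(t + pi / y) against [k], and dominated convergence applies to the difference. The
    hypothesis on [k] covers cosine and sine together. *)
Lemma riemann_lebesgue (f k : R -> R) (M a : R) : measurable_fun setT f -> (forall x, `|f x| <= M) ->
  (forall x, ~ `[- a, a]%classic x -> f x = 0) -> {ae mu, forall x, {for x, continuous f}} ->
  measurable_fun setT k -> (forall x, `|k x| <= 1) -> (forall x : R, k (x + pi) = - k x) ->
  rint (fun t => f t * k (t * y)) @[y --> +oo] --> (0 : R).
Proof.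
move=> mf fM f0 cf mk k1 kpi; have M0 : 0 <= M := le_trans (normr_ge0 _) (fM 0).
have if_ := integ_bdd_supp mf fM f0.
have mky (y : R) : measurable_fun setT (fun t : R => k (t * y)).
  by apply: (measurableT_comp mk); exact: measurable_funM.
(* The maximum with 1 keeps every shift at most pi, so that one dominating function serves for all
   [y]. *)
pose V (y : R) := rint (fun t => `|f (t + pi / Num.max y 1) - f t|).
have my1 (y : R) : 1 <= Num.max y 1 by rewrite le_max lexx orbT.
have py (y : R) : 0 <= pi / Num.max y 1 <= pi.
  have p0 := pi_ge0 R; have := my1 y; move: (Num.max y 1) => m m1; have m0 : 0 < m by lra.
  by rewrite divr_ge0 ?(ltW m0)//= ler_pdivrMr// ler_peMr.
have mfy (y : R) : measurable_fun setT (fun t : R => f (t + pi / Num.max y 1)).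
  by apply: (measurableT_comp mf); exact: measurable_funD.
have Vc : V y @[y --> +oo] --> rint (fun x : R => `|f x - f x|).
  have ib := integZ (2 * M) (@integ_indic R (- a - pi) (a + pi)).
  apply: (dct_pinfty _ _ _ ib) => [y|||y x].
  - by apply: measurableT_comp => //; exact: measurable_funB.
  - by apply: measurableT_comp => //; exact: measurable_funB.
  - apply: (@filterS _ _ (ae_filter_ringOfSetsType mu) _ _ _ cf) => x cx.
    apply: cvg_norm; apply: cvgB; last exact: cvg_cst.
    apply/cvgrPdist_lt => e e0; have /cvgrPdist_lt/(_ e e0)/nbhs_ballP[d /= d0 hd] := cx.
    exists (Num.max 1 (pi / d)); split; first exact: num_real.
    move=> y; rewrite gt_max => /andP[y1 yd]; apply: hd; rewrite /ball /= opprD addNKr normrN.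
    have -> : Num.max y 1 = y by apply/max_idPl/ltW.
    have y0 : 0 < y by lra.
    by rewrite ger0_norm ?divr_ge0 ?pi_ge0 ?(ltW y0)// ltr_pdivrMr// mulrC -ltr_pdivrMr.
  - rewrite normr_id indicE; have /andP[p1 p2] := py y.
    case: (boolP (x \in _)) => [_|]; last first.
      move=> /negP; rewrite in_setE /= in_itv /= => hx; rewrite mulr0 !f0 ?subrr ?normr0//= in_itv /= => /andP[h1 h2]; apply: hx; lra.
    by rewrite mulr1; apply: le_trans (ler_normB _ _) _; have := fM x; have := fM (x + pi / Num.max y 1); lra.
have V0 : rint (fun x : R => `|f x - f x|) = 0.
  by apply: rint_eq0 => x; rewrite subrr normr0.
rewrite V0 in Vc; apply: cvg_squeeze_abs Vc; exists 1; split; first exact: num_real.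
move=> y y1 /=; have y0 : 0 < y by lra.
have iI : integ (fun t => f t * k (t * y)) by apply: (integM_bdd if_ (mky y) (M := 1)).
have E1 := rint_shift (pi / y) iI.
have E2 : rint (fun x => f (x + pi / y) * k ((x + pi / y) * y)) = - rint (fun x => f (x + pi / y) * k (x * y)).
  rewrite -rintN; last by apply: (integM_bdd (integ_shift _ if_) (mky y) (M := 1)).
  have e (x : R) : (x + pi / y) * y = x * y + pi by rewrite mulrDl divfK ?gt_eqF.
  by apply: eq_Rintegral => x _; rewrite e kpi mulrN.
have E3 : 2 * rint (fun t => f t * k (t * y)) = rint (fun t => (f t - f (t + pi / y)) * k (t * y)).
  rewrite mulr2n mulrDl mul1r -{1}E1 E2 addrC -RintegralB//; first by apply: eq_Rintegral => x _; rewrite mulrBl.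
  by apply: (integM_bdd (integ_shift _ if_) (mky y) (M := 1)).
have : `|2 * rint (fun t => f t * k (t * y))| <= V y.
  rewrite E3 /V; apply: le_norm_rint.
  - apply: measurable_funM => //; apply: measurable_funB => //.
    by apply: (measurableT_comp mf); exact: measurable_funD.
  - by apply: integ_norm; apply: integB => //; exact: integ_shift.
  - move=> x; rewrite normrM distrC (_ : Num.max y 1 = y) ?ler_piMr//.
    exact/max_idPl/ltW.
rewrite normrM ger0_norm//; have := normr_ge0 (rint (fun t => f t * k (t * y))); lra.
Qed.
End LaplaceAbs.

(** * Fourier inversion *)

Section Inversion.
Variable R : realType.
Local Notation mu := (@lebesgue_measure R).
Local Notation rint := (Rintegral mu setT).
Local Notation cintT := (cint setT).
Local Notation C := R[i].
Local Notation Re := (@complex.Re R).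
Local Notation Im := (@complex.Im R).
Implicit Types (phi : R -> C).

Lemma ae_neq (x0 : R) (P : R -> Prop) : (forall x, x != x0 -> P x) -> {ae mu, forall x, P x}.
Proof.
move=> h; exists [set x0]; split; [exact: measurable_set1|exact: lebesgue_measure_set1|].
by move=> x /= nP; apply: contrapT => /eqP ne; apply: nP; exact: h.
Qed.

Lemma rint_ae_neq (x0 : R) (f g : R -> R) : integ f -> integ g -> (forall x, x != x0 -> f x = g x) -> rint f = rint g.
Proof.
move=> hf hg fg; rewrite /Rintegral; congr fine; apply: ae_eq_integral => //.
- exact: mea_EFin (integ_mea hf).
- exact: mea_EFin (integ_mea hg).
- by apply: (@ae_neq x0) => x xx _ /=; rewrite fg.
Qed.

Lemma cint_ae_neq (x0 : R) (f g : R -> C) : cinteg f -> cinteg g -> (forall x, x != x0 -> f x = g x) -> cintT f = cintT g.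
Proof.
by move=> [f1 f2] [g1 g2] fg; apply: C_ext => /=; apply: (@rint_ae_neq x0) => // x xx; rewrite fg.
Qed.

Lemma tfun_shift a (b : R) (f : R -> R) : tfun a f -> tfun (a + `|b|) (fun x => f (x + b)).
Proof.
move=> [sf zf]; split.
  exact: (@smooth_comp R (fun x => x + b) f (smoothD (@smooth_id R) (@smooth_cst R b)) sf).
move=> t ht; apply: zf; rewrite /= in_itv/= => /andP[h1 h2]; apply: ht; rewrite /= in_itv/=.
by have := ler_norm b; have := ler_norm (- b); rewrite normrN; lra.
Qed.

Lemma tfun_refl a (f : R -> R) : tfun a f -> tfun a (fun x => f (- x)).
Proof.
move=> [sf zf]; split; first exact: (@smooth_comp R (fun x => - x) f (smoothN (@smooth_id R)) sf).
move=> t ht; apply: zf; rewrite /= in_itv/= => h; apply: ht; rewrite /= in_itv/=; lra.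
Qed.

Lemma ctest_shift a (b : R) phi : ctest a phi -> ctest (a + `|b|) (fun x => phi (x + b)).
Proof.
by move=> [a0 [t1 t2]]; split; [rewrite addr_ge0|split; [exact: (tfun_shift b t1)|exact: (tfun_shift b t2)]].
Qed.

Lemma ctest_refl a phi : ctest a phi -> ctest a (fun x => phi (- x)).
Proof. by move=> [a0 [t1 t2]]; split => //; split; [exact: (tfun_refl t1)|exact: (tfun_refl t2)]. Qed.

Lemma cmea_expN_i (y : R) : cmea (fun x => cexp (- (iC R * RtoC (y * x)))).
Proof.
by apply: cmea_cexp; apply: cmeaN; apply: cmeaM; [exact: cmea_cst|apply: cmea_RtoC; exact: measurable_funM].
Qed.

Lemma cnorm_expN_i (y : R) : cnorm (cexp (- (iC R * RtoC y))) = 1.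
Proof. by rewrite cnorm_cexp ReN ReM /= mul0r mulr0 subrr oppr0 expR0. Qed.

Lemma fourier_shift (b : R) phi x : cinteg phi -> fourier (fun u => phi (u + b)) x = cexp (iC R * RtoC (x * b)) * fourier phi x.
Proof.
move=> ip; have ik : cinteg (fun u => cexp (- (iC R * RtoC (x * u))) * phi u).
  by apply: eq_cinteg (cintegM_bdd ip (cmea_expN_i x) (fun u => _)) => [u|u]; [exact: mulrC|rewrite cnorm_expN_i].
rewrite /fourier -(cint_shift b ik) -cintZ; last exact: (cinteg_shift b ik).
apply: eq_cint => u; rewrite mulrA -cexpD; congr (cexp _ * _).
by rewrite !RtoCM RtoCD; ring.
Qed.

Lemma fourier_refl phi x : cinteg phi -> fourier (fun u => phi (- u)) x = fourier phi (- x).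
Proof.
move=> ip; have ik : cinteg (fun u => cexp (- (iC R * RtoC (- x * u))) * phi u).
  by apply: eq_cinteg (cintegM_bdd ip (cmea_expN_i (- x)) (fun u => _)) => [u|u]; [exact: mulrC|rewrite cnorm_expN_i].
rewrite /fourier -(cint_refl 0 ik); apply: eq_cint => u; by rewrite sub0r mulrNN.
Qed.

(** The substitution t = s u turns the Poisson kernel into 2 / (1 + u^2), of integral 2 pi, against
    f(s u) -> f(0). *)
Lemma cauchy_approx (f : R -> R) (M : R) : integ f -> (forall x, `|f x| <= M) -> {for 0, continuous f} ->
  rint (fun t => 2 * s / (s ^+ 2 + t ^+ 2) * f t) @[s --> 0^'+] --> 2 * pi * f 0.
Proof.
move=> if_ fM cf; have mf := integ_mea if_.
have iM := integZ (2 * M) (integ_cauchy R).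
have D : rint (fun t => 2 * (1 + t ^+ 2)^-1 * f (s * t)) @[s --> 0^'+] --> rint (fun t => 2 * (1 + t ^+ 2)^-1 * f 0).
  apply: (dct_right0 (d := 1) ltr01 _ _ _ iM) => [s _|||s t _].
  - apply: measurable_funM; first exact: (integ_mea (integZ 2 (integ_cauchy R))).
    by apply: (measurableT_comp mf); exact: measurable_funM.
  - by apply: measurable_funM => //; exact: (integ_mea (integZ 2 (integ_cauchy R))).
  - apply: aeW => t; apply: cvgM; first exact: cvg_cst.
    have h : {for (0 : R), continuous (fun s : R => f (s * t))}.
      apply: (@continuous_comp _ _ _ (fun s : R => s * t) f 0); last by rewrite mul0r.
      by apply: cvgM; [exact: cvg_id|exact: cvg_cst].
    by move/cvg_at_right_filter: h; rewrite mul0r.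
  - have d0 : 0 <= (1 + t ^+ 2)^-1 by rewrite invr_ge0 addr_ge0// sqr_ge0.
    rewrite !normrM ger0_norm// ger0_norm//; have := fM (s * t); nra.
have E : rint (fun t => 2 * (1 + t ^+ 2)^-1 * f 0) = 2 * pi * f 0.
  under eq_Rintegral do rewrite [2 * _]mulrC -mulrA mulrC.
  by rewrite rintZ ?rint_cauchy; [ring|exact: integ_cauchy].
rewrite E in D; apply: cvg_trans D; apply: near_eq_cvg; near=> s.
have s0 : 0 < s by near: s; exact: nbhs_right_gt.
have iS : integ (fun t => 2 * s / (s ^+ 2 + t ^+ 2) * f t).
  have i1 := integZ (2 / s) (@integ_affine R s^-1 0 _ (lt0r_neq0 (ltac:(by rewrite invr_gt0) : 0 < s^-1)) (integ_cauchy R)).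
  apply: eq_integ (integM_bdd i1 mf fM) => t; congr (_ * _).
  have h : s ^+ 2 + t ^+ 2 != 0 by rewrite gt_eqF// ltr_wpDr ?sqr_ge0// exprn_gt0.
  have h2 : 1 + (s^-1 * t + 0) ^+ 2 != 0 by rewrite gt_eqF// ltr_wpDr ?sqr_ge0.
  have -> : 1 + (s^-1 * t + 0) ^+ 2 = (s ^+ 2 + t ^+ 2) / s ^+ 2 by field; rewrite gt_eqF.
  by field; rewrite h gt_eqF.
rewrite (rint_affine 0 (lt0r_neq0 s0) iS) gtr0_norm// -rintZ; last first.
  exact: (integ_affine 0 (lt0r_neq0 s0) iS).
apply: eq_Rintegral => t _; rewrite addr0 mulrA; congr (_ * _).
have h : s ^+ 2 + (s * t) ^+ 2 != 0 by rewrite gt_eqF// ltr_wpDr ?sqr_ge0// exprn_gt0.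
have h2 : 1 + t ^+ 2 != 0 by rewrite gt_eqF// ltr_wpDr ?sqr_ge0.
by field; rewrite h h2.
Unshelve. all: by end_near. Qed.

Lemma cderiv_lip (F : C -> C) (z l : C) : cderiv_at F z l -> exists2 d : R, 0 < d &
  forall h : C, cnorm h < d -> cnorm (F (z + h) - F z) <= (1 + cnorm l) * cnorm h.
Proof.
move=> /cderiv_cnorm/(_ 1 ltr01)[d d0 hd]; exists d => // h /hd; rewrite mul1r => H.
have := cnormD (F (z + h) - F z - l * h) (l * h); rewrite subrK cnormM; lra.
Qed.

Lemma cderiv_line (F : C -> C) (s : R) : (forall t : R, exists l, cderiv_at F (Complex s t) l) ->
  continuous (fun t : R => Re (F (Complex s t))) /\ continuous (fun t : R => Im (F (Complex s t))).
Proof.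
move=> H; have K (t e : R) : 0 < e -> \forall u \near t, cnorm (F (Complex s u) - F (Complex s t)) < e.
  move=> e0; have [l /cderiv_lip[d d0 hd]] := H t.
  have c0 := cnorm_ge0 l; have c1 : 0 < 1 + cnorm l by lra.
  apply/nbhs_ballP; exists (Num.min d (e / (1 + cnorm l))); first by rewrite /= lt_min d0 divr_gt0.
  move=> u /=; rewrite /ball /= lt_min => /andP[h1 h2].
  have E : Complex s u = Complex s t + Complex 0 (u - t) by apply: C_ext; rewrite ?ReD ?ImD /= ?addr0 ?subrKC.
  have E2 : cnorm (Complex 0 (u - t)) = `|t - u|.
    by rewrite /cnorm /= expr0n add0r sqrtr_sqr distrC.
  rewrite E; apply: le_lt_trans (hd _ _) _; first by rewrite E2.
  by rewrite E2 mulrC -ltr_pdivlMr.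
split => t; apply/cvgrPdist_lt => e e0; near=> u.
- rewrite distrC -ReB; apply: le_lt_trans (norm_Re _) _; near: u; exact: K.
- rewrite distrC -ImB; apply: le_lt_trans (norm_Im _) _; near: u; exact: K.
Unshelve. all: by end_near. Qed.

Lemma LT_cmea g (s : R) : lapl g -> 0 < s -> cmea (fun t : R => LT g (Complex s t)).
Proof.
move=> lg s0; have [c1 c2] := cderiv_line (fun t => @LT_cderiv R g (Complex s t) lg s0).
by split; exact: continuous_measurable_fun.
Qed.

Lemma LT_bound g (s t : R) : lapl g -> 0 < s -> cnorm (LT g (Complex s t)) <= 2 * rint (fun x => cnorm (g x) * expR (- (s * x))).
Proof.
move=> lg s0; have [mg _ ig] := lg; apply: cnorm_cint; first by apply: cmeaM => //; exact: cmea_ker.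
  exact: ig.
by move=> x; rewrite cnormM cnorm_ker.
Qed.

(** Abel summation: damped by exp(- s |x|), the half-line integrals of the transform are pairings of
    [phi] with 1 / (s + i t) and 1 / (s - i t), whose sum 2 s / (s^2 + t^2) is the kernel of
    [cauchy_approx]. *)
Lemma cint_fourier a phi : ctest a phi -> cintT (fourier phi) = RtoC (2 * pi) * phi 0.
Proof.
move=> ct; have ip := ctest_cinteg ct; have ct' := ctest_refl ct; have ip' := ctest_cinteg ct'.
have lh : lapl (fun x : R => RtoC (hv x)).
  apply: (@lapl_bdd R _ 1) => [|x x0|x]; first by apply: cmea_RtoC; exact: mea_hv.
    by rewrite hv_lt0.
  by rewrite cnorm_RtoC hv_norm.
have i1 := fourier_cinteg ct; have i2 := fourier_cinteg ct'.
have [K1 K10 h1] := fourier_decay ct; have [K2 K20 h2] := fourier_decay ct'.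
have mF : cmea (fun x : R => RtoC (hv x) * (fourier phi x + fourier (fun u => phi (- u)) x)).
  by apply: cmeaM; [apply: cmea_RtoC; exact: mea_hv|apply: cmeaD; exact: cinteg_mea].
have A := @exp_weight_limit R (fun x => RtoC (hv x) * (fourier phi x + fourier (fun u => phi (- u)) x)) (fun x => (K1 + K2) * (1 + x ^+ 2)^-1) mF.
have {}A := A _ (integZ _ (integ_cauchy R)) _.
have [z1 z2] := (ctest_cinteg ct).
have bd (f : R -> R) : tfun a f -> exists M : R, forall x, `|f x| <= M.
  by move=> tf; have [K _ hK] := tfun_bounded ct.1 tf; exists K.
have [a0 [t1 t2]] := ct; have [M1 hM1] := bd _ t1; have [M2 hM2] := bd _ t2.
have c1 := cauchy_approx z1 hM1 (@smooth_continuous R (fun x => Re (phi x)) t1.1 (0 : R)).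
have c2 := cauchy_approx z2 hM2 (@smooth_continuous R (fun x => Im (phi x)) t2.1 (0 : R)).
have B : ccvg_right0 (fun s => cintT (fun t => RtoC (2 * s / (s ^+ 2 + t ^+ 2)) * phi t)) (RtoC (2 * pi) * phi 0).
  apply/ccvg_right0P; split.
  - rewrite ReM /= mul0r subr0; apply: cvg_trans c1; apply: near_eq_cvg; apply: nearW => s /=.
    by apply: eq_Rintegral => t _; rewrite ReM /= mul0r subr0.
  - rewrite ImM /= mul0r addr0; apply: cvg_trans c2; apply: near_eq_cvg; apply: nearW => s /=.
    by apply: eq_Rintegral => t _; rewrite ImM /= mul0r addr0.
have cF : cintT (fun x : R => RtoC (hv x) * (fourier phi x + fourier (fun u => phi (- u)) x)) = cintT (fourier phi).
  have mh : cmea (fun x : R => RtoC (hv x)) by apply: cmea_RtoC; exact: mea_hv.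
  have hb (x : R) : cnorm (RtoC (hv x)) <= 1 by rewrite cnorm_RtoC hv_norm.
  have j1 : cinteg (fun x : R => RtoC (hv x) * fourier phi x).
    by apply: eq_cinteg (cintegM_bdd i1 mh hb) => x; exact: mulrC.
  have j2 : cinteg (fun x : R => RtoC (hv x) * fourier phi (- x)).
    by apply: eq_cinteg (cintegM_bdd i2 mh hb) => x; rewrite mulrC fourier_refl.
  have j3 : cinteg (fun x : R => RtoC (hv (- x)) * fourier phi x).
    by apply: eq_cinteg (cinteg_refl 0 j2) => x; rewrite sub0r opprK.
  have -> : cintT (fun x : R => RtoC (hv x) * (fourier phi x + fourier (fun u => phi (- u)) x)) =
      cintT (fun x => RtoC (hv x) * fourier phi x) + cintT (fun x => RtoC (hv x) * fourier phi (- x)).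
    rewrite -(cintD j1 j2); apply: eq_cint => x; rewrite (fourier_refl x ip); exact: mulrDr.
  have j4 : cinteg (fun x : R => RtoC (hv (0 - x)) * fourier phi (- (0 - x))) by apply: eq_cinteg j3 => x; rewrite sub0r opprK.
  rewrite -(cint_refl 0 j2) -(cintD j1 j4).
  apply: (@cint_ae_neq 0 _ _ (cintegD j1 j4) i1).
  move=> x x0; rewrite sub0r opprK -mulrDl -RtoCD.
  have [xn|xp|xe] := ltgtP x 0; last by rewrite xe eqxx in x0.
  - by rewrite hv_lt0// hv_ge0 ?add0r ?mul1r// oppr_ge0 ltW.
  - by rewrite hv_ge0 ?(ltW xp)// hv_lt0 ?addr0 ?mul1r// oppr_lt0.
rewrite -cF; apply: (@ccvg_right0_unique R _ _ _ _ B); apply: (@ccvg_right0_near R _ _ _ 1 ltr01) (A _ _).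
- move=> s /andP[s0 _].
  have k1 := LT_pairing lh ct s0; have k2 := LT_pairing lh ct' s0.
  have js (g : R -> C) : cinteg g -> cinteg (fun x => RtoC (hv x) * RtoC (expR (- (s * x))) * g x).
    move=> ig; apply: eq_cinteg (cintegM_bdd (M := 1) ig (cmeaM (cmea_RtoC (@mea_hv R)) (cmea_RtoC (mea_expRN s))) _) => x; first exact: mulrC.
    rewrite -RtoCM cnorm_RtoC ger0_norm; last by rewrite mulr_ge0 ?expR_ge0//; case/andP: (hv01 x).
    have [x0|x0] := ltP x 0; first by rewrite hv_lt0// mul0r.
    by rewrite hv_ge0// mul1r -expR0 ler_expR oppr_le0 mulr_ge0// ltW.
  transitivity (cintT (fun x => RtoC (hv x) * RtoC (expR (- (s * x))) * fourier phi x) + cintT (fun x => RtoC (hv x) * RtoC (expR (- (s * x))) * fourier (fun u => phi (- u)) x)).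
    rewrite -(cintD (js _ i1) (js _ i2)); apply: eq_cint => x; ring.
  have m1 : cmea (fun t : R => LT (fun x : R => RtoC (hv x)) (Complex s t)).
    exact: LT_cmea.
  have bL (t : R) : cnorm (LT (fun x : R => RtoC (hv x)) (Complex s t)) <= 2 * rint (fun x => cnorm (RtoC (hv x)) * expR (- (s * x))).
    by apply: LT_bound.
  have l1 : cinteg (fun t => LT (fun x : R => RtoC (hv x)) (Complex s t) * phi t).
    by apply: eq_cinteg (cintegM_bdd ip m1 bL) => t; exact: mulrC.
  have l2 : cinteg (fun t => LT (fun x : R => RtoC (hv x)) (Complex s t) * phi (- t)).
    by apply: eq_cinteg (cintegM_bdd ip' m1 bL) => t; exact: mulrC.
  rewrite -k1 -k2 -(cint_refl 0 l2) -(cintD l1 (cinteg_refl 0 l2)).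
  apply: eq_cint => t; rewrite sub0r opprK -mulrDl !LT_heaviside//; congr (_ * _).
  have h : s ^+ 2 + t ^+ 2 != 0 by rewrite gt_eqF// ltr_wpDr ?sqr_ge0// exprn_gt0.
  by apply: C_ext; rewrite ?ReD ?ImD /= ?sqrrN; field.
- by move=> x x0; rewrite hv_lt0// mul0r.
- move=> x; rewrite cnormM cnorm_RtoC mulrDl; apply: le_trans (_ : 1 * (cnorm (fourier phi x) + cnorm (fourier (fun u => phi (- u)) x)) <= _).
    by apply: ler_pM => //; [exact: cnorm_ge0|exact: hv_norm|exact: cnormD].
  by rewrite mul1r lerD.
Qed.

Lemma fourier_inversion a phi (t : R) : ctest a phi ->
  phi t = cintT (fun x => ifourier phi x * cexp (- (iC R * RtoC (x * t)))).
Proof.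
move=> ct; have ip := ctest_cinteg ct.
have E := cint_fourier (ctest_shift t ct); rewrite add0r in E.
have i1 := fourier_cinteg (ctest_shift t ct).
have p0 : RtoC (2 * pi) != 0 :> C by rewrite RtoC_eq0 mulf_neq0// gt_eqF// pi_gt0.
rewrite -[LHS]mul1r -(mulVf p0) -mulrA -E -RtoCV -(cint_refl 0 i1) -cintZ; last exact: cinteg_refl.
apply: eq_cint => x; rewrite sub0r fourier_shift// ifourier_fourier -!mulrA; congr (_ * _).
by rewrite mulrC mulNr RtoCN mulrN.
Qed.

Lemma parseval a phi (w : R -> C) : ctest a phi -> cinteg w ->
  cintT (fun t => phi t * w t) = cintT (fun x => fourier w x * ifourier phi x).
Proof.
move=> ct iw; have i1 : cinteg (ifourier phi).
  have := cinteg_refl 0 (cintegZ (RtoC (2 * pi)^-1) (fourier_cinteg ct)).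
  by apply: eq_cinteg => x; rewrite ifourier_fourier sub0r.
transitivity (cintT (fun x => ifourier phi x * fourier w x)); last by apply: eq_cint => x; exact: mulrC.
rewrite -(fourier_fubini i1 iw); apply: eq_cint => t; congr (_ * _).
exact: (fourier_inversion t ct).
Qed.
End Inversion.

(** * A nonnegative kernel that is the transform of a test function *)

Section Kernel.
Variable R : realType.
Local Notation mu := (@lebesgue_measure R).
Local Notation rint := (Rintegral mu setT).

Definition conv (w psi : R -> R) (t : R) : R := rint (fun y => w y * psi (t - y)).

Lemma conv_integ a (w psi : R -> R) (t : R) : 0 <= a -> integ w -> tfun a psi -> integ (fun y => w y * psi (t - y)).
Proof.
move=> a0 iw tp; have [K _ hK] := tfun_bounded a0 tp; apply: (integM_bdd iw _ (fun y => hK _)).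
apply: (measurableT_comp (smooth_mea tp.1)); exact: measurable_funB.
Qed.

Lemma conv_is_derive a (w psi : R -> R) (t : R) : 0 <= a -> integ w -> tfun a psi ->
  is_derive t (1 : R) (conv w psi) (conv w (derive1 psi) t).
Proof.
move=> a0 iw tp; have tp1 := tfun_derive1 tp; have tp2 := tfun_derive1 tp1.
have [K K0 hK] := tfun_bounded a0 tp2.
have i0 := @conv_integ a w psi _ a0 iw tp; have i1 := @conv_integ a w _ _ a0 iw tp1.
apply: (@is_derive_quad R _ t _ (K * rint (fun y => `|w y|)) 1 ltr01) => h _.
have E : conv w psi (t + h) - conv w psi t - conv w (derive1 psi) t * h =
   rint (fun y => w y * (psi (t - y + h) - psi (t - y) - h * derive1 psi (t - y))).
  have j1 := integZ h (i1 t); have j2 := integB (i0 (t + h)) (i0 t).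
  rewrite /conv [_ * h]mulrC -(rintZ h (i1 t)) -(RintegralB measurableT (i0 (t + h)) (i0 t)) -(RintegralB measurableT j2 j1).
  apply: eq_Rintegral => y _; have -> : t + h - y = t - y + h by ring.
  ring.
have iK := integZ (K * h ^+ 2) (integ_norm iw).
rewrite E [leRHS]mulrAC -(rintZ _ (integ_norm iw)); apply: le_norm_rint => // [|y].
  apply: measurable_funM; first exact: integ_mea.
  have mt (f : R -> R) (b : R) : smooth f -> measurable_fun setT (fun y : R => f (b - y)).
    by move=> sf; apply: (measurableT_comp (smooth_mea sf)); exact: measurable_funB.
  have mt2 : measurable_fun setT (fun y : R => psi (t - y + h)).
    apply: eq_measurable_fun (mt psi (t + h) tp.1) => y _; congr psi; ring.
  by apply: measurable_funB; [apply: measurable_funB => //; exact: mt tp.1|apply: measurable_funM => //; exact: mt tp1.1].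
rewrite normrM mulrC ler_wpM2r// taylor2//; exact: tp.1.
Qed.

Lemma conv_smooth a (w psi : R -> R) : 0 <= a -> integ w -> tfun a psi -> smooth (conv w psi).
Proof.
move=> a0 iw tp; suff : forall f, (exists2 p, tfun a p & f = conv w p) -> smooth f by apply; exists psi.
apply: smooth_ind => [f [p tp' ->] x|f [p tp' ->]].
  by have [] := conv_is_derive x a0 iw tp'.
exists (derive1 p); first exact: tfun_derive1.
apply/funext => x; rewrite derive1E; exact: (@derive_val _ _ _ _ _ _ _ (conv_is_derive x a0 iw tp')).
Qed.

Lemma conv_tfun a (w psi : R -> R) : 0 <= a -> tfun a w -> tfun a psi -> tfun (a + a) (conv w psi).
Proof.
move=> a0 tw tp; split; first exact: (conv_smooth a0 (tfun_integ a0 tw) tp).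
move=> t; rewrite /= in_itv/= => ht; apply: rint_eq0 => y.
have [h|h] := pselect (- a <= y <= a); last by rewrite tw.2 ?mul0r//= in_itv.
rewrite [psi _]tp.2 ?mulr0//= in_itv/= => h'; apply: ht; lra.
Qed.

Lemma conv_even (w psi : R -> R) a : 0 <= a -> tfun a w -> tfun a psi -> (forall x, w (- x) = w x) -> (forall x, psi (- x) = psi x) ->
  forall t, conv w psi (- t) = conv w psi t.
Proof.
move=> a0 tw tp ew ep t; have i := conv_integ (- t) a0 (tfun_integ a0 tw) tp.
rewrite /conv -(rint_refl 0 i); apply: eq_Rintegral => y _.
by rewrite sub0r ew opprK -ep; congr (_ * psi _); ring.
Qed.

Lemma fs_even (w : R -> R) x : integ w -> (forall x, w (- x) = w x) -> fs w x = 0.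
Proof.
move=> iw ew; have i := integ_sin x iw; have := rint_refl 0 i; rewrite -/(fs w x).
have -> : rint (fun y => w (0 - y) * sin (x * (0 - y))) = - fs w x.
  rewrite /fs -rintN//; apply: eq_Rintegral => y _; by rewrite sub0r ew mulrN sinN mulrN.
lra.
Qed.

(** Expanding cos(x (t + y)) gives a product of cosine integrals and one of sine integrals; evenness
    kills the latter. *)
Lemma fc_conv (w psi : R -> R) a x : 0 <= a -> tfun a w -> tfun a psi -> (forall x, w (- x) = w x) -> (forall x, psi (- x) = psi x) ->
  fc (conv w psi) x = fc w x * fc psi x.
Proof.
move=> a0 tw tp ew ep; have iw := tfun_integ a0 tw; have ip := tfun_integ a0 tp.
pose F (z : R * R) := w z.1 * (psi (z.2 - z.1) * cos (x * z.2)).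
have ipy (y : R) : integ (fun t => psi (t - y)) by exact: (integ_shift (- y) ip).
have S (y : R) : rint (fun t => psi (t - y) * cos (x * t)) = cos (x * y) * fc psi x.
  rewrite -(rint_shift y (integ_cos x (ipy y))) -[LHS]addr0.
  have -> : cos (x * y) * fc psi x = cos (x * y) * fc psi x - sin (x * y) * fs psi x by rewrite (fs_even x ip ep) mulr0 subr0.
  rewrite addr0.
  have j1 := integ_cos x ip; have j2 := integ_sin x ip.
  have j3 : integ (fun t => psi (t + y - y) * cos (x * (t + y))) by exact: (integ_shift y (integ_cos x (ipy y))).
  rewrite /fc /fs -(rintZ _ j1) -(rintZ _ j2) -(RintegralB measurableT (integZ _ j1) (integZ _ j2)).
  by apply: eq_Rintegral => t _; rewrite addrK mulrDr cosD; ring.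
have mF : measurable_fun setT F.
  apply: measurable_funM; first exact: (mea_prod1 (smooth_mea tw.1)).
  apply: measurable_funM; last exact: (mea_prod2 (mea_cos_lin x)).
  apply: (measurableT_comp (smooth_mea tp.1)); apply: measurable_funB; [exact: measurable_snd|exact: measurable_fst].
have iF y : integ (fun t => F (y, t)) by rewrite /F /=; apply: integZ; exact: integ_cos.
have := @fubini R F (fun y => `|w y| * rint (fun t => `|psi t|)) mF iF _ _.
have -> : rint (fun y => rint (fun t => F (y, t))) = fc w x * fc psi x.
  rewrite mulrC /fc -(rintZ _ (integ_cos x iw)); apply: eq_Rintegral => y _.
  rewrite /F /= rintZ; last exact: integ_cos.
  by rewrite S /fc; ring.
move=> E; rewrite E.
- apply: eq_Rintegral => t _; rewrite mulrC /conv -rintZ; last exact: (conv_integ _ a0 iw tp).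
  by apply: eq_Rintegral => y _; rewrite /F /=; ring.
- move=> y; rewrite -(rint_shift (- y) (integ_norm ip)) -rintZ; last exact: (integ_shift _ (integ_norm ip)).
  apply: le_rint; [exact: integ_norm|by apply: integZ; exact: (integ_shift _ (integ_norm ip))|].
  by move=> t; rewrite /F /= !normrM ler_wpM2l// ler_piMr// norm_cos.
- by apply: eq_integ (integZ (rint (fun t => `|psi t|)) (integ_norm iw)) => y; rewrite mulrC.
Qed.

(** The test function is the convolution square of an even bump, so its transform is the square of a
    real function. Squaring also doubles the decay, which leaves room for integrating against linear
    growth. A bump of radius d / 3 has a convolution square supported strictly inside (-d, d). *)
Lemma tauberian_kernel (d : R) : 0 < d -> exists2 a, 0 <= a < d & exists phi (K : R -> R) (c : R),
  [/\ ctest a phi, forall x, fourier phi x = RtoC (K x), continuous K, forall x, 0 <= K x <= c * ((1 + x ^+ 2)^-1) ^+ 2 & 0 < K 0].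
Proof.
move=> d0; pose b := d / 3; have b0 : 0 < b by rewrite divr_gt0.
pose psi (t : R) := bump (b ^+ 2 - t ^+ 2).
have ep x : psi (- x) = psi x by rewrite /psi sqrrN.
have tp : tfun b psi.
  split; last first.
    move=> t; rewrite /= in_itv/= => ht; rewrite /psi /bump bumpf_eq0//; apply: contrapT => /negP; rewrite -ltNge => h; apply: ht; nra.
  have := @smooth_bump_comp R 1 1 (b ^+ 2); congr smooth; apply/funext => t.
  by rewrite hornerE mul1r.
have b0' := ltW b0; have ip := tfun_integ b0' tp.
have tc := conv_tfun b0' tp tp; have ec := conv_even b0' tp tp ep ep.
have bb0 : 0 <= b + b by lra.
have ct : ctest (b + b) (fun t => RtoC (conv psi psi t)).
  split => //; split => //=; split => //; exact: smooth_cst.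
have [c c0 hc] := fcs_decay b0' tp.
exists (b + b); first by rewrite bb0 /= /b; lra.
exists (fun t => RtoC (conv psi psi t)), (fun x => fc psi x ^+ 2), (c ^+ 2); split => //.
- move=> x; rewrite (fourierE x ct) /= (fs_even x (tfun_integ bb0 tc) ec) oppr0.
  rewrite (fc_conv x b0' tp tp ep ep) -expr2 /RtoC; congr Complex.
    by rewrite /fs (@rint_eq0 R) ?addr0// => t; rewrite mul0r.
  by rewrite /fc (@rint_eq0 R) ?addr0// => t; rewrite mul0r.
- have [cf _] := fcs_continuous b0' tp; move=> x; rewrite /continuous_at expr2.
  under eq_fun do rewrite expr2.
  by apply: cvgM; exact: cf.
- move=> x; rewrite sqr_ge0 /= -exprMn -real_normK ?num_real// lerXn2r ?nnegrE//; last exact: (hc x).1.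
  exact: le_trans (normr_ge0 _) (hc x).1.
- rewrite exprn_gt0// /fc; under eq_Rintegral do rewrite mul0r cos0 mulr1.
  apply: rint_gt0 => //; [by move=> x; exact: bump_ge0| |exact: (smooth_continuous tp.1)].
  by rewrite /psi expr0n subr0 bump_gt0// exprn_gt0.
Qed.
End Kernel.

(** * A Tauberian theorem *)

Section Tauberian.
Variable R : realType.
Local Notation mu := (@lebesgue_measure R).
Local Notation rint := (Rintegral mu setT).
Implicit Types (f rho K : R -> R).

Lemma weight_bound (u y : R) : (1 + `|u + y|) * (1 + u ^+ 2)^-1 <= 2 * (1 + `|y|).
Proof.
have h := ler_normD u y; have y0 := normr_ge0 y; have u0 := normr_ge0 u.
have d0 : 0 < 1 + u ^+ 2 by rewrite ltr_wpDr ?sqr_ge0.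
rewrite ler_pdivrMr// -[u ^+ 2]real_normK ?num_real//.
move: h y0 u0; move: (`|u + y|) (`|u|) (`|y|) => p q s h y0 u0.
have q2 := sqr_ge0 q; have q1 := sqr_ge0 (q - 1); have sq := mulr_ge0 y0 q2.
have -> : 2 * (1 + s) * (1 + q ^+ 2) = 2 + 2 * s + 2 * q ^+ 2 + 2 * (s * q ^+ 2) by ring.
have E : (q - 1) ^+ 2 = q ^+ 2 - 2 * q + 1 by ring.
rewrite E in q1; lra.
Qed.

Section KernelBounds.
Variables (K : R -> R) (c : R).
Hypotheses (cK : continuous K) (K0 : forall x, 0 <= K x <= c * ((1 + x ^+ 2)^-1) ^+ 2).

Let c0 : 0 <= c.
Proof. by have /andP[h1 h2] := K0 0; have := le_trans h1 h2; rewrite expr0n addr0 invr1 expr1n mulr1. Qed.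
Let mK : measurable_fun setT K. Proof. exact: continuous_measurable_fun. Qed.

Lemma kernel_weight_integ (y : R) : integ (fun x => (1 + `|x|) * K (x - y)).
Proof.
have i := integZ (2 * (1 + `|y|) * c) (integ_shift (- y) (integ_cauchy R)).
apply: (integ_dom _ i) => [|x].
  apply: measurable_funM; last by apply: (measurableT_comp mK); exact: measurable_funB.
  by apply: measurable_funD => //; exact: measurableT_comp.
have /andP[k0 kc] := K0 (x - y).
rewrite ger0_norm ?mulr_ge0 ?addr_ge0//; apply: le_trans (_ : (1 + `|x|) * (c * ((1 + (x - y) ^+ 2)^-1) ^+ 2) <= _).
  by rewrite ler_wpM2l// addr_ge0.
have := weight_bound (x - y) y; rewrite subrK expr2 => h.
have d0 : 0 <= (1 + (x - y) ^+ 2)^-1 by rewrite invr_ge0 addr_ge0// sqr_ge0.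
rewrite -expr2; move: d0 h; rewrite -expr2; move: ((1 + (x - y) ^+ 2)^-1) => v v0 h.
by have := ler_wpM2r (mulr_ge0 c0 v0) h; rewrite expr2; congr (_ <= _); ring.
Qed.

Lemma kernel_integ (y : R) : integ (fun x => K (x - y)).
Proof.
apply: (integ_dom _ (kernel_weight_integ y)) => [|x].
  by apply: (measurableT_comp mK); exact: measurable_funB.
have /andP[k0 _] := K0 (x - y); rewrite ger0_norm//.
by have := normr_ge0 x; nra.
Qed.

(** The mass of the kernel inside a window of half-width [La]. Its companion [tail] is the mass
    outside with the weight 1 + 2 |u|, the price that a function of linear growth pays by
    [weight_shift]. *)
Definition kap (La : R) := rint (fun u => ind (- La) La u * K u).
Definition tail (La : R) := rint (fun u => (1 - ind (- La) La u) * ((1 + 2 * `|u|) * K u)).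

Lemma integK : integ K.
Proof. by apply: eq_integ (kernel_integ 0) => x; rewrite subr0. Qed.
Lemma integK2 : integ (fun u => (1 + 2 * `|u|) * K u).
Proof.
apply: eq_integ (integB (integZ 2 (kernel_weight_integ 0)) integK) => x; rewrite subr0; ring.
Qed.
Lemma ind01 (a b u : R) : `|ind a b u| <= 1.
Proof. by rewrite /ind; case: ifP => _; rewrite ?normr1 ?normr0. Qed.
Lemma mea_ind1 (a b : R) : measurable_fun setT (ind a b).
Proof. exact: (mea_ind _ _ (@measurable_id _ _ _)). Qed.

Lemma kap_integ (La : R) : integ (fun u => ind (- La) La u * K u).
Proof. by apply: eq_integ (integM_bdd integK (mea_ind1 _ _) (fun u => ind01 (- La) La u)) => u; exact: mulrC. Qed.
Lemma ind01C (a b u : R) : `|1 - ind a b u| <= 1.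
Proof. by rewrite /ind; case: ifP => _; rewrite ?subrr ?subr0 ?normr1 ?normr0. Qed.
Lemma tail_integ (La : R) : integ (fun u => (1 - ind (- La) La u) * ((1 + 2 * `|u|) * K u)).
Proof.
apply: eq_integ (integM_bdd integK2 _ (fun u => ind01C (- La) La u)) => [u|]; first exact: mulrC.
by apply: measurable_funB => //; exact: mea_ind1.
Qed.

Lemma tail_ge0 (La : R) : 0 <= tail La.
Proof.
apply: rint_ge0 => u; have /andP[k0 _] := K0 u; apply: mulr_ge0.
  by rewrite /ind; case: ifP; rewrite ?subrr ?subr0.
by apply: mulr_ge0 => //; have := normr_ge0 u; lra.
Qed.

Lemma kap_mono (L1 L2 : R) : L1 <= L2 -> kap L1 <= kap L2.
Proof.
move=> h; apply: le_rint; [exact: kap_integ|exact: kap_integ|move=> u].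
have /andP[k0 _] := K0 u; rewrite ler_wpM2r// /ind; case: (boolP (- L1 <= u <= L1)) => [/andP[h1 h2]|_]; last by case: ifP.
by rewrite ifT//; apply/andP; lra.
Qed.

Lemma kap_gt0 (La : R) : 0 < La -> 0 < K 0 -> 0 < kap La.
Proof.
move=> l0 k0; apply: rint_gt0; first exact: kap_integ.
- by move=> u; have /andP[k _] := K0 u; rewrite mulr_ge0// /ind; case: ifP.
- by rewrite ind_in ?mul1r//; lra.
- move/cvgrPdist_lt : (cK (x := 0)) => h; apply/cvgrPdist_lt => e e0.
  rewrite ind_in ?mul1r; last by lra.
  have h1 := h e e0; near=> u; rewrite ind_in ?mul1r; first by near: u.
  have : `|0 - u| < La by near: u; exact: (@cvgrPdist_lt _ _ _ _ _ id 0).1.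
  by rewrite sub0r normrN ltr_norml; lra.
Unshelve. all: by end_near. Qed.

Lemma tail_small (e : R) : 0 < e -> exists2 L0 : R, 0 < L0 & forall La, L0 <= La -> tail La <= e.
Proof.
move=> e0; have T : tail La @[La --> +oo] --> rint (fun _ : R => (0 : R)).
  apply: (dct_pinfty _ _ _ (integ_norm integK2)) => [La|||La u].
  - exact: integ_mea (tail_integ La).
  - exact: measurable_cst.
  - apply: aeW => u; apply: cvg_near_cst; exists `|u|; split; first exact: num_real.
    move=> La /= hL; rewrite ind_in ?subrr ?mul0r//.
    by rewrite -ler_norml ltW.
  - by rewrite normrM ler_piMl// ind01C.
rewrite (rint_eq0 (f := fun=> 0))// in T; move/cvgrPdist_lt: T => /(_ e e0)[M [_ hM]].
exists (Num.max 1 (M + 1)) => [|La]; first by rewrite lt_max ltr01.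
rewrite ge_max => /andP[_ h]; have := hM La ltac:(lra); rewrite sub0r normrN.
by move=> /ltW; apply: le_trans; exact: ler_norm.
Qed.

Lemma window (f : R -> R) (a La m B : R) : integ (fun x => f x * K (x - a)) ->
  (forall x, `|x - a| <= La -> m <= f x) -> (forall x, La < `|x - a| -> - (B * (1 + 2 * `|x - a|)) <= f x) ->
  m * kap La - B * tail La <= rint (fun x => f x * K (x - a)).
Proof.
move=> iF hm hB.
have i1 := integ_shift (- a) (kap_integ La); have i2 := integ_shift (- a) (tail_integ La).
rewrite /kap /tail -(rint_shift (- a) (kap_integ La)) -(rint_shift (- a) (tail_integ La)).
rewrite -(rintZ m i1) -(rintZ B i2) -(RintegralB measurableT (integZ _ i1) (integZ _ i2)).
apply: le_rint => //; first exact: integB (integZ _ i1) (integZ _ i2).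
move=> x; have /andP[k0 _] := K0 (x - a).
have [h|h] := leP `|x - a| La.
  by rewrite ind_in ?subrr ?mul0r ?mulr0 ?subr0 ?mul1r -?ler_norml// ler_wpM2r// hm.
rewrite ind_out; last by rewrite -ler_norml; apply/negP; rewrite -ltNge.
by rewrite mul0r mulr0 subr0 mul1r sub0r mulrA -mulNr ler_wpM2r// hB.
Qed.

(** The point is uniformity: the same factor 1 + 2 d absorbs the shift for every weight with 0 <=
    eta <= 1. *)
Lemma weight_shift (eta x x0 d : R) : 0 <= eta <= 1 -> `|x - x0| <= 2 * d -> 1 + eta * `|x| <= (1 + eta * `|x0|) * (1 + 2 * d).
Proof.
move=> /andP[e0 e1] h; have := ler_normD (x - x0) x0; rewrite subrK => h1.
have := normr_ge0 x0; have := normr_ge0 (x - x0); have := normr_ge0 x.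
move: h h1; move: (`|x - x0|) (`|x|) (`|x0|) => p q s h h1 q0 p0 s0.
have d0 : 0 <= d by lra.
have a1 : eta * q <= eta * (s + 2 * d) by apply: ler_wpM2l => //; lra.
have a2 : eta * d <= d by rewrite ler_piMl.
have a3 : 0 <= eta * s * d by rewrite !mulr_ge0.
have -> : (1 + eta * s) * (1 + 2 * d) = 1 + eta * s + 2 * d + 2 * (eta * s * d) by ring.
lra.
Qed.

(** The kernel is centred at x0 + La so that its window [x0, x0 + 2 La] lies to the right of [x0],
    where [rho] has dropped by at most [D]: a large value at [x0] therefore shows in the average.
    For a large negative value the window is placed to the left. *)
Lemma window_up rho (x0 La D N eta : R) : 0 <= La -> 0 <= eta <= 1 -> 0 <= N -> integ (fun x => rho x * K (x - (x0 + La))) ->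
  (forall x, x0 <= x <= x0 + 2 * La -> rho x0 - D <= rho x) -> (forall x, - (N * (1 + eta * `|x|)) <= rho x) ->
  rho x0 * kap La <= rint (fun x => rho x * K (x - (x0 + La))) + D * kap La + N * (1 + eta * `|x0|) * tail La.
Proof.
move=> l0 e01 N0 iF hD hN.
have := @window rho (x0 + La) La (rho x0 - D) (N * (1 + eta * `|x0|)) iF.
have w1 x : `|x - (x0 + La)| <= La -> rho x0 - D <= rho x.
  by rewrite ler_norml => h; apply: hD; lra.
have w2 x : La < `|x - (x0 + La)| -> - (N * (1 + eta * `|x0|) * (1 + 2 * `|x - (x0 + La)|)) <= rho x.
  move=> h; apply: le_trans (hN x); rewrite lerN2 -mulrA ler_wpM2l//; apply: weight_shift => //.
  have := ler_normD (x - (x0 + La)) La; rewrite (_ : x - (x0 + La) + La = x - x0); last by ring.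
  by rewrite (ger0_norm l0); lra.
by move=> /(_ w1 w2); rewrite mulrBl; lra.
Qed.

Lemma window_dn rho (x0 La D N eta : R) : 0 <= La -> 0 <= eta <= 1 -> 0 <= N -> integ (fun x => rho x * K (x - (x0 - La))) ->
  (forall x, x0 - 2 * La <= x <= x0 -> rho x <= rho x0 + D) -> (forall x, rho x <= N * (1 + eta * `|x|)) ->
  - rho x0 * kap La <= - rint (fun x => rho x * K (x - (x0 - La))) + D * kap La + N * (1 + eta * `|x0|) * tail La.
Proof.
move=> l0 e01 N0 iF hD hN.
have iF' : integ (fun x => - rho x * K (x - (x0 - La))) by apply: eq_integ (integN iF) => x; rewrite mulNr.
have := @window (fun x => - rho x) (x0 - La) La (- rho x0 - D) (N * (1 + eta * `|x0|)) iF'.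
have w1 x : `|x - (x0 - La)| <= La -> - rho x0 - D <= - rho x.
  rewrite ler_norml => h; have := hD x ltac:(lra); lra.
have w2 x : La < `|x - (x0 - La)| -> - (N * (1 + eta * `|x0|) * (1 + 2 * `|x - (x0 - La)|)) <= - rho x.
  move=> h; rewrite lerN2; apply: le_trans (hN x) _; rewrite -mulrA ler_wpM2l//; apply: weight_shift => //.
  have := ler_normB (x - (x0 - La)) La; rewrite (_ : x - (x0 - La) - La = x - x0); last by ring.
  by rewrite (ger0_norm l0); lra.
have -> : rint (fun x => - rho x * K (x - (x0 - La))) = - rint (fun x => rho x * K (x - (x0 - La))).
  by rewrite -rintN//; apply: eq_Rintegral => x _; rewrite mulNr.
by move=> /(_ w1 w2); rewrite mulrBl; lra.
Qed.
End KernelBounds.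
End Tauberian.

(** * Boundedness and convergence from window averages *)

Section Tauberian2.
Variable R : realType.
Local Notation mu := (@lebesgue_measure R).
Local Notation rint := (Rintegral mu setT).
Variables (K : R -> R) (c : R).
Hypotheses (cK : continuous K) (K0 : forall x, 0 <= K x <= c * ((1 + x ^+ 2)^-1) ^+ 2) (Kpos : 0 < K 0).
Variables (rho : R -> R) (X0 c1 : R).
Hypotheses (X00 : 0 <= X0) (c10 : 0 <= c1) (rho0 : forall x, x < X0 -> rho x = 0)
  (drop : forall x h, X0 <= x -> 0 <= h -> - (c1 * (1 + h)) <= rho (x + h) - rho x)
  (iK : forall y, integ (fun x => rho x * K (x - y))).
Local Notation Q := (fun y => rint (fun x => rho x * K (x - y))).
Hypothesis Q0 : Q y @[y --> +oo] --> (0 : R).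

Lemma Q_small (e : R) : 0 < e -> exists2 X : R, X0 <= X & forall y, X <= y -> `|Q y| <= e.
Proof.
move=> e0; have /cvgrPdist_lt/(_ e e0)[M [_ hM]] := Q0.
exists (Num.max X0 (M + 1)) => [|y]; first by rewrite le_max lexx.
by rewrite ge_max => /andP[_ h]; have := hM y ltac:(lra); rewrite sub0r normrN => /ltW.
Qed.

(** Downwards [drop] gives linear growth. Upwards, a value at x persists on [x, x + 2] up to the
    loss 3 c1, so an excessive one would contradict the bounded average on a window of half-width
    1. *)
Lemma linear_bound : exists2 A : R, 0 <= A & forall x, `|rho x| <= A * (1 + `|x|).
Proof.
pose A1 := c1 + `|rho X0|.
have low x : - (A1 * (1 + `|x|)) <= rho x.
  have p1 := normr_ge0 x; have p2 := normr_ge0 (rho X0).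
  have A10 : 0 <= A1 by exact: addr_ge0.
  have [h|h] := ltP x X0; first by rewrite rho0// oppr_le0 mulr_ge0//; lra.
  have h0 : 0 <= x - X0 by lra.
  have := drop (lexx X0) h0; rewrite subrKC (ger0_norm (le_trans X00 h)).
  have := ler_norm (- rho X0); rewrite normrN /A1 => h2.
  have := mulr_ge0 p2 (le_trans X00 h); have := mulr_ge0 c10 X00; lra.
have [X hX hQ] := Q_small ltr01.
have k1 := kap_gt0 cK K0 ltr01 Kpos; have t0 := tail_ge0 K0 1.
have A10 : 0 <= A1 by exact: addr_ge0.
pose B := (1 + 3 * c1 * kap K 1 + A1 * tail K 1) / kap K 1.
have n1 : 0 <= A1 * tail K 1 by exact: mulr_ge0.
have B0 : 0 <= B.
  by apply: divr_ge0; rewrite ?(ltW k1)// !addr_ge0// !mulr_ge0// ltW.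
have up x : X <= x -> rho x <= B * (1 + `|x|).
  move=> hx; have e01 : 0 <= (1 : R) <= 1 by rewrite lexx ler01.
  have := @window_up R K c cK K0 rho x 1 (3 * c1) A1 1 ler01 e01 A10 (iK _).
  have w1 z : x <= z <= x + 2 * 1 -> rho x - 3 * c1 <= rho z.
    move=> hz; have hz' : 0 <= z - x by lra.
    have := drop (le_trans hX hx) hz'; rewrite subrKC.
    have : c1 * (1 + (z - x)) <= c1 * 3 by rewrite ler_wpM2l//; lra.
    lra.
  move=> /(_ w1); have w2 z : - (A1 * (1 + 1 * `|z|)) <= rho z by rewrite mul1r.
  move=> /(_ w2); have := hQ (x + 1) ltac:(lra); have := ler_norm (rint (fun z => rho z * K (z - (x + 1)))).
  rewrite mul1r => q1 q2 q3; rewrite -(ler_pM2r k1); apply: le_trans q3 _.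
  have -> : B * (1 + `|x|) * kap K 1 = (1 + 3 * c1 * kap K 1 + A1 * tail K 1) * (1 + `|x|) by rewrite /B mulrAC divfK// gt_eqF.
  have p1 := normr_ge0 x; have p3 : 0 <= 3 * c1 * kap K 1 by rewrite !mulr_ge0// ltW.
  have p2 : 0 <= (1 + 3 * c1 * kap K 1) * `|x| by rewrite mulr_ge0// addr_ge0.
  have -> : A1 * (1 + `|x|) * tail K 1 = A1 * tail K 1 * (1 + `|x|) by ring.
  have -> : (1 + 3 * c1 * kap K 1 + A1 * tail K 1) * (1 + `|x|) = (1 + 3 * c1 * kap K 1) + A1 * tail K 1 * (1 + `|x|) + (1 + 3 * c1 * kap K 1) * `|x| by ring.
  by apply: ler_wpDr => //; rewrite !lerD2r (le_trans q1 q2).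
pose A2 := `|rho X| + c1 * (1 + X).
have X0' : 0 <= X by exact: le_trans hX.
have A20 : 0 <= A2 by rewrite addr_ge0// mulr_ge0//; lra.
exists (A1 + B + A2) => [|x]; first exact: addr_ge0 (addr_ge0 A10 B0) A20.
have p1 := normr_ge0 x.
have p2 : 0 <= 1 + `|x| by rewrite addr_ge0.
have q1 := mulr_ge0 A10 p2; have q2 := mulr_ge0 B0 p2; have q3 := mulr_ge0 A20 p2.
rewrite (mulrDl (A1 + B)) (mulrDl A1) ler_norml; apply/andP; split; first by have := low x; lra.
have [h|h] := leP X x; first by have := up x h; lra.
have [h0|h0] := ltP x X0; first by rewrite rho0//; lra.
have := drop h0 (ltW (ltac:(lra) : 0 < X - x)); rewrite subrKC.
have x0 := le_trans X00 h0.
have : c1 * (1 + (X - x)) <= c1 * (1 + X) by rewrite ler_wpM2l// lerD2l gerBl.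
have := ler_norm (rho X); have : A2 <= A2 * (1 + `|x|) by rewrite ler_peMr//; lra.
by rewrite /A2; lra.
Qed.

(* The new constant is a fixed fraction of [N], uniformly in the weight [eta]; iterating it bounds [rho]. *)
Lemma window_sweep (La D N eta X e : R) : 0 < La -> 0 <= eta <= 1 -> 0 <= N -> X0 <= X -> 0 <= D ->
  (forall y, X <= y -> `|Q y| <= e) ->
  (forall x h, X <= x -> 0 <= h <= 2 * La -> - D <= rho (x + h) - rho x) ->
  (forall x, `|rho x| <= N * (1 + eta * `|x|)) ->
  forall x, X + 2 * La <= x -> `|rho x| <= e / kap K La + D + N * (1 + eta * `|x|) * (tail K La / kap K La).
Proof.
move=> l0 e01 N0 hX D0 hQ hD hN x hx; have l0' := ltW l0.
have k0 := kap_gt0 cK K0 l0 Kpos.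
have U := @window_up R K c cK K0 rho x La D N eta l0' e01 N0 (iK _).
have V := @window_dn R K c cK K0 rho x La D N eta l0' e01 N0 (iK _).
have {}U := U _ _; have {}V := V _ _.
have u1 z : x <= z <= x + 2 * La -> rho x - D <= rho z.
  by move=> hz; have := hD x (z - x) ltac:(lra) ltac:(lra); rewrite subrKC; lra.
have u2 z : - (N * (1 + eta * `|z|)) <= rho z by have := hN z; rewrite ler_norml => /andP[].
have v1 z : x - 2 * La <= z <= x -> rho z <= rho x + D.
  by move=> hz; have := hD z (x - z) ltac:(lra) ltac:(lra); rewrite subrKC; lra.
have v2 z : rho z <= N * (1 + eta * `|z|) by have := hN z; rewrite ler_norml => /andP[].
have {}U := U u1 u2; have {}V := V v1 v2.
have q1 := hQ (x + La) ltac:(lra); have q2 := hQ (x - La) ltac:(lra).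
rewrite ler_norml in q1; rewrite ler_norml in q2.
rewrite -(ler_pM2r k0).
have -> : (e / kap K La + D + N * (1 + eta * `|x|) * (tail K La / kap K La)) * kap K La =
    e + D * kap K La + N * (1 + eta * `|x|) * tail K La.
  by field; rewrite gt_eqF.
rewrite -[X in _ * X <= _](gtr0_norm k0) -normrM ler_norml.
move: q1 q2 U V; rewrite mulNr; set E := N * _ * _; set P := rint _; set P' := rint _ => /andP[q1 q2] /andP[q3 q4] U V.
by apply/andP; split; lra.
Qed.

(** By [linear_bound] the best constant N in |rho x| <= N (1 + eta |x|) is finite for every eta > 0.
    A sweep gives N <= B0 + N / 4 with [B0] independent of [eta], so N <= 2 B0, and then eta -> 0
    removes the weight. *)
Lemma tauberian_bounded : exists2 B : R, 0 <= B & forall x, `|rho x| <= B.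
Proof.
have [A A0 hA] := linear_bound.
have k1 := kap_gt0 cK K0 ltr01 Kpos.
have k4 : 0 < kap K 1 / 4 by rewrite divr_gt0.
(* Since [kap] increases with the window, comparing the tail with a quarter of [kap K 1] makes tail
   / kap at most 1/4 for every wider window. *)
have [L0 L00 hL] := tail_small cK K0 k4.
pose La := Num.max L0 1; have L1 : 1 <= La by rewrite le_max lexx orbT.
have l0 : 0 < La by lra.
have k0 := kap_gt0 cK K0 l0 Kpos.
have t4 : tail K La / kap K La <= 4^-1.
  rewrite ler_pdivrMr//; apply: le_trans (hL La _) _; first by rewrite le_max lexx.
  by rewrite [leLHS]mulrC ler_pM2l ?invr_gt0//; exact: (kap_mono cK K0 L1).
have [X hX hQ] := Q_small ltr01.
pose D := c1 * (1 + 2 * La); have D0 : 0 <= D by rewrite mulr_ge0//; lra.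
have hD x h : X <= x -> 0 <= h <= 2 * La -> - D <= rho (x + h) - rho x.
  move=> hx /andP[h0 h1]; apply: le_trans (drop (le_trans hX hx) h0).
  by rewrite lerN2 /D ler_wpM2l//; lra.
pose B0 := A * (1 + (X + 2 * La)) + ((kap K La)^-1 + D).
have X00' : 0 <= X by exact: le_trans hX.
have ki : 0 < (kap K La)^-1 by rewrite invr_gt0.
have b1 : 0 <= A * (1 + (X + 2 * La)) by rewrite mulr_ge0//; lra.
have b2 : 0 <= (kap K La)^-1 + D by lra.
have B00 : 0 <= B0 by exact: addr_ge0.
have main eta x : 0 < eta <= 1 -> `|rho x| <= 2 * B0 * (1 + eta * `|x|).
  move=> /andP[e0 e1]; have e01 : 0 <= eta <= 1 by rewrite (ltW e0).
  have w1 (z : R) : 1 <= 1 + eta * `|z| by rewrite lerDl mulr_ge0// ltW.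
  have w0 (z : R) : 0 < 1 + eta * `|z| by have := w1 z; lra.
  pose S := [set `|rho z| / (1 + eta * `|z|) | z in [set: R]].
  have Sx z : S (`|rho z| / (1 + eta * `|z|)) by exists z.
  have ubS : has_ubound S.
    exists (A / eta) => _ [z _ <-]; rewrite ler_pdivrMr//; apply: le_trans (hA z) _.
    have -> : A / eta * (1 + eta * `|z|) = A * (eta^-1 + `|z|) by field; rewrite gt_eqF.
    by rewrite ler_wpM2l// lerD2r invf_ge1.
  pose N := sup S.
  have hN z : `|rho z| <= N * (1 + eta * `|z|).
    by rewrite -ler_pdivrMr//; apply: ub_le_sup.
  have N0 : 0 <= N by apply: le_trans (ub_le_sup ubS (Sx 0)); rewrite divr_ge0// ltW.
  have NB z : `|rho z| <= (B0 + N * 4^-1) * (1 + eta * `|z|).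
    have w1z := w1 z; have w0z := w0 z.
    have p1 : B0 <= B0 * (1 + eta * `|z|) by rewrite ler_peMr.
    have p2 : 0 <= N * 4^-1 * (1 + eta * `|z|) by rewrite !mulr_ge0// ?invr_ge0// ltW.
    rewrite mulrDl; have [h|h] := leP (X + 2 * La) z.
      have := @window_sweep La D N eta X 1 l0 e01 N0 hX D0 hQ hD hN z h.
      have : N * (1 + eta * `|z|) * (tail K La / kap K La) <= N * (1 + eta * `|z|) * 4^-1.
        by rewrite ler_wpM2l// mulr_ge0// ltW.
      rewrite mul1r (_ : N * 4^-1 * (1 + eta * `|z|) = N * (1 + eta * `|z|) * 4^-1); last by ring.
      move: p1; rewrite /B0; lra.
    suff : `|rho z| <= A * (1 + (X + 2 * La)) by move: p1; rewrite /B0; lra.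
    have [hz|hz] := ltP z X0; first by rewrite rho0// normr0.
    apply: le_trans (hA z) _; rewrite ler_wpM2l// ger0_norm; first by lra.
    exact: le_trans hz.
  have : N <= B0 + N * 4^-1.
    apply: ge_sup; first by eexists; exact: (Sx 0).
    by move=> _ [z _ <-]; rewrite ler_pdivrMr.
  move=> NN; apply: le_trans (hN x) _; rewrite ler_wpM2r ?(ltW (w0 x))//; lra.
exists (2 * B0) => [|x]; first by rewrite mulr_ge0.
apply/ler_addgt0Pr => e e0; pose M := 2 * B0 * `|x| + 1.
have M0 : 0 < M by rewrite ltr_wpDl// !mulr_ge0.
pose eta := Num.min 1 (e / M).
have eta0 : 0 < eta <= 1 by rewrite lt_min ltr01 divr_gt0//= ge_min lexx.
apply: le_trans (main eta x eta0) _; rewrite mulrDr mulr1 lerD2l mulrCA.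
have h1 : eta <= e / M by rewrite ge_min lexx orbT.
apply: (@le_trans _ _ (eta * M)); first by rewrite ler_wpM2l ?(ltW (andP eta0).1)// /M lerDl.
by rewrite -ler_pdivlMr.
Qed.

(** Once [rho] is bounded, a single sweep with eta = 0 suffices: the average, the drop over the
    window and the tail contribute e / 3 each. *)
Lemma tauberian_zero : vsd_real rho -> rho x @[x --> +oo] --> (0 : R).
Proof.
move=> vr; have [B B0 hB] := tauberian_bounded; apply/cvgrPdist_le => e e0.
have k1 := kap_gt0 cK K0 ltr01 Kpos; have B1 : 0 < B + 1 by lra.
have e3 : 0 < e / 3 by rewrite divr_gt0.
have ek : 0 < e / 3 * kap K 1 / (B + 1) by rewrite divr_gt0// mulr_gt0.
have [L0 L00 hL] := tail_small cK K0 ek.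
pose La := Num.max L0 1; have L1 : 1 <= La by rewrite le_max lexx orbT.
have l0 : 0 < La by lra.
have k0 := kap_gt0 cK K0 l0 Kpos.
have tB : B * (tail K La / kap K La) <= e / 3.
  rewrite mulrA ler_pdivrMr//; have h1 := hL La ltac:(by rewrite le_max lexx).
  rewrite ler_pdivlMr// in h1; have h2 := kap_mono cK K0 L1; have t0 := tail_ge0 K0 La.
  apply: (@le_trans _ _ (e / 3 * kap K 1)); last by rewrite ler_pM2l.
  by apply: le_trans h1; rewrite mulrC ler_wpM2l//; lra.
have [X1 hX1] := vsd_window (2 * La) vr e3.
have [X2 hX2 hQ] := Q_small (mulr_gt0 e3 k0).
pose X := Num.max X1 X2.
have a1 : X1 <= X by rewrite le_max lexx.
have a2 : X2 <= X by rewrite le_max lexx orbT.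
have hN z : `|rho z| <= B * (1 + 0 * `|z|) by rewrite mul0r addr0 mulr1.
have e01 : 0 <= (0 : R) <= 1 by rewrite lexx ler01.
have hD z h : X <= z -> 0 <= h <= 2 * La -> - (e / 3) <= rho (z + h) - rho z.
  by move=> hz; apply: hX1; exact: le_trans hz.
have hQ' y : X <= y -> `|Q y| <= e / 3 * kap K La by move=> hy; apply: hQ; exact: le_trans hy.
exists (X + 2 * La); split; first exact: num_real.
move=> x /ltW hx; rewrite sub0r normrN.
have := @window_sweep La (e / 3) B 0 X (e / 3 * kap K La) l0 e01 B0 (le_trans hX2 a2) (ltW e3) hQ' hD hN x hx.
rewrite mulfK ?gt_eqF// mul0r addr0 mulr1; lra.
Qed.
End Tauberian2.

(** * From limits of exponentially damped averages to convergence *)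

Section Tauberian3.
Variable R : realType.
Local Notation mu := (@lebesgue_measure R).
Local Notation rint := (Rintegral mu setT).

Lemma kernel_vanish (K : R -> R) (c x : R) : (forall x, 0 <= K x <= c * ((1 + x ^+ 2)^-1) ^+ 2) ->
  K (x - y) @[y --> +oo] --> (0 : R).
Proof.
move=> K0; have c0 : 0 <= c.
  by have /andP[h1 h2] := K0 0; have := le_trans h1 h2; rewrite expr0n addr0 invr1 expr1n mulr1.
apply/cvgrPdist_lt => e e0; exists (x + c / e + 1); split; first exact: num_real.
move=> y hy; have /andP[k0 kc] := K0 (x - y).
have ce : 0 <= c / e by rewrite divr_ge0// ltW.
rewrite sub0r normrN ger0_norm//; apply: le_lt_trans kc _.
have u0 : 0 < y - x by move: hy => /=; lra.
have d1 : y - x <= 1 + (x - y) ^+ 2.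
  by have := sqr_ge0 (y - x - 1); rewrite (_ : (y - x - 1) ^+ 2 = (x - y) ^+ 2 - 2 * (y - x) + 1); [lra|ring].
have d0 : 0 < 1 + (x - y) ^+ 2 by lra.
have v1 : (1 + (x - y) ^+ 2)^-1 <= 1 by rewrite invf_le1// lerDl sqr_ge0.
have v0 : 0 <= (1 + (x - y) ^+ 2)^-1 by rewrite invr_ge0 ltW.
apply: (@le_lt_trans _ _ (c * (y - x)^-1)).
  rewrite ler_wpM2l// expr2; apply: (@le_trans _ _ ((1 + (x - y) ^+ 2)^-1)); first by rewrite ler_piMl.
  by rewrite lef_pV2.
rewrite ltr_pdivrMr// mulrC -ltr_pdivrMr//; move: hy => /=; lra.
Qed.

Lemma kernel_bound (K : R -> R) (c x : R) : (forall x, 0 <= K x <= c * ((1 + x ^+ 2)^-1) ^+ 2) -> `|K x| <= c.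
Proof.
move=> K0; have /andP[h1 h2] := K0 x; rewrite ger0_norm//; apply: le_trans h2 _.
have c0 : 0 <= c.
  by have /andP[h3 h4] := K0 0; have := le_trans h3 h4; rewrite expr0n addr0 invr1 expr1n mulr1.
rewrite ler_piMr// exprn_ile1//; first by rewrite invr_ge0 addr_ge0// sqr_ge0.
by rewrite invf_le1 ?lerDl ?sqr_ge0// ltr_wpDr// sqr_ge0.
Qed.

Lemma exp_weight_cvg (a b x : R) : a * expR (- (s * x)) * b @[s --> 0^'+] --> a * b.
Proof.
rewrite -[a in X in _ --> X]mulr1; apply: cvgM; last exact: cvg_cst.
by apply: cvgM; [exact: cvg_cst|exact: expRN_cvg1].
Qed.

Lemma expRN_le1 (s x : R) : 0 <= s -> 0 <= x -> expR (- (s * x)) <= 1.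
Proof. by move=> s0 x0; rewrite -expR0 ler_expR oppr_le0 mulr_ge0. Qed.

(* Positivity of the kernel lets monotone convergence remove the exponential weight. *)
Lemma abel_integ (K rho : R -> R) (c c1 y l : R) : continuous K -> (forall x, 0 <= K x <= c * ((1 + x ^+ 2)^-1) ^+ 2) ->
  measurable_fun setT rho -> (forall x, x < 0 -> rho x = 0) -> 0 <= c1 -> (forall x, - (c1 * (1 + `|x|)) <= rho x) ->
  (forall sg : R, 0 < sg -> integ (fun x => rho x * expR (- (sg * x)))) ->
  rint (fun x => rho x * expR (- (sg * x)) * K (x - y)) @[sg --> 0^'+] --> l ->
  integ (fun x => rho x * K (x - y)) /\ rint (fun x => rho x * K (x - y)) = l.
Proof.
move=> cK K0 mr cr c10 low ie cl.
have mK : measurable_fun setT K by exact: continuous_measurable_fun.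
have mKy : measurable_fun setT (fun x : R => K (x - y)) by apply: (measurableT_comp mK); exact: measurable_funB.
have Kc x : `|K x| <= c by exact: kernel_bound K0.
have iw := kernel_weight_integ cK K0 y.
have ieK sg : 0 < sg -> integ (fun x => rho x * expR (- (sg * x)) * K (x - y)).
  by move=> sg0; apply: (integM_bdd (ie sg sg0) mKy (fun x => Kc _)).
have [d d0 hd] : exists2 d : R, 0 < d & forall sg, 0 < sg < d -> rint (fun x => rho x * expR (- (sg * x)) * K (x - y)) <= l + 1.
  move/cvgrPdist_lt: cl => /(_ 1 ltr01)[d /= d0 hd]; exists d => // sg /andP[sg0 sgd].
  have := hd sg; rewrite /= sub0r normrN gtr0_norm// => /(_ sgd sg0).
  by rewrite distrC ltr_norml; lra.
pose sg (n : nat) : R := d / 2 * n.+1%:R^-1.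
have d20 : 0 < d / 2 by rewrite divr_gt0.
have sg0 n : 0 < sg n by rewrite mulr_gt0// invr_gt0.
have sgd n : sg n < d.
  apply: (@le_lt_trans _ _ (d / 2)); last by lra.
  by rewrite ler_piMr ?(ltW d20)// invf_le1// ler1n.
pose p x := rho x + c1 * (hv x * (1 + `|x|)).
have p0 x : 0 <= p x.
  rewrite /p; have [x0|x0] := ltP x 0; first by rewrite cr// hv_lt0// mul0r mulr0 addr0.
  by rewrite hv_ge0// mul1r; have := low x; lra.
have ihw : integ (fun x => c1 * (hv x * ((1 + `|x|) * K (x - y)))).
  apply: integZ; apply: eq_integ (integM_bdd iw (@mea_hv R) (@hv_norm R)) => x; exact: mulrC.
have ihe n : integ (fun x => c1 * (hv x * ((1 + `|x|) * K (x - y))) * expR (- (sg n * x))).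
  have m : measurable_fun setT (fun x => hv x * expR (- (sg n * x))) by apply: measurable_funM; [exact: mea_hv|exact: mea_expRN].
  apply: eq_integ (integM_bdd ihw m (M := 1) _) => x; rewrite /hv; case: ifP => x0; rewrite ?(mul1r, mul0r, mulr0)//.
  - by rewrite ger0_norm ?expR_ge0// expRN_le1// ltW.
  - by rewrite normr0.
pose Fn n x := p x * K (x - y) * expR (- (sg n * x)).
have FnE n x : Fn n x = rho x * expR (- (sg n * x)) * K (x - y) + c1 * (hv x * ((1 + `|x|) * K (x - y))) * expR (- (sg n * x)).
  by rewrite /Fn /p; ring.
have iFn n : integ (Fn n) by apply: eq_integ (integD (ieK _ (sg0 n)) (ihe n)) => x; rewrite FnE.
have pneg x : x < 0 -> p x = 0 by move=> x0; rewrite /p cr// hv_lt0// mul0r mulr0 addr0.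
have h1 n x : 0 <= Fn n x.
  by rewrite /Fn; have /andP[k0 _] := K0 (x - y); apply: mulr_ge0; [exact: mulr_ge0|exact: expR_ge0].
have h2 x m n : (m <= n)%N -> Fn m x <= Fn n x.
  move=> mn; have [x0|x0] := ltP x 0; first by rewrite /Fn pneg// !mul0r.
  rewrite /Fn; have /andP[k0 _] := K0 (x - y); apply: ler_wpM2l; first exact: mulr_ge0.
  by rewrite ler_expR lerN2 ler_wpM2r// /sg ler_wpM2l ?(ltW d20)// lef_pV2 ?posrE// ler_nat.
have h3 x : Fn ^~ x @ \oo --> p x * K (x - y).
  have cs : - (sg n * x) @[n --> \oo] --> (0 : R).
    have -> : (0 : R) = - (d / 2 * 0 * x) by rewrite mulr0 mul0r oppr0.
    by apply: cvgN; apply: cvgM; [apply: cvgM; [exact: cvg_cst|exact: cvg_harmonic]|exact: cvg_cst].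
  have := cvg_comp _ _ cs (@continuous_expR R 0); rewrite expR0 => e1.
  by have := cvgM (cvg_cst (p x * K (x - y))) e1; rewrite mulr1; exact.
have h4 n : rint (Fn n) <= l + 1 + rint (fun x => c1 * (hv x * ((1 + `|x|) * K (x - y)))).
  have -> : rint (Fn n) = rint (fun x => rho x * expR (- (sg n * x)) * K (x - y) + c1 * (hv x * ((1 + `|x|) * K (x - y))) * expR (- (sg n * x))).
    by apply: eq_Rintegral => x _; exact: FnE.
  rewrite (RintegralD measurableT (ieK _ (sg0 n)) (ihe n)); apply: lerD; first by apply: hd; rewrite sg0 sgd.
  apply: le_rint => // x; have /andP[k0 _] := K0 (x - y); rewrite /hv; case: ifP => x0; last by rewrite !(mul0r, mulr0).
  rewrite mul1r ler_piMr ?expRN_le1 ?(ltW (sg0 n))//; apply: mulr_ge0 => //; apply: mulr_ge0 => //; exact: addr_ge0.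
have [iF _] := mono_integ iFn h1 h2 h3 h4.
have iR : integ (fun x => rho x * K (x - y)).
  by apply: eq_integ (integB iF ihw) => x; rewrite /p; ring.
split => //; apply: (cvg_unique _ _ cl) => //.
apply: (dct_right0 ltr01 _ (integ_mea iR) _ (integ_norm iR)) => [s /andP[s0 _]||s x /andP[s0 _]].
- exact: integ_mea (ieK s s0).
- by apply: aeW => x; exact: exp_weight_cvg.
- have [x0|x0] := ltP x 0; first by rewrite cr// !mul0r.
  by rewrite mulrAC normrM ler_piMr// ger0_norm ?expR_ge0// expRN_le1// ltW.
Qed.

(** Before [X0] the function is merely integrable, so r = rho + q with [rho] cut off below [X0]. The
    averages of [q] tend to 0 because the translated kernel does so pointwise, and [rho] satisfies
    the one-sided bounds of the preceding argument. *)
Lemma tauberian (K r Rf : R -> R) (c : R) : continuous K -> (forall x, 0 <= K x <= c * ((1 + x ^+ 2)^-1) ^+ 2) -> 0 < K 0 ->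
  measurable_fun setT r -> (forall x, x < 0 -> r x = 0) -> vsd_real r ->
  (forall sg : R, 0 < sg -> integ (fun x => r x * expR (- (sg * x)))) ->
  (forall y, rint (fun x => r x * expR (- (sg * x)) * K (x - y)) @[sg --> 0^'+] --> Rf y) ->
  Rf y @[y --> +oo] --> (0 : R) -> r x @[x --> +oo] --> (0 : R).
Proof.
move=> cK K0 Kpos mr cr vr ie cl R0.
have mK : measurable_fun setT K by exact: continuous_measurable_fun.
have c0 : 0 <= c.
  by have /andP[h1 h2] := K0 0; have := le_trans h1 h2; rewrite expr0n addr0 invr1 expr1n mulr1.
have Kc x : `|K x| <= c by exact: kernel_bound K0.
have mKy (y : R) : measurable_fun setT (fun x : R => K (x - y)) by apply: (measurableT_comp mK); exact: measurable_funB.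
have [X1 X10 [a1 a10 low]] := vsd_lower vr; have [X2 [c1 c10 drop]] := vsd_drop vr.
pose X0 := Num.max X1 X2; have x1 : X1 <= X0 by rewrite le_max lexx.
have x2 : X2 <= X0 by rewrite le_max lexx orbT.
have X00 : 0 <= X0 by exact: le_trans x1.
have mhX : measurable_fun setT (fun x : R => hv (x - X0)) by apply: (measurableT_comp (@mea_hv R)); exact: measurable_funB.
pose rho x := r x * hv (x - X0); pose q x := r x * (1 - hv (x - X0)).
have rhoE x : X0 <= x -> rho x = r x by move=> h; rewrite /rho hv_ge0 ?mulr1// subr_ge0.
have rho0 x : x < X0 -> rho x = 0 by move=> h; rewrite /rho hv_lt0 ?mulr0// subr_lt0.
have mrho : measurable_fun setT rho by exact: measurable_funM.
have rlow x : - (a1 * (1 + `|x|)) <= rho x.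
  have [h|h] := ltP x X0; first by rewrite rho0// oppr_le0 mulr_ge0// addr_ge0.
  by rewrite rhoE//; have := low x (le_trans x1 h); rewrite ger0_norm// (le_trans X00).
(* Written as r x exp(- x), which is integrable, times a factor bounded by exp(X0). *)
have iq : integ q.
  have m : measurable_fun setT (fun x : R => expR x * (1 - hv (x - X0)) * hv x).
    by apply: measurable_funM; [apply: measurable_funM => //; exact: measurable_funB|exact: mea_hv].
  apply: eq_integ (integM_bdd (ie 1 ltr01) m (M := expR X0) _) => x.
    rewrite mul1r /q; have [x0|x0] := ltP x 0; first by rewrite cr// !mul0r.
    by rewrite (hv_ge0 x0) mulr1 mulrA -[r x * _ * _]mulrA -expRD addNr expR0 mulr1.
  have [h|h] := ltP x X0; last by rewrite (@hv_ge0 R (x - X0)) ?subr_ge0// subrr mulr0 mul0r normr0 expR_ge0.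
  rewrite (@hv_lt0 R (x - X0)) ?subr_lt0// subr0 mulr1 /hv; case: ifP => _; rewrite ?mulr1 ?mulr0 ?normr0 ?expR_ge0//.
  by rewrite ger0_norm ?expR_ge0// ler_expR ltW.
have q0 x : x < 0 -> q x = 0 by move=> h; rewrite /q cr// mul0r.
have irho sg : 0 < sg -> integ (fun x => rho x * expR (- (sg * x))).
  move=> sg0; apply: eq_integ (integM_bdd (ie sg sg0) mhX (fun x => hv_norm _)) => x; rewrite /rho; ring.
have iqK (y : R) : integ (fun x => q x * K (x - y)) by apply: (integM_bdd iq (mKy y) (fun x => Kc _)).
have qlim y : rint (fun x => q x * expR (- (sg * x)) * K (x - y)) @[sg --> 0^'+] --> rint (fun x => q x * K (x - y)).
  apply: (dct_right0 ltr01 _ (integ_mea (iqK y)) _ (integ_norm (iqK y))) => [s /andP[s0 _]||s x /andP[s0 _]].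
  - by apply: measurable_funM => //; apply: measurable_funM; [exact: integ_mea|exact: mea_expRN].
  - by apply: aeW => x; exact: exp_weight_cvg.
  - have [x0|x0] := ltP x 0; first by rewrite q0// !mul0r.
    by rewrite mulrAC normrM ler_piMr// ger0_norm ?expR_ge0// expRN_le1// ltW.
have rlim y : rint (fun x => rho x * expR (- (sg * x)) * K (x - y)) @[sg --> 0^'+] --> Rf y - rint (fun x => q x * K (x - y)).
  apply: cvg_trans (cvgB (cl y) (qlim y)); apply: near_eq_cvg; near=> sg.
  have sg0 : 0 < sg by near: sg; exact: nbhs_right_gt.
  have i1 : integ (fun x => r x * expR (- (sg * x)) * K (x - y)) by apply: (integM_bdd (ie sg sg0) (mKy y) (fun x => Kc _)).
  have i2 : integ (fun x => rho x * expR (- (sg * x)) * K (x - y)) by apply: (integM_bdd (irho sg sg0) (mKy y) (fun x => Kc _)).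
  have i3 : integ (fun x => q x * expR (- (sg * x)) * K (x - y)).
    by apply: eq_integ (integB i1 i2) => x; rewrite /rho /q; ring.
  apply: etrans (esym (RintegralB measurableT i1 i3)) _; apply: eq_Rintegral => x _; rewrite /rho /q; ring.
have rA y := abel_integ cK K0 mrho (fun x x0 => rho0 x (lt_le_trans x0 X00)) a10 rlow irho (rlim y).
have Q0 : rint (fun x => rho x * K (x - y)) @[y --> +oo] --> (0 : R).
  have D : rint (fun x => q x * K (x - y)) @[y --> +oo] --> rint (fun=> 0 : R).
    apply: (dct_pinfty _ _ _ (integZ c (integ_norm iq))) => [y|||y x].
    - exact: integ_mea (iqK y).
    - exact: measurable_cst.
    - by apply: aeW => x; have := cvgM (cvg_cst (q x)) (kernel_vanish x K0); rewrite mulr0; exact.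
    - by rewrite normrM mulrC ler_wpM2r.
  have L : (Rf y - rint (fun x => q x * K (x - y))) @[y --> +oo] --> (0 : R).
    by have := cvgB R0 D; rewrite (@rint_eq0 R (fun=> 0))// subr0; exact.
  by apply: cvg_trans L; apply: near_eq_cvg; apply: nearW => y; exact: (esym (rA y).2).
have dropr x h : X0 <= x -> 0 <= h -> - (c1 * (1 + h)) <= rho (x + h) - rho x.
  by move=> hx h0; rewrite !rhoE//; [apply: drop => //; exact: le_trans hx|rewrite (le_trans hx)// lerDl].
have vrho : vsd_real rho.
  case: vr => dl dl0 H; exists dl => // e e0; have [X hX] := H e e0; exists (Num.max X X0) => x h.
  rewrite ge_max => /andP[h1 h2] h3; rewrite !rhoE//; first exact: hX.
  by rewrite (le_trans h2)// lerDl; case/andP: h3.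
have := tauberian_zero cK K0 Kpos X00 c10 rho0 dropr (fun y => proj1 (rA y)) Q0 vrho.
apply: cvg_trans; apply: near_eq_cvg; exists X0; split; first exact: num_real.
by move=> x /ltW; exact: rhoE.
Unshelve. all: by end_near. Qed.
End Tauberian3.

(** * Primitives and slow variation *)

Section Primitive.
Variable R : realType.
Local Notation mu := (@lebesgue_measure R).
Local Notation rint := (Rintegral mu setT).
Local Notation C := R[i].
Local Notation Re := (@complex.Re R).
Local Notation Im := (@complex.Im R).
Implicit Types (g : R -> C).

Lemma bdd_loc_integrable g (M : R) : cmea g -> (forall x, cnorm (g x) <= M) -> loc_integrable g.
Proof.
move=> mg gM a b; apply/(cinteg_mkcond _ (measurable_itv _)).
apply: (cinteg_dom _ (integZ M (integ_indic a b))).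
  by apply: cmeaM => //; apply: cmea_RtoC; exact: measurable_indic.
by move=> x; rewrite cnormM cnorm_RtoC ger0_norm ?indicE// ler_wpM2r.
Qed.

Lemma prim_diff g (x h e : R) : loc_integrable g -> 0 <= x -> 0 <= h -> (forall u, x <= u <= x + h -> cnorm (g u) <= e) ->
  cnorm (cint `[0, x + h] g - cint `[0, x] g) <= 2 * (e * h).
Proof.
move=> lg x0 h0 ge; have e0 : 0 <= e by apply: le_trans (cnorm_ge0 _) (ge x _); rewrite lexx lerDl.
have i1 := (cinteg_mkcond _ (measurable_itv _)).1 (lg 0 (x + h)).
have i2 := (cinteg_mkcond _ (measurable_itv _)).1 (lg 0 x).
rewrite (cint_mkcond `[0, x + h]) (cint_mkcond `[0, x]) -(cintB i1 i2).
have -> : e * h = rint (fun u => e * \1_(`[x, x + h]%classic) u).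
  by rewrite rintZ ?rint_indic ?lerDl//; [congr (_ * _); ring|exact: integ_indic].
apply: cnorm_cint; first exact: cinteg_mea (cintegB i1 i2).
  exact: integZ (integ_indic _ _).
move=> u; rewrite -mulrBr cnormM !ind_indic.
have -> : RtoC (ind 0 (x + h) u) - RtoC (ind 0 x u) = RtoC (ind 0 (x + h) u - ind 0 x u) by rewrite -RtoCN -RtoCD.
rewrite cnorm_RtoC; have [u0|u0] := ltP u 0; first by rewrite !ind_out ?subrr ?normr0 ?mulr0//; lra.
have [h1|h1] := leP u x.
  rewrite !(@ind_in R 0)//; [|lra..]; rewrite subrr normr0 mulr0 mulr_ge0//.
  by rewrite /ind; case: ifP.
rewrite (@ind_out R 0 x) ?subr0; last by lra.
have [h2|h2] := leP u (x + h).
  by rewrite !ind_in ?normr1 ?mulr1 ?ge//; lra.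
by rewrite !ind_out ?normr0 ?mulr0//; lra.
Qed.

Lemma cint_itv00 g : cint `[0, 0] g = 0.
Proof.
rewrite set_itv1; have z (f : R -> R) : Rintegral mu [set 0] f = 0 by rewrite /Rintegral integral_set1.
by rewrite /cint !z.
Qed.

Lemma prim_lin g (M x : R) : cmea g -> (forall x, cnorm (g x) <= M) -> 0 <= x -> cnorm (cint `[0, x] g) <= 2 * (M * x).
Proof.
move=> mg gM x0; have := @prim_diff g 0 x M (bdd_loc_integrable mg gM) (lexx _) x0 (fun u _ => gM u).
by rewrite add0r cint_itv00 subr0.
Qed.

Lemma prim_cmea g (M : R) : cmea g -> (forall x, cnorm (g x) <= M) -> cmea (fun x => RtoC (hv x) * cint `[0, x] g).
Proof.
move=> mg gM; have lg := bdd_loc_integrable mg gM.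
have M0 : 0 <= M by exact: le_trans (cnorm_ge0 _) (gM 0).
pose P x := cint `[0, Num.max x 0] g.
have L0 (x y : R) : x <= y -> cnorm (P y - P x) <= 2 * M * (y - x).
  move=> xy; have m1 : Num.max x 0 <= Num.max y 0 by rewrite ge_max !le_max xy lexx orbT.
  have m2 : 0 <= Num.max x 0 by rewrite le_max lexx orbT.
  have := @prim_diff g (Num.max x 0) (Num.max y 0 - Num.max x 0) M lg m2 _ (fun u _ => gM u).
  rewrite subr_ge0 => /(_ m1); rewrite subrKC => h; apply: le_trans h _; rewrite mulrA ler_wpM2l ?mulr_ge0//.
  by rewrite /Num.max; case: ifP => h1; case: ifP => h2; lra.
have L (x y : R) : cnorm (P x - P y) <= 2 * M * `|x - y|.
  have [xy|yx] := leP x y; first by rewrite cnormBC distrC ger0_norm ?subr_ge0// L0.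
  by rewrite gtr0_norm ?subr_gt0// L0// ltW.
have cP : cmea P.
  split; apply: continuous_measurable_fun; apply: (@lipschitz_continuous R _ (2 * M)) => x y.
    by rewrite -ReB; exact: le_trans (norm_Re _) (L x y).
  by rewrite -ImB; exact: le_trans (norm_Im _) (L x y).
have -> : (fun x => RtoC (hv x) * cint `[0, x] g) = (fun x => RtoC (hv x) * P x).
  apply/funext => x; have [x0|x0] := leP 0 x; last by rewrite hv_lt0// !mul0r.
  by rewrite /P (max_idPl x0).
by apply: cmeaM => //; apply: cmea_RtoC; exact: mea_hv.
Qed.

Lemma prim_lapl g (M : R) : cmea g -> (forall x, cnorm (g x) <= M) -> lapl (fun x => RtoC (hv x) * cint `[0, x] g).
Proof.
move=> mg gM; have M0 : 0 <= M by exact: le_trans (cnorm_ge0 _) (gM 0).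
apply: (@lapl_lin R _ (2 * M)); [exact: prim_cmea gM|by move=> x x0; rewrite hv_lt0// mul0r|].
move=> x x0; rewrite hv_ge0// mul1r; apply: le_trans (prim_lin mg gM x0) _; nra.
Qed.

(** The two-sided form of slow oscillation with steps up to 1: [vsd_slow] obtains it from [f] and
    [- f], while [slow_vsd] and [slowN] lead back. It is the form that adds and subtracts freely. *)
Definition slow (f : R -> R) := forall e : R, 0 < e -> exists X : R, forall x h : R,
  X <= x -> 0 <= h <= 1 -> `|f (x + h) - f x| <= e.

Lemma slowD f1 f2 : slow f1 -> slow f2 -> slow (fun x => f1 x + f2 x).
Proof.
move=> s1 s2 e e0; have e2 : 0 < e / 2 by rewrite divr_gt0.
have [X1 h1] := s1 _ e2; have [X2 h2] := s2 _ e2; exists (Num.max X1 X2) => x h.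
rewrite ge_max => /andP[a1 a2] hh; have := h1 x h a1 hh; have := h2 x h a2 hh.
by rewrite !ler_norml; lra.
Qed.

Lemma slowN f : slow f -> slow (fun x => - f x).
Proof. by move=> s e e0; have [X hX] := s e e0; exists X => x h a b; rewrite -opprD normrN hX. Qed.

Lemma slow_cst (c : R) : slow (fun=> c).
Proof. by move=> e e0; exists 0 => x h _ _; rewrite subrr normr0 ltW. Qed.

Lemma slow_cvg (f : R -> R) (l : R) : f x @[x --> +oo] --> l -> slow f.
Proof.
move=> /cvgrPdist_le cf e e0; have [M [_ hM]] := cf (e / 2) (divr_gt0 e0 (ltr0n R 2)).
exists (M + 1) => x h hx /andP[h0 _].
by have := hM x ltac:(lra); have := hM (x + h) ltac:(lra); rewrite !ler_norml; lra.
Qed.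

Lemma slow_ext (f f' : R -> R) (X : R) : (forall x, X <= x -> f x = f' x) -> slow f -> slow f'.
Proof.
move=> ff s e e0; have [Y hY] := s e e0; exists (Num.max X Y) => x h; rewrite ge_max => /andP[a1 a2] hh.
by rewrite -!ff//; [exact: hY|rewrite (le_trans a1)// lerDl; case/andP: hh].
Qed.

Lemma slow_vsd f : slow f -> vsd_real f.
Proof.
move=> s; exists 1 => // e e0; have [X hX] := s e e0; exists X => x h a b.
by have := hX x h a b; rewrite ler_norml => /andP[].
Qed.

Lemma vsd_slowD f1 f2 : vsd_real f1 -> slow f2 -> vsd_real (fun x => f1 x + f2 x).
Proof.
move=> [dl dl0 s1] s2; exists (Num.min dl 1) => [|e e0]; first by rewrite lt_min dl0 ltr01.
have e2 : 0 < e / 2 by rewrite divr_gt0.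
have [X1 h1] := s1 _ e2; have [X2 h2] := s2 _ e2; exists (Num.max X1 X2) => x h.
rewrite ge_max le_min => /andP[a1 a2] /and3P[b0 b1 b2].
have := h1 x h a1 ltac:(by rewrite b0); have := h2 x h a2 ltac:(by rewrite b0).
by rewrite ler_norml; lra.
Qed.

Lemma vsd_slow f : vsd_real f -> vsd_real (fun x => - f x) -> slow f.
Proof.
move=> v1 v2 e e0; have [X1 h1] := vsd_window 1 v1 e0; have [X2 h2] := vsd_window 1 v2 e0.
exists (Num.max X1 X2) => x h; rewrite ge_max => /andP[a1 a2] hh.
have := h1 x h a1 hh; have := h2 x h a2 hh; rewrite ler_norml; lra.
Qed.

Lemma vsd_ext (f f' : R -> R) (X : R) : (forall x, X <= x -> f x = f' x) -> vsd_real f -> vsd_real f'.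
Proof.
move=> ff [dl dl0 s]; exists dl => // e e0; have [Y hY] := s e e0; exists (Num.max X Y) => x h.
rewrite ge_max => /andP[a1 a2] hh.
by rewrite -!ff//; [exact: hY|rewrite (le_trans a1)// lerDl; case/andP: hh].
Qed.

Lemma prim_slow g : loc_integrable g -> ccvg_pinfty g 0 ->
  slow (fun x => Re (cint `[0, x] g)) /\ slow (fun x => Im (cint `[0, x] g)).
Proof.
move=> lg cg; have H e : 0 < e -> exists X : R, forall x h : R, X <= x -> 0 <= h <= 1 ->
    cnorm (cint `[0, x + h] g - cint `[0, x] g) <= e.
  move=> e0; have [M hM] := cg (e / 2) (divr_gt0 e0 (ltr0n R 2)); exists (Num.max 0 (M + 1)) => x h.
  rewrite ge_max => /andP[x0 xM] /andP[h0 h1].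
  apply: le_trans (@prim_diff g x h (e / 2) lg x0 h0 _) _; last by rewrite mulrA mulrCA divff// mulr1 ler_piMr// ltW.
  by move=> u hu; have := hM u ltac:(lra); rewrite subr0 => /ltW.
split => e /H[X hX]; exists X => x h a b; have := hX x h a b; apply: le_trans.
  by rewrite -ReB; exact: norm_Re.
by rewrite -ImB; exact: norm_Im.
Qed.
End Primitive.

(** * Gluing across the imaginary axis *)

Section Glue.
Variable R : realType.
Local Notation mu := (@lebesgue_measure R).
Local Notation cintT := (cint setT).
Local Notation C := R[i].
Local Notation Re := (@complex.Re R).
Local Notation Im := (@complex.Im R).
Implicit Types (g : R -> C).

(** Only the point 0 of the axis matters afterwards, so all neighbourhoods shrink to one symmetric
    interval carrying a single representative [h]. *)
Lemma pf_local (F : C -> C) : pf_boundary F -> exists (rho : R) (h : R -> C) (M : R),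
  [/\ 0 < rho, cmea h, forall x, cnorm (h x) <= M,
      (forall e : R, 0 < e -> exists A : R, forall x, A < `|x| -> cnorm (h x) < e) &
      forall a phi, a < rho -> ctest a phi ->
        ccvg_right0 (fun sigma => cintT (fun t => F (Complex sigma t) * phi t)) (cintT (fun x => h x * ifourier phi x))].
Proof.
move=> [U [[oU iU U0] [T [hT hl]]]]; have [V [[oV V0 VU] [h [m1 [m2 [[M hM] [hv hp]]]]]]] := hl 0 U0.
have /nbhs_ballP[rho /= r0 hr] := open_nbhs_nbhs (conj oV V0).
exists rho, h, M; split => // a phi ar ct.
have [s1 [s2 [a' [b' [ab z]]]]] := ctest_test_fun ar ct.
have sV : `](- rho), rho[%classic `<=` V.
  by move=> x /=; rewrite in_itv/= => hx; apply: hr; rewrite /ball /= sub0r normrN ltr_norml.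
have tV : test_fun V phi by split=> //; split => //; exists a', b'; split => // x hx; apply: sV; exact: ab.
have tU : test_fun U phi by split=> //; split => //; exists a', b'; split => // x hx; apply: VU; apply: sV; exact: ab.
by rewrite -(hp _ tV); exact: hT.
Qed.

Lemma cont_supp_integ (f : R -> R) (a : R) : continuous f -> (forall t, ~ (- a <= t <= a) -> f t = 0) -> integ f.
Proof.
move=> cf f0; have : mu.-integrable `[- a, a]%classic (EFin \o f).
  by apply: continuous_compact_integrable; [exact: segment_compact|exact: continuous_subspaceT].
move/(integ_mkcond _ (measurable_itv _)); apply: eq_integ => t; rewrite ind_indic.
have [h|h] := pselect (- a <= t <= a); first by rewrite ind_in// mulr1.
by rewrite f0// mul0r.
Qed.

(** Beyond |t| < r the values of [F] are arbitrary. The support of [phi] hides them, so continuity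
    of the product is shown separately where [F] is differentiable and where [phi] vanishes. *)
Lemma line_integ (F : C -> C) (sg r a : R) phi : (forall t : R, `|t| < r -> exists l, cderiv_at F (Complex sg t) l) ->
  a < r -> ctest a phi -> cinteg (fun t => F (Complex sg t) * phi t).
Proof.
move=> dF ar ct; have [a0 [[s1 _] [s2 _]]] := ct.
have out t : ~ (- a <= t <= a) -> F (Complex sg t) * phi t = 0 by move=> h; rewrite (ctest_out ct h) mulr0.
have c1 := smooth_continuous s1; have c2 := smooth_continuous s2.
have cF (t : R) : `|t| < r -> Re (F (Complex sg u)) @[u --> t] --> Re (F (Complex sg t)) /\ Im (F (Complex sg u)) @[u --> t] --> Im (F (Complex sg t)).
  move=> tr; have K e : 0 < e -> \forall u \near t, cnorm (F (Complex sg u) - F (Complex sg t)) < e.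
    move=> e0; have [l /cderiv_lip[d d0 hd]] := dF t tr.
    have l0 := cnorm_ge0 l; have l1 : 0 < 1 + cnorm l by lra.
    apply/nbhs_ballP; exists (Num.min d (e / (1 + cnorm l))); first by rewrite /= lt_min d0 divr_gt0.
    move=> u /=; rewrite /ball /= lt_min => /andP[h1 h2].
    have E : Complex sg u = Complex sg t + Complex 0 (u - t) by apply: C_ext; rewrite ?ReD ?ImD /= ?addr0 ?subrKC.
    have E2 : cnorm (Complex 0 (u - t)) = `|t - u| by rewrite /cnorm /= expr0n add0r sqrtr_sqr distrC.
    by rewrite E; apply: le_lt_trans (hd _ _) _; rewrite E2// mulrC -ltr_pdivlMr.
  split; apply/cvgrPdist_lt => e e0; near=> u.
  - rewrite distrC -ReB; apply: le_lt_trans (norm_Re _) _; near: u; exact: K.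
  - rewrite distrC -ImB; apply: le_lt_trans (norm_Im _) _; near: u; exact: K.
have far (f : R -> R) (t : R) : (forall t, ~ (- a <= t <= a) -> f t = 0) -> a < `|t| -> f u @[u --> t] --> f t.
  move=> f0 at_; rewrite (f0 t); last by rewrite -ler_norml; apply/negP; rewrite -ltNge.
  apply: cvg_near_cst; have d0 : 0 < `|t| - a by rewrite subr_gt0.
  apply/nbhs_ballP; exists (`|t| - a) => // u; rewrite /ball /= => hu; rewrite f0// -ler_norml.
  by apply/negP; rewrite -ltNge; have := lerB_dist t (t - u); rewrite subKr; lra.
split; apply: (@cont_supp_integ _ a) => [t|t /out ->//].
- have [h|h] := ltP `|t| r; last by apply: far => [u /out ->//|]; exact: lt_le_trans h.
  have [k1 k2] := cF t h; rewrite /continuous_at ReM; under eq_fun do rewrite ReM.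
  by apply: cvgB; apply: cvgM => //; [exact: c1|exact: c2].
- have [h|h] := ltP `|t| r; last by apply: far => [u /out ->//|]; exact: lt_le_trans h.
  have [k1 k2] := cF t h; rewrite /continuous_at ImM; under eq_fun do rewrite ImM.
  by apply: cvgD; apply: cvgM => //; [exact: c2|exact: c1].
Unshelve. all: by end_near. Qed.

Lemma dfree_ext (p q p' q' : R -> R -> R) (x y dl : R) : 0 < dl ->
  (forall h k, `|h| < dl -> `|k| < dl -> p (x + h) (y + k) = p' (x + h) (y + k) /\ q (x + h) (y + k) = q' (x + h) (y + k)) ->
  dfree p q x y -> dfree p' q' x y.
Proof.
move=> dl0 E [p1 [p2 [q1 H]]]; exists p1, p2, q1 => e e0; have [d d0 hd] := H e e0.
have z : `|0 : R| < dl by rewrite normr0.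
have [E1 E2] := E 0 0 z z; rewrite !addr0 in E1 E2.
exists (Num.min d dl) => [|h k]; first by rewrite lt_min d0.
rewrite !lt_min => /andP[a1 a2] /andP[b1 b2]; have [E3 E4] := E h k a2 b2.
by rewrite -E1 -E2 -E3 -E4; exact: hd.
Qed.

(** The limit at 0 is the supremum of the lower bounds f(x) - K |x|, each of which is below every
    upper bound f(x') + K |x'|. *)
Lemma lip_limit (f : R -> R) (K dl : R) : 0 < dl -> 0 <= K ->
  (forall x x', 0 < `|x| < dl -> 0 < `|x'| < dl -> `|f x' - f x| <= K * `|x' - x|) ->
  exists l, forall x, 0 < `|x| < dl -> `|f x - l| <= K * `|x|.
Proof.
move=> dl0 K0 H; pose S := [set f x - K * `|x| | x in [set x : R | 0 < `|x| < dl]].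
have ub x x' : 0 < `|x| < dl -> 0 < `|x'| < dl -> f x - K * `|x| <= f x' + K * `|x'|.
  move=> hx hx'; have h := H x' x hx' hx; have := ler_norm (f x - f x').
  have : K * `|x - x'| <= K * (`|x| + `|x'|) by rewrite ler_wpM2l// ler_normB.
  rewrite mulrDr; lra.
have h2 : 0 < `|dl / 2| < dl by rewrite gtr0_norm; lra.
have hS : has_ubound S by exists (f (dl / 2) + K * `|dl / 2|) => _ [x hx <-]; exact: ub.
exists (sup S) => x hx; rewrite ler_norml; apply/andP; split.
  have : sup S <= f x + K * `|x|; last by lra.
  by apply: ge_sup; [exists (f (dl / 2) - K * `|dl / 2|); exists (dl / 2)|move=> _ [z hz <-]; exact: ub].
have : f x - K * `|x| <= sup S; last by lra.
by apply: ub_le_sup => //; exists x.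
Qed.

Lemma ctest_mod a (y : R) phi : ctest a phi -> ctest a (fun t => phi t * cexp (iC R * RtoC (t * y))).
Proof.
move=> [a0 [[s1 z1] [s2 z2]]]; split; first exact: a0.
have sl : smooth (fun t : R => t * y) by apply: smoothM; [exact: smooth_id|exact: smooth_cst].
have [sc ss] := smooth_cos R.
have s3 : smooth (fun t : R => cos (t * y)) := @smooth_comp R (fun t => t * y) (@cos R) sl sc.
have s4 : smooth (fun t : R => sin (t * y)) := @smooth_comp R (fun t => t * y) (@sin R) sl ss.
split; split.
- have -> : (fun x => Re (phi x * cexp (iC R * RtoC (x * y)))) = (fun x => Re (phi x) * cos (x * y) - Im (phi x) * sin (x * y)).
    by apply/funext => x; rewrite cexp_pi ReM.
  by apply: smoothB; [exact: (smoothM s1 s3)|exact: (smoothM s2 s4)].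
- by move=> t ht; rewrite ReM (z1 _ ht) (z2 _ ht) !mul0r subrr.
- have -> : (fun x => Im (phi x * cexp (iC R * RtoC (x * y)))) = (fun x => Re (phi x) * sin (x * y) + Im (phi x) * cos (x * y)).
    by apply/funext => x; rewrite cexp_pi ImM.
  by apply: smoothD; [exact: (smoothM s1 s4)|exact: (smoothM s2 s3)].
- by move=> t ht; rewrite ImM (z1 _ ht) (z2 _ ht) !mul0r addr0.
Qed.

Lemma fourier_mod phi (x y : R) : fourier (fun t => phi t * cexp (iC R * RtoC (t * y))) x = fourier phi (x - y).
Proof.
apply: eq_cint => t; rewrite [phi t * _]mulrC mulrA -cexpD; congr (cexp _ * _).
rewrite !RtoCM RtoCD RtoCN; ring.
Qed.
End Glue.

Section Glue2.
Variable R : realType.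
Local Notation mu := (@lebesgue_measure R).
Local Notation rint := (Rintegral mu setT).
Local Notation cintT := (cint setT).
Local Notation C := R[i].
Local Notation Re := (@complex.Re R).
Local Notation Im := (@complex.Im R).

Variables (G : C -> C) (rG rho M : R) (g : R -> C).
Hypotheses (rG0 : 0 < rG) (rho0 : 0 < rho) (mg : cmea g) (gM : forall x, cnorm (g x) <= M).
Hypothesis dG : forall z, cnorm z < rG -> 0 < Re z -> exists l, cderiv_at G z l.
Hypothesis LG : forall a phi, a < rho -> ctest a phi ->
  ccvg_right0 (fun sigma => cintT (fun t => G (Complex sigma t) * phi t)) (cintT (fun x => g x * fourier phi x)).

Definition gplus x : C := RtoC (hv x) * g x.
Definition gminus x : C := RtoC (hv x) * g (- x).

Lemma hvM_bound (f : R -> C) x : (forall x, cnorm (f x) <= M) -> cnorm (RtoC (hv x) * f x) <= M.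
Proof.
move=> fM; rewrite cnormM cnorm_RtoC; apply: le_trans (fM x).
by rewrite ler_piMl ?cnorm_ge0// hv_norm.
Qed.

Lemma gplus_cmea : cmea gplus.
Proof. by apply: cmeaM => //; apply: cmea_RtoC; exact: mea_hv. Qed.
Lemma gminus_cmea : cmea gminus.
Proof.
apply: cmeaM; first by apply: cmea_RtoC; exact: mea_hv.
by apply: cmea_comp => //; exact: measurable_funN.
Qed.
Lemma gplus_neg x : x < 0 -> gplus x = 0. Proof. by move=> h; rewrite /gplus hv_lt0// mul0r. Qed.
Lemma gminus_neg x : x < 0 -> gminus x = 0. Proof. by move=> h; rewrite /gminus hv_lt0// mul0r. Qed.
Lemma gplus_bound x : cnorm (gplus x) <= M. Proof. exact: hvM_bound. Qed.
Lemma gminus_bound x : cnorm (gminus x) <= M.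
Proof. by apply: (@hvM_bound (fun x => g (- x))) => u; exact: gM. Qed.
Lemma gplus_lapl : lapl gplus.
Proof. by apply: (@lapl_bdd R _ M gplus_cmea gplus_neg gplus_bound). Qed.
Lemma gminus_lapl : lapl gminus.
Proof. by apply: (@lapl_bdd R _ M gminus_cmea gminus_neg gminus_bound). Qed.

(** On the axis [G] tends to the distribution with transform [g], and the Laplace transform of the
    positive half to that of [gplus]; the difference is carried by the negative half. [Afun] tends
    to the same distribution from the left. *)
Definition Dfun (s : C) := G s - LT gplus s.
Definition Afun (s : C) := LT gminus (- s).

Let d0 := rG / 2.
Let d00 : 0 < d0. Proof. by rewrite divr_gt0. Qed.

Lemma cnorm_lt_half (x y : R) : `|x| < rG / 2 -> `|y| < rG / 2 -> cnorm (Complex x y) < rG.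
Proof. by move=> hx hy; apply: le_lt_trans (cnorm_le _) _ => /=; lra. Qed.

Lemma Dfun_cderiv (x y : R) : 0 < x -> x < rG / 2 -> `|y| < rG / 2 -> exists l, cderiv_at Dfun (Complex x y) l.
Proof.
move=> x0 hx hy; have [l1 h1] := dG (cnorm_lt_half (ltac:(by rewrite gtr0_norm) : `|x| < rG / 2) hy) x0.
have [l2 h2] := @LT_cderiv R gplus (Complex x y) gplus_lapl x0.
by exists (l1 - l2); exact: cderivB.
Qed.

Lemma AfunN (x : R) : Afun (Complex (- x) 0) = LT gminus (RtoC x).
Proof. by rewrite /Afun; congr (LT gminus _); apply: C_ext; rewrite ?ReN ?ImN /= ?opprK ?oppr0. Qed.

Lemma Afun_cderiv (x y : R) : x < 0 -> exists l, cderiv_at Afun (Complex x y) l.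
Proof.
move=> x0; have := @LT_cderiv R gminus (- Complex x y) gminus_lapl; rewrite ReN /= oppr_gt0 => /(_ x0)[l hl].
by exists (- l); exact: cderiv_refl.
Qed.

(** The two analytic functions side by side on a square minus the axis. The value 0 elsewhere makes
    this measurable on the whole plane, as Fubini requires. *)
Definition Hfun (x y : R) : C :=
  if `|y| < d0 then if 0 < x < d0 then Dfun (Complex x y) else if - d0 < x < 0 then Afun (Complex x y) else 0 else 0.

Lemma HfunD (x y : R) : 0 < x < d0 -> `|y| < d0 -> Hfun x y = Dfun (Complex x y).
Proof. by move=> h1 h2; rewrite /Hfun h2 h1. Qed.
Lemma HfunA (x y : R) : - d0 < x < 0 -> `|y| < d0 -> Hfun x y = Afun (Complex x y).
Proof. by move=> h1 h2; rewrite /Hfun h2 h1; case: ifP => // /andP[a b]; exfalso; case/andP: h1; lra. Qed.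
Lemma Hfun0 (x y : R) : ~ (0 < `|x| < d0 /\ `|y| < d0) -> Hfun x y = 0.
Proof.
move=> h; rewrite /Hfun; case: ifP => // hy; case: ifP => [/andP[a b]|_].
  by exfalso; apply: h; rewrite gtr0_norm// a b.
by case: ifP => // /andP[a b]; exfalso; apply: h; rewrite ltr0_norm// oppr_gt0 b ltrNl.
Qed.

Lemma Hfun_loc (x y : R) : 0 < `|x| < d0 -> `|y| < d0 -> exists F l, exists2 dl : R, 0 < dl &
  cderiv_at F (Complex x y) l /\ forall h k : R, `|h| < dl -> `|k| < dl -> Hfun (x + h) (y + k) = F (Complex (x + h) (y + k)).
Proof.
move=> /andP[x0 xd] yd; pose dl := Num.min `|x| (Num.min (d0 - `|x|) (d0 - `|y|)).
have dl0 : 0 < dl by rewrite !lt_min x0 !subr_gt0 xd.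
have hk (h k : R) : `|h| < dl -> `|k| < dl -> `|y + k| < d0 /\ `|x + h| < d0 /\ `|h| < `|x|.
  rewrite !lt_min => /and3P[h1 h2 h3] /and3P[k1 k2 k3]; split; last split => //.
    by have := ler_normD y k; lra.
  by have := ler_normD x h; lra.
have [xp|xn|xe] := ltgtP 0 x; last by rewrite -xe normr0 ltxx in x0.
- have [l hl] := Dfun_cderiv xp (ltac:(by rewrite gtr0_norm in xd) : x < rG / 2) yd.
  exists Dfun, l, dl => //; split => // h k /hk H /H [a [b c]].
  rewrite HfunD//; move: b c; rewrite (gtr0_norm xp) !ltr_norml; lra.
- have [l hl] := @Afun_cderiv x y xn; exists Afun, l, dl => //; split => // h k /hk H /H [a [b c]].
  rewrite HfunA//; move: b c; rewrite (ltr0_norm xn) !ltr_norml; lra.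
Qed.

Lemma Hfun_dfree (x y : R) : 0 < `|x| < d0 -> `|y| < d0 ->
  dfree (fun x y => Re (Hfun x y)) (fun x y => - Im (Hfun x y)) x y /\
  dfree (fun x y => Im (Hfun x y)) (fun x y => Re (Hfun x y)) x y.
Proof.
move=> hx hy; have [F [l [dl dl0 [hF HE]]]] := Hfun_loc hx hy; have [h1 h2] := cderiv_dfree hF.
by split; [apply: dfree_ext dl0 _ h1|apply: dfree_ext dl0 _ h2] => h k hh hk; rewrite HE.
Qed.

Lemma Hfun_mea : cmea2 (fun z : R * R => Hfun z.1 z.2).
Proof.
pose O := [set z : R * R | 0 < `|z.1| < d0 /\ `|z.2| < d0].
have oO z : O z -> exists2 e : R, 0 < e & forall x y, `|x - z.1| < e -> `|y - z.2| < e -> O (x, y).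
  case: z => x y [/= /andP[x0 xd] yd].
  pose dl := Num.min `|x| (Num.min (d0 - `|x|) (d0 - `|y|)).
  exists dl => [|u v]; first by rewrite !lt_min x0 !subr_gt0 xd.
  rewrite !lt_min => /and3P[h1 h2 h3] /and3P[k1 k2 k3]; rewrite /O /=.
  have a1 := lerB_dist x u; have a2 := lerB_dist u x; have a3 := lerB_dist v y.
  by rewrite distrC in a1; split; [apply/andP|]; lra.
have cO z (e : R) : O z -> 0 < e -> exists2 d : R, 0 < d & forall x y, `|x - z.1| < d -> `|y - z.2| < d -> cnorm (Hfun x y - Hfun z.1 z.2) < e.
  case: z => x y [/= hx hy] e0; have [F [l [dl dl0 [hF HE]]]] := Hfun_loc hx hy.
  have [d d1 hd] := cderiv_lip hF; have l0 := cnorm_ge0 l; have l1 : 0 < 1 + cnorm l by lra.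
  have z0 : `|0 : R| < dl by rewrite normr0.
  exists (Num.min dl (Num.min d (e / (1 + cnorm l)) / 2)) => [|u v].
    by rewrite lt_min dl0 divr_gt0// lt_min d1 divr_gt0.
  rewrite !lt_min => /andP[u1 u2] /andP[v1 v2].
  have := HE _ _ u1 v1; have := HE 0 0 z0 z0; rewrite !addr0 !subrKC => -> ->.
  have E : Complex u v = Complex x y + Complex (u - x) (v - y) by apply: C_ext; rewrite ?ReD ?ImD /= subrKC.
  have N : cnorm (Complex (u - x) (v - y)) < Num.min d (e / (1 + cnorm l)) by apply: le_lt_trans (cnorm_le _) _ => /=; lra.
  rewrite lt_min in N; have /andP[N1 N2] := N.
  by rewrite E; apply: le_lt_trans (hd _ N1) _; rewrite mulrC -ltr_pdivlMr.
split; apply: (box_continuous_measurable oO) => [z hz|z e hz e0].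
- by rewrite Hfun0.
- have [d d1 hd] := cO z e hz e0; exists d => // x y h1 h2; apply: le_lt_trans (hd x y h1 h2).
  by rewrite -ReB; exact: norm_Re.
- by rewrite Hfun0.
- have [d d1 hd] := cO z e hz e0; exists d => // x y h1 h2; apply: le_lt_trans (hd x y h1 h2).
  by rewrite -ImB; exact: norm_Im.
Qed.

Lemma cvg_dnbhs0 (f : R -> R) (l : R) : f s @[s --> 0^'+] --> l -> f (- s) @[s --> 0^'+] --> l -> f x @[x --> 0^'] --> l.
Proof.
move=> /cvgrPdist_lt h1 /cvgrPdist_lt h2; apply/cvgrPdist_lt => e e0.
have [d1 /= d10 k1] := h1 e e0; have [d2 /= d20 k2] := h2 e e0.
exists (Num.min d1 d2) => /=; first by rewrite lt_min d10.
move=> x /=; rewrite sub0r normrN lt_min => /andP[a1 a2] x0.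
have [xp|xn|xe] := ltgtP 0 x; last by rewrite -xe eqxx in x0.
  by apply: (k1 x) => //=; rewrite sub0r normrN.
by have := k2 (- x); rewrite /= sub0r !normrN opprK oppr_gt0; apply.
Qed.

Lemma Hfun_limit a phi : a < rho -> a < d0 -> ctest a phi -> exists l : C,
  ccvg_right0 (fun s => cintT (fun t => Hfun s t * phi t)) l /\ ccvg_right0 (fun s => cintT (fun t => Hfun (- s) t * phi t)) l.
Proof.
move=> ar ad ct; have bt (t : R) : ~ (`|t| < d0) -> phi t = 0.
  move=> h; apply: (ctest_out ct) => h'; apply: h; have := ler_norml t a; rewrite h'; lra.
have igp := integ_bdd_cauchy gplus_cmea gplus_bound.
have igm := integ_bdd_cauchy gminus_cmea gminus_bound.
have ct' := ctest_refl ct.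
have [K K0 hK] := fourier_decay ct; have mf := fourier_cmea ct.
have iG (f : R -> C) : cmea f -> (forall x, cnorm (f x) <= M) -> cinteg (fun x => f x * fourier phi x).
  move=> m b; apply: eq_cinteg (cintegM_bdd (fourier_cinteg ct) m b) => x; exact: mulrC.
have i1 := iG g mg gM; have i2 := iG gplus gplus_cmea gplus_bound.
(* The part of [g] on the negative half-line: its pairing with the transform of [phi] is the common
   limit from both sides. *)
pose g0 x := RtoC (hv (- x)) * g x.
have mg0 : cmea g0.
  apply: cmeaM => //; apply: cmea_RtoC; apply: (measurableT_comp (@mea_hv R)); exact: measurable_funN.
have bg0 x : cnorm (g0 x) <= M.
  by rewrite cnormM cnorm_RtoC; apply: le_trans (gM x); rewrite ler_piMl ?cnorm_ge0// hv_norm.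
have i3 := iG g0 mg0 bg0.
exists (cintT (fun x => g0 x * fourier phi x)); split.
- have -> : cintT (fun x => g0 x * fourier phi x) = cintT (fun x => g x * fourier phi x) - cintT (fun x => gplus x * fourier phi x).
    (* At x = 0 both [hv x] and [hv (- x)] are 1, so the decomposition of [g] holds off a null
       set. *)
    rewrite -(cintB i1 i2); apply: (@cint_ae_neq R 0 _ _ i3 (cintegB i1 i2)) => x x0.
    rewrite -mulrBl; congr (_ * _); rewrite /g0 /gplus.
    have [xn|xp|xe] := ltgtP x 0; last by rewrite xe eqxx in x0.
      by rewrite hv_ge0 ?oppr_ge0 ?ltW// (hv_lt0 xn) mul1r mul0r subr0.
    by rewrite hv_lt0 ?oppr_lt0// hv_ge0 ?ltW// mul1r mul0r subrr.
  have L := ccvg_right0D (LG ar ct) (ccvg_right0N (LT_limit gplus_lapl ct igp)).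
  apply: (@ccvg_right0_near R _ _ _ d0 d00) L => s /andP[s0 sd].
  have j1 : cinteg (fun t => G (Complex s t) * phi t).
    apply: (@line_integ R _ _ d0 a) => // t ht; apply: dG => //; apply: cnorm_lt_half => //.
    by rewrite gtr0_norm.
  have j2 : cinteg (fun t => LT gplus (Complex s t) * phi t).
    by apply: (@line_integ R _ _ d0 a) => // t ht; apply: LT_cderiv => //; exact: gplus_lapl.
  rewrite -(cintB j1 j2); apply: eq_cint => t.
  have [h|h] := pselect (`|t| < d0); last by rewrite bt// !mulr0 subrr.
  by rewrite HfunD ?s0// /Dfun mulrBl.
- have i4 : cinteg (fun x => gminus x * fourier (fun u => phi (- u)) x).
    apply: eq_cinteg (cintegM_bdd (fourier_cinteg ct') gminus_cmea gminus_bound) => x; exact: mulrC.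
  have -> : cintT (fun x => g0 x * fourier phi x) = cintT (fun x => gminus x * fourier (fun u => phi (- u)) x).
    rewrite -(cint_refl 0 i4); apply: eq_cint => x.
    by rewrite (fourier_refl _ (ctest_cinteg ct)) /gminus sub0r !opprK.
  apply: (@ccvg_right0_near R _ _ _ d0 d00) (LT_limit gminus_lapl ct' igm) => s /andP[s0 sd].
  have j2 : cinteg (fun t => LT gminus (Complex s t) * phi (- t)).
    by apply: (@line_integ R _ _ d0 a) => // t ht; apply: LT_cderiv => //; exact: gminus_lapl.
  rewrite -(cint_refl 0 j2); apply: eq_cint => t; rewrite sub0r opprK.
  have [h|h] := pselect (`|t| < d0); last by rewrite bt// !mulr0.
  have hs : - d0 < - s < 0 by rewrite ltrN2 sd oppr_lt0.
  rewrite (HfunA hs h); congr (LT _ _ * _).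
  by apply: C_ext; rewrite ?ReN ?ImN /= ?opprK.
Qed.

Lemma cnorm_chain (a b p q : C) (m n : R) : cnorm (p - a) <= m -> cnorm (q - b) <= m -> cnorm (p - q) <= n ->
  cnorm (a - b) <= n + (m + m).
Proof.
have := cnorm_triangle a b p; have := cnorm_triangle p b q; rewrite (cnormBC a p).
move: (cnorm _) (cnorm _) (cnorm _) (cnorm _) (cnorm _) => *; lra.
Qed.

(** [edge_of_wedge] bounds its first function only, so it is applied to (u, v) and to (v, -u) for
    the real and imaginary parts. [E t] is the limit at the axis point i t, the same from the right
    along [D] and from the left along [A]. *)
Lemma glue : exists2 dl : R, 0 < dl <= d0 & exists2 K : R, 0 <= K & exists E : R -> C,
  [/\ forall x t : R, 0 < x < dl -> `|t| < dl -> cnorm (Dfun (Complex x t) - E t) <= K * x,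
      forall x : R, 0 < x < dl -> cnorm (LT gminus (RtoC x) - E 0) <= K * x &
      forall t t' : R, `|t| < dl -> `|t'| < dl -> cnorm (E t - E t') <= K * `|t - t'|].
Proof.
pose u x y := Re (Hfun x y); pose v x y := Im (Hfun x y).
have [mu_ mv_] := Hfun_mea.
pose rr := Num.min (Num.min rho 1) (d0 / 2).
have rr1 : 0 < rr <= 1 by rewrite !lt_min rho0 ltr01 divr_gt0//= !ge_min lexx orbT.
have rrd : rr <= d0 / 2 by rewrite ge_min lexx orbT.
have rrr : rr <= rho by rewrite !ge_min lexx.
have yr (y : R) : - rr <= y <= rr -> `|y| < d0.
  by rewrite -ler_norml => h; lra.
have Lim a phi : 0 <= a < rr -> tfun a phi -> exists l : C, rint (fun y => u x y * phi y) @[x --> 0^'] --> Re l /\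
    rint (fun y => v x y * phi y) @[x --> 0^'] --> Im l.
  move=> /andP[a0 ar] tp; have ct : ctest a (fun t => RtoC (phi t)).
    by split => //; split => //; split => //; exact: smooth_cst.
  have [l [/ccvg_right0P[l1 l2] /ccvg_right0P[l3 l4]]] := Hfun_limit (lt_le_trans ar rrr) (ltac:(lra) : a < d0) ct.
  have E1 (x : R) : Re (cintT (fun t => Hfun x t * RtoC (phi t))) = rint (fun y => u x y * phi y).
    by apply: eq_Rintegral => t _; rewrite ReM /= mulr0 subr0.
  have E2 (x : R) : Im (cintT (fun t => Hfun x t * RtoC (phi t))) = rint (fun y => v x y * phi y).
    by apply: eq_Rintegral => t _; rewrite ImM /= mulr0 add0r.
  exists l; split; apply: cvg_dnbhs0.
  - by apply: cvg_trans l1; apply: near_eq_cvg; apply: nearW => s; exact: E1.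
  - by apply: cvg_trans l3; apply: near_eq_cvg; apply: nearW => s; exact: E1.
  - by apply: cvg_trans l2; apply: near_eq_cvg; apply: nearW => s; exact: E2.
  - by apply: cvg_trans l4; apply: near_eq_cvg; apply: nearW => s; exact: E2.
have D1 x y : 0 < `|x| < d0 -> - rr <= y <= rr -> dfree u (fun x y => - v x y) x y.
  by move=> hx /yr hy; have [] := Hfun_dfree hx hy.
have D2 x y : 0 < `|x| < d0 -> - rr <= y <= rr -> dfree v u x y.
  by move=> hx /yr hy; have [] := Hfun_dfree hx hy.
have D3 x y : 0 < `|x| < d0 -> - rr <= y <= rr -> dfree v (fun x y => - (- u x y)) x y.
  by move=> hx hy; under eq_fun => x' do under eq_fun => y' do rewrite opprK; exact: D2.
have D4 x y : 0 < `|x| < d0 -> - rr <= y <= rr -> dfree (fun x y => - u x y) v x y.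
  move=> hx hy; have := dfreeN (D1 x y hx hy); under [fun x y => - - v x y]eq_fun => x' do under eq_fun => y' do rewrite opprK; exact.
have Lu a phi : 0 <= a < rr -> tfun a phi -> exists l : R, rint (fun y => u x y * phi y) @[x --> 0^'] --> l.
  by move=> h1 h2; have [l [h _]] := Lim a phi h1 h2; exists (Re l).
have Lv a phi : 0 <= a < rr -> tfun a phi -> exists l : R, rint (fun y => v x y * phi y) @[x --> 0^'] --> l.
  by move=> h1 h2; have [l [_ h]] := Lim a phi h1 h2; exists (Im l).
have Lu' a phi : 0 <= a < rr -> tfun a phi -> exists l : R, rint (fun y => - u x y * phi y) @[x --> 0^'] --> l.
  move=> h1 [s1 z1]; have tn : tfun a (fun y => - phi y).
    by split=> [|t ht]; [exact: smoothN|rewrite (z1 _ ht) oppr0].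
  have [l hl] := Lu a _ h1 tn; exists l; apply: cvg_trans hl; apply: near_eq_cvg; apply: nearW => x.
  by apply: eq_Rintegral => y _; rewrite mulrN mulNr.
have mnu : measurable_fun setT (fun z : R * R => - u z.1 z.2) by exact: measurable_funN.
have [l1 l10 [K1 K10 H1]] := edge_of_wedge d00 rr1 mu_ mv_ D1 D2 Lu Lv.
have [l2 l20 [K2 K20 H2]] := edge_of_wedge d00 rr1 mv_ mnu D3 D4 Lv Lu'.
pose dl := Num.min d0 (Num.min l1 l2); pose K := K1 + K2.
have dl0 : 0 < dl by rewrite !lt_min d00 l10.
have dld : dl <= d0 by rewrite ge_min lexx.
have dl1 : dl <= l1 by rewrite !ge_min lexx orbT.
have dl2 : dl <= l2 by rewrite !ge_min lexx !orbT.
have K0 : 0 <= K by exact: addr_ge0.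
have {}H1 x t x' t' : 0 < `|x| < dl -> 0 < `|x'| < dl -> `|t| < dl -> `|t'| < dl -> `|u x' t' - u x t| <= K1 * (`|x' - x| + `|t' - t|).
  by move=> /andP[a1 a2] /andP[b1 b2] c1 c2; apply: H1; rewrite ?a1 ?b1 ?(lt_le_trans _ dl1).
have {}H2 x t x' t' : 0 < `|x| < dl -> 0 < `|x'| < dl -> `|t| < dl -> `|t'| < dl -> `|v x' t' - v x t| <= K2 * (`|x' - x| + `|t' - t|).
  by move=> /andP[a1 a2] /andP[b1 b2] c1 c2; apply: H2; rewrite ?a1 ?b1 ?(lt_le_trans _ dl2).
have H x t x' t' : 0 < `|x| < dl -> 0 < `|x'| < dl -> `|t| < dl -> `|t'| < dl -> cnorm (Hfun x' t' - Hfun x t) <= K * (`|x' - x| + `|t' - t|).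
  move=> a1 a2 a3 a4; apply: le_trans (cnorm_le _) _; rewrite ReB ImB /K mulrDl.
  by apply: lerD; [exact: H1|exact: H2].
have EX (t : R) : exists z : C, `|t| < dl -> forall x, 0 < `|x| < dl -> cnorm (Hfun x t - z) <= K * `|x|.
  have [h|h] := ltP `|t| dl; last by exists 0 => h'; lra.
  have q1 x x' : 0 < `|x| < dl -> 0 < `|x'| < dl -> `|u x' t - u x t| <= K1 * `|x' - x|.
    by move=> p p'; rewrite -[`|x' - x|]addr0 -(normr0 R) -(subrr t); exact: H1.
  have q2 x x' : 0 < `|x| < dl -> 0 < `|x'| < dl -> `|v x' t - v x t| <= K2 * `|x' - x|.
    by move=> p p'; rewrite -[`|x' - x|]addr0 -(normr0 R) -(subrr t); exact: H2.
  have [a1 ha1] := @lip_limit R (fun x => u x t) K1 dl dl0 K10 q1.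
  have [b1 hb1] := @lip_limit R (fun x => v x t) K2 dl dl0 K20 q2.
  exists (Complex a1 b1) => _ x hx; apply: le_trans (cnorm_le _) _; rewrite ReB ImB /K mulrDl.
  by apply: lerD; [exact: ha1|exact: hb1].
have [E hE] := choice EX; have z0 : `|0 : R| < dl by rewrite normr0.
exists dl; first by rewrite dl0.
exists K => //; exists E; split.
- move=> x t /andP[x0 xd] ht; have hx : 0 < `|x| < dl by rewrite gtr0_norm// x0.
  by have := hE t ht x hx; rewrite (gtr0_norm x0) HfunD// ?x0 (lt_le_trans _ dld).
- move=> x /andP[x0 xd]; have hx : 0 < `|- x| < dl by rewrite normrN gtr0_norm// x0.
  have := hE 0 z0 (- x) hx; rewrite normrN (gtr0_norm x0) HfunA.
  + by rewrite AfunN.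
  + by rewrite oppr_lt0 x0 ltrN2 (lt_le_trans xd).
  + by rewrite normr0.
- move=> t t' ht ht'; apply/ler_addgt0Pr => e e0.
  have K1' : 0 < 2 * (K + 1) by rewrite mulr_gt0// ltr_wpDl.
  (* Two axis values are compared through points at distance [x] from the axis, small enough for the
     extra error 2 K x to stay below [e]. *)
  pose x := Num.min (dl / 2) (e / (2 * (K + 1))).
  have x0 : 0 < x by rewrite lt_min !divr_gt0.
  have xd : x < dl by apply: (@le_lt_trans _ _ (dl / 2)); [rewrite ge_min lexx|rewrite ltr_pdivrMr// ltr_pMr// ltr1n].
  have hx : 0 < `|x| < dl by rewrite gtr0_norm// x0.
  have xe : x * (2 * (K + 1)) <= e by rewrite -ler_pdivlMr// ge_min lexx orbT.
  have h1 := hE t ht x hx; have h2 := hE t' ht' x hx; have h3 := H x t' x t hx hx ht' ht.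
  rewrite (gtr0_norm x0) in h1 h2; rewrite subrr normr0 add0r in h3.
  apply: le_trans (cnorm_chain h1 h2 h3) _; rewrite lerD2l; apply: le_trans xe.
  by rewrite (_ : x * (2 * (K + 1)) = K * x + K * x + 2 * x) ?lerDl ?mulr_ge0 ?(ltW x0)//; ring.
Qed.
End Glue2.

(** * The asymptotic expansion *)

Section Residual.
Variable R : realType.
Local Notation mu := (@lebesgue_measure R).
Local Notation rint := (Rintegral mu setT).
Local Notation cintT := (cint setT).
Local Notation C := R[i].
Local Notation Re := (@complex.Re R).
Local Notation Im := (@complex.Im R).

Lemma complex_riemann_lebesgue (w : R -> C) (M a : R) : cmea w -> (forall x, cnorm (w x) <= M) ->
  (forall x, ~ (- a <= x <= a) -> w x = 0) -> {ae mu, forall x : R, {for x, continuous (fun x => Re (w x))}} ->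
  {ae mu, forall x : R, {for x, continuous (fun x => Im (w x))}} ->
  forall e : R, 0 < e -> exists A : R, forall y : R, A < `|y| -> cnorm (cintT (fun t => w t * cexp (iC R * RtoC (t * y)))) < e.
Proof.
move=> [m1 m2] wM w0 c1 c2 e e0.
have o1 x : ~ `[- a, a]%classic x -> Re (w x) = 0 by rewrite /= in_itv/= => h; rewrite w0.
have o2 x : ~ `[- a, a]%classic x -> Im (w x) = 0 by rewrite /= in_itv/= => h; rewrite w0.
have b1 x : `|Re (w x)| <= M by exact: le_trans (norm_Re _) (wM x).
have b2 x : `|Im (w x)| <= M by exact: le_trans (norm_Im _) (wM x).
have mc : measurable_fun setT (@cos R) by apply: continuous_measurable_fun; exact: continuous_cos.
have ms : measurable_fun setT (@sin R) by apply: continuous_measurable_fun; exact: continuous_sin.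
have i1 := integ_bdd_supp m1 b1 o1; have i2 := integ_bdd_supp m2 b2 o2.
have e4 : 0 < e / 4 by rewrite divr_gt0.
have near4 (f k : R -> R) : rint (fun t => f t * k (t * y)) @[y --> +oo] --> (0 : R) ->
    exists A, forall y, A < y -> `|rint (fun t => f t * k (t * y))| < e / 4.
  by move=> /cvgrPdist_lt/(_ _ e4)[A [_ hA]]; exists A => y /hA; rewrite sub0r normrN.
have [A1 h1] := near4 _ _ (riemann_lebesgue m1 b1 o1 c1 mc (@norm_cos R) (@cosDpi R)).
have [A2 h2] := near4 _ _ (riemann_lebesgue m2 b2 o2 c2 mc (@norm_cos R) (@cosDpi R)).
have [A3 h3] := near4 _ _ (riemann_lebesgue m1 b1 o1 c1 ms (@norm_sin R) (@sinDpi R)).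
have [A4 h4] := near4 _ _ (riemann_lebesgue m2 b2 o2 c2 ms (@norm_sin R) (@sinDpi R)).
exists (Num.max (Num.max A1 A2) (Num.max A3 A4)) => y; rewrite !gt_max => /andP[/andP[y1 y2] /andP[y3 y4]].
have EC (f : R -> R) : rint (fun t => f t * cos (t * y)) = rint (fun t => f t * cos (t * `|y|)).
  apply: eq_Rintegral => t _; have [y0|y0] := leP 0 y; first by rewrite ger0_norm.
  by rewrite ltr0_norm// mulrN cosN.
have ik (f k : R -> R) (z : R) : integ f -> measurable_fun setT k -> (forall x, `|k x| <= 1) -> integ (fun t => f t * k (t * z)).
  move=> if_ mk k1; apply: (integM_bdd if_ _ (fun t => k1 _)).
  by apply: (measurableT_comp mk); exact: measurable_funM.
have ES (f : R -> R) : integ f -> `|rint (fun t => f t * sin (t * y))| = `|rint (fun t => f t * sin (t * `|y|))|.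
  move=> if_; have [y0|y0] := leP 0 y; first by rewrite [`|y|]ger0_norm.
  rewrite [`|y|]ltr0_norm// -[LHS]normrN -rintN; last exact: (ik _ _ _ if_ ms (@norm_sin R)).
  by congr `|_|; apply: eq_Rintegral => t _; rewrite mulrN sinN mulrN.
have j1 := ik _ _ y i1 mc (@norm_cos R); have j2 := ik _ _ y i2 mc (@norm_cos R).
have j3 := ik _ _ y i1 ms (@norm_sin R); have j4 := ik _ _ y i2 ms (@norm_sin R).
have E1 : Re (cintT (fun t => w t * cexp (iC R * RtoC (t * y)))) = rint (fun t => Re (w t) * cos (t * y)) - rint (fun t => Im (w t) * sin (t * y)).
  by rewrite -(RintegralB measurableT j1 j4); apply: eq_Rintegral => t _; rewrite cexp_pi ReM.
have E2 : Im (cintT (fun t => w t * cexp (iC R * RtoC (t * y)))) = rint (fun t => Re (w t) * sin (t * y)) + rint (fun t => Im (w t) * cos (t * y)).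
  by rewrite -(RintegralD measurableT j3 j2); apply: eq_Rintegral => t _; rewrite cexp_pi ImM.
apply: le_lt_trans (cnorm_le _) _; rewrite E1 E2.
have {}h1 := h1 _ y1; have {}h2 := h2 _ y2; have {}h3 := h3 _ y3; have {}h4 := h4 _ y4.
rewrite -EC in h1; rewrite -EC in h2; rewrite -(ES _ i1) in h3; rewrite -(ES _ i2) in h4.
apply: le_lt_trans (lerD (ler_normB _ _) (ler_normD _ _)) _.
move: h1 h2 h3 h4; move: (`|_|) (`|_|) (`|_|) (`|_|) => *; lra.
Qed.

Lemma mea_cont_off (f : R -> R) : (forall x : R, x != 0 -> {for x, continuous f}) -> measurable_fun setT f.
Proof.
move=> cf; have -> : [set: R] = [set x | x != 0] `|` [set 0].
  by apply/seteqP; split => // x _ /=; case: (eqVneq x 0) => [->|]; [right|left].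
have oD : open [set x : R | x != 0] by exact: open_neq.
apply/measurable_funU; [exact: open_measurable|exact: measurable_set1|split].
  apply: open_continuous_measurable_fun => // x; rewrite inE /=; exact: cf.
exact: measurable_fun_set1.
Qed.

Definition clamp (m t : R) := Num.max (- m) (Num.min t m).

Lemma clamp_lip (m t t' : R) : `|clamp m t - clamp m t'| <= `|t - t'|.
Proof.
have h1 := ler_norm (t - t'); have := ler_norm (t' - t); rewrite (distrC t') => h2.
rewrite /clamp /Num.max /Num.min; case: (ltP t m) => ?; case: (ltP t' m) => ?;
  try (case: (ltP (- m) _) => ?); try (case: (ltP (- m) _) => ?); rewrite ler_norml; apply/andP; split; lra.
Qed.

Lemma clamp_id (m t : R) : `|t| <= m -> clamp m t = t.
Proof. by rewrite ler_norml => /andP[h1 h2]; rewrite /clamp (min_idPl h2) (max_idPr h1). Qed.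

Lemma clamp_bound (m t : R) : 0 <= m -> `|clamp m t| <= m.
Proof. move=> m0; rewrite /clamp /Num.max /Num.min; case: (ltP t m) => ?; case: (ltP (- m) _) => ?; rewrite ler_norml; lra. Qed.

Section Quotient.
Variables (D : C -> C) (E : R -> C) (dl K : R).
Hypotheses (dl0 : 0 < dl) (K0 : 0 <= K).
Hypothesis hD : forall x t : R, 0 < x < dl -> `|t| < dl -> cnorm (D (Complex x t) - E t) <= K * x.
Hypothesis hE : forall t t' : R, cnorm (E t - E t') <= K * `|t - t'|.
Hypothesis dD : forall x y : R, 0 < x < dl -> `|y| < dl -> exists l, cderiv_at D (Complex x y) l.

Definition quot (s : C) : C := (D s - E 0) / s.
(* The boundary value [(E t - E 0) / (i t)] of [quot]; it is [0] at [t = 0]. *)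
Definition bdry_quot (t : R) : C := Complex ((Im (E t) - Im (E 0)) / t) (- ((Re (E t) - Re (E 0)) / t)).

Lemma cnormC_ge (x t : R) : `|x| <= cnorm (Complex x t) /\ `|t| <= cnorm (Complex x t).
Proof. by split; [exact: (norm_Re (Complex x t))|exact: (norm_Im (Complex x t))]. Qed.

Lemma bdry_quot_bound t : cnorm (bdry_quot t) <= 2 * K.
Proof.
have B (f : C -> R) : (forall z w, f (z - w) = f z - f w) -> (forall z, `|f z| <= cnorm z) -> `|(f (E t) - f (E 0)) / t| <= K.
  move=> fB fn; have [->|t0] := eqVneq t 0; first by rewrite subrr mul0r normr0.
  rewrite normrM normfV ler_pdivrMr ?normr_gt0// -fB; apply: le_trans (fn _) _.
  by have := hE t 0; rewrite subr0.
apply: le_trans (cnorm_le _) _; rewrite /= normrN (_ : 2 * K = K + K); last by ring.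
apply: lerD.
  by apply: B => [z w|z]; [exact: ImB|exact: norm_Im].
by apply: B => [z w|z]; [exact: ReB|exact: norm_Re].
Qed.

Lemma bdry_quotM t : t != 0 -> bdry_quot t * Complex 0 t = E t - E 0.
Proof.
move=> t0; apply: C_ext; rewrite ?ReM ?ImM ?ReB ?ImB /=; first by rewrite mulr0 sub0r mulNr opprK divfK.
by rewrite mulr0 addr0 divfK.
Qed.

(** The numerator is at most K x + K |t| and so at most 2 K |s|, which the denominator cancels: this
    is where the Lipschitz bound pays for 1/s. *)
Lemma quot_bound (x t : R) : 0 < x < dl -> `|t| < dl -> cnorm (quot (Complex x t)) <= 2 * K.
Proof.
move=> hx ht; have [x0 _] := andP hx; have [n1 n2] := cnormC_ge x t.
have s0 : 0 < cnorm (Complex x t) by apply: lt_le_trans n1; rewrite gtr0_norm.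
have sn : Complex x t != 0 :> C by rewrite -cnorm_gt0.
have qs : quot (Complex x t) * Complex x t = D (Complex x t) - E 0 by rewrite /quot divfK.
rewrite -(ler_pM2r s0) -cnormM qs; apply: le_trans (cnorm_triangle _ _ (E t)) _.
have h1 := hD hx ht; have := hE t 0; rewrite subr0 => h2.
rewrite (gtr0_norm x0) in n1; have := ler_wpM2l K0 n1; have := ler_wpM2l K0 n2.
by move: h1 h2; move: (cnorm _) (cnorm _) (cnorm _) (`|t|) => *; lra.
Qed.

Lemma quot_cvg (t : R) : t != 0 -> `|t| < dl -> ccvg_right0 (fun x => quot (Complex x t)) (bdry_quot t).
Proof.
move=> t0 ht e e0; have tp : 0 < `|t| by rewrite normr_gt0.
(* The constant 3 K collects K from D - E t and 2 K from [bdry_quot t] times x; the 1 keeps the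
   divisor positive. *)
have c0 : 0 < 3 * K + 1 by rewrite ltr_wpDl// mulr_ge0.
exists (Num.min dl (e * `|t| / (3 * K + 1))) => [|x]; first by rewrite lt_min dl0 divr_gt0// mulr_gt0.
rewrite lt_min => /and3P[x0 xd xe]; have hx : 0 < x < dl by rewrite x0.
have [n1 n2] := cnormC_ge x t; have s0 : 0 < cnorm (Complex x t) by exact: lt_le_trans tp n2.
have sn : Complex x t != 0 :> C by rewrite -cnorm_gt0.
have qs : quot (Complex x t) * Complex x t = D (Complex x t) - E 0 by rewrite /quot divfK.
have bs : bdry_quot t * Complex x t = (E t - E 0) + bdry_quot t * RtoC x.
  by rewrite -(bdry_quotM t0) -mulrDr; congr (_ * _); apply: C_ext; rewrite ?ReD ?ImD /= ?add0r ?addr0.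
have H : cnorm (quot (Complex x t) - bdry_quot t) * cnorm (Complex x t) <= 3 * K * x.
  rewrite -cnormM mulrBl qs bs.
  have -> : D (Complex x t) - E 0 - (E t - E 0 + bdry_quot t * RtoC x) = (D (Complex x t) - E t) - bdry_quot t * RtoC x by ring.
  apply: le_trans (cnormB _ _) _; rewrite cnormM cnorm_RtoC (gtr0_norm x0).
  have h1 := hD hx ht; have := ler_wpM2r (ltW x0) (bdry_quot_bound t); move=> h2.
  by rewrite (_ : 3 * K * x = K * x + 2 * K * x); [exact: lerD|ring].
rewrite -(ltr_pM2r tp); apply: (@le_lt_trans _ _ (3 * K * x)).
  by apply: le_trans H; rewrite ler_wpM2l// cnorm_ge0.
rewrite ltr_pdivlMr// in xe; apply: le_lt_trans xe; rewrite mulrC ler_wpM2l ?(ltW x0)//.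
by rewrite lerDl.
Qed.

Lemma bdry_quot_cont t : t != 0 -> {for t, continuous (fun t => Re (bdry_quot t))} /\ {for t, continuous (fun t => Im (bdry_quot t))}.
Proof.
move=> t0.
have cR : continuous (fun t => Re (E t)).
  by apply: (@lipschitz_continuous R _ K) => x y; rewrite -ReB; exact: le_trans (norm_Re _) (hE x y).
have cI : continuous (fun t => Im (E t)).
  by apply: (@lipschitz_continuous R _ K) => x y; rewrite -ImB; exact: le_trans (norm_Im _) (hE x y).
split => /=.
- apply: cvgM; last exact: (cvgV t0 cvg_id).
  by apply: cvgB; [exact: cI|exact: cvg_cst].
- apply: cvgN; apply: cvgM; last exact: (cvgV t0 cvg_id).
  by apply: cvgB; [exact: cR|exact: cvg_cst].
Qed.

Lemma bdry_quotM_cont a phi t : ctest a phi -> t != 0 ->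
  {for t, continuous (fun t => Re (bdry_quot t * phi t))} /\ {for t, continuous (fun t => Im (bdry_quot t * phi t))}.
Proof.
move=> [a0 [[s1 _] [s2 _]]] t0; have [c1 c2] := bdry_quot_cont t0.
have c3 := @smooth_continuous R _ s1 t; have c4 := @smooth_continuous R _ s2 t.
split; rewrite /prop_for /continuous_at.
- by rewrite ReM; under eq_fun do rewrite ReM; apply: cvgB; exact: cvgM.
- by rewrite ImM; under eq_fun do rewrite ImM; apply: cvgD; exact: cvgM.
Qed.

Lemma bdry_quotM_cmea a phi : ctest a phi -> cmea (fun t => bdry_quot t * phi t).
Proof.
by move=> ct; split; apply: mea_cont_off => t t0; have [] := bdry_quotM_cont ct t0.
Qed.

Lemma quot_cinteg a phi (s : R) : a < dl -> ctest a phi -> 0 < s < dl -> cinteg (fun t => quot (Complex s t) * phi t).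
Proof.
move=> ad ct hs; have [s0 _] := andP hs.
have lh : lapl (fun x : R => RtoC (hv x)).
  apply: (@lapl_bdd R _ 1) => [|x x0|x]; first by apply: cmea_RtoC; exact: mea_hv.
    by rewrite hv_lt0.
  by rewrite cnorm_RtoC hv_norm.
have i1 : cinteg (fun t => D (Complex s t) * phi t).
  by apply: (@line_integ R _ _ dl a) => // t ht; exact: dD.
have i2 := cintegB i1 (cintegZ (E 0) (ctest_cinteg ct)).
apply: eq_cinteg (cintegM_bdd i2 (LT_cmea lh s0) (fun t => LT_bound t lh s0)) => t.
by rewrite LT_heaviside// /quot -mulrBl mulrAC.
Qed.

Lemma quot_limit a phi : a < dl -> ctest a phi ->
  ccvg_right0 (fun s => cintT (fun t => quot (Complex s t) * phi t)) (cintT (fun t => bdry_quot t * phi t)).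
Proof.
move=> ad ct; have in_ t : ~ (`|t| < dl) -> phi t = 0.
  move=> h; apply: (ctest_out ct) => h'; apply: h; have := ler_norml t a; rewrite h'; lra.
apply: (@cdct_right0 R _ _ (fun t => 2 * K * cnorm (phi t)) dl dl0) => [s hs||||s t hs].
- exact: cinteg_mea (quot_cinteg ad ct hs).
- exact: bdry_quotM_cmea ct.
- apply: (@ae_neq R 0) => t t0 e e0.
  have [h|h] := pselect (`|t| < dl); last first.
    by exists 1 => // s _; rewrite in_// !mulr0 subrr cnorm0.
  have n0 := cnorm_ge0 (phi t); have n1 : 0 < cnorm (phi t) + 1 by rewrite ltr_wpDl.
  have [d d0 hd] := quot_cvg t0 h (divr_gt0 e0 n1); exists d => // s /hd.
  rewrite -mulrBl cnormM ltr_pdivlMr// => H; apply: le_lt_trans H.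
  by rewrite ler_wpM2l ?cnorm_ge0// lerDl.
- exact: integZ (cinteg_norm (ctest_cinteg ct)).
- have [h|h] := pselect (`|t| < dl); last by rewrite in_// !mulr0 cnorm0 mulr0.
  by rewrite cnormM ler_wpM2r ?cnorm_ge0// quot_bound.
Qed.

(** The boundary quotient is bounded and continuous off 0, which is all that the Riemann-Lebesgue
    lemma asks for; it may jump at 0. *)
Lemma bdry_quot_vanish a phi : ctest a phi -> forall e : R, 0 < e -> exists A : R, forall y : R, A < `|y| ->
  cnorm (cintT (fun t => bdry_quot t * (phi t * cexp (iC R * RtoC (t * y))))) < e.
Proof.
move=> ct e e0; have [a0 [t1 t2]] := ct.
have [M1 M10 hM1] := tfun_bounded a0 t1; have [M2 M20 hM2] := tfun_bounded a0 t2.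
have bd t : cnorm (bdry_quot t * phi t) <= 2 * K * (M1 + M2).
  rewrite cnormM; apply: ler_pM; [exact: cnorm_ge0|exact: cnorm_ge0|exact: bdry_quot_bound|].
  by apply: le_trans (cnorm_le _) _; exact: lerD.
have out t : ~ (- a <= t <= a) -> bdry_quot t * phi t = 0 by move=> h; rewrite (ctest_out ct h) mulr0.
have [A hA] := complex_riemann_lebesgue (bdry_quotM_cmea ct) bd out
  (ae_neq (fun t t0 => proj1 (bdry_quotM_cont ct t0))) (ae_neq (fun t t0 => proj2 (bdry_quotM_cont ct t0))) e0.
by exists A => y /hA; under eq_cint do rewrite -mulrA.
Qed.
End Quotient.
End Residual.

Section Expansion.
Variable R : realType.
Local Notation mu := (@lebesgue_measure R).
Local Notation rint := (Rintegral mu setT).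
Local Notation cintT := (cint setT).
Local Notation C := R[i].
Local Notation Re := (@complex.Re R).
Local Notation Im := (@complex.Im R).

Lemma ccvg_lin (f : R -> C) (l : C) (dl K : R) : 0 < dl -> 0 <= K -> (forall x, 0 < x < dl -> cnorm (f x - l) <= K * x) -> ccvg_right0 f l.
Proof.
move=> dl0 K0 H e e0; have K1 : 0 < K + 1 by rewrite ltr_wpDl.
exists (Num.min dl (e / (K + 1))) => [|s]; first by rewrite lt_min dl0 divr_gt0.
rewrite lt_min => /and3P[s0 sd]; rewrite ltr_pdivlMr// mulrC => se; apply: le_lt_trans (H s _) _; first by rewrite s0.
by apply: le_lt_trans se; rewrite ler_wpM2r ?(ltW s0)// lerDl.
Qed.

Lemma lapl_heaviside : lapl (fun x : R => RtoC (hv x)).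
Proof.
apply: (@lapl_bdd R _ 1) => [|x x0|x]; first by apply: cmea_RtoC; exact: mea_hv.
  by rewrite hv_lt0.
by rewrite cnorm_RtoC hv_norm.
Qed.

Lemma laplZ (c : C) (f : R -> C) : lapl f -> lapl (fun x => c * f x).
Proof.
move=> [m z i]; apply: (@lapl_dom R _ (fun x => cnorm c * cnorm (f x))).
- by apply: cmeaM => //; exact: cmea_cst.
- by move=> x x0; rewrite z// mulr0.
- by move=> sg s0; apply: eq_integ (integZ (cnorm c) (i sg s0)) => x; rewrite mulrA.
- by move=> x; rewrite cnormM.
Qed.

Lemma cint_gplus (g : R -> C) (x : R) : cint `[0, x] g = cint `[0, x] (gplus g).
Proof.
have h u : u \in `[0, x]%classic -> gplus g u = g u.
  by rewrite inE /= in_itv/= => /andP[u0 _]; rewrite /gplus hv_ge0// mul1r.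
by apply: C_ext => /=; apply: eq_Rintegral => u /h ->.
Qed.

Lemma cint_half (f : R -> C) (sg : R) : cint `[0, +oo[%classic (fun x => f x * RtoC (expR (- (sg * x)))) =
  LT (fun x => RtoC (hv x) * f x) (RtoC sg).
Proof.
rewrite cint_mkcond; apply: eq_cint => x.
have -> : \1_`[0, +oo[%classic x = hv x :> R.
  rewrite indicE /hv; case: (boolP (0 <= x)) => h; first by rewrite mem_set//= in_itv/= h.
  by rewrite memNset//= in_itv/= andbT; exact/negP.
by rewrite -RtoCM -RtoCN cexp_RtoC; ring.
Qed.

Variables (tau : R -> C) (b : C) (g : R -> C) (M : R).
Hypotheses (lt : lapl tau) (mg : cmea g) (gM : forall x, cnorm (g x) <= M).

(** The remainder of the expansion. The Heaviside factors make it vanish on the negative half-line,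
    so that it has a Laplace transform. *)
Definition resid (x : R) : C := tau x - b * RtoC (hv x) - RtoC (hv x) * cint `[0, x] (gplus g).

Lemma resid_lapl : lapl resid.
Proof.
apply: laplB; last exact: (prim_lapl (gplus_cmea mg) (gplus_bound gM)).
by apply: laplB => //; apply: laplZ; exact: lapl_heaviside.
Qed.

Lemma resid_LT s : 0 < Re s -> LT resid s = LT tau s - b / s - LT (gplus g) s / s.
Proof.
move=> s0; have l1 := prim_lapl (gplus_cmea mg) (gplus_bound gM).
have l2 := laplZ b lapl_heaviside; rewrite /resid LTB//; last exact: laplB.
rewrite LTB// (LTZ b lapl_heaviside s0) (LT_heaviside s0).
by rewrite (LT_primitive (gplus_cmea mg) (@gplus_neg R g) (gplus_bound gM) s0).
Qed.

Lemma resid_pos x : 0 <= x -> resid x = tau x - b - cint `[0, x] g.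
Proof. by move=> x0; rewrite /resid hv_ge0// mulr1 mul1r -cint_gplus. Qed.

Lemma resid_vsd : vsd tau -> ccvg_pinfty g 0 -> vsd_real (fun x => Re (resid x)) /\ vsd_real (fun x => Im (resid x)).
Proof.
move=> [v1 v2] g0; have [s1 s2] := prim_slow (bdd_loc_integrable mg gM) g0.
split.
- apply: (@vsd_ext R (fun x => Re (tau x) + (- Re b - Re (cint `[0, x] g))) _ 0) => [x x0|].
    by rewrite resid_pos// !ReB; ring.
  by apply: vsd_slowD => //; apply: slowD; [exact: slow_cst|exact: slowN].
- apply: (@vsd_ext R (fun x => Im (tau x) + (- Im b - Im (cint `[0, x] g))) _ 0) => [x x0|].
    by rewrite resid_pos// !ImB; ring.
  by apply: vsd_slowD => //; apply: slowD; [exact: slow_cst|exact: slowN].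
Qed.

Lemma resid_tauberian (K : R -> R) (c : R) (Rf : R -> C) : continuous K ->
  (forall x, 0 <= K x <= c * ((1 + x ^+ 2)^-1) ^+ 2) -> 0 < K 0 -> vsd tau -> ccvg_pinfty g 0 ->
  (forall y, ccvg_right0 (fun sg => cintT (fun x => resid x * RtoC (expR (- (sg * x))) * RtoC (K (x - y)))) (Rf y)) ->
  ccvg_pinfty Rf 0 -> ccvg_pinfty (fun x => tau x - b - cint `[0, x] g) 0.
Proof.
move=> cK K0 Kp vt g0 cl /ccvg_pinftyP[r1 r2].
have [v1 v2] := resid_vsd vt g0; have [[m1 m2] z ie] := resid_lapl.
(* The Tauberian theorem is real; it is used for [Re] and for [Im]. *)
have T (f : C -> R) : measurable_fun setT (fun x => f (resid x)) -> vsd_real (fun x => f (resid x)) -> f 0 = 0 ->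
    (forall z, `|f z| <= cnorm z) ->
    (forall y, rint (fun x => f (resid x) * expR (- (sg * x)) * K (x - y)) @[sg --> 0^'+] --> f (Rf y)) ->
    f (Rf y) @[y --> +oo] --> f 0 -> f (resid x) @[x --> +oo] --> (0 : R).
  move=> mf vf f0 fn cf rf; rewrite f0 in rf; apply: (tauberian cK K0 Kp mf _ vf _ cf rf) => [x x0|sg sg0].
    by rewrite z.
  apply: (integ_dom _ (ie sg sg0)) => [|x]; first by apply: measurable_funM => //; exact: mea_expRN.
  by rewrite normrM [`|expR _|]ger0_norm ?expR_ge0// ler_wpM2r ?expR_ge0.
have t1 := T Re m1 v1 erefl (@norm_Re R).
have t2 := T Im m2 v2 erefl (@norm_Im R).
have {}t1 : Re (resid x) @[x --> +oo] --> (0 : R).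
  apply: t1 => // y; have [h _] := (ccvg_right0P _ _).1 (cl y); apply: cvg_trans h; apply: near_eq_cvg; apply: nearW => sg.
  by apply: eq_Rintegral => x _; rewrite !ReM ?ImM /= !mulr0 !subr0.
have {}t2 : Im (resid x) @[x --> +oo] --> (0 : R).
  apply: t2 => // y; have [_ h] := (ccvg_right0P _ _).1 (cl y); apply: cvg_trans h; apply: near_eq_cvg; apply: nearW => sg.
  by apply: eq_Rintegral => x _; rewrite !ImM ?ReM /= !mulr0 !add0r.
have : ccvg_pinfty resid 0 by apply/ccvg_pinftyP.
move=> H e e0; have [A hA] := H e e0; exists (Num.max A 0) => x; rewrite gt_max => /andP[xA x0].
by rewrite -resid_pos ?(ltW x0)//; exact: hA.
Qed.
End Expansion.

(** * Vanishing of the pairings, and the expansion *)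

Section Part2.
Variable R : realType.
Local Notation cintT := (cint setT).
Local Notation C := R[i].
Local Notation Re := (@complex.Re R).

(** Modulation by [y] translates the transform, so the pairing is a convolution of [h] with the
    kernel evaluated at - y, where [h] is small. *)
Lemma pairing_vanish (h : R -> C) (M : R) (phi : R -> C) (K : R -> R) : cmea h -> (forall x, cnorm (h x) <= M) ->
  (forall e : R, 0 < e -> exists A : R, forall x, A < `|x| -> cnorm (h x) < e) -> integ K -> (forall x, 0 <= K x) ->
  (forall x, fourier phi x = RtoC (K x)) ->
  ccvg_pinfty (fun y => cintT (fun x => h x * ifourier (fun t => phi t * cexp (iC R * RtoC (t * y))) x)) 0.
Proof.
move=> mh hM hv iK K0 fE; have M0 : 0 <= M by exact: le_trans (cnorm_ge0 _) (hM 0).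
pose c : C := RtoC (2 * pi)^-1.
have p0 : 0 <= (2 * pi)^-1 :> R by rewrite invr_ge0 mulr_ge0// pi_ge0.
have mK := integ_mea iK.
have E y : cintT (fun x => h x * ifourier (fun t => phi t * cexp (iC R * RtoC (t * y))) x) = cintT (fun u => h (- y - u) * (c * RtoC (K u))).
  have i : cinteg (fun u => h (- y - u) * (c * RtoC (K u))).
    apply: (cinteg_dom _ (integZ (M * (2 * pi)^-1) iK)) => [|u].
      apply: cmeaM; first by apply: cmea_comp => //; exact: measurable_funB.
      by apply: cmeaM; [exact: cmea_cst|exact: cmea_RtoC].
    rewrite !cnormM !cnorm_RtoC (ger0_norm p0) (ger0_norm (K0 u)) mulrA.
    by rewrite ler_wpM2r// ler_wpM2r.
  rewrite -(cint_refl (- y) i); apply: eq_cint => x.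
  rewrite ifourier_fourier fourier_mod fE; congr (h _ * (_ * RtoC (K _))); ring.
have -> : (fun y => cintT (fun x => h x * ifourier (fun t => phi t * cexp (iC R * RtoC (t * y))) x)) = (fun y => cintT (fun u => h (- y - u) * (c * RtoC (K u)))).
  exact/funext.
have -> : (0 : C) = cintT (fun=> 0) by rewrite /cint !Rintegral_cst// !mul0r.
apply: (@cdct_pinfty R _ _ (fun u => M * (2 * pi)^-1 * K u)) => [y|||| y u].
- apply: cmeaM; first by apply: cmea_comp => //; exact: measurable_funB.
  by apply: cmeaM; [exact: cmea_cst|exact: cmea_RtoC].
- exact: cmea_cst.
- apply: aeW => u e e0; have n0 := cnorm_ge0 (c * RtoC (K u)).
  have n1 : 0 < cnorm (c * RtoC (K u)) + 1 by rewrite ltr_wpDl.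
  have [A hA] := hv _ (divr_gt0 e0 n1); exists (A - u) => y hy.
  have : A < `|- y - u| by rewrite -normrN opprB opprK; apply: lt_le_trans (ler_norm _); rewrite -ltrBlDl; move: hy; congr (_ < _).
  move=> /hA; rewrite ltr_pdivlMr// subr0 => H; apply: le_lt_trans H.
  by rewrite (cnormM (h _)) ler_wpM2l ?cnorm_ge0// lerDl.
- exact: integZ.
- rewrite !cnormM !cnorm_RtoC (ger0_norm p0) (ger0_norm (K0 u)) mulrA.
  by rewrite ler_wpM2r// ler_wpM2r.
Qed.

(** Half of the radius given by [glue], with [E] frozen beyond it, so that the Lipschitz bound for
    [E] holds on the whole line. *)
Lemma glue_global (G : C -> C) (rG rho M : R) (g : R -> C) : 0 < rG -> 0 < rho -> cmea g -> (forall x, cnorm (g x) <= M) ->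
  (forall z, cnorm z < rG -> 0 < Re z -> exists l, cderiv_at G z l) ->
  (forall a phi, a < rho -> ctest a phi ->
    ccvg_right0 (fun sigma => cintT (fun t => G (Complex sigma t) * phi t)) (cintT (fun x => g x * fourier phi x))) ->
  exists2 dl : R, 0 < dl < rG / 2 & exists2 K : R, 0 <= K & exists E : R -> C,
  [/\ forall x t : R, 0 < x < dl -> `|t| < dl -> cnorm (Dfun G g (Complex x t) - E t) <= K * x,
      forall x : R, 0 < x < dl -> cnorm (LT (gminus g) (RtoC x) - E 0) <= K * x &
      forall t t' : R, cnorm (E t - E t') <= K * `|t - t'|].
Proof.
move=> rG0 rho0 mg gM dG LG; have [d /andP[d0 dr] [K K0 [E [E1 E2 E3]]]] := glue rG0 rho0 mg gM dG LG.
have d2 : d / 2 < d by rewrite ltr_pdivrMr// ltr_pMr// ltr1n.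
have d20 : 0 < d / 2 by rewrite divr_gt0.
have z0 : clamp (d / 2) 0 = 0 by rewrite clamp_id// normr0 ltW.
have cb t : `|clamp (d / 2) t| < d by apply: le_lt_trans d2; apply: clamp_bound; exact: ltW.
exists (d / 2); first by rewrite d20 (lt_le_trans d2).
exists K => //; exists (fun t => E (clamp (d / 2) t)); split.
- move=> x t /andP[x0 xd] ht; rewrite clamp_id ?(ltW ht)//; apply: E1; last exact: lt_trans d2.
  by rewrite x0 (lt_trans xd).
- by move=> x /andP[x0 xd]; rewrite z0; apply: E2; rewrite x0 (lt_trans xd).
- by move=> t t'; apply: le_trans (E3 _ _ (cb t) (cb t')) _; rewrite ler_wpM2l// clamp_lip.
Qed.

Lemma expansion (tau : R -> C) (L : C -> C) (b' : C) (G : C -> C) :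
  lapl tau -> (forall s, 0 < Re s -> L s = LT tau s) -> vsd tau -> analytic_near0_right G ->
  pf_boundary (fun s => L s - b' / s - G s / s) -> pf_boundary G ->
  exists (rho : R) (g : R -> C) (M : R), [/\ 0 < rho, cmea g, forall x, cnorm (g x) <= M, ccvg_pinfty g 0 &
    (forall a phi, a < rho -> ctest a phi ->
      ccvg_right0 (fun sigma => cintT (fun t => G (Complex sigma t) * phi t)) (cintT (fun x => g x * fourier phi x))) /\
    exists b : C,
      [/\ ccvg_right0 (fun sigma => cint `[0, +oo[%classic (fun x => g (- x) * RtoC (expR (- (sigma * x))))) (b - b'),
          ccvg_right0 (fun sigma => G (RtoC sigma) - cint `[0, +oo[%classic (fun x => g x * RtoC (expR (- (sigma * x))))) (b - b')
        & ccvg_pinfty (fun x => tau x - b - cint `[0, x]%classic g) 0]].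
Proof.
move=> lt LE vt [rG rG0 [_ dG']] /pf_local[rP [hP [MP [rP0 mP bP vP TP]]]] /pf_local[rho [h [Mh [rho0 mh bh vh TG]]]].
have dG z : cnorm z < rG -> 0 < Re z -> exists l, cderiv_at G z l by move=> h1 h2; exact: dG'.
(* A pseudofunction is paired with inverse transforms; the reflection and the factor 1 / (2 pi) turn
   this into a pairing of [g] with Fourier transforms. *)
pose c : C := RtoC (2 * pi)^-1; pose g x := c * h (- x).
have mg : cmea g by apply: cmeaM; [exact: cmea_cst|apply: cmea_comp => //; exact: measurable_funN].
pose M := cnorm c * Mh.
have gM x : cnorm (g x) <= M by rewrite cnormM ler_wpM2l ?cnorm_ge0.
have g0 : ccvg_pinfty g 0.
  move=> e e0; have c1 : 0 < cnorm c + 1 by rewrite ltr_wpDl ?cnorm_ge0.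
  have [A hA] := vh _ (divr_gt0 e0 c1); exists A => x hx; rewrite subr0 cnormM.
  have := hA (- x) (lt_le_trans hx (ltac:(by rewrite normrN ler_norm) : x <= `|- x|)).
  rewrite ltr_pdivlMr// mulrC => H; apply: le_lt_trans H.
  by rewrite ler_wpM2r ?cnorm_ge0// lerDl.
have LG a phi : a < rho -> ctest a phi ->
    ccvg_right0 (fun sigma => cintT (fun t => G (Complex sigma t) * phi t)) (cintT (fun x => g x * fourier phi x)).
  move=> ar ct; have := TG a phi ar ct.
  have i : cinteg (fun x => h x * ifourier phi x).
    have i1 := cinteg_refl 0 (cintegZ c (fourier_cinteg ct)).
    apply: eq_cinteg (cintegM_bdd i1 mh bh) => x; rewrite mulrC ifourier_fourier sub0r; congr (_ * _).
  rewrite -(cint_refl 0 i); congr ccvg_right0; apply: eq_cint => x.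
  by rewrite ifourier_fourier sub0r opprK /g -/c; ring.
have [dl /andP[dl0 dlr] [K K0 [E [E1 E2 E3]]]] := glue_global rG0 rho0 mg gM dG LG.
(* [E 0] is the common value of [D] and [A] at 0. Approaching it from the left and from the right
   gives the two formulas for b - b', and subtracting it makes the quotient below bounded. *)
exists rho, g, M; split => //; split => //; exists (b' + E 0); rewrite (_ : b' + E 0 - b' = E 0); last by ring.
split.
- apply: (ccvg_lin dl0 K0) => x hx; have := E2 x hx; rewrite (cint_half (fun x => g (- x))); exact.
- by apply: (ccvg_lin dl0 K0) => x hx; have := E1 x 0 hx; rewrite normr0 cint_half; apply.
have dD (x y : R) : 0 < x < dl -> `|y| < dl -> exists l, cderiv_at (Dfun G g) (Complex x y) l.
  by move=> /andP[x0 xd] yd; apply: (Dfun_cderiv mg gM dG x0); exact: lt_trans dlr.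
pose rr := Num.min dl rP; have rr0 : 0 < rr by rewrite lt_min dl0.
(* The support of the test function must stay below [dl], where the quotient is controlled, and
   below [rP], where P has its boundary value. *)
have [a /andP[a0 ar] [phi [Kk [cc [ct fE cK Kb Kp]]]]] := tauberian_kernel rr0.
have ad : a < dl by apply: lt_le_trans ar _; rewrite ge_min lexx.
have aP : a < rP by apply: lt_le_trans ar _; rewrite ge_min lexx orbT.
pose P s := L s - b' / s - G s / s.
have lr := resid_lapl (b' + E 0) lt mg gM.
(* Adding and subtracting G / s separates the part with pseudofunction boundary behavior from the
   bounded quotient. *)
have rE s : 0 < Re s -> LT (resid tau (b' + E 0) g) s = P s + quot (Dfun G g) E s.
  by move=> s0; rewrite (resid_LT _ lt mg gM s0) /P (LE _ s0) /quot /Dfun; ring.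
(* Modulation by [y] turns K(x) into K(x - y), so one test function yields all the averages. *)
pose phiy y t : C := phi t * cexp (iC R * RtoC (t * y)).
pose R1 y := cintT (fun x => hP x * ifourier (phiy y) x).
pose R2 y := cintT (fun t => bdry_quot E t * phiy y t).
have Kb0 x : 0 <= Kk x by have /andP[] := Kb x.
apply: (resid_tauberian (K := Kk) (c := cc) (Rf := fun y => R1 y + R2 y) lt mg gM) => // [y|].
- have cty := ctest_mod y ct.
  have L1 := TP a _ aP cty.
  have L2 := quot_limit dl0 K0 E1 E3 dD ad cty.
  apply: (@ccvg_right0_near R _ _ _ dl dl0) (ccvg_right0D L1 L2) => s hs; have /andP[s0 sd] := hs.
  have i2 := quot_cinteg E dD ad cty hs.
  have i3 : cinteg (fun t => LT (resid tau (b' + E 0) g) (Complex s t) * phiy y t).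
    by apply: eq_cinteg (cintegM_bdd (ctest_cinteg cty) (LT_cmea lr s0) (fun t => LT_bound t lr s0)) => t; exact: mulrC.
  have i1 : cinteg (fun t => P (Complex s t) * phiy y t).
    by apply: eq_cinteg (cintegB i3 i2) => t; rewrite (rE (Complex s t) s0) mulrDl; exact: addrK.
  apply: etrans (esym (cintD i1 i2)) _.
  transitivity (cintT (fun t => LT (resid tau (b' + E 0) g) (Complex s t) * phiy y t)).
    by apply: eq_cint => t; rewrite (rE (Complex s t) s0) (mulrDl (P _)).
  rewrite (LT_pairing lr cty s0); apply: eq_cint => x; by rewrite fourier_mod fE.
- have V1 := pairing_vanish mP bP vP (integK cK Kb) Kb0 fE.
  move=> e e0; have e2 : 0 < e / 2 by rewrite divr_gt0.
  have [A1 h1] := V1 _ e2; have [A2 h2] := bdry_quot_vanish K0 E3 ct e2.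
  exists (Num.max A1 A2) => y; rewrite gt_max => /andP[y1 y2].
  have := h1 y y1; rewrite !subr0 => q1; have q2 := h2 y (lt_le_trans y2 (ler_norm _)).
  by apply: le_lt_trans (cnormD _ _) _; rewrite (splitr e); exact: ltrD.
Qed.
End Part2.

(** * Very slowly oscillating functions *)

Section Oscillation.
Variable R : realType.
Local Notation mu := (@lebesgue_measure R).
Local Notation rint := (Rintegral mu setT).
Local Notation cintT := (cint setT).
Local Notation C := R[i].
Local Notation Re := (@complex.Re R).
Local Notation Im := (@complex.Im R).
Implicit Types (f h w : R -> C).

Definition vanishing h := forall e : R, 0 < e -> exists A : R, forall x, A < `|x| -> cnorm (h x) < e.

(** The boundary value of a Laplace transform is the pairing of [f] with the transform of the test
    function; [h] rewrites it with a bounded vanishing representative, which only has to agree on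
    test functions supported in (-1, 1). *)
Lemma pf_of_pairing (F : C -> C) f h (M : R) : lapl f -> (forall s, 0 < Re s -> F s = LT f s) ->
  integ (fun x => cnorm (f x) * (1 + x ^+ 2)^-1) -> cmea h -> (forall x, cnorm (h x) <= M) -> vanishing h ->
  (forall a phi, a < 1 -> ctest a phi -> cintT (fun x => f x * fourier phi x) = cintT (fun x => h x * ifourier phi x)) ->
  pf_boundary F.
Proof.
move=> lf FE wf [m1 m2] hM vh E; exists `](-1), 1[%classic; split.
  split; [exact: interval_open|exact: interval_is_interval|by rewrite /= in_itv/= ltr01 oppr_lt0 ltr01].
have ct phi : test_fun `](-1), 1[%classic phi -> exists2 a : R, a < 1 & ctest a phi.
  by move=> /(test_fun_ctest ltr01 (@subset_refl _ _))[a /andP[_ a1] h2]; exists a.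
exists (fun phi => cintT (fun x => f x * fourier phi x)); split.
  move=> phi /ct[a a1 h1]; apply: (@ccvg_right0_near R _ _ _ 1 ltr01) (LT_limit lf h1 wf) => s /andP[s0 _].
  by apply: eq_cint => t; rewrite FE.
move=> t0 ht0; exists `](-1), 1[%classic; split; first by split => //; exact: interval_open.
exists h; split => //; split => //; split; first by exists M.
by split => // phi /ct[a a1 h1]; exact: E h1.
Qed.

Lemma pairing_refl h (M a : R) phi : cmea h -> (forall x, cnorm (h x) <= M) -> ctest a phi ->
  cintT (fun x => h x * fourier phi x) = cintT (fun x => RtoC (2 * pi) * h (- x) * ifourier phi x).
Proof.
move=> mh hM ct; have i : cinteg (fun x => h x * fourier phi x).
  by apply: eq_cinteg (cintegM_bdd (fourier_cinteg ct) mh hM) => x; exact: mulrC.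
rewrite -(cint_refl 0 i); apply: eq_cint => x; rewrite sub0r ifourier_fourier RtoCV.
have p0 : RtoC (2 * pi) != 0 :> C by rewrite RtoC_eq0 mulf_neq0// gt_eqF// pi_gt0.
by rewrite [RtoC _ * _]mulrC -mulrA; congr (_ * _); rewrite mulrA divff// mul1r.
Qed.

Lemma fourier_bound f x : cinteg f -> cnorm (fourier f x) <= 2 * rint (fun t => cnorm (f t)).
Proof.
move=> if_; apply: cnorm_cint.
- by apply: cmeaM; [exact: cmea_expN_i|exact: cinteg_mea].
- exact: cinteg_norm.
- by move=> t; rewrite cnormM cnorm_expN_i mul1r.
Qed.

Lemma fourier_lip f (A x y : R) : 0 <= A -> cinteg f -> (forall t, ~ (- A <= t <= A) -> f t = 0) ->
  cnorm (fourier f x - fourier f y) <= 4 * A * rint (fun t => cnorm (f t)) * `|x - y|.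
Proof.
move=> A0 if_ f0.
have ik z : cinteg (fun t => cexp (- (iC R * RtoC (z * t))) * f t).
  by apply: eq_cinteg (cintegM_bdd if_ (cmea_expN_i z) (fun u => _)) => [u|u]; [exact: mulrC|rewrite cnorm_expN_i].
rewrite /fourier -(cintB (ik x) (ik y)).
have -> : 4 * A * rint (fun t => cnorm (f t)) * `|x - y| = 2 * rint (fun t => 2 * A * `|x - y| * cnorm (f t)).
  by rewrite rintZ; [ring|exact: cinteg_norm].
apply: cnorm_cint; first exact: cinteg_mea (cintegB (ik x) (ik y)).
  exact: integZ (cinteg_norm if_).
move=> t; rewrite -mulrBl cnormM; have [ht|ht] := pselect (- A <= t <= A); last by rewrite f0// cnorm0 !mulr0.
rewrite ler_wpM2r ?cnorm_ge0// !cexp_i; apply: le_trans (cnorm_le _) _.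
have h1 : `|x * t - y * t| <= A * `|x - y|.
  by rewrite -mulrBl normrM mulrC ler_wpM2r// ler_norml.
rewrite ReB ImB /= -opprD normrN (_ : 2 * A * `|x - y| = A * `|x - y| + A * `|x - y|); last by ring.
by apply: lerD; [exact: le_trans (cos_lip _ _) h1|exact: le_trans (sin_lip _ _) h1].
Qed.

Lemma fourier_continuous f (A : R) : 0 <= A -> cinteg f -> (forall t, ~ (- A <= t <= A) -> f t = 0) ->
  continuous (fun x => Re (fourier f x)) /\ continuous (fun x => Im (fourier f x)).
Proof.
move=> A0 if_ f0; split; apply: lipschitz_continuous => x y.
  by rewrite -ReB; apply: le_trans (norm_Re _) _; exact: fourier_lip f0.
by rewrite -ImB; apply: le_trans (norm_Im _) _; exact: fourier_lip f0.
Qed.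

Lemma ind_cont (u v t : R) : t != u -> t != v -> ind u v s @[s --> t] --> ind u v t.
Proof.
move=> tu tv; apply: cvg_near_cst.
have du : 0 < `|t - u| by rewrite normr_gt0 subr_eq0.
have dv : 0 < `|t - v| by rewrite normr_gt0 subr_eq0.
apply/nbhs_ballP; exists (Num.min `|t - u| `|t - v|); first by rewrite /= lt_min du.
move=> s; rewrite /ball /= lt_min => /andP[h1 h2]; rewrite /ind; congr (if _ then _ else _).
have k (z : R) : `|t - s| < `|t - z| -> (z <= s) = (z <= t) /\ (s <= z) = (t <= z).
  move=> hz; have := ler_norm (t - s); have := ler_norm (s - t); rewrite [`|s - t|]distrC => a1 a2.
  have [zt|tz] := leP z t.
    have tz' : z < t.
      by rewrite lt_neqAle zt andbT; apply: contraTneq hz => ->; rewrite subrr normr0 -leNgt.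
    rewrite (gtr0_norm (ltac:(by rewrite subr_gt0) : 0 < t - z)) in hz.
    have zs : z < s by lra.
    by rewrite (ltW zs) [s <= z]leNgt zs [t <= z]leNgt tz'.
  rewrite (ltr0_norm (ltac:(by rewrite subr_lt0) : t - z < 0)) in hz.
  have sz : s < z by lra.
  by rewrite [z <= s]leNgt sz !ltW.
by have [-> _] := k u h1; have [_ ->] := k v h2.
Qed.

(* The transform of a compactly supported piece may be cut off sharply, since the test functions only see it near [0]. *)
Lemma pairing_compact f (A : R) : 0 <= A -> cinteg f -> (forall t, ~ (- A <= t <= A) -> f t = 0) ->
  exists h (M : R), [/\ cmea h, forall x, cnorm (h x) <= M, vanishing h &
    forall a phi, a < 1 -> ctest a phi -> cintT (fun x => f x * fourier phi x) = cintT (fun x => h x * ifourier phi x)].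
Proof.
move=> A0 if_ f0; have [c1 c2] := fourier_continuous A0 if_ f0.
pose w t := fourier f t * RtoC (ind (-1) 1 t).
have mw : cmea w.
  apply: cmeaM; first by split; exact: continuous_measurable_fun.
  apply: cmea_RtoC; exact: mea_ind1.
have wM t : cnorm (w t) <= 2 * rint (fun t => cnorm (f t)).
  rewrite cnormM cnorm_RtoC; apply: le_trans (fourier_bound t if_).
  by rewrite ler_piMr ?cnorm_ge0// ind01.
have w0 t : ~ (- 1 <= t <= 1) -> w t = 0 by move=> h; rewrite /w ind_out// mulr0.
have iw : cinteg w.
  split; [apply: (integ_bdd_supp mw.1 (fun t => le_trans (norm_Re _) (wM t)) (a := -1) (b := 1))|apply: (integ_bdd_supp mw.2 (fun t => le_trans (norm_Im _) (wM t)) (a := -1) (b := 1))];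
  by move=> t h; rewrite w0// => h'; apply: h; rewrite /= in_itv.
(* The cut-off transform jumps at -1 and 1 only, a null set for the Riemann-Lebesgue lemma. *)
have ae2 (P : R -> Prop) : (forall t, t != -1 -> t != 1 -> P t) -> {ae mu, forall t, P t}.
  move=> H; have F := ae_filter_ringOfSetsType mu.
  have n1 := @ae_neq R (-1) (fun t => t != -1) (fun t p => p).
  have n2 := @ae_neq R 1 (fun t => t != 1) (fun t p => p).
  by apply: (@filterS _ _ F _ _ _ (@filterI _ _ F _ _ n1 n2)) => t [h1 h2]; exact: H.
have W1 : {ae mu, forall t : R, {for t, continuous (fun t => Re (w t))}}.
  apply: ae2 => t t1 t2; have -> : (fun t => Re (w t)) = (fun t => Re (fourier f t) * ind (-1) 1 t).
    by apply/funext => s; rewrite ReM /= mulr0 subr0.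
  by apply: cvgM; [exact: c1|exact: ind_cont].
have W2 : {ae mu, forall t : R, {for t, continuous (fun t => Im (w t))}}.
  apply: ae2 => t t1 t2; have -> : (fun t => Im (w t)) = (fun t => Im (fourier f t) * ind (-1) 1 t).
    by apply/funext => s; rewrite ImM /= mulr0 add0r.
  by apply: cvgM; [exact: c2|exact: ind_cont].
have [c3 c4] := fourier_continuous ler01 iw w0.
exists (fourier w), (2 * rint (fun t => cnorm (w t))); split.
- by split; exact: continuous_measurable_fun.
- by move=> x; exact: fourier_bound.
- move=> e e0; have [B hB] := complex_riemann_lebesgue mw wM w0 W1 W2 e0; exists B => x hx.
  have := hB (- x); rewrite normrN => /(_ hx); congr (cnorm _ < _); apply: eq_cint => t.
  by rewrite mulrC mulrN RtoCN mulrN [t * x]mulrC.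
- move=> a phi a1 ct; rewrite -(parseval ct iw) -(fourier_fubini if_ (ctest_cinteg ct)); apply: eq_cint => t.
  have [h|h] := pselect (- 1 <= t <= 1); last by rewrite (ctest_out ct) ?mulr0 ?mul0r// => h'; apply: h; lra.
  rewrite /w ind_in// mulr1 mulrC; congr (_ * _); apply: eq_cint => x.
  by rewrite mulrC [x * t]mulrC.
Qed.

Lemma cint_split f (x y z : R) : loc_integrable f -> x <= y -> y <= z -> cint `[x, z] f = cint `[x, y] f + cint `[y, z] f.
Proof.
move=> lf xy yz.
have i u v := (cinteg_mkcond _ (measurable_itv _)).1 (lf u v).
rewrite (cint_mkcond `[x, z]) (cint_mkcond `[x, y]) (cint_mkcond `[y, z]) -(cintD (i x y) (i y z)).
apply: (@cint_ae_neq R y _ _ (i x z) (cintegD (i x y) (i y z))) => u uy.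
rewrite -mulrDr -RtoCD !ind_indic; congr (_ * RtoC _).
have [h|h|h] := ltgtP u y; last by rewrite h eqxx in uy.
  rewrite (@ind_out R y z) ?addr0; last by lra.
  by rewrite /ind (ltW h) (le_trans (ltW h) yz).
rewrite (@ind_out R x y) ?add0r; last by lra.
by rewrite /ind (ltW h) (le_trans xy (ltW h)).
Qed.
End Oscillation.

(** * Boundary behavior from slow oscillation *)

Section Converse.
Variable R : realType.
Local Notation mu := (@lebesgue_measure R).
Local Notation rint := (Rintegral mu setT).
Local Notation cintT := (cint setT).
Local Notation C := R[i].
Local Notation Re := (@complex.Re R).
Local Notation Im := (@complex.Im R).

Lemma slow_csmall (f : R -> C) : slow (fun x => Re (f x)) -> slow (fun x => Im (f x)) -> forall e : R, 0 < e ->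
  exists2 X : R, 0 <= X & forall x h : R, X <= x -> 0 <= h <= 1 -> cnorm (f (x + h) - f x) <= e.
Proof.
move=> s1 s2 e e0; have e2 : 0 < e / 2 by rewrite divr_gt0.
have [X1 h1] := s1 _ e2; have [X2 h2] := s2 _ e2; exists (Num.max 0 (Num.max X1 X2)); first by rewrite le_max lexx.
move=> x h; rewrite !ge_max => /and3P[_ a1 a2] hh; apply: le_trans (cnorm_le _) _.
by rewrite ReB ImB (splitr e); apply: lerD; [exact: h1|exact: h2].
Qed.

Section Smooth.
Variables (tau : R -> C) (X : R).
Hypotheses (lt : loc_integrable tau) (lap : lapl tau) (X0 : 0 <= X).
Hypothesis H1 : forall x h : R, X <= x -> 0 <= h <= 1 -> cnorm (tau (x + h) - tau x) <= 1.

(** Cut off below [X], since only from there on are the increments of [tau] bounded. *)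
Definition increment (x : R) : C := RtoC (hv (x - X)) * (tau (x + 1) - tau x).
Definition mean0 : C := cint `[X, X + 1] tau.

Let mhX : measurable_fun setT (fun x : R => hv (x - X)).
Proof. by apply: (measurableT_comp (@mea_hv R)); exact: measurable_funB. Qed.

Lemma increment_cmea : cmea increment.
Proof.
have [mt _ _] := lap; apply: cmeaM; first exact: cmea_RtoC.
by apply: cmeaB => //; apply: cmea_comp => //; exact: measurable_funD.
Qed.

Lemma increment_neg x : x < X -> increment x = 0.
Proof. by move=> h; rewrite /increment hv_lt0 ?mul0r// subr_lt0. Qed.

Lemma increment_pos x : X <= x -> increment x = tau (x + 1) - tau x.
Proof. by move=> h; rewrite /increment hv_ge0 ?mul1r// subr_ge0. Qed.

Lemma increment_bound x : cnorm (increment x) <= 1.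
Proof.
have [h|h] := ltP x X; first by rewrite increment_neg// cnorm0.
by rewrite increment_pos// H1// ler01 lexx.
Qed.

Lemma increment_lapl : lapl increment.
Proof.
apply: (lapl_bdd increment_cmea _ increment_bound) => x x0; exact: increment_neg (lt_le_trans x0 X0).
Qed.

Lemma gplus_increment : gplus increment = increment.
Proof.
apply/funext => x; rewrite /gplus; have [x0|x0] := ltP x 0; last by rewrite hv_ge0// mul1r.
by rewrite hv_lt0// mul0r (increment_neg (lt_le_trans x0 X0)).
Qed.

(** The integral of tau(u + 1) - tau(u) over [X, x] telescopes to a difference of two means over
    unit intervals, and [mean0] cancels the first of them. *)
Lemma increment_prim x : X <= x -> mean0 + cint `[0, x] increment = cint `[x, x + 1] tau.
Proof.
move=> Xx; have i u v := (cinteg_mkcond _ (measurable_itv _)).1 (lt u v).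
have E : cint `[0, x] increment = cint `[X + 1, x + 1] tau - cint `[X, x] tau.
  have j := cinteg_shift 1 (i (X + 1) (x + 1)).
  rewrite (cint_mkcond `[0, x]) (cint_mkcond `[X + 1, x + 1]) (cint_mkcond `[X, x]).
  rewrite -(cint_shift 1 (i (X + 1) (x + 1))) -(cintB j (i X x)); apply: eq_cint => u; rewrite !ind_indic.
  have -> : ind (X + 1) (x + 1) (u + 1) = ind X x u by rewrite /ind !lerD2r.
  have [h|h] := pselect (X <= u <= x).
    have /andP[h1 h2] := h; rewrite (ind_in h) ind_in ?increment_pos// ?mulr1//.
    by rewrite (le_trans X0 h1) h2.
  rewrite (ind_out h) !mulr0 subrr; have [h1|h1] := ltP u X; first by rewrite increment_neg// mul0r.
  by rewrite ind_out ?mulr0// => /andP[_ h2]; apply: h; rewrite h1.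
have E1 := @cint_split R tau X (X + 1) (x + 1) lt (ltac:(lra)) (ltac:(lra)).
have E2 := @cint_split R tau X x (x + 1) lt Xx (ltac:(lra)).
by rewrite E /mean0 addrA -E1 E2; ring.
Qed.

(** By [increment_prim] the residual at x is the mean of tau(x) - tau(u) over u in [x, x + 1]. *)
Lemma resid_small x (e : R) : X <= x -> (forall h, 0 <= h <= 1 -> cnorm (tau (x + h) - tau x) <= e) ->
  cnorm (resid tau mean0 increment x) <= 2 * e.
Proof.
move=> Xx He; rewrite resid_pos; last exact: le_trans Xx.
have i := (cinteg_mkcond _ (measurable_itv _)).1 (lt x (x + 1)).
have -> : tau x - mean0 - cint `[0, x] increment = cintT (fun u => (tau x - tau u) * RtoC (\1_(`[x, x + 1]%classic) u)).
  rewrite -addrA -opprD increment_prim// cint_mkcond.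
  have j : cinteg (fun u : R => RtoC (\1_(`[x, x + 1]%classic) u)) by split => /=; [exact: integ_indic|exact: integ0].
  have T : cintT (fun u => tau x * RtoC (\1_(`[x, x + 1]%classic) u)) = tau x.
    by rewrite (cintZ _ j) cint_RtoC rint_indic ?lerDl// [x + 1]addrC addrK mulr1.
  by rewrite -[X in X - _]T -(cintB (cintegZ (tau x) j) i); apply: eq_cint => u; rewrite mulrBl.
have -> : e = rint (fun u => e * \1_(`[x, x + 1]%classic) u).
  by rewrite rintZ ?rint_indic ?lerDl//; [ring|exact: integ_indic].
apply: cnorm_cint; [|exact: integZ (integ_indic _ _)|].
  apply: cmeaM; last by apply: cmea_RtoC; exact: measurable_indic.
  by have [mt _ _] := lap; apply: cmeaB => //; exact: cmea_cst.
move=> u; rewrite cnormM cnorm_RtoC ind_indic; have [h|h] := pselect (x <= u <= x + 1); last by rewrite ind_out// normr0 !mulr0.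
have /andP[h1 h2] := h; rewrite ind_in// normr1 !mulr1 cnormBC; have := He (u - x); rewrite subrKC; apply; lra.
Qed.
End Smooth.

(** With G the transform of [g] itself, the combination L - b'/s - G/s is exactly the transform of
    the residual, so both boundary conditions concern Laplace transforms of explicit functions. *)
Lemma slow_boundary (tau : R -> C) (L : C -> C) : loc_integrable tau -> lapl tau -> (forall s, 0 < Re s -> L s = LT tau s) ->
  slow (fun x => Re (tau x)) -> slow (fun x => Im (tau x)) ->
  exists (b' : C) (G : C -> C), [/\ analytic_near0_right G, pf_boundary (fun s => L s - b' / s - G s / s) & pf_boundary G].
Proof.
move=> lt lap LE s1 s2; have H := slow_csmall s1 s2; have [X X0 H1] := H 1 ltr01.
pose g := increment tau X; pose b' := mean0 tau X.
have mg : cmea g by exact: increment_cmea.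
have gM x : cnorm (g x) <= 1 by exact: increment_bound.
have lg : lapl g by exact: increment_lapl.
have g0 e : 0 < e -> exists A : R, forall x, A < x -> cnorm (g x) < e.
  move=> e0; have [Y Y0 hY] := H (e / 2) (divr_gt0 e0 (ltr0n R 2)); exists (Num.max X Y) => x; rewrite gt_max => /andP[xX xY].
  rewrite /g increment_pos ?(ltW xX)//; apply: le_lt_trans (hY x 1 (ltW xY) _) _; first by rewrite ler01 lexx.
  by rewrite ltr_pdivrMr// ltr_pMr// ltr1n.
have gneg x : x < 0 -> g x = 0 by move=> x0; apply: increment_neg; exact: lt_le_trans X0.
(* The factor of [pairing_refl]: passing from Fourier to inverse transforms reflects the function
   and multiplies it by 2 pi. *)
pose pp : R := 2 * pi; have pp0 : 0 < pp by rewrite mulr_gt0// pi_gt0.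
have refl_van (f : R -> C) : (forall x, x < 0 -> f x = 0) -> (forall e, 0 < e -> exists A : R, forall x, A < x -> cnorm (f x) < e) ->
    vanishing (fun x => RtoC pp * f (- x)).
  move=> fneg f0 e e0; have [A hA] := f0 (e / pp) (divr_gt0 e0 pp0); exists A => x hx.
  rewrite cnormM cnorm_RtoC (gtr0_norm pp0) mulrC -ltr_pdivlMr//.
  have [x0|x0] := ltP 0 x; first by rewrite fneg ?oppr_lt0// cnorm0 divr_gt0.
  by apply: hA; rewrite -(ler0_norm x0).
have refl_mea (f : R -> C) : cmea f -> cmea (fun x => RtoC pp * f (- x)).
  by move=> mf; apply: cmeaM; [exact: cmea_cst|apply: cmea_comp => //; exact: measurable_funN].
have refl_bd (f : R -> C) (M : R) : (forall x, cnorm (f x) <= M) -> forall x, cnorm (RtoC pp * f (- x)) <= pp * M.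
  by move=> fM x; rewrite cnormM cnorm_RtoC (gtr0_norm pp0) ler_wpM2l// ltW.
exists b', (LT g); split.
- exists 1 => //; split => z [z1 z2]; last exact: LT_cderiv.
  exists (Num.min (1 - cnorm z) (Re z)); first by rewrite lt_min subr_gt0 z1 z2.
  move=> w; rewrite lt_min => /andP[h1 h2]; split.
    by have := cnormD (w - z) z; rewrite subrK; lra.
  by have := norm_Re (w - z); rewrite ReB ler_norml => /andP[]; lra.
- pose r := resid tau b' g; have lr : lapl r := resid_lapl b' lap mg gM.
  have [mr rneg ir] := lr.
  have mhX : measurable_fun setT (fun x : R => hv (x - X)).
    by apply: (measurableT_comp (@mea_hv R)); exact: measurable_funB.
  (* Past [X] the residual is bounded and tends to 0, so its reflection serves as the representative
     directly. Before [X] it is merely integrable with compact support, and [pairing_compact]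
     replaces it by a bounded vanishing function. *)
  pose rb x := RtoC (hv (x - X)) * r x; pose rc x := RtoC (1 - hv (x - X)) * r x.
  have mrb : cmea rb by apply: cmeaM => //; exact: cmea_RtoC.
  have mrc : cmea rc by apply: cmeaM => //; apply: cmea_RtoC; exact: measurable_funB.
  have rbc x : r x = rb x + rc x by rewrite /rb /rc -mulrDl -RtoCD subrKC mul1r.
  have rbneg x : x < X -> rb x = 0 by move=> h; rewrite /rb hv_lt0 ?mul0r// subr_lt0.
  have rbpos x : X <= x -> rb x = r x by move=> h; rewrite /rb hv_ge0 ?mul1r// subr_ge0.
  have rbM x : cnorm (rb x) <= 2 * 1.
    have [h|h] := ltP x X; first by rewrite rbneg// cnorm0.
    by rewrite rbpos//; apply: (@resid_small tau X lt lap X0 x 1 h) => u; exact: H1.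
  have rb0 e : 0 < e -> exists A : R, forall x, A < x -> cnorm (rb x) < e.
    move=> e0; have [Y Y0 hY] := H (e / 4) (divr_gt0 e0 (ltr0n R 4)); exists (Num.max X Y) => x; rewrite gt_max => /andP[xX xY].
    rewrite rbpos ?(ltW xX)//; apply: le_lt_trans (@resid_small tau X lt lap X0 x (e / 4) (ltW xX) _) _.
      by move=> u; apply: hY; exact: ltW.
    lra.
  have rc0 t : ~ (- X <= t <= X) -> rc t = 0.
    move=> h; have [t0|t0] := ltP t 0; first by rewrite /rc rneg// mulr0.
    rewrite /rc hv_ge0 ?subrr ?mul0r// subr_ge0; apply: contrapT => /negP; rewrite -ltNge => tX; apply: h; lra.
  have irc : cinteg rc.
    have m : measurable_fun setT (fun x : R => expR x * (hv x * (1 - hv (x - X)))).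
      by apply: measurable_funM => //; apply: measurable_funM; [exact: mea_hv|exact: measurable_funB].
    apply: (cinteg_dom mrc (integM_bdd (ir 1 ltr01) m (M := expR X) _)) => x.
      have [x0|x0] := ltP x 0; first by rewrite (hv_lt0 x0) mul0r mulr0 normr0 expR_ge0.
      rewrite (hv_ge0 x0) mul1r; have [h|h] := ltP x X.
        by rewrite hv_lt0 ?subr_lt0// subr0 mulr1 ger0_norm ?expR_ge0// ler_expR ltW.
      by rewrite hv_ge0 ?subr_ge0// subrr mulr0 normr0 expR_ge0.
    have [x0|x0] := ltP x 0; first by rewrite /rc rneg// mulr0 cnorm0 mul0r mul0r.
    have /andP[k1 k2] := hv01 (x - X).
    rewrite cnormM cnorm_RtoC ger0_norm ?subr_ge0// (hv_ge0 x0) !mul1r.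
    by rewrite mulrA -[_ * expR x]mulrA -expRD addNr expR0 mulr1 mulrC.
  have [hc [Mc [mhc bhc vhc Ec]]] := pairing_compact X0 irc rc0.
  apply: (@pf_of_pairing R _ r (fun x => RtoC pp * rb (- x) + hc x) (pp * (2 * 1) + Mc) lr).
  + by move=> s s0; rewrite (resid_LT b' lap mg gM s0) (LE s s0) /g gplus_increment.
  + apply: (integ_dom _ (integD (integ_bdd_cauchy mrb rbM) (cinteg_norm irc))) => [|x].
      by apply: measurable_funM; [exact: mea_cnorm|exact: (integ_mea (integ_cauchy R))].
    have d0 : 0 <= (1 + x ^+ 2)^-1 by rewrite invr_ge0 addr_ge0// sqr_ge0.
    have d1 : (1 + x ^+ 2)^-1 <= 1 by rewrite invf_le1 ?lerDl ?sqr_ge0// ltr_wpDr// sqr_ge0.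
    rewrite ger0_norm ?mulr_ge0 ?cnorm_ge0// rbc; apply: le_trans (ler_wpM2r d0 (cnormD _ _)) _.
    by rewrite mulrDl lerD2l ler_piMr// cnorm_ge0.
  + by apply: cmeaD => //; exact: refl_mea.
  + by move=> x; apply: le_trans (cnormD _ _) _; apply: lerD => //; exact: refl_bd.
  + move=> e e0; have e2 : 0 < e / 2 by rewrite divr_gt0.
    have [A1 h1] := refl_van rb (fun x x0 => rbneg x (lt_le_trans x0 X0)) rb0 _ e2; have [A2 h2] := vhc _ e2.
    exists (Num.max A1 A2) => x; rewrite gt_max => /andP[x1 x2]; apply: le_lt_trans (cnormD _ _) _.
    by rewrite (splitr e); apply: ltrD; [exact: h1|exact: h2].
  + move=> a phi a1 ct; have i1 : cinteg (fun x => rb x * fourier phi x).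
      by apply: eq_cinteg (cintegM_bdd (fourier_cinteg ct) mrb rbM) => x; exact: mulrC.
    have [Kf _ hK] := fourier_decay ct.
    have bf x : cnorm (fourier phi x) <= 2 * rint (fun t => cnorm (phi t)) by exact: fourier_bound (ctest_cinteg ct).
    have i2 : cinteg (fun x => rc x * fourier phi x) by exact: (cintegM_bdd irc (fourier_cmea ct) bf).
    have iif : cinteg (ifourier phi).
      have := cinteg_refl 0 (cintegZ (RtoC (2 * pi)^-1) (fourier_cinteg ct)).
      by apply: eq_cinteg => x; rewrite ifourier_fourier sub0r.
    have i3 : cinteg (fun x => RtoC pp * rb (- x) * ifourier phi x).
      by apply: eq_cinteg (cintegM_bdd iif (refl_mea _ mrb) (refl_bd _ _ rbM)) => x; exact: mulrC.
    have i4 : cinteg (fun x => hc x * ifourier phi x).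
      by apply: eq_cinteg (cintegM_bdd iif mhc bhc) => x; exact: mulrC.
    transitivity (cintT (fun x => rb x * fourier phi x + rc x * fourier phi x)).
      by apply: eq_cint => x; rewrite rbc mulrDl.
    rewrite (cintD i1 i2) (pairing_refl mrb rbM ct) (Ec a phi a1 ct) -(cintD i3 i4).
    by apply: eq_cint => x; rewrite mulrDl.
- apply: (@pf_of_pairing R _ g (fun x => RtoC pp * g (- x)) (pp * 1) lg) => //.
  + exact: integ_bdd_cauchy mg gM.
  + exact: refl_mea.
  + exact: refl_bd.
  + exact: refl_van.
  + by move=> a phi a1 ct; exact: (pairing_refl mg gM ct).
Qed.
End Converse.

(** * Tempered growth, slow oscillation of the expansion, and the theorem *)

Section Tempered.
Variable R : realType.
Local Notation C := R[i].
Local Notation Re := (@complex.Re R).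
Local Notation Im := (@complex.Im R).

Lemma bdd_tempered (g : R -> C) (M : R) : cmea g -> (forall x, cnorm (g x) <= M) -> tempered_fun g.
Proof.
move=> mg gM; split; first exact: bdd_loc_integrable gM.
have M0 : 0 <= M by exact: le_trans (cnorm_ge0 _) (gM 0).
exists 2%N; suff : cinteg (fun x => g x * RtoC ((1 + `|x|) ^+ 2)^-1).
  by rewrite /cintegrable; under eq_fun do rewrite RtoCV.
apply: (cinteg_dom _ (integZ M (integ_cauchy R))) => [|x].
  apply: cmeaM => //; apply: cmea_RtoC; apply: continuous_measurable_fun => x.
  have p0 : 0 < (1 + `|x|) ^+ 2 by rewrite exprn_gt0// ltr_pwDl.
  apply: cvgV; first by rewrite gt_eqF.
  under eq_fun do rewrite expr2; rewrite expr2.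
  by apply: cvgM; apply: cvgD; [exact: cvg_cst|apply: cvg_norm; exact: cvg_id|exact: cvg_cst|apply: cvg_norm; exact: cvg_id].
have d0 : 0 < 1 + x ^+ 2 by rewrite ltr_wpDr// sqr_ge0.
have p0 : 0 < (1 + `|x|) ^+ 2 by rewrite exprn_gt0// ltr_pwDl.
rewrite cnormM cnorm_RtoC ger0_norm ?invr_ge0 ?(ltW p0)//; apply: ler_pM => //; first exact: cnorm_ge0.
rewrite lef_pV2 ?posrE// -[x ^+ 2]real_normK ?num_real// sqrrD expr1n mul1r.
by have := normr_ge0 x; lra.
Qed.

Lemma vso_slow (tau : R -> C) : vso tau -> slow (fun x => Re (tau x)) /\ slow (fun x => Im (tau x)).
Proof.
move=> [[v1 v2] [v3 v4]]; split; apply: vsd_slow => //.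
  by apply: (vsd_ext (X := 0) _ v3) => x _; rewrite ReN.
by apply: (vsd_ext (X := 0) _ v4) => x _; rewrite ImN.
Qed.

Lemma slow_vso (tau : R -> C) : slow (fun x => Re (tau x)) -> slow (fun x => Im (tau x)) -> vso tau.
Proof.
move=> s1 s2; split; first by split; exact: slow_vsd.
split; [apply: (vsd_ext (X := 0) _ (slow_vsd (slowN s1))) => x _; rewrite ReN//|].
by apply: (vsd_ext (X := 0) _ (slow_vsd (slowN s2))) => x _; rewrite ImN.
Qed.

Lemma expansion_slow (tau g : R -> C) (b : C) : loc_integrable g -> ccvg_pinfty g 0 ->
  ccvg_pinfty (fun x => tau x - b - cint `[0, x]%classic g) 0 -> vso tau.
Proof.
move=> lg g0 /ccvg_pinftyP[r1 r2]; have [s1 s2] := prim_slow lg g0; apply: slow_vso.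
- apply: (slow_ext (X := 0) (f := fun x => Re (tau x - b - cint `[0, x]%classic g) + (Re b + Re (cint `[0, x]%classic g)))) => [x _|].
    by rewrite !ReB; ring.
  by apply: slowD; [exact: slow_cvg r1|apply: slowD => //; exact: slow_cst].
- apply: (slow_ext (X := 0) (f := fun x => Im (tau x - b - cint `[0, x]%classic g) + (Im b + Im (cint `[0, x]%classic g)))) => [x _|].
    by rewrite !ImB; ring.
  by apply: slowD; [exact: slow_cvg r2|apply: slowD => //; exact: slow_cst].
Qed.
End Tempered.

Theorem theorem5p3 (R : realType) (tau : R -> R[i]) (L : R[i] -> R[i]) :
  loc_integrable tau ->
  (forall x : R, x < 0 -> tau x = 0) ->
  (forall s : R[i], 0 < complex.Re s -> laplace_conv tau s (L s)) ->
  vsd tau ->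
  (vso tau <->
     exists (b' : R[i]) (G : R[i] -> R[i]),
       [/\ analytic_near0_right G,
           pf_boundary (fun s => L s - b' / s - G s / s)
         & pf_boundary G]) /\
  (forall (b' : R[i]) (G : R[i] -> R[i]),
     analytic_near0_right G ->
     pf_boundary (fun s => L s - b' / s - G s / s) ->
     pf_boundary G ->
     exists2 lambda0 : R, 0 < lambda0 &
       forall lambda : R, 0 < lambda < lambda0 ->
         exists g : R -> R[i],
           [/\ tempered_fun g,
               ccvg_pinfty g 0,
               (forall phi, test_fun `](- lambda), lambda[%classic phi ->
                  ccvg_right0 (fun sigma => cint setT (fun t => G (Complex sigma t) * phi t))
                              (cint setT (fun x => g x * fourier phi x))) &
               exists b : R[i],
                 [/\ ccvg_right0 (fun sigma =>
                        cint `[0, +oo[%classic (fun x => g (- x) * RtoC (expR (- (sigma * x)))))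
                        (b - b'),
                     ccvg_right0 (fun sigma =>
                        G (RtoC sigma) - cint `[0, +oo[%classic (fun x => g x * RtoC (expR (- (sigma * x)))))
                        (b - b')
                   & ccvg_pinfty (fun x => tau x - b - cint `[0, x]%classic g) 0]]).
Proof.
move=> lt ct cv vt; have [la LE] := laplace_abs lt ct cv vt.
split; first split.
- by move=> /vso_slow[s1 s2]; exact: slow_boundary.
- move=> [b' [G [aG bP bG]]]; have [rho [g [M [_ mg gM g0 [_ [b [_ _ tb]]]]]]] := expansion la LE vt aG bP bG.
  exact: expansion_slow (bdd_loc_integrable mg gM) g0 tb.
- move=> b' G aG bP bG; have [rho [g [M [rho0 mg gM g0 [LG ex_b]]]]] := expansion la LE vt aG bP bG.
  (* A single [g], bounded and hence tempered, serves every [lambda] below the radius on which G has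
     its boundary value. *)
  exists rho => // lambda /andP[l0 lr]; exists g; split => //; first exact: bdd_tempered gM.
  move=> phi /(test_fun_ctest l0 (@subset_refl _ _))[a /andP[_ al] cphi].
  by apply: LG cphi; exact: lt_trans lr.
Qed.
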